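(* Assume the standing setting below. Assume moreover: (i) (nondegeneracy outside $\Sigma$) for every $\delta>0$ there exists $\nu_\delta>0$ such that for all $\theta\in\Theta$, $A_\theta(x)\ge \nu_\delta I$ for all $x\in\Sigma_\delta^C:=\{x\in\mathbb T^N:\operatorname{dist}(x,\Sigma)>\delta\}$; (ii) $p\mapsto H_\theta(x,p)$ is convex for every $x\in\mathbb T^N$ and $\theta\in\Theta$; (iii) (uniform strict convexity on $\Sigma$) for all $x\in\Sigma$, $0<\lambda<1$ and $p,q\in\mathbb R^N$ with $p\neq q$, $$\inf_{\theta\in\Theta}\{\lambda H_\theta(x,p)+(1-\lambda)H_\theta(x,q)-H_\theta(x,\lambda p+(1-\lambda)q)\}>0.$$ Then, with $u$ the Lipschitz viscosity solution of (E) and $c$ the ergodic constant, $u(\cdot,t)+ct\to u_\infty$ uniformly on $\mathbb T^N$ as $t\to+\infty$, where $u_\infty$ is a viscosity solution of the ergodic problem (S).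
   Context: Standing setting. $\mathbb T^N=\mathbb R^N/\mathbb Z^N$ is the flat torus, $\Theta$ is a metric space and $C>0$ is a fixed constant. For every $\theta\in\Theta$: $\sigma_\theta\in W^{1,\infty}(\mathbb T^N;\mathcal M_N)$ with $|\sigma_\theta|,|D\sigma_\theta|\le C$, and $A_\theta=\sigma_\theta\sigma_\theta^T$; $H_\theta\in W^{1,\infty}_{\rm loc}(\mathbb T^N\times\mathbb R^N)$ with $|H_\theta(x,0)|\le C$, and for every $R>0$ there is $C_R>0$ independent of $\theta$ with $|H_\theta(x,p)-H_\theta(y,q)|\le C_R(|x-y|+|p-q|)$ for $x,y\in\mathbb T^N$, $|p|,|q|\le R$. Consider (E) $u_t+\sup_{\theta\in\Theta}\{-\mathrm{tr}(A_\theta(x)D^2u)+H_\theta(x,Du)\}=0$ in $\mathbb T^N\times(0,\infty)$, $u(x,0)=u_0(x)$; (E$_\lambda$) $\lambda v_\lambda+\sup_{\theta}\{-\mathrm{tr}(A_\theta(x)D^2v_\lambda)+H_\theta(x,Dv_\lambda)\}=0$ in $\mathbb T^N$, $\lambda>0$; (S) $\sup_{\theta}\{-\mathrm{tr}(A_\theta(x)D^2v)+H_\theta(x,Dv)\}=c$ in $\mathbb T^N$. It is assumed that there exist viscosity solutions $u\in C(\mathbb T^N\times[0,\infty))$ of (E) and $v_\lambda\in C(\mathbb T^N)$ of (E$_\lambda$) for all $\lambda>0$ with $|u(x,t)-u(y,t)|,|v_\lambda(x)-v_\lambda(y)|\le C|x-y|$ for all $x,y,t,\lambda$. Under this assumption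 a comparison principle holds for (E) and (E$_\lambda$), there is a unique constant $c\in\mathbb R$ (the ergodic constant) for which (S) has a solution $v\in W^{1,\infty}(\mathbb T^N)$, and $u+ct$ is bounded. All solutions are viscosity solutions. $\Sigma:=\{x\in\mathbb T^N: A_\theta(x)=0\text{ for all }\theta\in\Theta\}$ (possibly empty). *)

(* Defs.v *)
From Stdlib Require Import Reals.
From mathcomp Require Import all_boot.
Set Implicit Arguments. Unset Strict Implicit.
Open Scope R_scope.

(* Points of R^N (lifts of points of the torus T^N), and N x N matrices. *)
Definition vec (N : nat) := 'I_N -> R.
Definition mat (N : nat) := 'I_N -> 'I_N -> R.

Definition sumN (N : nat) (f : 'I_N -> R) : R := \big[Rplus/0]_(i < N) f i.

Definition vadd N (x y : vec N) : vec N := fun i => x i + y i.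
Definition vsub N (x y : vec N) : vec N := fun i => x i - y i.
Definition vscale N (a : R) (x : vec N) : vec N := fun i => a * x i.
Definition vzero N : vec N := fun _ => 0.
Definition vint N (k : 'I_N -> Z) : vec N := fun i => IZR (k i).

Definition dot N (x y : vec N) : R := sumN (fun i => x i * y i).
Definition norm N (x : vec N) : R := sqrt (dot x x).

Definition quad N (X : mat N) (z : vec N) : R :=
  sumN (fun i => sumN (fun j => X i j * z i * z j)).
Definition trprod N (A X : mat N) : R :=
  sumN (fun i => sumN (fun j => A i j * X j i)).
Definition mnorm N (M : mat N) : R :=
  sqrt (sumN (fun i => sumN (fun j => M i j * M i j))).
Definition msub N (M P : mat N) : mat N := fun i j => M i j - P i j.
Definition symmetric N (X : mat N) : Prop := forall i j, X i j = X j i.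
Definition gram N (s : mat N) : mat N := fun i j => sumN (fun k => s i k * s j k).

(* Z^N-periodic functions on R^N = functions on T^N *)
Definition periodic N (T : Type) (f : vec N -> T) : Prop :=
  forall (x : vec N) (k : 'I_N -> Z), f (vadd x (vint k)) = f x.

Definition lipschitz N (L : R) (f : vec N -> R) : Prop :=
  forall x y, Rabs (f x - f y) <= L * norm (vsub x y).

Definition is_metric (T : Type) (d : T -> T -> R) : Prop :=
  (forall a b, 0 <= d a b) /\ (forall a b, d a b = 0 <-> a = b) /\
  (forall a b, d a b = d b a) /\ (forall a b c, d a c <= d a b + d b c).

Definition IsSup (Th : Type) (f : Th -> R) (s : R) : Prop :=
  is_lub (fun r => exists th, r = f th) s.

Definition Fsup N (Th : Type) (sigma : Th -> vec N -> mat N)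
  (H : Th -> vec N -> vec N -> R) (x p : vec N) (X : mat N) (s : R) : Prop :=
  IsSup (fun th => - trprod (gram (sigma th x)) X + H th x p) s.

Definition superjet N (v : vec N -> R) (x p : vec N) (X : mat N) : Prop :=
  forall eps, 0 < eps -> exists delta, 0 < delta /\
    forall y, norm (vsub y x) < delta ->
      v y <= v x + dot p (vsub y x) + / 2 * quad X (vsub y x)
             + eps * (norm (vsub y x) ^ 2).
Definition subjet N (v : vec N -> R) (x p : vec N) (X : mat N) : Prop :=
  forall eps, 0 < eps -> exists delta, 0 < delta /\
    forall y, norm (vsub y x) < delta ->
      v y >= v x + dot p (vsub y x) + / 2 * quad X (vsub y x)
             - eps * (norm (vsub y x) ^ 2).

Definition par_superjet N (u : vec N -> R -> R) (x : vec N) (t a : R)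
  (p : vec N) (X : mat N) : Prop :=
  forall eps, 0 < eps -> exists delta, 0 < delta /\
    forall y s, 0 < s -> norm (vsub y x) < delta -> Rabs (s - t) < delta ->
      u y s <= u x t + a * (s - t) + dot p (vsub y x) + / 2 * quad X (vsub y x)
               + eps * (Rabs (s - t) + norm (vsub y x) ^ 2).
Definition par_subjet N (u : vec N -> R -> R) (x : vec N) (t a : R)
  (p : vec N) (X : mat N) : Prop :=
  forall eps, 0 < eps -> exists delta, 0 < delta /\
    forall y s, 0 < s -> norm (vsub y x) < delta -> Rabs (s - t) < delta ->
      u y s >= u x t + a * (s - t) + dot p (vsub y x) + / 2 * quad X (vsub y x)
               - eps * (Rabs (s - t) + norm (vsub y x) ^ 2).

Definition continuous_on_torus N (v : vec N -> R) : Prop :=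
  forall x eps, 0 < eps -> exists delta, 0 < delta /\
    forall y, norm (vsub y x) < delta -> Rabs (v y - v x) < eps.

Definition visc_sol_E N (Th : Type) (sigma : Th -> vec N -> mat N)
  (H : Th -> vec N -> vec N -> R) (u0 : vec N -> R) (u : vec N -> R -> R) : Prop :=
  (forall x t, 0 <= t -> forall eps, 0 < eps -> exists delta, 0 < delta /\
     forall y s, 0 <= s -> norm (vsub y x) < delta -> Rabs (s - t) < delta ->
       Rabs (u y s - u x t) < eps) /\
  (forall t, periodic (fun x => u x t)) /\
  (forall x, u x 0 = u0 x) /\
  (forall x t a p X, 0 < t -> symmetric X -> par_superjet u x t a p X ->
     exists s, Fsup sigma H x p X s /\ a + s <= 0) /\
  (forall x t a p X, 0 < t -> symmetric X -> par_subjet u x t a p X ->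
     exists s, Fsup sigma H x p X s /\ a + s >= 0).

Definition visc_sol_Elam N (Th : Type) (sigma : Th -> vec N -> mat N)
  (H : Th -> vec N -> vec N -> R) (lam : R) (v : vec N -> R) : Prop :=
  continuous_on_torus v /\ periodic v /\
  (forall x p X, symmetric X -> superjet v x p X ->
     exists s, Fsup sigma H x p X s /\ lam * v x + s <= 0) /\
  (forall x p X, symmetric X -> subjet v x p X ->
     exists s, Fsup sigma H x p X s /\ lam * v x + s >= 0).

Definition visc_sol_S N (Th : Type) (sigma : Th -> vec N -> mat N)
  (H : Th -> vec N -> vec N -> R) (c : R) (v : vec N -> R) : Prop :=
  continuous_on_torus v /\ periodic v /\
  (forall x p X, symmetric X -> superjet v x p X ->
     exists s, Fsup sigma H x p X s /\ s <= c) /\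
  (forall x p X, symmetric X -> subjet v x p X ->
     exists s, Fsup sigma H x p X s /\ s >= c).

Definition inSigma N (Th : Type) (sigma : Th -> vec N -> mat N) (x : vec N) : Prop :=
  forall th i j, gram (sigma th x) i j = 0.

(* dist_{T^N}(x, Sigma) > delta  (inf over an empty Sigma is +oo) *)
Definition dist_Sigma_gt N (Th : Type) (sigma : Th -> vec N -> mat N)
  (x : vec N) (delta : R) : Prop :=
  exists d', delta < d' /\
    forall y, inSigma sigma y -> forall k : 'I_N -> Z,
      d' <= norm (vsub x (vadd y (vint k))).

(* Main.v *)
(* Replacing [u] by [u + c t] we may take [c = 0]; let [v] solve (S).  Convexity in [(p, X)] lets a
   subsolution be approximated by smooth almost-subsolutions (sup-convolution in space, then averaging),
   so smooth functions built from [u], [v] and barriers can be tested against the supersolution property.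
   This yields comparison, hence [sup |u (t + h) - u t|] and [sup |u t - w|] ([w] stationary) decrease in [t].

   If [Sigma] is empty, a Harnack-type barrier makes [u - v] converge to a constant.  Otherwise shift [v]
   so that [1 <= u - v <= B], fix [eta > 0] and let [mu] be the supremum of the numbers for which eventually
   [u (t + h) - v + eta h >= mu (u t - v)] for all [h >= 0].  Suppose [mu < 1] and let [D x >= 0] be the
   eventual lower bound at [x] of the difference of the two sides.  Since [mu u + (1 - mu) v] is a
   subsolution, [D] obeys the Hopf principle where the equation is nondegenerate, so its zero set meets
   [Sigma].  There the diffusion is quadratically small and a three-point doubling compares gradients [p]
   of [u] and [q] of [v]: strict convexity excludes [p] far from [q], and the speed [eta] excludes [p]
   close to [q].  So [mu = 1], and [u] is asymptotically nondecreasing up to [eta h].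

   Finally, let [phi] be the limit of [u n] along an ultrafilter.  The convergence is uniform, so [u] has
   arbitrarily long almost-periods; with almost monotonicity, [u] is nearly constant, equal to [phi], on
   arbitrarily late time windows.  By stability [phi] is stationary, so [sup |u t - phi|] decreases, to 0. *)
From HB Require Import structures.
From Stdlib Require Import Reals Lra Lia FunctionalExtensionality Classical ClassicalEpsilon.
From mathcomp Require Import all_boot.
From mathcomp Require filter.
From Coquelicot Require Import Coquelicot.
Require Import Defs.
Set Implicit Arguments. Unset Strict Implicit. Unset Printing Implicit Defensive.
Open Scope R_scope.

(** * Vectors, matrices and quadratic forms *)

(** The obstacle is second order: comparing two merely continuous viscosity functions usually rests
    on the theorem on sums, hence on almost everywhere twice differentiability of semiconvex
    functions. Here the subsolution is smoothed first, so each contact involves a single nonsmooth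
    function and [touch] suffices. The price is to show, without differentiating it, that averages
    of a subsolution with constant coefficients are subsolutions: it is compared with a random walk,
    and the walk commutes with averages. Nonsmooth functions are doubled only at a point of [Sigma],
    where the test matrices are multiples of the identity and [sigma] vanishes at a Lipschitz rate,
    so the traces can be estimated by hand. The number [eta] gives time slopes [- eta] at the later
    time and [- eta / mu] at the earlier one. Weighted by 1 and [mu] they cancel in the convexity
    inequality, but they leave the Hamiltonian bounded below by about [eta] at the mixed gradient,
    which nearly equal gradients cannot satisfy. The normalisation [u - v >= 1] together with
    [mu < 1] keeps the two times apart. *)

HB.instance Definition _ := Monoid.isComLaw.Build R 0 Rplus
  (fun x y z => esym (Rplus_assoc x y z)) Rplus_comm Rplus_0_l.

Lemma sumN_ext n (f g : 'I_n -> R) : (forall i, f i = g i) -> sumN f = sumN g.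
Proof. by move=> h; apply: eq_bigr. Qed.

Lemma sumN_plus n (f g : 'I_n -> R) : sumN (fun i => f i + g i) = sumN f + sumN g.
Proof. by rewrite /sumN big_split. Qed.

Lemma sumN_scal n a (f : 'I_n -> R) : sumN (fun i => a * f i) = a * sumN f.
Proof. by rewrite /sumN; elim/big_rec2: _ => [|i y1 y2 _ ->]; ring. Qed.

Lemma sumN_minus n (f g : 'I_n -> R) : sumN (fun i => f i - g i) = sumN f - sumN g.
Proof.
have -> : sumN f - sumN g = sumN f + (-1) * sumN g by ring.
by rewrite -sumN_scal -sumN_plus; apply: sumN_ext => i; ring.
Qed.

Lemma sumN_le n (f g : 'I_n -> R) : (forall i, f i <= g i) -> sumN f <= sumN g.
Proof. by move=> h; rewrite /sumN; elim/big_rec2: _ => [|i y1 y2 _ H]; [exact: Rle_refl | have := h i => hi; apply: Rplus_le_compat]. Qed.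

Lemma sumN_cst n c : sumN (fun _ : 'I_n => c) = INR n * c.
Proof.
rewrite /sumN big_const_ord; elim: n => [|n IH]; first by rewrite /=; ring.
by rewrite iterS IH S_INR; ring.
Qed.

Lemma sumN0 n (f : 'I_n -> R) : (forall i, f i = 0) -> sumN f = 0.
Proof. by move=> h; apply: big1. Qed.

Lemma sumN_ge0 n (f : 'I_n -> R) : (forall i, 0 <= f i) -> 0 <= sumN f.
Proof. by move=> h; rewrite -(@sumN0 n (fun _ => 0)) //; apply: sumN_le. Qed.

Lemma sumN_ge1 n (f : 'I_n -> R) i : (forall i, 0 <= f i) -> f i <= sumN f.
Proof.
move=> h.
have -> : sumN f = f i + \big[Rplus/0]_(j < n | j != i) f j by exact: bigD1.
suff : 0 <= \big[Rplus/0]_(j < n | j != i) f j by lra.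
by elim/big_ind: _ => [|x y hx hy|//]; lra.
Qed.

Lemma sumN_exch n m (f : 'I_n -> 'I_m -> R) :
  sumN (fun i => sumN (fun j => f i j)) = sumN (fun j => sumN (fun i => f i j)).
Proof. by rewrite /sumN exchange_big. Qed.

Lemma sumN_recl n (f : 'I_n.+1 -> R) : sumN f = f ord0 + sumN (fun i => f (lift ord0 i)).
Proof. by rewrite /sumN big_ord_recl. Qed.

Lemma sumN_abs n (f : 'I_n -> R) : Rabs (sumN f) <= sumN (fun i => Rabs (f i)).
Proof.
rewrite /sumN; elim/big_rec2: _ => [|i y1 y2 _ H]; first by rewrite Rabs_R0; lra.
apply: Rle_trans (Rabs_triang _ _) _; lra.
Qed.

Lemma sumN_delta n (f : 'I_n -> R) i : sumN (fun j => if j == i then f j else 0) = f i.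
Proof.
rewrite /sumN (bigD1 i) //= eqxx big1 ?Rplus_0_r // => j /negbTE ->.
by [].
Qed.

Ltac vring := let i := fresh "i" in
  apply: functional_extensionality => i; rewrite /vadd /vsub /vscale /vzero; ring.

Section Vec.
Variable n : nat.
Implicit Types (x y z : vec n) (X : mat n).

Lemma dotC x y : dot x y = dot y x.
Proof. by apply: sumN_ext => i; ring. Qed.
Lemma dotDl x y z : dot (vadd x y) z = dot x z + dot y z.
Proof. by rewrite /dot -sumN_plus; apply: sumN_ext => i; rewrite /vadd; ring. Qed.
Lemma dotZl a x z : dot (vscale a x) z = a * dot x z.
Proof. by rewrite /dot -sumN_scal; apply: sumN_ext => i; rewrite /vscale; ring. Qed.
Lemma dotBl x y z : dot (vsub x y) z = dot x z - dot y z.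
Proof. by rewrite /dot -sumN_minus; apply: sumN_ext => i; rewrite /vsub; ring. Qed.
Lemma dotDr x y z : dot z (vadd x y) = dot z x + dot z y.
Proof. by rewrite dotC dotDl !(dotC z). Qed.
Lemma dotZr a x z : dot z (vscale a x) = a * dot z x.
Proof. by rewrite dotC dotZl !(dotC z). Qed.
Lemma dotBr x y z : dot z (vsub x y) = dot z x - dot z y.
Proof. by rewrite dotC dotBl !(dotC z). Qed.
Lemma dot0l x : dot (@vzero n) x = 0.
Proof. by apply: sumN0 => i; rewrite /vzero; ring. Qed.
Lemma dot0r x : dot x (@vzero n) = 0.
Proof. by rewrite dotC dot0l. Qed.
Lemma dot_ge0 x : 0 <= dot x x.
Proof. by apply: sumN_ge0 => i; nra. Qed.

Lemma norm_ge0 x : 0 <= norm x.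
Proof. exact: sqrt_pos. Qed.
Lemma norm_sq x : norm x ^ 2 = dot x x.
Proof. by rewrite /norm -Rsqr_pow2 Rsqr_sqrt //; apply: dot_ge0. Qed.
Lemma coord_le_norm x i : Rabs (x i) <= norm x.
Proof.
rewrite -sqrt_Rsqr_abs; apply: sqrt_le_1_alt; rewrite /dot /Rsqr.
by apply: (@sumN_ge1 _ (fun i => x i * x i)) => j; nra.
Qed.
Lemma norm_le_sq x r : 0 <= r -> dot x x <= r ^ 2 -> norm x <= r.
Proof. by move=> h0 h; rewrite -norm_sq in h; have := norm_ge0 x; nra. Qed.
Lemma norm_zero : norm (@vzero n) = 0.
Proof. by rewrite /norm dot0l sqrt_0. Qed.
Lemma norm0_eq x : norm x = 0 -> x = @vzero n.
Proof.
move=> h; apply: functional_extensionality => i; rewrite /vzero.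
have := coord_le_norm x i; rewrite h; have := Rabs_pos (x i); split_Rabs; lra.
Qed.
Lemma norm_gt0 x : x <> @vzero n -> 0 < norm x.
Proof. by move=> h; have [//|/esym/norm0_eq] := Rle_lt_or_eq_dec _ _ (norm_ge0 x). Qed.

Lemma cauchy x y : dot x y <= norm x * norm y.
Proof.
have [->|hy] := classic (y = @vzero n); first by rewrite dot0r norm_zero; lra.
have p := norm_gt0 hy.
have h := dot_ge0 (vsub (vscale (norm y) x) (vscale (norm x) y)).
rewrite !(dotBl, dotBr, dotZl, dotZr) (dotC y x) -!norm_sq in h.
have := norm_ge0 x => q.
have [q0|q0] := Rle_lt_or_eq_dec _ _ q; last first.
  by rewrite (norm0_eq (esym q0)) dot0l norm_zero; lra.
have : 0 <= (norm x * norm y) * (norm x * norm y - dot x y) by nra.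
have : 0 < norm x * norm y by nra.
by move: (norm x * norm y) (dot x y) => a b ha hb; nra.
Qed.
Lemma dot_scaleN x y : dot (vscale (-1) x) y = - dot x y.
Proof. by rewrite dotZl; ring. Qed.
Lemma norm_scale a x : norm (vscale a x) = Rabs a * norm x.
Proof.
rewrite /norm dotZl dotZr -Rmult_assoc sqrt_mult; [|nra|exact: dot_ge0].
by rewrite -sqrt_Rsqr_abs.
Qed.
Lemma cauchy_abs x y : Rabs (dot x y) <= norm x * norm y.
Proof.
have h1 := cauchy x y; have h2 := cauchy (vscale (-1) x) y.
rewrite dot_scaleN norm_scale Rabs_Ropp Rabs_R1 Rmult_1_l in h2.
by split_Rabs; lra.
Qed.
Lemma norm_add_sq x y : norm (vadd x y) ^ 2 = norm x ^ 2 + 2 * dot x y + norm y ^ 2.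
Proof. by rewrite !norm_sq !(dotDl, dotDr) (dotC y x); ring. Qed.
Lemma norm_triang x y : norm (vadd x y) <= norm x + norm y.
Proof.
apply: norm_le_sq; first by have := norm_ge0 x; have := norm_ge0 y; lra.
rewrite !(dotDl, dotDr) (dotC y x) -!norm_sq; have := cauchy x y; nra.
Qed.
Lemma norm_subC x y : norm (vsub x y) = norm (vsub y x).
Proof.
have -> : vsub x y = vscale (-1) (vsub y x) by vring.
by rewrite norm_scale Rabs_Ropp Rabs_R1; ring.
Qed.
Lemma norm_sub_triang x y z : norm (vsub x z) <= norm (vsub x y) + norm (vsub y z).
Proof.
have -> : vsub x z = vadd (vsub x y) (vsub y z) by vring.
exact: norm_triang.
Qed.
Lemma norm_subvv x : norm (vsub x x) = 0.
Proof. by have -> : vsub x x = @vzero n; [vring | exact: norm_zero]. Qed.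
Lemma norm_sub_le x y : norm x - norm y <= norm (vsub x y).
Proof. have := norm_triang (vsub x y) y; have -> : vadd (vsub x y) y = x by vring. lra. Qed.
Lemma norm_subl x y : norm (vsub x y) <= norm x + norm y.
Proof.
have := norm_triang x (vscale (-1) y); rewrite norm_scale Rabs_Ropp Rabs_R1.
have -> : vadd x (vscale (-1) y) = vsub x y by vring.
lra.
Qed.
Lemma norm_le_sum x : norm x <= sumN (fun i => Rabs (x i)).
Proof.
have h0 : 0 <= sumN (fun i => Rabs (x i)) by apply: sumN_ge0 => i; apply: Rabs_pos.
apply: norm_le_sq => //.
have -> : sumN (fun i => Rabs (x i)) ^ 2
  = sumN (fun i => sumN (fun j => Rabs (x j)) * Rabs (x i)) by rewrite sumN_scal; ring.
apply: sumN_le => i.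
have h := @sumN_ge1 _ (fun j => Rabs (x j)) i (fun j => Rabs_pos _).
have -> : x i * x i = Rabs (x i) * Rabs (x i) by split_Rabs; ring.
have := Rabs_pos (x i); nra.
Qed.
Lemma norm_le_coord x d : (forall i, Rabs (x i) <= d) -> norm x <= INR n * d.
Proof.
move=> h; apply: Rle_trans (norm_le_sum x) _.
by rewrite -(sumN_cst n d); apply: sumN_le.
Qed.

Definition bil X y z := sumN (fun i => sumN (fun j => X i j * y i * z j)).
Lemma quadE X z : quad X z = bil X z z. Proof. by []. Qed.
Lemma bilDl X x y z : bil X (vadd x y) z = bil X x z + bil X y z.
Proof.
rewrite /bil -sumN_plus; apply: sumN_ext => i; rewrite -sumN_plus; apply: sumN_ext => j.
by rewrite /vadd; ring.
Qed.
Lemma bilDr X x y z : bil X z (vadd x y) = bil X z x + bil X z y.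
Proof.
rewrite /bil -sumN_plus; apply: sumN_ext => i; rewrite -sumN_plus; apply: sumN_ext => j.
by rewrite /vadd; ring.
Qed.
Lemma bilZl X a y z : bil X (vscale a y) z = a * bil X y z.
Proof.
rewrite /bil -sumN_scal; apply: sumN_ext => i; rewrite -sumN_scal; apply: sumN_ext => j.
by rewrite /vscale; ring.
Qed.
Lemma bilZr X a y z : bil X y (vscale a z) = a * bil X y z.
Proof.
rewrite /bil -sumN_scal; apply: sumN_ext => i; rewrite -sumN_scal; apply: sumN_ext => j.
by rewrite /vscale; ring.
Qed.
Lemma bilC X y z : symmetric X -> bil X y z = bil X z y.
Proof.
move=> s; rewrite /bil sumN_exch; apply: sumN_ext => i; apply: sumN_ext => j.
by rewrite (s j i); ring.
Qed.
Lemma bil_dot X y z : bil X y z = dot y (fun i => sumN (fun j => X i j * z j)).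
Proof.
apply: sumN_ext => i; rewrite -sumN_scal; apply: sumN_ext => j; ring.
Qed.
Lemma quadZ X a z : quad X (vscale a z) = a ^ 2 * quad X z.
Proof. by rewrite !quadE bilZl bilZr; ring. Qed.
Lemma quadD X y z : symmetric X -> quad X (vadd y z) = quad X y + 2 * bil X y z + quad X z.
Proof. by move=> s; rewrite !quadE !(bilDl, bilDr) (bilC z y s); ring. Qed.

Definition madd X Y : mat n := fun i j => X i j + Y i j.
Definition mscale a X : mat n := fun i j => a * X i j.
Definition mid : mat n := fun i j => if j == i then 1 else 0.
Lemma bil_madd X Y y z : bil (madd X Y) y z = bil X y z + bil Y y z.
Proof.
rewrite /bil -sumN_plus; apply: sumN_ext => i; rewrite -sumN_plus; apply: sumN_ext => j.
by rewrite /madd; ring.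
Qed.
Lemma bil_mscale a X y z : bil (mscale a X) y z = a * bil X y z.
Proof.
rewrite /bil -sumN_scal; apply: sumN_ext => i; rewrite -sumN_scal; apply: sumN_ext => j.
by rewrite /mscale; ring.
Qed.
Lemma bil_mid y z : bil mid y z = dot y z.
Proof.
apply: sumN_ext => i.
rewrite -(@sumN_delta n (fun j => y i * z j) i); apply: sumN_ext => j.
by rewrite /mid; case: (j == i); ring.
Qed.
Lemma quad_madd X Y z : quad (madd X Y) z = quad X z + quad Y z.
Proof. exact: bil_madd. Qed.
Lemma quad_mscale a X z : quad (mscale a X) z = a * quad X z.
Proof. exact: bil_mscale. Qed.
Lemma quad_mid z : quad mid z = dot z z.
Proof. exact: bil_mid. Qed.
Lemma sym_madd X Y : symmetric X -> symmetric Y -> symmetric (madd X Y).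
Proof. by move=> h1 h2 i j; rewrite /madd h1 h2. Qed.
Lemma sym_mscale a X : symmetric X -> symmetric (mscale a X).
Proof. by move=> h1 i j; rewrite /mscale h1. Qed.
Lemma sym_mid : symmetric mid.
Proof. by move=> i j; rewrite /mid eq_sym. Qed.

Definition mabs X := sumN (fun i => sumN (fun j => Rabs (X i j))).
Lemma mabs_ge0 X : 0 <= mabs X.
Proof. by apply: sumN_ge0 => i; apply: sumN_ge0 => j; apply: Rabs_pos. Qed.
Lemma bil_bound X y z : Rabs (bil X y z) <= mabs X * (norm y * norm z).
Proof.
apply: Rle_trans (sumN_abs _) _.
rewrite /mabs Rmult_comm -sumN_scal; apply: sumN_le => i.
apply: Rle_trans (sumN_abs _) _; rewrite -sumN_scal; apply: sumN_le => j.
rewrite !Rabs_mult.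
have h1 := coord_le_norm y i; have h2 := coord_le_norm z j.
have := Rabs_pos (y i); have := Rabs_pos (z j); have := Rabs_pos (X i j) => a b c.
have : Rabs (y i) * Rabs (z j) <= norm y * norm z by nra.
nra.
Qed.
Lemma quad_bound X z : Rabs (quad X z) <= mabs X * norm z ^ 2.
Proof. by have := bil_bound X z z; rewrite quadE; have -> : norm z ^ 2 = norm z * norm z by ring. Qed.

Definition colv (s : mat n) k : vec n := fun i => s i k.
Lemma trprod_gram (s : mat n) X : trprod (gram s) X = sumN (fun k => quad X (colv s k)).
Proof.
rewrite /trprod /gram /quad.
rewrite sumN_exch.
transitivity (sumN (fun j => sumN (fun k => sumN (fun i => X j i * s j k * s i k)))).
  apply: sumN_ext => j; rewrite sumN_exch; apply: sumN_ext => i.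
  rewrite Rmult_comm -sumN_scal; apply: sumN_ext => k; ring.
by rewrite sumN_exch.
Qed.
Lemma mnorm_col (s : mat n) : mnorm s ^ 2 = sumN (fun k => norm (colv s k) ^ 2).
Proof.
rewrite /mnorm -Rsqr_pow2 Rsqr_sqrt.
  by rewrite sumN_exch; apply: sumN_ext => k; rewrite norm_sq.
by apply: sumN_ge0 => i; apply: sumN_ge0 => j; nra.
Qed.
Lemma mnorm_ge0 (s : mat n) : 0 <= mnorm s. Proof. exact: sqrt_pos. Qed.
End Vec.
Arguments mid {n}.

(** * Compactness along an ultrafilter *)

Lemma exists_nat_ultrafilter : exists U : (nat -> Prop) -> Prop,
  (forall A B, U A -> U B -> U (fun n => A n /\ B n)) /\
  (forall A B : nat -> Prop, (forall n, A n -> B n) -> U A -> U B) /\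
  (forall A, U A \/ U (fun n => ~ A n)) /\
  (~ U (fun _ => False)) /\
  (forall N, U (fun n => (N <= n)%coq_nat)).
Proof.
have [U [uU sU]] := @filter.ultraFilterLemma nat filter.eventually filter.eventually_filter.
have pU := @filter.ultra_proper _ _ uU.
have fU := @filter.filter_filter _ _ pU.
exists U; split; [|split; [|split; [|split]]].
- by move=> A B; apply: filter.filterI.
- by move=> A B AB; apply: filter.filterS.
- by move=> A; apply: filter.in_ultra_setVsetC.
- exact: filter.filter_not_empty.
- move=> N; apply: sU; exists N => // n /=; exact: leP.
Qed.

(* [UF A]: [A] holds along a fixed free ultrafilter; limits along it replace the extraction of subsequences. *)
Definition UF := proj1_sig (constructive_indefinite_description _ exists_nat_ultrafilter).
Definition UF_spec := proj2_sig (constructive_indefinite_description _ exists_nat_ultrafilter).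
Lemma UF_and A B : UF A -> UF B -> UF (fun n => A n /\ B n).
Proof. exact: (proj1 UF_spec). Qed.
Lemma UF_sub (A B : nat -> Prop) : (forall n, A n -> B n) -> UF A -> UF B.
Proof. exact: (proj1 (proj2 UF_spec)). Qed.
Lemma UF_em A : UF A \/ UF (fun n => ~ A n).
Proof. exact: (proj1 (proj2 (proj2 UF_spec))). Qed.
Lemma UF_tail N : UF (fun n => (N <= n)%coq_nat).
Proof. exact: (proj2 (proj2 (proj2 (proj2 UF_spec)))). Qed.
Lemma UF_ex (A : nat -> Prop) : UF A -> exists n, A n.
Proof.
move=> h; apply: NNPP => h'; apply: (proj1 (proj2 (proj2 (proj2 UF_spec)))).
by apply: UF_sub h => n hn; apply: h'; exists n.
Qed.
Lemma UF_all (A : nat -> Prop) : (forall n, A n) -> UF A.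
Proof. by move=> h; apply: UF_sub (UF_tail 0) => n _. Qed.

(** The limit is the supremum of the levels that [f] reaches along the ultrafilter: if a one-sided
    bound failed, [UF_em] would put the opposite inequality in the ultrafilter and contradict this
    supremum. *)
Lemma ulim_ex (f : nat -> R) a b : (forall n, a <= f n <= b) ->
  exists l, a <= l <= b /\ forall e, 0 < e -> UF (fun n => Rabs (f n - l) < e).
Proof.
move=> h.
have [l [l1 l2]] : {l | is_lub (fun r => UF (fun n => r <= f n)) l}.
  apply: completeness.
    exists b => r /UF_ex [n hn]; have := h n; lra.
  by exists a; apply: UF_all => n; have := h n; lra.
exists l; split.
  split; first by apply: l1; apply: UF_all => n; have := h n; lra.
  by apply: l2 => r /UF_ex [n hn]; have := h n; lra.
move=> e he.
have h1 : UF (fun n => l - e < f n).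
  have [//|h'] := UF_em (fun n => l - e < f n).
  have : l <= l - e; last lra.
  apply: l2 => r hr; have [n [/= h3 h4]] := UF_ex (UF_and hr h'); lra.
have h2 : UF (fun n => f n < l + e).
  have [//|h'] := UF_em (fun n => f n < l + e).
  have : l + e <= l; last lra.
  by apply: l1; apply: UF_sub h' => n; lra.
by apply: UF_sub (UF_and h1 h2) => n [h3 h4]; split_Rabs; lra.
Qed.

Lemma UF_fin n (P : 'I_n -> nat -> Prop) :
  (forall i, UF (P i)) -> UF (fun m => forall i, P i m).
Proof.
move=> h.
suff H (l : seq 'I_n) : UF (fun m => forall i, i \in l -> P i m).
  by apply: UF_sub (H (enum 'I_n)) => m hm i; apply: hm; rewrite mem_enum.
elim: l => [|i l IH]; first by apply: UF_all.
apply: UF_sub (UF_and (h i) IH) => m [h1 h2] j; rewrite in_cons => /orP [/eqP ->//|].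
exact: h2.
Qed.

Section Ucpt.
Variables (T : Type) (d : T -> T -> R) (D : T -> Prop).
(** Sequential compactness in which whole sequences converge along the one fixed ultrafilter, so
    limits of several sequences are taken together without refining subsequences. Nothing is
    required of [d]. *)
Definition ucpt := forall z : nat -> T, (forall n, D (z n)) ->
  exists x, D x /\ forall e, 0 < e -> UF (fun n => d (z n) x < e).

(** From local to uniform, in place of finite subcovers: points violating the property with margin
    [/ INR n.+1] have a limit, near which the local margin contradicts the violation for large [n].
    Attained maxima, moduli of continuity, strict convexity gaps and waiting times all get their
    uniformity here. *)
Lemma ucpt_uniform (P : T -> R -> Prop) : ucpt ->
  (forall x m m', P x m -> 0 < m' <= m -> P x m') ->
  (forall x, D x -> exists m e, 0 < m /\ 0 < e /\ forall y, D y -> d y x < e -> P y m) ->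
  exists m, 0 < m /\ forall x, D x -> P x m.
Proof.
move=> cD mP h; apply: NNPP => hn.
have hz n : exists x, D x /\ ~ P x (/ INR n.+1).
  apply: NNPP => h1; apply: hn; exists (/ INR n.+1); split.
    by apply: Rinv_0_lt_compat; apply: lt_0_INR; lia.
  by move=> x Dx; apply: NNPP => h2; apply: h1; exists x.
pose z n := proj1_sig (constructive_indefinite_description _ (hz n)).
have hz1 n : D (z n) /\ ~ P (z n) (/ INR n.+1).
  exact: (proj2_sig (constructive_indefinite_description _ (hz n))).
have [x [Dx hx]] := cD z (fun n => proj1 (hz1 n)).
have [m [e [m0 [e0 H]]]] := h x Dx.
have [N [hN N0]] := archimed_cor1 _ m0.
have [n [h1 h2]] := UF_ex (UF_and (UF_tail N) (hx e e0)).
apply: (proj2 (hz1 n)); apply: (mP _ m); first by apply: H => //; apply: (proj1 (hz1 n)).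
have hn1 : 0 < INR n.+1 by apply: lt_0_INR; lia.
split; first exact: Rinv_0_lt_compat.
apply: Rle_trans (Rlt_le _ _ hN); apply: Rinv_le_contravar; first by apply: lt_0_INR; lia.
by apply: le_INR; lia.
Qed.

Lemma ucpt_max (G : T -> R) : ucpt -> (exists x, D x) ->
  (forall x, D x -> forall e, 0 < e -> exists r, 0 < r /\
     forall y, D y -> d y x < r -> G y < G x + e) ->
  exists x, D x /\ forall y, D y -> G y <= G x.
Proof.
move=> cD [x0 Dx0] cG.
(* The upper bound is sought as [/ m], because [ucpt_uniform] wants a property that persists when
   [m] decreases. *)
have [m [m0 bd]] : exists m, 0 < m /\ forall x, D x -> G x <= / m.
  apply: (@ucpt_uniform (fun x m => G x <= / m) cD).
    by move=> x m m' h [h1 h2]; apply: Rle_trans h _; apply: Rinv_le_contravar.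
  move=> x Dx; have [r [r0 hr]] := cG x Dx 1 Rlt_0_1.
  have a0 : 0 < Rabs (G x) + 1 by have := Rabs_pos (G x); lra.
  exists (/ (Rabs (G x) + 1)), r; split; first exact: Rinv_0_lt_compat.
  split=> // y Dy hy; rewrite Rinv_inv; have := hr y Dy hy; have := Rle_abs (G x); lra.
have [s [s1 s2]] : {s | is_lub (fun r => exists x, D x /\ r = G x) s}.
  apply: completeness; last by exists (G x0), x0.
  by exists (/ m) => r [x [Dx ->]]; apply: bd.
apply: NNPP => hn.
have [k [k0 hk]] : exists k, 0 < k /\ forall x, D x -> G x <= s - k.
  apply: (@ucpt_uniform (fun x k => G x <= s - k) cD); first by move=> *; lra.
  move=> x Dx.
  have hs : G x < s.
    apply: Rnot_le_lt => hs; apply: hn; exists x; split=> // y Dy.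
    by apply: Rle_trans hs; apply: s1; exists y.
  have [r [r0 hr]] := cG x Dx ((s - G x) / 2) ltac:(lra).
  exists ((s - G x) / 2), r; split; [lra|split=> //] => y Dy hy.
  have := hr y Dy hy; lra.
have : s <= s - k; last lra.
by apply: s2 => r [x [Dx ->]]; apply: hk.
Qed.
End Ucpt.

Lemma ucpt_sub T d (D D' : T -> Prop) : ucpt d D -> (forall x, D' x -> D x) ->
  (forall x, D x -> (forall e, 0 < e -> exists y, D' y /\ d y x < e) -> D' x) -> ucpt d D'.
Proof.
move=> cD sub cl z hz.
have [x [Dx hx]] := cD z (fun n => sub _ (hz n)).
exists x; split=> //; apply: cl => // e e0.
have [n hn] := UF_ex (hx e e0); by exists (z n).
Qed.

Definition dprod S T (d1 : S -> S -> R) (d2 : T -> T -> R) (p q : S * T) : R :=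
  Rmax (d1 p.1 q.1) (d2 p.2 q.2).
Lemma ucpt_prod S T d1 d2 (D1 : S -> Prop) (D2 : T -> Prop) : ucpt d1 D1 -> ucpt d2 D2 ->
  ucpt (dprod d1 d2) (fun p => D1 p.1 /\ D2 p.2).
Proof.
move=> c1 c2 z hz.
have [x [Dx hx]] := c1 (fun n => (z n).1) (fun n => proj1 (hz n)).
have [y [Dy hy]] := c2 (fun n => (z n).2) (fun n => proj2 (hz n)).
exists (x, y); split=> // e e0.
apply: UF_sub (UF_and (hx e e0) (hy e e0)) => n [h1 h2].
exact: Rmax_lub_lt.
Qed.

Definition dR (s t : R) := Rabs (s - t).
Definition dV n (x y : vec n) := norm (vsub x y).

Lemma ucpt_itv a b : ucpt dR (fun t => a <= t <= b).
Proof. by move=> z /ulim_ex [l [h1 h2]]; exists l. Qed.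

Lemma ucpt_box n B : ucpt (@dV n) (fun x => forall i, Rabs (x i) <= B).
Proof.
move=> z hz.
have hi i : exists l, - B <= l <= B /\ forall e, 0 < e -> UF (fun m => Rabs (z m i - l) < e).
  by apply: ulim_ex => m; have := hz m i; split_Rabs; lra.
pose x : vec n := fun i => proj1_sig (constructive_indefinite_description _ (hi i)).
have hx i : - B <= x i <= B /\ forall e, 0 < e -> UF (fun m => Rabs (z m i - x i) < e).
  exact: (proj2_sig (constructive_indefinite_description _ (hi i))).
exists x; split; first by move=> i; have [h _] := hx i; split_Rabs; lra.
move=> e e0.
have n0 : 0 < INR n + 1 by have := pos_INR n; lra.
have d0 : 0 < e / (INR n + 1) by apply: Rdiv_lt_0_compat.
have := UF_fin (fun i => proj2 (hx i) _ d0); apply: UF_sub => m hm.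
have : dV (z m) x <= INR n * (e / (INR n + 1)).
  by apply: norm_le_coord => i; apply: Rlt_le; apply: hm.
have : INR n * (e / (INR n + 1)) = e - e / (INR n + 1) by field; lra.
lra.
Qed.

Lemma ucpt_ball n (c : vec n) B : ucpt (@dV n) (fun x => norm (vsub x c) <= B).
Proof.
apply: (@ucpt_sub _ _ (fun x => forall i, Rabs (x i) <= B + norm c)); first exact: ucpt_box.
  move=> x hx i; apply: Rle_trans (coord_le_norm x i) _.
  have := norm_sub_le x c; lra.
move=> x _ hx; apply: Rnot_lt_le => h.
have [y [h1 h2]] := hx (norm (vsub x c) - B) ltac:(lra).
have := norm_sub_triang x y c; rewrite (norm_subC x y); rewrite /dV in h2; lra.
Qed.

Lemma box_repr n (x : vec n) : exists k : 'I_n -> Z, forall i, 0 <= vadd x (vint k) i <= 1.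
Proof.
exists (fun i => (1 - up (x i))%Z) => i; rewrite /vadd /vint minus_IZR.
have := archimed (x i); lra.
Qed.

Definition inbox n (x : vec n) := forall i, 0 <= x i <= 1.
Lemma ucpt_inbox n : ucpt (@dV n) (@inbox n).
Proof.
apply: (@ucpt_sub _ _ (fun x => forall i, Rabs (x i) <= 1)); first exact: ucpt_box.
  by move=> x hx i; have := hx i; split_Rabs; lra.
move=> x _ hx i.
have H e : 0 < e -> exists y, 0 <= y <= 1 /\ Rabs (y - x i) < e.
  move=> /hx [y [h1 h2]]; exists (y i); split; first exact: h1.
  exact: Rle_lt_trans (coord_le_norm (vsub y x) i) h2.
split; apply: Rnot_lt_le => h.
  have [y [h1 h2]] := H (- x i) ltac:(lra); split_Rabs; lra.
have [y [h1 h2]] := H (x i - 1) ltac:(lra); split_Rabs; lra.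
Qed.

Lemma inbox_zero n : inbox (@vzero n).
Proof. by move=> i; rewrite /vzero; lra. Qed.

Lemma periodic_box n T (f : vec n -> T) (P : T -> Prop) : periodic f ->
  (forall x, inbox x -> P (f x)) -> forall x, P (f x).
Proof. by move=> pf h x; have [k hk] := box_repr x; rewrite -(pf x k); apply: h. Qed.

Lemma inbox_norm n (x : vec n) : inbox x -> norm x <= INR n.
Proof.
move=> h; rewrite -[INR n]Rmult_1_r; apply: norm_le_coord => i; have := h i; split_Rabs; lra.
Qed.

(** * Averaging over small boxes *)

Definition cont1 (F : R -> R) := forall s, continuous F s.

Lemma cont1_int F a b : cont1 F -> ex_RInt F a b.
Proof. by move=> h; apply: (@ex_RInt_continuous R_CompleteNormedModule) => z _; apply: h. Qed.

Definition mean (F : R -> R) := / 2 * RInt F (-1) 1.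

Lemma mean_cst c : mean (fun _ => c) = c.
Proof. by rewrite /mean RInt_const /scal /= /mult /=; field. Qed.
Lemma mean_plus F G : cont1 F -> cont1 G -> mean (fun s => F s + G s) = mean F + mean G.
Proof.
move=> hF hG; rewrite /mean (@RInt_plus R_CompleteNormedModule); try exact: cont1_int.
by rewrite /plus /=; ring.
Qed.
Lemma mean_scal a F : cont1 F -> mean (fun s => a * F s) = a * mean F.
Proof.
move=> hF; rewrite /mean (@RInt_scal R_CompleteNormedModule); last exact: cont1_int.
by rewrite /scal /= /mult /=; ring.
Qed.
Lemma mean_le F G : cont1 F -> cont1 G -> (forall s, -1 <= s <= 1 -> F s <= G s) -> mean F <= mean G.
Proof.
move=> hF hG h; rewrite /mean; apply: Rmult_le_compat_l; first lra.
by apply: RInt_le; [lra | exact: cont1_int | exact: cont1_int | move=> x hx; apply: h; lra].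
Qed.

Lemma RInt_small F a u M : cont1 F -> (forall s, Rabs (s - a) <= Rabs u -> Rabs (F s) <= M) ->
  Rabs (RInt F a (a + u)) <= Rabs u * M.
Proof.
move=> hF h; have [u0|u0] := Rle_lt_dec 0 u.
  have -> : Rabs u * M = (a + u - a) * M by rewrite Rabs_pos_eq //; ring.
  apply: abs_RInt_le_const; [lra | exact: cont1_int | move=> t ht; apply: h].
  by split_Rabs; lra.
rewrite -(opp_RInt_swap _ _ _ (cont1_int _ _ hF)) /opp /= Rabs_Ropp.
have -> : Rabs u * M = (a - (a + u)) * M by rewrite Rabs_left //; ring.
apply: abs_RInt_le_const; [lra | exact: cont1_int | move=> t ht; apply: h].
by split_Rabs; lra.
Qed.

(** Shifting the window changes the integral by its two end pieces only. This is how one averaging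
    gains one derivative: a bounded function becomes Lipschitz ([mean_shift_bounded]), a Lipschitz
    one becomes differentiable with a quadratic remainder ([mean_shift_lip]). *)
Lemma mean_shift F u : cont1 F ->
  mean (fun s => F (s + u)) - mean F = / 2 * (RInt F 1 (1 + u) - RInt F (-1) (-1 + u)).
Proof.
move=> hF; rewrite /mean.
have -> : RInt (fun s => F (s + u)) (-1) 1 = RInt F (-1 + u) (1 + u).
  have := @RInt_comp_lin R_CompleteNormedModule F 1 u (-1) 1.
  rewrite !Rmult_1_l => <-; last exact: cont1_int.
  by apply: RInt_ext => x _; rewrite /scal /= /mult /= !Rmult_1_l.
have h1 := @RInt_Chasles R_CompleteNormedModule F (-1) (-1 + u) (1 + u)
  (cont1_int _ _ hF) (cont1_int _ _ hF).
have h2 := @RInt_Chasles R_CompleteNormedModule F (-1) 1 (1 + u)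
  (cont1_int _ _ hF) (cont1_int _ _ hF).
rewrite /plus /= in h1 h2; lra.
Qed.

Lemma mean_shift_bounded F u B : cont1 F -> (forall s, Rabs (F s) <= B) ->
  Rabs (mean (fun s => F (s + u)) - mean F) <= B * Rabs u.
Proof.
move=> hF h; rewrite mean_shift //.
have h1 := @RInt_small F 1 u B hF (fun s _ => h s).
have h2 := @RInt_small F (-1) u B hF (fun s _ => h s).
split_Rabs; nra.
Qed.

Lemma cont1_minus F c : cont1 F -> cont1 (fun s => F s - c).
Proof.
by move=> hF s; apply: (@continuous_minus _ R_AbsRing R_NormedModule) => //; apply: continuous_const.
Qed.

Lemma mean_shift_lip F u L : cont1 F -> (forall s t, Rabs (F s - F t) <= L * Rabs (s - t)) ->
  Rabs (mean (fun s => F (s + u)) - mean F - u * (/ 2 * (F 1 - F (-1)))) <= L * u ^ 2.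
Proof.
move=> hF h; rewrite mean_shift //.
have L0 : 0 <= L by have := h 1 0; rewrite Rminus_0_r Rabs_R1; have := Rabs_pos (F 1 - F 0); lra.
have H a : Rabs (RInt F a (a + u) - u * F a) <= L * u ^ 2.
  have -> : RInt F a (a + u) - u * F a = RInt (fun s => F s - F a) a (a + u).
    rewrite (@RInt_minus R_CompleteNormedModule); [|exact: cont1_int|exact: ex_RInt_const].
    by rewrite RInt_const /minus /plus /opp /scal /= /mult /=; ring.
  have -> : L * u ^ 2 = Rabs u * (L * Rabs u) by rewrite -(pow2_abs u); ring.
  apply: RInt_small; first exact: cont1_minus.
  by move=> s hs; apply: Rle_trans (h _ _) _; apply: Rmult_le_compat_l.
have h1 := H 1; have h2 := H (-1).
set a := RInt F 1 (1 + u) in h1 *; set b := RInt F (-1) (-1 + u) in h2 *.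
move: h1 h2; split_Rabs; lra.
Qed.

Lemma bigR_cons I (i : I) l (f : I -> R) :
  \big[Rplus/0]_(j <- i :: l) f j = f i + \big[Rplus/0]_(j <- l) f j.
Proof. exact: big_cons. Qed.
Lemma bigR_nil I (f : I -> R) : \big[Rplus/0]_(j <- [::]) f j = 0.
Proof. exact: big_nil. Qed.

(** * Regularity gained by iterated averages *)

Section MQ.
Variable n : nat.
Implicit Types (f g : vec n -> R) (z d : vec n).

(* Uniform continuity in a form that passes to averages and to the random walk with the same constants. *)
Definition MQ e K f := forall z z', Rabs (f z - f z') <= e + K * norm (vsub z z') ^ 2.
Definition mq f := forall e, 0 < e -> exists K, 0 < K /\ MQ e K f.
Definition Lip L f := forall z z', Rabs (f z - f z') <= L * norm (vsub z z').

Lemma vadd_sub z z' : vadd z (vsub z' z) = z'. Proof. by vring. Qed.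
Lemma vsub_add z d : vsub (vadd z d) z = d. Proof. by vring. Qed.

Lemma mq_sub f e : 0 < e -> mq f -> exists r, 0 < r /\ forall z z', norm (vsub z z') < r -> Rabs (f z - f z') < e.
Proof.
move=> e0 h; have [K [K0 hK]] := h (e / 2) ltac:(lra).
have q : 0 < e / 2 / K by apply: Rdiv_lt_0_compat; lra.
exists (sqrt (e / 2 / K)); split; first exact: sqrt_lt_R0.
move=> z z' hz; apply: Rle_lt_trans (hK z z') _.
have h1 := sqrt_sqrt _ (Rlt_le _ _ q).
have : norm (vsub z z') ^ 2 < e / 2 / K by have := norm_ge0 (vsub z z'); nra.
move/(Rmult_lt_compat_l K _ _ K0).
have -> : K * (e / 2 / K) = e / 2 by field; lra.
lra.
Qed.

Lemma Lip_ge0 L f : Lip L f -> 0 < L \/ Lip 1 f.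
Proof.
move=> h; have [l0|l0] := Rlt_le_dec 0 L; [by left|right] => z z'.
by have := h z z'; have := norm_ge0 (vsub z z'); nra.
Qed.

Lemma Lip_mq L f : Lip L f -> mq f.
Proof.
move=> h.
have [L' [L0 h']] : exists L', 0 < L' /\ Lip L' f.
  by case: (Lip_ge0 h) => ?; [exists L|exists 1; split; [lra|]].
move=> e e0; exists (L' ^ 2 / e); split; first by apply: Rdiv_lt_0_compat; nra.
move=> z z'; apply: Rle_trans (h' z z') _.
move: (norm (vsub z z')) => t.
have -> : L' * t = e * (L' * t / e) by field; lra.
have -> : e + L' ^ 2 / e * t ^ 2 = e * (1 + (L' * t / e) ^ 2) by field; lra.
apply: Rmult_le_compat_l; [lra | nra].
Qed.

Lemma mq_ext f g : (forall z, f z = g z) -> mq f -> mq g.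
Proof. by move=> h; have -> : f = g by apply: functional_extensionality. Qed.
Lemma mq_cst c : mq (fun _ => c).
Proof. by apply: (@Lip_mq 1) => z z'; have := norm_ge0 (vsub z z'); split_Rabs; lra. Qed.
Lemma mq_plus f g : mq f -> mq g -> mq (fun z => f z + g z).
Proof.
move=> hf hg e e0; have [K [K0 h1]] := hf (e / 2) ltac:(lra).
have [K' [K'0 h2]] := hg (e / 2) ltac:(lra).
exists (K + K'); split; first lra.
move=> z z'; have := h1 z z'; have := h2 z z'; split_Rabs; lra.
Qed.
Lemma mq_scal a f : mq f -> mq (fun z => a * f z).
Proof.
move=> hf e e0.
have a0 : 0 < Rabs a + 1 by have := Rabs_pos a; lra.
have [K [K0 h1]] := hf (e / (Rabs a + 1)) ltac:(by apply: Rdiv_lt_0_compat).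
exists ((Rabs a + 1) * K); split; first nra.
move=> z z'; have := h1 z z'; move: (norm (vsub z z') ^ 2) => t.
rewrite -Rmult_minus_distr_l Rabs_mult => h.
have : (Rabs a + 1) * Rabs (f z - f z') <= (Rabs a + 1) * (e / (Rabs a + 1) + K * t).
  by apply: Rmult_le_compat_l; lra.
have -> : (Rabs a + 1) * (e / (Rabs a + 1) + K * t) = e + (Rabs a + 1) * K * t by field; lra.
by have := Rabs_pos (f z - f z'); lra.
Qed.
Lemma mq_sumN m (f : 'I_m -> vec n -> R) : (forall i, mq (f i)) -> mq (fun z => sumN (fun i => f i z)).
Proof.
move=> h; rewrite /sumN; elim: (index_enum _) => [|i l IH].
  by apply: mq_ext (mq_cst 0) => z; rewrite bigR_nil.
by apply: mq_ext (mq_plus (h i) IH) => z; rewrite bigR_cons.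
Qed.
Lemma mq_trans f d : mq f -> mq (fun z => f (vadd z d)).
Proof.
move=> h e /h [K [K0 hK]]; exists K; split=> // z z'.
have -> : vsub z z' = vsub (vadd z d) (vadd z' d) by vring.
exact: hK.
Qed.

Lemma mq_line f z d : mq f -> cont1 (fun s => f (vadd z (vscale s d))).
Proof.
move=> h s; apply/continuity_pt_filterlim => e e0.
have [r [r0 hr]] := mq_sub e0 h.
have p : 0 < norm d + 1 by have := norm_ge0 d; lra.
exists (r / (norm d + 1)); split; first exact: Rdiv_lt_0_compat.
move=> t [_ ht]; rewrite /= /R_dist in ht *; apply: hr.
have -> : vsub (vadd z (vscale t d)) (vadd z (vscale s d)) = vscale (t - s) d by vring.
rewrite norm_scale.
have : Rabs (t - s) * (norm d + 1) < r.
  have -> : r = r / (norm d + 1) * (norm d + 1) by field; lra.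
  exact: Rmult_lt_compat_r.
by have := Rabs_pos (t - s); lra.
Qed.

Definition Avg d f z := mean (fun s => f (vadd z (vscale s d))).

Lemma Avg_cst d c : Avg d (fun _ => c) = fun _ => c.
Proof. by apply: functional_extensionality => z; apply: mean_cst. Qed.
Lemma Avg_plus d f g z : mq f -> mq g -> Avg d (fun z => f z + g z) z = Avg d f z + Avg d g z.
Proof. by move=> hf hg; rewrite /Avg -mean_plus //; apply: mq_line. Qed.
Lemma Avg_scal d a f z : mq f -> Avg d (fun z => a * f z) z = a * Avg d f z.
Proof. by move=> hf; rewrite /Avg -mean_scal //; apply: mq_line. Qed.
Lemma Avg_sumN d m (f : 'I_m -> vec n -> R) z : (forall i, mq (f i)) ->
  Avg d (fun z => sumN (fun i => f i z)) z = sumN (fun i => Avg d (f i) z).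
Proof.
move=> h; rewrite /sumN.
have aux (l : seq 'I_m) : mq (fun z => \big[Rplus/0]_(i <- l) f i z) /\
   Avg d (fun z => \big[Rplus/0]_(i <- l) f i z) z = \big[Rplus/0]_(i <- l) Avg d (f i) z.
  elim: l => [|i l [IH1 IH2]].
    rewrite bigR_nil.
    have -> : (fun z => \big[Rplus/0]_(i <- [::]) f i z) = fun _ => 0.
      by apply: functional_extensionality => z'; rewrite bigR_nil.
    by rewrite Avg_cst; split=> //; apply: mq_cst.
  rewrite bigR_cons -IH2 -Avg_plus //.
  have -> : (fun z => \big[Rplus/0]_(j <- i :: l) f j z)
     = (fun z => f i z + \big[Rplus/0]_(j <- l) f j z).
    by apply: functional_extensionality => z'; rewrite bigR_cons.
  by split=> //; apply: mq_plus.
by case: (aux (index_enum _)).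
Qed.
Lemma Avg_trans d f c z : Avg d (fun z => f (vadd z c)) z = Avg d f (vadd z c).
Proof.
rewrite /Avg; congr mean; apply: functional_extensionality => s; congr f; vring.
Qed.
Lemma Avg_mono d f g z : mq f -> mq g ->
  (forall z', norm (vsub z' z) <= norm d -> f z' <= g z') -> Avg d f z <= Avg d g z.
Proof.
move=> hf hg h; apply: mean_le; try exact: mq_line.
move=> s hs; apply: h; rewrite vsub_add norm_scale.
have : Rabs s <= 1 by split_Rabs; lra.
have := norm_ge0 d; nra.
Qed.
Lemma Avg_diff d f g z c : mq f -> mq g ->
  (forall z', norm (vsub z' z) <= norm d -> Rabs (f z' - g z') <= c) -> Rabs (Avg d f z - Avg d g z) <= c.
Proof.
move=> hf hg h.
have h1 : Avg d f z <= Avg d (fun z => g z + c) z.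
  apply: Avg_mono => //; first by apply: mq_plus => //; apply: mq_cst.
  by move=> z' /h; split_Rabs; lra.
have h2 : Avg d g z <= Avg d (fun z => f z + c) z.
  apply: Avg_mono => //; first by apply: mq_plus => //; apply: mq_cst.
  by move=> z' /h; split_Rabs; lra.
rewrite !Avg_plus ?Avg_cst in h1 h2; try exact: mq_cst => //.
all: try by [].
by split_Rabs; lra.
Qed.
Lemma Avg_MQ d e K f : mq f -> MQ e K f -> MQ e K (Avg d f).
Proof.
move=> hf h z z'.
have -> : Avg d f z = Avg d (fun y => f (vadd y (vsub z z'))) z'.
  by rewrite Avg_trans; congr Avg; vring.
apply: Avg_diff => //; first exact: mq_trans.
move=> y _; apply: Rle_trans (h _ _) _; rewrite vsub_add; lra.
Qed.
Lemma Avg_mq d f : mq f -> mq (Avg d f).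
Proof. by move=> h e e0; have [K [K0 hK]] := h e e0; exists K; split=> //; apply: Avg_MQ. Qed.
Lemma Avg_bound d f B : mq f -> (forall z, Rabs (f z) <= B) -> forall z, Rabs (Avg d f z) <= B.
Proof.
move=> h hB z; have := @Avg_diff d f (fun _ => 0) z B h (mq_cst 0).
rewrite Avg_cst Rminus_0_r; apply=> z' _; by rewrite Rminus_0_r.
Qed.
Lemma Avg_Lip d L f : Lip L f -> Lip L (Avg d f).
Proof.
move=> h z z'; have hf := Lip_mq h.
have -> : Avg d f z = Avg d (fun y => f (vadd y (vsub z z'))) z'.
  by rewrite Avg_trans; congr Avg; vring.
apply: Avg_diff => //; first exact: mq_trans.
move=> y _; apply: Rle_trans (h _ _) _; rewrite vsub_add; lra.
Qed.

(** Iterated averages over segments stand for a convolution in dimension [n]: over the axis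
    directions they give the mean over a box, while only integrals on [[-1, 1]] occur. [rad] bounds
    how far the values of [f] are fetched. *)
Definition Avgs (l : seq (vec n)) f := foldr Avg f l.
Definition rad (l : seq (vec n)) := foldr (fun d r => norm d + r) 0 l.

Lemma Avgs_mq l f : mq f -> mq (Avgs l f).
Proof. by move=> h; elim: l => //= d l IH; apply: Avg_mq. Qed.
Lemma Avgs_mono l f g z : mq f -> mq g ->
  (forall z', norm (vsub z' z) <= rad l -> f z' <= g z') -> Avgs l f z <= Avgs l g z.
Proof.
move=> hf hg; elim: l z => [|d l IH] z /= h.
  by apply: h; rewrite norm_subvv; lra.
apply: Avg_mono; try exact: Avgs_mq.
move=> z' hz'; apply: IH => y hy; apply: h.
have := norm_sub_triang y z' z; lra.
Qed.
Lemma Avgs_bound l f B : mq f -> (forall z, Rabs (f z) <= B) -> forall z, Rabs (Avgs l f z) <= B.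
Proof. by move=> h hB; elim: l => //= d l IH; apply: Avg_bound => //; apply: Avgs_mq. Qed.
Lemma Avgs_Lip l L f : Lip L f -> Lip L (Avgs l f).
Proof. by move=> h; elim: l => //= d l IH; apply: Avg_Lip. Qed.
Lemma Avgs_cst l c : Avgs l (fun _ => c) = fun _ => c.
Proof. by elim: l => //= d l ->; rewrite Avg_cst. Qed.
Lemma Avgs_plus l f g z : mq f -> mq g -> Avgs l (fun z => f z + g z) z = Avgs l f z + Avgs l g z.
Proof.
move=> hf hg; elim: l z => //= d l IH z.
by rewrite -Avg_plus; [congr Avg; apply: functional_extensionality| exact: Avgs_mq|exact: Avgs_mq].
Qed.
Lemma Avgs_scal l a f z : mq f -> Avgs l (fun z => a * f z) z = a * Avgs l f z.
Proof.
move=> hf; elim: l z => //= d l IH z.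
by rewrite -Avg_scal; [congr Avg; apply: functional_extensionality| exact: Avgs_mq].
Qed.
Lemma Avgs_sumN l m (f : 'I_m -> vec n -> R) z : (forall i, mq (f i)) ->
  Avgs l (fun z => sumN (fun i => f i z)) z = sumN (fun i => Avgs l (f i) z).
Proof.
move=> h; elim: l z => //= d l IH z.
by rewrite -Avg_sumN; [congr Avg; apply: functional_extensionality| move=> i; exact: Avgs_mq].
Qed.
Lemma Avgs_trans l f c z : Avgs l (fun z => f (vadd z c)) z = Avgs l f (vadd z c).
Proof.
elim: l z => //= d l IH z; rewrite -Avg_trans; congr Avg; exact: functional_extensionality.
Qed.
Lemma Avgs_diff l f g z c : mq f -> mq g ->
  (forall z', norm (vsub z' z) <= rad l -> Rabs (f z' - g z') <= c) -> Rabs (Avgs l f z - Avgs l g z) <= c.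
Proof.
move=> hf hg; elim: l z => [|d l IH] z /= h.
  by apply: h; rewrite norm_subvv; lra.
apply: Avg_diff; try exact: Avgs_mq.
move=> z' hz'; apply: IH => y hy; apply: h.
have := norm_sub_triang y z' z; lra.
Qed.
Lemma Avgs_close l f z c : mq f ->
  (forall z', norm (vsub z' z) <= rad l -> Rabs (f z' - f z) <= c) -> Rabs (Avgs l f z - f z) <= c.
Proof.
move=> hf h; have := @Avgs_diff l f (fun _ => f z) z c hf (mq_cst _).
by rewrite Avgs_cst; apply.
Qed.

Definition grad1 K f (G : vec n -> vec n) :=
  forall z d, Rabs (f (vadd z d) - f z - dot (G z) d) <= K * norm d ^ 2.

Lemma Avg_grad1 v K f G : mq f -> (forall i, mq (fun z => G z i)) -> grad1 K f G ->
  grad1 K (Avg v f) (fun z i => Avg v (fun z => G z i) z).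
Proof.
move=> hf hG h z d.
have mG : forall i, mq (fun z => d i * G z i) by move=> i; apply: mq_scal.
have -> : dot (fun i => Avg v (fun z => G z i) z) d = Avg v (fun z => dot (G z) d) z.
  rewrite /dot.
  have -> : (fun z => sumN (fun i => G z i * d i)) = (fun z => sumN (fun i => d i * G z i)).
    by apply: functional_extensionality => y; apply: sumN_ext => i; ring.
  rewrite Avg_sumN //; apply: sumN_ext => i; rewrite Avg_scal //; ring.
have mD : mq (fun z => dot (G z) d).
  by apply: mq_ext (mq_sumN mG) => y; apply: sumN_ext => i; ring.
rewrite -Avg_trans.
have -> : Avg v (fun z => f (vadd z d)) z - Avg v f z - Avg v (fun z => dot (G z) d) z
  = Avg v (fun z => f (vadd z d)) z - Avg v (fun z => f z + dot (G z) d) z.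
  by rewrite Avg_plus //; ring.
apply: Avg_diff; [exact: mq_trans|exact: mq_plus|] => y _.
have -> : f (vadd y d) - (f y + dot (G y) d) = f (vadd y d) - f y - dot (G y) d by ring.
exact: h.
Qed.
Lemma Avgs_grad1 l K f G : mq f -> (forall i, mq (fun z => G z i)) -> grad1 K f G ->
  grad1 K (Avgs l f) (fun z i => Avgs l (fun z => G z i) z).
Proof.
move=> hf hG h; elim: l => //= d l IH.
apply: (@Avg_grad1 d K (Avgs l f) (fun z i => Avgs l (fun z => G z i) z)) => //.
  exact: Avgs_mq.
by move=> i; apply: Avgs_mq.
Qed.

Definition evec i : vec n := fun j => if j == i then 1 else 0.
Lemma norm_evec i : norm (evec i) = 1.
Proof.
rewrite /norm -[RHS]sqrt_1; congr sqrt; rewrite /dot.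
rewrite -(@sumN_delta n (fun _ => 1) i); apply: sumN_ext => j; rewrite /evec.
by case: (j == i); ring.
Qed.

Definition DirLip i L f := forall z s, Rabs (f (vadd z (vscale s (evec i))) - f z) <= L * Rabs s.
Definition P1 i K f (g : vec n -> R) :=
  forall z s, Rabs (f (vadd z (vscale s (evec i))) - f z - s * g z) <= K * s ^ 2.

Lemma Avg_DirLip v i L f : mq f -> DirLip i L f -> DirLip i L (Avg v f).
Proof.
move=> hf h z s; rewrite -Avg_trans; apply: Avg_diff; [exact: mq_trans|by []|].
by move=> y _; apply: h.
Qed.
Lemma Avg_P1 v i K f g : mq f -> mq g -> P1 i K f g -> P1 i K (Avg v f) (Avg v g).
Proof.
move=> hf hg h z s; rewrite -Avg_trans.
have -> : Avg v (fun z => f (vadd z (vscale s (evec i)))) z - Avg v f z - s * Avg v g z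
  = Avg v (fun z => f (vadd z (vscale s (evec i)))) z - Avg v (fun z => f z + s * g z) z.
  by rewrite Avg_plus //; [rewrite Avg_scal //; ring | exact: mq_scal].
apply: Avg_diff; [exact: mq_trans|by apply: mq_plus => //; apply: mq_scal|] => y _.
have -> : f (vadd y (vscale s (evec i))) - (f y + s * g y)
  = f (vadd y (vscale s (evec i))) - f y - s * g y by ring.
exact: h.
Qed.

Section Gain.
Variables (r : R) (r0 : 0 < r).
Lemma line_shift f z i s : Avg (vscale r (evec i)) f (vadd z (vscale s (evec i)))
  = mean (fun t => f (vadd z (vscale (t + s / r) (vscale r (evec i))))).
Proof.
rewrite /Avg; congr mean; apply: functional_extensionality => t; congr f.
apply: functional_extensionality => j; rewrite /vadd /vscale; field; lra.
Qed.
Lemma gain0 i f B : mq f -> (forall z, Rabs (f z) <= B) -> DirLip i (B / r) (Avg (vscale r (evec i)) f).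
Proof.
move=> hf hB z s; rewrite line_shift.
have := @mean_shift_bounded _ (s / r) B (@mq_line f z (vscale r (evec i)) hf) (fun s => hB _).
rewrite /Avg; have -> : B / r * Rabs s = B * Rabs (s / r); last by [].
by rewrite Rabs_div ?(Rabs_pos_eq r); try lra; field; lra.
Qed.
(** The exact partial derivative along axis [i] of [Avg (vscale r (evec i)) f]: the two end pieces
    of [mean_shift] leave a centred difference quotient. *)
Definition dq i f z := / (2 * r) * (f (vadd z (vscale r (evec i))) - f (vadd z (vscale (- r) (evec i)))).
Lemma gain1 i f L : Lip L f -> P1 i (L / r) (Avg (vscale r (evec i)) f) (dq i f).
Proof.
move=> hf z s; rewrite line_shift.
have mf := Lip_mq hf.
have := @mean_shift_lip _ (s / r) (L * r) (@mq_line f z (vscale r (evec i)) mf).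
have -> : L / r * s ^ 2 = L * r * (s / r) ^ 2 by field; lra.
have -> : s * dq i f z = s / r * (/ 2 * (f (vadd z (vscale 1 (vscale r (evec i)))) - f (vadd z (vscale (-1) (vscale r (evec i)))))).
  rewrite /dq.
  have -> : vscale 1 (vscale r (evec i)) = vscale r (evec i) by vring.
  have -> : vscale (-1) (vscale r (evec i)) = vscale (- r) (evec i) by vring.
  by field; lra.
apply=> a b; apply: Rle_trans (hf _ _) _.
have -> : vsub (vadd z (vscale a (vscale r (evec i)))) (vadd z (vscale b (vscale r (evec i))))
  = vscale ((a - b) * r) (evec i) by vring.
rewrite norm_scale norm_evec Rabs_mult (Rabs_pos_eq r); lra.
Qed.
Lemma dq_Lip i f L : Lip L f -> Lip (L / r) (dq i f).
Proof.
move=> h z z'; rewrite /dq.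
set a := vscale r _; set b := vscale (- r) _.
have h1 := h (vadd z a) (vadd z' a); have h2 := h (vadd z b) (vadd z' b).
have e1 : vsub (vadd z a) (vadd z' a) = vsub z z' by vring.
have e2 : vsub (vadd z b) (vadd z' b) = vsub z z' by vring.
rewrite e1 in h1; rewrite e2 in h2.
have -> : / (2 * r) * (f (vadd z a) - f (vadd z b)) - / (2 * r) * (f (vadd z' a) - f (vadd z' b))
  = / r * (((f (vadd z a) - f (vadd z' a)) - (f (vadd z b) - f (vadd z' b))) / 2) by field; lra.
have -> : L / r * norm (vsub z z') = / r * (L * norm (vsub z z')) by field; lra.
have ir := Rinv_0_lt_compat _ r0.
rewrite Rabs_mult (Rabs_pos_eq (/ r)); last lra.
apply: Rmult_le_compat_l; first lra.
split_Rabs; lra.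
Qed.
Lemma dq_bound i f L : Lip L f -> forall z, Rabs (dq i f z) <= L.
Proof.
move=> h z; rewrite /dq; set a := vadd z _; set b := vadd z _.
have := h a b; have -> : vsub a b = vscale (2 * r) (evec i) by rewrite /a /b; vring.
rewrite norm_scale norm_evec (Rabs_pos_eq (2 * r)); last lra.
move=> h1; rewrite Rabs_mult (Rabs_pos_eq (/ (2 * r))); last by apply: Rlt_le; apply: Rinv_0_lt_compat; lra.
have -> : L = / (2 * r) * (L * (2 * r * 1)) by field; lra.
by apply: Rmult_le_compat_l => //; apply: Rlt_le; apply: Rinv_0_lt_compat; lra.
Qed.

Definition dirs := [seq vscale r (evec i) | i <- index_enum 'I_n].
Lemma rad_dirs : rad dirs = INR n * r.
Proof.
rewrite -(sumN_cst n r) /sumN /dirs; elim: (index_enum _) => [|i l IH] /=; first by rewrite bigR_nil.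
by rewrite bigR_cons norm_scale norm_evec Rmult_1_r Rabs_pos_eq; [congr Rplus | lra].
Qed.

(** The factor of the average in direction [i] provides the gain; every other factor preserves it,
    being a mean of translates. *)
Lemma Avgs_DirLip f B i : mq f -> (forall z, Rabs (f z) <= B) -> DirLip i (B / r) (Avgs dirs f).
Proof.
move=> hf hB; have : i \in index_enum 'I_n by exact: mem_index_enum.
rewrite /dirs; elim: (index_enum _) => //= j l IH.
set ll := [seq _ | i <- l] in IH *.
rewrite in_cons; have [->|_ /=] := eqVneq i j.
  by move=> _; apply: gain0; [exact: Avgs_mq | exact: Avgs_bound].
by move=> /IH h; apply: Avg_DirLip => //; apply: Avgs_mq.
Qed.
Lemma Avgs_P1 f L i : Lip L f -> exists g, P1 i (L / r) (Avgs dirs f) g /\ Lip (L / r) g /\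
  forall z, Rabs (g z) <= L.
Proof.
move=> hf; have mf := Lip_mq hf.
have : i \in index_enum 'I_n by exact: mem_index_enum.
rewrite /dirs; elim: (index_enum _) => //= j l IH.
set ll := [seq _ | i <- l] in IH *.
rewrite in_cons; have [->|_ /=] := eqVneq i j.
  move=> _; exists (dq j (Avgs ll f)); split; [|split].
  - by apply: gain1; apply: Avgs_Lip.
  - by apply: dq_Lip; apply: Avgs_Lip.
  - by apply: dq_bound; apply: Avgs_Lip.
move=> /IH [g [h1 [h2 h3]]]; exists (Avg (vscale r (evec j)) g).
have mg := Lip_mq h2.
split; first by apply: Avg_P1 => //; apply: Avgs_mq.
by split; [apply: Avg_Lip | apply: Avg_bound].
Qed.
End Gain.

Section Path.
Variables (z d : vec n).
(** Vertices of the path from [z] to [z + d] along the axes; [l] lists the coordinates already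
    moved. *)
Definition pt (l : seq 'I_n) : vec n := fun i => if i \in l then z i + d i else z i.
Lemma pt_cons j l : j \notin l -> pt (j :: l) = vadd (pt l) (vscale (d j) (evec j)).
Proof.
move=> hj; apply: functional_extensionality => i.
rewrite /pt /vadd /vscale /evec in_cons; have [->|_ /=] := eqVneq i j.
  by rewrite (negbTE hj) /=; ring.
by ring.
Qed.
Lemma pt_dist l : norm (vsub (pt l) z) <= norm d.
Proof.
apply: norm_le_sq; first exact: norm_ge0.
rewrite norm_sq; apply: sumN_le => i; rewrite /vsub /pt.
by case: (i \in l); nra.
Qed.
Lemma pt_full : pt (index_enum 'I_n) = vadd z d.
Proof. by apply: functional_extensionality => i; rewrite /pt mem_index_enum. Qed.

Lemma path_Lip f L : 0 <= L -> (forall i, DirLip i L f) -> Rabs (f (vadd z d) - f z) <= INR n * L * norm d.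
Proof.
move=> L0 h; rewrite -pt_full.
have -> : INR n * L * norm d = \big[Rplus/0]_(i <- index_enum 'I_n) (L * norm d).
  by rewrite -/(sumN (fun _ : 'I_n => L * norm d)) sumN_cst; ring.
have := index_enum_uniq 'I_n; elim: (index_enum _) => [_|j l IH /= /andP [h1 h2]].
  have -> : pt [::] = z by [].
  by rewrite bigR_nil; split_Rabs; lra.
rewrite bigR_cons pt_cons //; have := IH h2; have := h j (pt l) (d j).
have := coord_le_norm d j => h3 h4 h5.
have : L * Rabs (d j) <= L * norm d by apply: Rmult_le_compat_l.
move: h4 h5; set a := f _; set b := f _; set c := f z; move: (bigop _ _ _) => s.
split_Rabs; lra.
Qed.

(** Each axis step is expanded at its own vertex, with error [K]; moving that partial derivative
    back to [z], at distance at most [norm d], costs the extra [L]. The factor [INR n] counts the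
    steps. *)
Lemma path_grad f (G : vec n -> vec n) K L : 0 <= K -> 0 <= L ->
  (forall i, P1 i K f (fun z => G z i)) -> (forall i, Lip L (fun z => G z i)) ->
  Rabs (f (vadd z d) - f z - dot (G z) d) <= INR n * (K + L) * norm d ^ 2.
Proof.
move=> K0 L0 hP hL; rewrite -pt_full.
have -> : INR n * (K + L) * norm d ^ 2 = \big[Rplus/0]_(i <- index_enum 'I_n) ((K + L) * norm d ^ 2).
  by rewrite -/(sumN (fun _ : 'I_n => (K + L) * norm d ^ 2)) sumN_cst; ring.
rewrite /dot /sumN.
have := index_enum_uniq 'I_n; elim: (index_enum _) => [_|j l IH /= /andP [h1 h2]].
  have -> : pt [::] = z by [].
  by rewrite !bigR_nil; split_Rabs; lra.
rewrite !bigR_cons pt_cons //; have := IH h2; have := hP j (pt l) (d j).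
have := coord_le_norm d j => h3 h4 h5.
have h6 := hL j (pt l) z; have h7 := pt_dist l.
have n0 := norm_ge0 d.
have h8 : K * (d j) ^ 2 <= K * norm d ^ 2.
  by apply: Rmult_le_compat_l => //; rewrite -(pow2_abs (d j)); have := Rabs_pos (d j); nra.
have h9 : Rabs (d j * (G (pt l) j - G z j)) <= L * norm d ^ 2.
  rewrite Rabs_mult.
  have h6' : Rabs (G (pt l) j - G z j) <= L * norm d by apply: Rle_trans h6 _; apply: Rmult_le_compat_l.
  have := Rabs_pos (G (pt l) j - G z j); have := Rabs_pos (d j) => q1 q2.
  apply: Rle_trans (Rmult_le_compat _ _ _ _ q1 q2 h3 h6') _; apply: Req_le; ring.
move: h4 h5 h8 h9; set a := f (vadd _ _); set b := f _; set c := f z.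
move: (bigop _ _ _) => s1; move: (bigop _ _ _) => s2.
set u := K * norm d ^ 2; set v := L * norm d ^ 2; set w := K * d j ^ 2.
have -> : (K + L) * norm d ^ 2 = u + v by rewrite /u /v; ring.
move=> q1 q2 q3 q4.
have -> : a - c - (G z j * d j + s1) = (a - b - d j * G (pt l) j) + (b - c - s1) + d j * (G (pt l) j - G z j).
  by ring.
apply: Rle_trans (Rabs_triang _ _) _.
have := Rabs_triang (a - b - d j * G (pt l) j) (b - c - s1); lra.
Qed.
End Path.

Definition tay2 Lam f (G : vec n -> vec n) (X : vec n -> mat n) :=
  forall z d, Rabs (f (vadd z d) - f z - dot (G z) d - / 2 * quad (X z) d) <= Lam * norm d ^ 3.

Lemma grad_tay2 K f G X : 0 <= K -> grad1 K f G ->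
  (forall i, grad1 K (fun z => G z i) (fun z => X z i)) -> tay2 (INR n * K) f G X.
Proof.
move=> K0 hf hG z d.
(* [ga] is [f] on the segment minus its candidate Taylor polynomial. By the mean value theorem the
   increment is a value of [ga'], which is the first-order Taylor error of [G] paired with [d]:
   quadratic from [G], cubic after pairing. *)
pose ga s := f (vadd z (vscale s d)) - s * dot (G z) d - / 2 * s ^ 2 * quad (X z) d.
pose ga' s := dot (G (vadd z (vscale s d))) d - dot (G z) d - s * quad (X z) d.
have hd s : derivable_pt_lim ga s (ga' s).
  have hd1 : derivable_pt_lim (fun s => f (vadd z (vscale s d))) s (dot (G (vadd z (vscale s d))) d).
    move=> e e0.
    have q : 0 < K * norm d ^ 2 + 1 by have := norm_ge0 d; nra.
    have q1 : 0 < e / (K * norm d ^ 2 + 1) by exact: Rdiv_lt_0_compat.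
    exists (mkposreal _ q1) => h h0 /= hh.
    have := hf (vadd z (vscale s d)) (vscale h d).
    have -> : vadd (vadd z (vscale s d)) (vscale h d) = vadd z (vscale (s + h) d) by vring.
    rewrite norm_scale dotZr Rpow_mult_distr pow2_abs.
    set A := f _; set B := f _; set D := dot _ _ => h1.
    have -> : (A - B) / h - D = (A - B - h * D) * / h by field.
    have ah : 0 < Rabs h by apply: Rabs_pos_lt.
    rewrite Rabs_mult Rabs_inv.
    apply: (Rmult_lt_reg_r (Rabs h)) => //.
    rewrite Rmult_assoc Rinv_l ?Rmult_1_r; last lra.
    apply: Rle_lt_trans h1 _.
    have -> : K * (h ^ 2 * norm d ^ 2) = (K * norm d ^ 2) * Rabs h * Rabs h.
      by rewrite -(pow2_abs h); ring.
    apply: Rmult_lt_compat_r => //.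
    have h3 : Rabs h * (K * norm d ^ 2 + 1) < e.
      have -> : e = e / (K * norm d ^ 2 + 1) * (K * norm d ^ 2 + 1) by field; lra.
      exact: Rmult_lt_compat_r.
    have := norm_ge0 d; nra.
  have hd2 : derivable_pt_lim (fun s => s * dot (G z) d + / 2 * s ^ 2 * quad (X z) d) s
     (dot (G z) d + s * quad (X z) d).
    by apply/is_derive_Reals; auto_derive => //; field.
  have := derivable_pt_lim_minus _ _ _ _ _ hd1 hd2.
  have -> : dot (G (vadd z (vscale s d))) d - (dot (G z) d + s * quad (X z) d) = ga' s by rewrite /ga'; ring.
  have -> // : minus_fct (fun s => f (vadd z (vscale s d))) (fun s => s * dot (G z) d + / 2 * s ^ 2 * quad (X z) d) = ga.
  by apply: functional_extensionality => t; rewrite /minus_fct /ga; ring.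
have [c [hc1 hc2]] := MVT_cor2 ga ga' 0 1 Rlt_0_1 (fun c _ => hd c).
have -> : f (vadd z d) - f z - dot (G z) d - / 2 * quad (X z) d = ga' c.
  have e1 : vadd z (vscale 1 d) = vadd z d by vring.
  have e0 : vadd z (vscale 0 d) = z by vring.
  by rewrite /ga e1 e0 in hc1; lra.
have -> : ga' c = sumN (fun i => d i * (G (vadd z (vscale c d)) i - G z i - dot (X z i) (vscale c d))).
  have -> : sumN (fun i => d i * (G (vadd z (vscale c d)) i - G z i - dot (X z i) (vscale c d)))
     = sumN (fun i => (G (vadd z (vscale c d)) i * d i - G z i * d i) - c * sumN (fun j => X z i j * d i * d j)).
    apply: sumN_ext => i; rewrite dotZr /dot.
    have -> : sumN (fun j => X z i j * d i * d j) = d i * sumN (fun j => X z i j * d j).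
      by rewrite -sumN_scal; apply: sumN_ext => j; ring.
    ring.
  by rewrite sumN_minus sumN_minus sumN_scal.
apply: Rle_trans (sumN_abs _) _.
have -> : INR n * K * norm d ^ 3 = sumN (fun _ : 'I_n => K * norm d ^ 3) by rewrite sumN_cst; ring.
apply: sumN_le => i; rewrite Rabs_mult.
have h1 := hG i z (vscale c d).
have n0 := norm_ge0 d.
have h2 : K * norm (vscale c d) ^ 2 <= K * norm d ^ 2.
  apply: Rmult_le_compat_l => //; rewrite norm_scale (Rabs_pos_eq c); last lra.
  by apply: pow_incr; nra.
have h3 := coord_le_norm d i.
have h4 : Rabs (G (vadd z (vscale c d)) i - G z i - dot (X z i) (vscale c d)) <= K * norm d ^ 2.
  exact: Rle_trans h1 h2.
apply: Rle_trans (Rmult_le_compat _ _ _ _ (Rabs_pos _) (Rabs_pos _) h3 h4) _.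
by apply: Req_le; ring.
Qed.

Record smooth2 (f : vec n -> R) (G : vec n -> vec n) (X : vec n -> mat n) : Prop := Smooth2 {
  sm_mq : mq f;
  sm_tay : exists Lam, 0 < Lam /\ tay2 Lam f G X;
  sm_sym : forall z, symmetric (X z);
  sm_bd : exists B, 0 < B /\ forall z i j, Rabs (X z i j) <= B;
  sm_G : forall i, mq (fun z => G z i);
  sm_X : forall i j, mq (fun z => X z i j) }.

Lemma Lip_of_DirLip f L : 0 <= L -> (forall i, DirLip i L f) -> Lip (INR n * L) f.
Proof.
move=> L0 h z z'; have := @path_Lip z' (vsub z z') f L L0 h.
by rewrite vadd_sub.
Qed.

Lemma mollify_grad r f L : 0 < r -> 0 <= L -> Lip L f ->
  exists G K, 0 < K /\ grad1 K (Avgs (dirs r) f) G /\ (forall i, Lip (L / r) (fun z => G z i)) /\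
    forall z i, Rabs (G z i) <= L.
Proof.
move=> r0 L0 hf.
have Lr : 0 <= L / r by apply: Rmult_le_pos => //; apply: Rlt_le; exact: Rinv_0_lt_compat.
pose G z i := proj1_sig (constructive_indefinite_description _ (Avgs_P1 r0 i hf)) z.
have hG i := proj2_sig (constructive_indefinite_description _ (Avgs_P1 r0 i hf)).
exists G, (INR n * (L / r + L / r) + 1); split; first by have := pos_INR n; nra.
split; last by split=> [i|z i]; have [_ [q1 q2]] := hG i; [exact: q1|exact: q2].
move=> z d; have h1 := @path_grad z d _ G _ _ Lr Lr (fun i => proj1 (hG i)) (fun i => proj1 (proj2 (hG i))).
apply: Rle_trans h1 _; have := norm_ge0 d; nra.
Qed.

(** One round of averaging per derivative: bounded to Lipschitz, then to Lipschitz gradient, then to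
    Lipschitz second derivatives, which is what a cubic Taylor remainder requires. *)
Definition dirs3 r := dirs r ++ dirs r ++ dirs r.
Lemma rad_cat l l' : rad (l ++ l') = rad l + rad l'.
Proof. by elim: l => [|d l IH] /=; [ring | rewrite IH; ring]. Qed.
Lemma Avgs_cat l l' f : Avgs (l ++ l') f = Avgs l (Avgs l' f).
Proof. by rewrite /Avgs foldr_cat. Qed.
Lemma rad_dirs3 r : 0 < r -> rad (dirs3 r) = 3 * INR n * r.
Proof. by move=> r0; rewrite /dirs3 !rad_cat !rad_dirs //; ring. Qed.

Theorem mollify_smooth r f B : 0 < r -> mq f -> (forall z, Rabs (f z) <= B) ->
  exists G X, smooth2 (Avgs (dirs3 r) f) G X.
Proof.
move=> r0 mf hB.
have B0 : 0 <= B by have := hB (@vzero n); have := Rabs_pos (f (@vzero n)); lra.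
have Br : 0 <= B / r by apply: Rmult_le_pos => //; apply: Rlt_le; exact: Rinv_0_lt_compat.
pose L := INR n * (B / r).
have L0 : 0 <= L by have := pos_INR n; rewrite /L; nra.
have l1 : Lip L (Avgs (dirs r) f).
  by apply: Lip_of_DirLip => // i; apply: Avgs_DirLip.
have [G [K [K0 [gG [lG _]]]]] := mollify_grad r0 L0 l1.
have Lr : 0 <= L / r by apply: Rmult_le_pos => //; apply: Rlt_le; exact: Rinv_0_lt_compat.
have hX i := mollify_grad r0 Lr (lG i).
pose X0 (z : vec n) (i j : 'I_n) := proj1_sig (constructive_indefinite_description _ (hX i)) z j.
have hX0 i : exists K', 0 < K' /\ grad1 K' (Avgs (dirs r) (fun z => G z i)) (fun z => X0 z i) /\
   (forall j, Lip (L / r / r) (fun z => X0 z i j)) /\ forall z j, Rabs (X0 z i j) <= L / r.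
  exact: (proj2_sig (constructive_indefinite_description _ (hX i))).
have [K1 [K10 hK1]] : exists K1, 0 < K1 /\ forall i, grad1 K1 (Avgs (dirs r) (fun z => G z i)) (fun z => X0 z i).
  pose k i := proj1_sig (constructive_indefinite_description _ (hX0 i)).
  have hk i := proj2_sig (constructive_indefinite_description _ (hX0 i)).
  have k0 i : 0 <= k i by apply: Rlt_le; case: (hk i).
  exists (sumN k + 1); split; first by have := sumN_ge0 k0; lra.
  move=> i z d; case: (hk i) => _ [h _]; apply: Rle_trans (h z d) _.
  have := sumN_ge1 i k0; rewrite -/(k i); have := norm_ge0 d; nra.
pose G' z i := Avgs (dirs r) (fun z => G z i) z.
pose X z : mat n := mscale (/ 2) (madd (X0 z) (fun i j => X0 z j i)).
have qX z d : quad (X z) d = quad (X0 z) d.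
  rewrite /X quad_mscale quad_madd.
  have -> : quad (fun i j => X0 z j i) d = quad (X0 z) d; last field.
  by rewrite /quad sumN_exch; apply: sumN_ext => i; apply: sumN_ext => j; ring.
have mX0 i j : mq (fun z => X0 z i j).
  by have [K' [_ [_ [h _]]]] := hX0 i; apply: Lip_mq (h j).
have mG i : mq (fun z => G z i) by apply: Lip_mq (lG i).
have ms : mq (Avgs (dirs r) (Avgs (dirs r) f)) by do 2 apply: Avgs_mq.
exists G', X; rewrite /dirs3 !Avgs_cat; split.
- exact: Avgs_mq.
- pose KK := K + K1.
  have KK0 : 0 <= KK by rewrite /KK; lra.
  exists (INR n * KK + 1); split; first by have := pos_INR n; rewrite /KK; nra.
  have h1 : grad1 KK (Avgs (dirs r) (Avgs (dirs r) (Avgs (dirs r) f))) G'.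
    move=> z d; apply: Rle_trans (@Avgs_grad1 (dirs r) _ _ _ ms mG gG z d) _.
    by rewrite /KK; have := norm_ge0 d; nra.
  have h2 i : grad1 KK (fun z => G' z i) (fun z => X0 z i).
    move=> z d; apply: Rle_trans (hK1 i z d) _.
    by rewrite /KK; have := norm_ge0 d; nra.
  have h3 := grad_tay2 KK0 h1 h2.
  move=> z d; rewrite qX; apply: Rle_trans (h3 z d) _.
  by have := pow_le _ 3 (norm_ge0 d); lra.
- by move=> z i j; rewrite /X /mscale /madd; ring.
- exists (L / r + 1); split; first lra.
  move=> z i j; rewrite /X /mscale /madd.
  have [_ [_ [_ [_ b1]]]] := hX0 i; have [_ [_ [_ [_ b2]]]] := hX0 j.
  have := b1 z j; have := b2 z i; split_Rabs; lra.
- by move=> i; apply: Avgs_mq.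
- move=> i j; rewrite /X /mscale /madd.
  by apply: mq_scal; apply: mq_plus.
Qed.
End MQ.

(** * Viscosity inequalities with constant coefficients pass to averages *)

Section Walk.
Variables (n m : nat) (be : vec n) (S : 'I_m -> vec n).
Implicit Types (f g : vec n -> R) (z d : vec n) (G : vec n -> vec n) (X : vec n -> mat n).

Definition lin (p : vec n) (Y : mat n) := dot be p - sumN (fun k => quad Y (S k)).
Definition branches := INR m + 1.
Lemma branches_gt0 : 0 < branches. Proof. by have := pos_INR m; rewrite /branches; lra. Qed.
(** With [branches] equally likely branches and the Taylor factor one half, this length makes a step
    of time [r ^ 2] add exactly [r ^ 2] times the sum of the second derivatives along the [S k]. The
    branch without noise keeps [branches] positive when [m = 0]. *)
Definition jump := sqrt (2 * branches).
Lemma jump_sq : jump * jump = 2 * branches. Proof. by apply: sqrt_sqrt; have := branches_gt0; lra. Qed.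
Lemma jump_ge0 : 0 <= jump. Proof. exact: sqrt_pos. Qed.

Definition dr r := vscale (- r ^ 2) be.
Definition dp r k := vadd (dr r) (vscale (r * jump) (S k)).
Definition dm r k := vadd (dr r) (vscale (- (r * jump)) (S k)).

(* One step of a random walk of time step [r ^ 2] whose generator is [- lin]. *)
Definition Q r f z := / branches * (f (vadd z (dr r)) +
  sumN (fun k => / 2 * (f (vadd z (dp r k)) + f (vadd z (dm r k))))).

Lemma Q_plus r f g z : Q r (fun z => f z + g z) z = Q r f z + Q r g z.
Proof.
rewrite /Q -Rmult_plus_distr_l; congr Rmult.
rewrite (sumN_ext (g := fun k => / 2 * (f (vadd z (dp r k)) + f (vadd z (dm r k)))
  + / 2 * (g (vadd z (dp r k)) + g (vadd z (dm r k))))); last by move=> k; ring.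
by rewrite sumN_plus; ring.
Qed.
Lemma Q_scal r a f z : Q r (fun z => a * f z) z = a * Q r f z.
Proof.
rewrite /Q (sumN_ext (g := fun k => a * (/ 2 * (f (vadd z (dp r k)) + f (vadd z (dm r k))))));
  last by move=> k; ring.
by rewrite sumN_scal; ring.
Qed.
Lemma Q_cst r c z : Q r (fun _ => c) z = c.
Proof.
rewrite /Q (sumN_ext (g := fun k => c)); last by move=> k; field.
rewrite sumN_cst; have := branches_gt0; rewrite /branches => h; field; lra.
Qed.
Lemma Q_mono r f g z : (forall z, f z <= g z) -> Q r f z <= Q r g z.
Proof.
move=> h; apply: Rmult_le_compat_l; first by apply: Rlt_le; apply: Rinv_0_lt_compat; exact: branches_gt0.
apply: Rplus_le_compat => //; apply: sumN_le => k.
by have := h (vadd z (dp r k)); have := h (vadd z (dm r k)); lra.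
Qed.
Lemma Q_sumN r l (f : 'I_l -> vec n -> R) z :
  Q r (fun z => sumN (fun i => f i z)) z = sumN (fun i => Q r (f i) z).
Proof.
rewrite /sumN; elim: (index_enum _) => [|i s IH].
  have -> : (fun z => \big[Rplus/0]_(i <- [::]) f i z) = fun _ => 0.
    by apply: functional_extensionality => y; rewrite bigR_nil.
  by rewrite Q_cst bigR_nil.
have -> : (fun z => \big[Rplus/0]_(j <- i :: s) f j z)
   = (fun z => f i z + \big[Rplus/0]_(j <- s) f j z).
  by apply: functional_extensionality => y; rewrite bigR_cons.
by rewrite Q_plus IH bigR_cons.
Qed.
Lemma Q_trans r f c z : Q r (fun z => f (vadd z c)) z = Q r f (vadd z c).
Proof.
have E d : vadd (vadd z d) c = vadd (vadd z c) d by vring.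
by rewrite /Q E; congr (_ * (_ + _)); apply: sumN_ext => k; rewrite !E.
Qed.
Lemma Q_diff r f g z c : (forall z, Rabs (f z - g z) <= c) -> Rabs (Q r f z - Q r g z) <= c.
Proof.
move=> h.
have h1 : Q r f z <= Q r (fun z => g z + c) z by apply: Q_mono => y; have := h y; split_Rabs; lra.
have h2 : Q r g z <= Q r (fun z => f z + c) z by apply: Q_mono => y; have := h y; split_Rabs; lra.
by rewrite !Q_plus !Q_cst in h1 h2; split_Rabs; lra.
Qed.
Lemma Q_mq r f : mq f -> mq (Q r f).
Proof.
move=> h; apply: mq_scal; apply: mq_plus; first exact: mq_trans.
by apply: mq_sumN => k; apply: mq_scal; apply: mq_plus; apply: mq_trans.
Qed.
Lemma Q_MQ r e K f : MQ e K f -> MQ e K (Q r f).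
Proof.
move=> h z z'.
have -> : Q r f z = Q r (fun y => f (vadd y (vsub z z'))) z' by rewrite Q_trans; congr Q; vring.
by apply: Q_diff => y; apply: Rle_trans (h _ _) _; rewrite vsub_add; lra.
Qed.
Lemma Q_Avgs r l f z : mq f -> Avgs l (Q r f) z = Q r (Avgs l f) z.
Proof.
move=> h; rewrite /Q Avgs_scal; last first.
  apply: mq_plus; first exact: mq_trans.
  by apply: mq_sumN => k; apply: mq_scal; apply: mq_plus; apply: mq_trans.
rewrite Avgs_plus; [|exact: mq_trans|]; last first.
  by apply: mq_sumN => k; apply: mq_scal; apply: mq_plus; apply: mq_trans.
rewrite Avgs_trans Avgs_sumN; last first.
  by move=> k; apply: mq_scal; apply: mq_plus; apply: mq_trans.
congr (_ * (_ + _)); apply: sumN_ext => k.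
rewrite Avgs_scal; last by apply: mq_plus; apply: mq_trans.
by rewrite Avgs_plus ?Avgs_trans //; apply: mq_trans.
Qed.

Definition Qn r j f := iter j (Q r) f.
Lemma Qn_Sr r j f : Qn r j.+1 f = Qn r j (Q r f). Proof. exact: iterSr. Qed.
Lemma Qn_plus r j f g z : Qn r j (fun z => f z + g z) z = Qn r j f z + Qn r j g z.
Proof.
elim: j z => //= j IH z; rewrite -Q_plus; congr Q; exact: functional_extensionality.
Qed.
Lemma Qn_scal r j a f z : Qn r j (fun z => a * f z) z = a * Qn r j f z.
Proof.
elim: j z => //= j IH z; rewrite -Q_scal; congr Q; exact: functional_extensionality.
Qed.
Lemma Qn_cst r j c : Qn r j (fun _ => c) = fun _ => c.
Proof. by elim: j => //= j ->; apply: functional_extensionality => z; rewrite Q_cst. Qed.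
Lemma Qn_mono r j f g z : (forall z, f z <= g z) -> Qn r j f z <= Qn r j g z.
Proof. by move=> h; elim: j z => //= j IH z; apply: Q_mono. Qed.
Lemma Qn_diff r j f g z c : (forall z, Rabs (f z - g z) <= c) -> Rabs (Qn r j f z - Qn r j g z) <= c.
Proof. by move=> h; elim: j z => //= j IH z; apply: Q_diff. Qed.
Lemma Qn_mq r j f : mq f -> mq (Qn r j f).
Proof. by move=> h; elim: j => //= j IH; apply: Q_mq. Qed.
Lemma Qn_MQ r j e K f : MQ e K f -> MQ e K (Qn r j f).
Proof. by move=> h; elim: j => //= j IH; apply: Q_MQ. Qed.
Lemma Qn_Avgs r j l f z : mq f -> Avgs l (Qn r j f) z = Qn r j (Avgs l f) z.
Proof.
move=> h; elim: j z => //= j IH z; rewrite Q_Avgs; last exact: Qn_mq.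
by congr Q; apply: functional_extensionality.
Qed.

Definition moment2 := 2 * dot be be + 2 * sumN (fun k => dot (S k) (S k)) + 1.
Lemma moment2_ge1 : 1 <= moment2.
Proof.
have h1 := dot_ge0 be; have h2 : 0 <= sumN (fun k => dot (S k) (S k)).
  by apply: sumN_ge0 => k; apply: dot_ge0.
by rewrite /moment2; lra.
Qed.

Lemma Q_sqdist r c z : 0 < r -> r ^ 2 <= 1 ->
  Q r (fun z => norm (vsub z c) ^ 2) z <= (1 + r ^ 2) * norm (vsub z c) ^ 2 + r ^ 2 * moment2.
Proof.
move=> r0 r1.
set w := vsub z c.
have E d : norm (vsub (vadd z d) c) ^ 2 = dot w w + 2 * dot w d + dot d d.
  have -> : vsub (vadd z d) c = vadd w d by rewrite /w; vring.
  by rewrite norm_add_sq !norm_sq.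
have -> : Q r (fun z => norm (vsub z c) ^ 2) z =
   dot w w - 2 * r ^ 2 * dot w be + r ^ 4 * dot be be + 2 * r ^ 2 * sumN (fun k => dot (S k) (S k)).
  rewrite /Q E.
  rewrite (sumN_ext (g := fun k => (dot w w + 2 * dot w (dr r) + dot (dr r) (dr r)) + (r * jump) ^ 2 * dot (S k) (S k))).
    rewrite sumN_plus sumN_cst sumN_scal /dr !(dotZl, dotZr).
    have -> : (r * jump) ^ 2 = r ^ 2 * (jump * jump) by ring.
    rewrite jump_sq; have := branches_gt0; rewrite /branches => h; field; lra.
  move=> k; rewrite !E /dp /dm !(dotDl, dotDr, dotZl, dotZr) (dotC be (S k)); field.
rewrite -norm_sq /moment2.
have h1 : 0 <= norm w ^ 2 + 2 * dot w be + dot be be.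
  by have := dot_ge0 (vadd w be); rewrite -norm_sq norm_add_sq !norm_sq; lra.
have h2 := dot_ge0 be.
have : r ^ 4 * dot be be <= r ^ 2 * dot be be.
  apply: Rmult_le_compat_r => //; have -> : r ^ 4 = r ^ 2 * r ^ 2 by ring.
  nra.
have : 0 <= r ^ 2 by nra.
by nra.
Qed.

(** Discrete Gronwall: as long as the total time is at most one half, the bound being proved is at
    most [moment2], so the growth term of [Q_sqdist] costs no more than the source term; hence the
    factor 2. *)
Lemma Qn_sqdist r c j : 0 < r -> r ^ 2 <= 1 -> INR j * r ^ 2 <= / 2 ->
  Qn r j (fun z => norm (vsub z c) ^ 2) c <= 2 * moment2 * (INR j * r ^ 2).
Proof.
move=> r0 r1; elim: j => [|j IH] hj.
  by rewrite /= norm_subvv; lra.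
rewrite Qn_Sr; rewrite S_INR in hj *.
have K0 := moment2_ge1; have r2 : 0 < r ^ 2 by nra.
have {}IH := IH ltac:(lra).
have h1 : Qn r j (Q r (fun z => norm (vsub z c) ^ 2)) c <=
   Qn r j (fun z => (1 + r ^ 2) * norm (vsub z c) ^ 2 + r ^ 2 * moment2) c.
  by apply: Qn_mono => z; apply: Q_sqdist.
rewrite Qn_plus Qn_scal Qn_cst in h1.
have h2 : r ^ 2 * Qn r j (fun z => norm (vsub z c) ^ 2) c <= r ^ 2 * moment2.
  by apply: Rmult_le_compat_l; [lra|nra].
lra.
Qed.

Lemma Qn_close r j e K f z : 0 < r -> r ^ 2 <= 1 -> INR j * r ^ 2 <= / 2 -> 0 <= K -> MQ e K f ->
  Rabs (Qn r j f z - f z) <= e + K * (2 * moment2 * (INR j * r ^ 2)).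
Proof.
move=> r0 r1 hj K0 h.
have hq := @Qn_sqdist r z j r0 r1 hj.
have h1 : Qn r j f z <= Qn r j (fun y => f z + e + K * norm (vsub y z) ^ 2) z.
  by apply: Qn_mono => y; have := h y z; split_Rabs; lra.
have h2 : Qn r j (fun y => f z - e + (- K) * norm (vsub y z) ^ 2) z <= Qn r j f z.
  by apply: Qn_mono => y; have := h y z; split_Rabs; lra.
rewrite !Qn_plus !Qn_scal !Qn_cst in h1 h2.
have : K * Qn r j (fun z0 => norm (vsub z0 z) ^ 2) z <= K * (2 * moment2 * (INR j * r ^ 2)).
  exact: Rmult_le_compat_l.
by split_Rabs; lra.
Qed.

Definition QG r j G : vec n -> vec n := fun z i => Qn r j (fun z => G z i) z.
Definition QX r j X : vec n -> mat n := fun z i k => Qn r j (fun z => X z i k) z.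

Lemma Qn_sumN r j l (f : 'I_l -> vec n -> R) z :
  Qn r j (fun z => sumN (fun i => f i z)) z = sumN (fun i => Qn r j (f i) z).
Proof.
elim: j z => //= j IH z; rewrite -Q_sumN; congr Q; exact: functional_extensionality.
Qed.
Lemma Qn_dot r j G d z : Qn r j (fun z => dot (G z) d) z = dot (QG r j G z) d.
Proof.
rewrite /dot Qn_sumN; apply: sumN_ext => i; rewrite /QG Rmult_comm -Qn_scal.
by congr Qn; apply: functional_extensionality => y; ring.
Qed.
Lemma Qn_quad r j X d z : Qn r j (fun z => quad (X z) d) z = quad (QX r j X z) d.
Proof.
rewrite /quad Qn_sumN; apply: sumN_ext => i; rewrite Qn_sumN; apply: sumN_ext => k.
rewrite /QX.
have -> : Qn r j (fun z0 => X z0 i k) z * d i * d k = d i * d k * Qn r j (fun z0 => X z0 i k) z by ring.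
by rewrite -Qn_scal; congr Qn; apply: functional_extensionality => y; ring.
Qed.
Lemma Qn_lin r j G X z : Qn r j (fun z => lin (G z) (X z)) z = lin (QG r j G z) (QX r j X z).
Proof.
rewrite /lin.
have -> : (fun z => dot be (G z) - sumN (fun k => quad (X z) (S k)))
  = (fun z => dot (G z) be + (-1) * sumN (fun k => quad (X z) (S k))).
  by apply: functional_extensionality => y; rewrite dotC; ring.
rewrite Qn_plus Qn_scal Qn_sumN Qn_dot dotC.
rewrite (sumN_ext (g := fun k => quad (QX r j X z) (S k))); first ring.
by move=> k; rewrite Qn_quad.
Qed.
Lemma Qn_trans r j f c z : Qn r j (fun z => f (vadd z c)) z = Qn r j f (vadd z c).
Proof.
elim: j z => //= j IH z; rewrite -Q_trans; congr Q; exact: functional_extensionality.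
Qed.
Lemma Qn_tay2 r j Lam f G X : tay2 Lam f G X -> tay2 Lam (Qn r j f) (QG r j G) (QX r j X).
Proof.
move=> h z d; rewrite -Qn_trans -Qn_dot -Qn_quad.
have -> : Qn r j (fun z => f (vadd z d)) z - Qn r j f z - Qn r j (fun z => dot (G z) d) z
    - / 2 * Qn r j (fun z => quad (X z) d) z
  = Qn r j (fun z => f (vadd z d)) z - Qn r j (fun z => f z + (dot (G z) d + / 2 * quad (X z) d)) z.
  by rewrite !Qn_plus Qn_scal; ring.
apply: Qn_diff => y.
have -> : f (vadd y d) - (f y + (dot (G y) d + / 2 * quad (X y) d))
  = f (vadd y d) - f y - dot (G y) d - / 2 * quad (X y) d by ring.
exact: h.
Qed.
Lemma Qn_sym r j X z : (forall z, symmetric (X z)) -> symmetric (QX r j X z).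
Proof. by move=> h i k; rewrite /QX; congr Qn; apply: functional_extensionality => y; apply: h. Qed.
Lemma Qn_bd r j X B : (forall z i k, Rabs (X z i k) <= B) -> forall z i k, Rabs (QX r j X z i k) <= B.
Proof.
move=> h z i k; have := @Qn_diff r j (fun z => X z i k) (fun _ => 0) z B.
by rewrite Qn_cst Rminus_0_r; apply=> y; rewrite Rminus_0_r.
Qed.

Definition reach := norm be + jump * sumN (fun k => norm (S k)).
Lemma reach_ge0 : 0 <= reach.
Proof.
have := norm_ge0 be; have := jump_ge0.
have : 0 <= sumN (fun k => norm (S k)) by apply: sumN_ge0 => k; apply: norm_ge0.
by rewrite /reach; nra.
Qed.
Lemma dr_norm r : 0 < r <= 1 -> norm (dr r) <= r * reach.
Proof.
move=> hr; rewrite /dr norm_scale.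
have -> : Rabs (- r ^ 2) = r * r by rewrite Rabs_Ropp Rabs_pos_eq; nra.
have h2 := norm_ge0 be.
have : 0 <= jump * sumN (fun k => norm (S k)).
  by apply: Rmult_le_pos; [exact: jump_ge0 | apply: sumN_ge0 => k; apply: norm_ge0].
have : r * r * norm be <= r * 1 * norm be.
  by apply: Rmult_le_compat_r => //; apply: Rmult_le_compat_l; lra.
by rewrite /reach; nra.
Qed.
Lemma dpm_norm r k e : 0 < r <= 1 -> Rabs e = 1 ->
  norm (vadd (dr r) (vscale (e * (r * jump)) (S k))) <= r * reach.
Proof.
move=> hr he; apply: Rle_trans (norm_triang _ _) _.
rewrite /dr !norm_scale Rabs_mult he Rmult_1_l.
have -> : Rabs (- r ^ 2) = r * r by rewrite Rabs_Ropp Rabs_pos_eq; nra.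
rewrite (Rabs_pos_eq (r * jump)); last by have := jump_ge0; nra.
have h2 := norm_ge0 be.
have h3 := @sumN_ge1 _ (fun k => norm (S k)) k (fun k => norm_ge0 _).
have : r * r * norm be <= r * 1 * norm be.
  by apply: Rmult_le_compat_r => //; apply: Rmult_le_compat_l; lra.
have : r * jump * norm (S k) <= r * jump * sumN (fun k => norm (S k)).
  by apply: Rmult_le_compat_l => //; have := jump_ge0; nra.
rewrite /reach; lra.
Qed.

Lemma Q_expand Lam B f G X : 0 < Lam -> 0 < B -> tay2 Lam f G X ->
  (forall z, symmetric (X z)) -> (forall z i k, Rabs (X z i k) <= B) ->
  forall r z, 0 < r <= 1 ->
  Rabs (Q r f z - f z + r ^ 2 * lin (G z) (X z))
    <= r ^ 2 * (r * (INR n * (INR n * B) * norm be ^ 2 + Lam * reach ^ 3)).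
Proof.
move=> L0 B0 hT hS hB r z hr.
pose P d := f z + dot (G z) d + / 2 * quad (X z) d.
pose QP := / branches * (P (dr r) + sumN (fun k => / 2 * (P (dp r k) + P (dm r k)))).
have R0 : 0 <= Lam * (r * reach) ^ 3.
  by apply: Rmult_le_pos; [lra | apply: pow_le; have := reach_ge0; nra].
have hd d : norm d <= r * reach -> Rabs (f (vadd z d) - P d) <= Lam * (r * reach) ^ 3.
  move=> hd; have -> : f (vadd z d) - P d = f (vadd z d) - f z - dot (G z) d - / 2 * quad (X z) d.
    by rewrite /P; ring.
  apply: Rle_trans (hT z d) _; apply: Rmult_le_compat_l; first lra.
  by apply: pow_incr; split; [exact: norm_ge0|].
have mi : 0 < / branches by apply: Rinv_0_lt_compat; exact: branches_gt0.
have h1 : Rabs (Q r f z - QP) <= Lam * (r * reach) ^ 3.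
  rewrite /Q /QP -Rmult_minus_distr_l Rabs_mult (Rabs_pos_eq (/ branches)); last lra.
  have -> : Lam * (r * reach) ^ 3 = / branches * (branches * (Lam * (r * reach) ^ 3)).
    by field; have := branches_gt0; lra.
  apply: Rmult_le_compat_l; first lra.
  have -> : branches * (Lam * (r * reach) ^ 3) = Lam * (r * reach) ^ 3 + sumN (fun _ : 'I_m => Lam * (r * reach) ^ 3).
    by rewrite sumN_cst /branches; ring.
  set A := sumN _; set C := sumN (fun k => / 2 * (P _ + _)).
  have -> : f (vadd z (dr r)) + A - (P (dr r) + C) = (f (vadd z (dr r)) - P (dr r)) + (A - C) by ring.
  apply: Rle_trans (Rabs_triang _ _) _; apply: Rplus_le_compat; first by apply: hd; exact: dr_norm.
  rewrite /A /C -sumN_minus; apply: Rle_trans (sumN_abs _) _; apply: sumN_le => k.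
  have q1 : Rabs (f (vadd z (dp r k)) - P (dp r k)) <= Lam * (r * reach) ^ 3.
    by apply: hd; have := @dpm_norm r k 1 hr Rabs_R1; rewrite Rmult_1_l.
  have q2 : Rabs (f (vadd z (dm r k)) - P (dm r k)) <= Lam * (r * reach) ^ 3.
    apply: hd; have := @dpm_norm r k (-1) hr; rewrite Rabs_Ropp Rabs_R1 /dm.
    have -> : -1 * (r * jump) = - (r * jump) by ring.
    by apply.
  by move: q1 q2; split_Rabs; lra.
(* Opposite jumps cancel the terms odd in [S k], and [jump_sq] normalises the even ones; only the
   second-order effect of the common drift, of size [r ^ 4], survives. *)
have h2 : QP - f z + r ^ 2 * lin (G z) (X z) = / 2 * r ^ 4 * quad (X z) be.
  rewrite /QP (sumN_ext (g := fun k => P (dr r) + / 2 * (r * jump) ^ 2 * quad (X z) (S k))); last first.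
    move=> k; rewrite /P /dp /dm !quadD // !(dotDr, dotZr, quadZ, bilZr); field.
  rewrite sumN_plus sumN_cst sumN_scal /P /dr quadZ dotZr.
  have -> : (r * jump) ^ 2 = r ^ 2 * (jump * jump) by ring.
  rewrite jump_sq /lin (dotC be); have := branches_gt0; rewrite /branches => h; field; lra.
have h3 : Rabs (quad (X z) be) <= INR n * (INR n * B) * norm be ^ 2.
  apply: Rle_trans (quad_bound _ _) _; apply: Rmult_le_compat_r; first by have := norm_ge0 be; nra.
  rewrite -(sumN_cst n (INR n * B)); apply: sumN_le => i.
  by rewrite -(sumN_cst n B); apply: sumN_le => k.
have h4 : Rabs (/ 2 * r ^ 4 * quad (X z) be) <= r ^ 3 * (INR n * (INR n * B) * norm be ^ 2).
  rewrite Rabs_mult (Rabs_pos_eq (/ 2 * r ^ 4)); last by have := pow_le r 4; lra.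
  apply: Rmult_le_compat => //; [by have := pow_le r 4; lra|exact: Rabs_pos|].
  have := pow_lt r 3 (proj1 hr); have -> : r ^ 4 = r * r ^ 3 by ring.
  nra.
have -> : Q r f z - f z + r ^ 2 * lin (G z) (X z)
   = (Q r f z - QP) + (/ 2 * r ^ 4 * quad (X z) be) by rewrite -h2; ring.
apply: Rle_trans (Rabs_triang _ _) _.
apply: Rle_trans (Rplus_le_compat _ _ _ _ h1 h4) _.
by apply: Req_le; ring.
Qed.

Section MV.
Variables (f : vec n -> R) (mf : mq f) (B0 : R) (fB : forall z, Rabs (f z) <= B0).
Variables (z0 : vec n) (rho k : R) (rho0 : 0 < rho).
Hypothesis VP : forall zh p Y Lam, norm (vsub zh z0) <= rho -> symmetric Y ->
  (forall d, f (vadd zh d) <= f zh + dot p d + / 2 * quad Y d + Lam * norm d ^ 3) ->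
  lin p Y <= k.

Lemma lin_pen z1 z Kp p Y :
  lin (vadd p (vscale (2 * Kp) (vsub z z1))) (madd Y (mscale (2 * Kp) mid))
  = lin p Y + Kp * (2 * dot be (vsub z z1) - 2 * sumN (fun k => dot (S k) (S k))).
Proof.
rewrite /lin dotDr dotZr (sumN_ext (g := fun k => quad Y (S k) + 2 * Kp * dot (S k) (S k))).
  by rewrite sumN_plus sumN_scal; ring.
by move=> j; rewrite quad_madd quad_mscale quad_mid.
Qed.

Lemma small_prod a b : 0 < a -> 0 <= b -> exists t, 0 < t /\ forall s, 0 <= s <= t -> b * s <= a.
Proof.
move=> a0 b0; exists (a / (b + 1)); split; first by apply: Rdiv_lt_0_compat; lra.
move=> s [s0 hs]; have : (b + 1) * s <= (b + 1) * (a / (b + 1)) by apply: Rmult_le_compat_l; lra.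
have -> : (b + 1) * (a / (b + 1)) = a by field; lra.
nra.
Qed.

(** [f] is compared with the walk averages [phi i] of a smooth approximation [f0]. Where
    [f - phi i.+1] minus a quadratic penalty is maximal, [VP] bounds [lin] on the derivatives of
    [phi i.+1], and the expansion of one step turns this into a growth of at most [r ^ 2 * (k + e)].
    The threshold [r0] may depend on [ka], because the derivative bounds of [f0] blow up as [f0]
    approaches [f]; [tau0] may not. *)
Lemma mv_ineq e : 0 < e -> exists tau0, 0 < tau0 <= / 2 /\
  forall tau, 0 < tau <= tau0 -> forall ka, 0 < ka ->
  exists r0, 0 < r0 /\ forall r j, 0 < r <= r0 -> INR j * r ^ 2 = tau ->
  forall z1, norm (vsub z1 z0) <= rho / 2 -> f z1 <= Qn r j f z1 + tau * (k + e) + ka.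
Proof.
move=> e0; pose de := rho / 2.
have de0 : 0 < de by rewrite /de; lra.
(* [E] bounds how far [phi i] may stray from [f]. The weight [Kp] does two things:
   [Kp * de ^ 2 = 2 * E] makes the maximum over the ball global, and [Kp * C3 = e / 2] limits what
   the penalty adds to [lin]. *)
pose C3 := 2 * (norm be * de) + 2 * sumN (fun k => dot (S k) (S k)) + 1.
have SS0 : 0 <= sumN (fun k => dot (S k) (S k)) by apply: sumN_ge0 => ?; apply: dot_ge0.
have C30 : 0 < C3 by rewrite /C3; have := norm_ge0 be; nra.
pose E := e * de ^ 2 / (4 * C3).
have de2 : 0 < de ^ 2 by exact: pow_lt.
have E0 : 0 < E by apply: Rdiv_lt_0_compat; [exact: Rmult_lt_0_compat | lra].
pose Kp := 2 * E / de ^ 2.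
have Kp0 : 0 < Kp by apply: Rdiv_lt_0_compat; lra.
have KpC : Kp * C3 = e / 2 by rewrite /Kp /E; field; lra.
have Kpde : Kp * de ^ 2 = 2 * E by rewrite /Kp; field; lra.
have [Kf [Kf0 hKf]] := mf (e := E / 4) ltac:(lra).
have K20 := moment2_ge1.
have [t0 [t00 ht0]] := @small_prod (E / 4) (Kf * (2 * moment2)) ltac:(lra) ltac:(nra).
exists (Rmin t0 (/ 2)); split; first by split; [apply: Rmin_pos; lra | exact: Rmin_r].
move=> tau [tau0 htau] ka ka0.
have tau1 : tau <= t0 by apply: Rle_trans htau (Rmin_l _ _).
have tau2 : tau <= / 2 by apply: Rle_trans htau (Rmin_r _ _).
pose kk := Rmin (ka / 2) (E / 2).
have kk0 : 0 < kk by apply: Rmin_pos; lra.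
have kk1 : kk <= ka / 2 by exact: Rmin_l.
have kk2 : kk <= E / 2 by exact: Rmin_r.
have [w [w0 hw]] := mq_sub kk0 mf.
pose rr := w / (3 * INR n + 1) / 2.
have n0 := pos_INR n.
have rr0 : 0 < rr by rewrite /rr; apply: Rdiv_lt_0_compat; [apply: Rdiv_lt_0_compat|]; lra.
have hrad : rad (dirs3 n rr) < w.
  rewrite rad_dirs3 //.
  have -> : 3 * INR n * rr = w / 2 * (1 - / (3 * INR n + 1)) by rewrite /rr; field; lra.
  have : 0 < / (3 * INR n + 1) by apply: Rinv_0_lt_compat; lra.
  nra.
pose f0 := Avgs (dirs3 n rr) f.
have f0f z : Rabs (f0 z - f z) <= kk.
  apply: Avgs_close => // y hy; apply: Rlt_le; apply: hw; lra.
have [G [X [m0 [Lam [Lam0 hT]] hS [B [B1 hB]] mG mX]]] := mollify_smooth rr0 mf fB.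
rewrite -/f0 in m0 hT.
have ml : mq (fun z => lin (G z) (X z)).
  have h1 : mq (fun z => sumN (fun i => be i * G z i)).
    by apply: mq_sumN => i; apply: mq_scal.
  have h2 : mq (fun z => sumN (fun k => quad (X z) (S k))).
    apply: mq_sumN => l; apply: mq_sumN => i; apply: mq_sumN => l'.
    by apply: mq_ext (mq_scal (S l i * S l l') (mX i l')) => z; ring.
  by apply: mq_ext (mq_plus h1 (mq_scal (-1) h2)) => z; rewrite /lin /dot; ring.
have [Kl [Kl0 hKl]] := ml (e / 8) ltac:(lra).
pose C4 := INR n * (INR n * B) * norm be ^ 2 + Lam * reach ^ 3.
have C40 : 0 <= C4.
  have h1 : 0 <= INR n * (INR n * B) * norm be ^ 2.
    by apply: Rmult_le_pos; [nra | have := norm_ge0 be; nra].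
  have := pow_le _ 3 reach_ge0; rewrite /C4; nra.
have [t1 [t10 ht1]] := @small_prod (e / 4) C4 ltac:(lra) C40.
have [t2 [t20 ht2]] := @small_prod (e / 8) (Kl * (2 * moment2)) ltac:(lra) ltac:(nra).
exists (Rmin (/ 2) (Rmin t1 t2)); split; first by do 2 (apply: Rmin_pos; try lra).
move=> r j [r0 hr] hj z1 hz1.
have r1 : r <= / 2 by apply: Rle_trans hr (Rmin_l _ _).
have r2 : r <= t1 by apply: Rle_trans hr (Rle_trans _ _ _ (Rmin_r _ _) (Rmin_l _ _)).
have r3 : r <= t2 by apply: Rle_trans hr (Rle_trans _ _ _ (Rmin_r _ _) (Rmin_r _ _)).
have rs : r ^ 2 <= r by nra.
have rsp : 0 < r ^ 2 by nra.
pose phi i := Qn r i f0.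
have hE i z : (i <= j)%N -> Rabs (phi i z - f z) <= E.
  move=> /leP /le_INR hi.
  have a1 : INR i * r ^ 2 <= tau by rewrite -hj; apply: Rmult_le_compat_r; lra.
  have h1 := @Qn_diff r i f0 f z kk f0f.
  have h2 := @Qn_close r i (E / 4) Kf f z r0 ltac:(lra) ltac:(lra) (Rlt_le _ _ Kf0) hKf.
  have h3 := ht0 (INR i * r ^ 2).
  have h4 : Kf * (2 * moment2) * (INR i * r ^ 2) <= E / 4.
    by apply: h3; split; [have := pos_INR i; nra | lra].
  rewrite /phi; move: h1 h2; split_Rabs; lra.
have claim i : (i <= j)%N -> forall z,
    f z - phi i z - Kp * norm (vsub z z1) ^ 2 <= ka / 2 + INR i * r ^ 2 * (k + e).
  elim: i => [_ z|i IH hi z].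
    have := f0f z; have := norm_ge0 (vsub z z1); rewrite /phi /=; split_Rabs; nra.
  pose W y := f y - phi i.+1 y - Kp * norm (vsub y z1) ^ 2.
  have [zh [zh1 zhmax]] : exists zh, norm (vsub zh z1) <= de /\
      forall y, norm (vsub y z1) <= de -> W y <= W zh.
    apply: (@ucpt_max _ (@dV n) (fun y => norm (vsub y z1) <= de)); first exact: ucpt_ball.
      by exists z1; rewrite norm_subvv; lra.
    move=> x hx e1 e10.
    have mW : mq (fun y => f y + (-1) * phi i.+1 y) by apply: mq_plus => //; apply: mq_scal; apply: Qn_mq.
    have [q [q0 hq]] := mq_sub (e := e1 / 2) ltac:(lra) mW.
    have [q' [q'0 hq']] := @small_prod (e1 / 4) (Kp * (2 * de)) ltac:(lra) ltac:(nra).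
    exists (Rmin q q'); split; first exact: Rmin_pos.
    move=> y hy hyx.
    have hyx1 : norm (vsub y x) < q by apply: Rlt_le_trans hyx (Rmin_l _ _).
    have hyx2 : norm (vsub y x) <= q' by apply: Rlt_le; apply: Rlt_le_trans hyx (Rmin_r _ _).
    have a1 := hq _ _ hyx1.
    have a2 := hq' (norm (vsub y x)) (conj (norm_ge0 _) hyx2).
    have a3 : norm (vsub x z1) - norm (vsub y z1) <= norm (vsub y x).
      have := norm_sub_triang x y z1; rewrite (norm_subC x y); lra.
    have a4 : norm (vsub x z1) ^ 2 - norm (vsub y z1) ^ 2 <= 2 * de * norm (vsub y x).
      have := norm_ge0 (vsub x z1); have := norm_ge0 (vsub y z1); have := norm_ge0 (vsub y x).
      move: a3 hx hy; move: (norm _) (norm _) (norm _) => u v w1 *; nra.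
    have a5 : Kp * (norm (vsub x z1) ^ 2 - norm (vsub y z1) ^ 2) <= Kp * (2 * de * norm (vsub y x)).
      by apply: Rmult_le_compat_l; lra.
    by rewrite /W; move: a1; split_Rabs; lra.
  have zhmax' y : W y <= W zh.
    have [hy|hy] := Rle_lt_dec (norm (vsub y z1)) de; first exact: zhmax.
    have h1 := zhmax z1; rewrite norm_subvv in h1; have {}h1 := h1 (Rlt_le _ _ de0).
    have h2 := hE _ y hi; have h3 := hE _ z1 hi.
    have h4 : 2 * E <= Kp * norm (vsub y z1) ^ 2.
      by rewrite -Kpde; apply: Rmult_le_compat_l; [lra|apply: pow_incr; lra].
    rewrite /W norm_subvv in h1; rewrite /W; move: h2 h3; split_Rabs; lra.
  have hT' := @Qn_tay2 r i.+1 _ _ _ _ hT.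
  have lz : lin (QG r i.+1 G zh) (QX r i.+1 X zh) <= k + e / 2.
    have := @VP zh (vadd (QG r i.+1 G zh) (vscale (2 * Kp) (vsub zh z1)))
      (madd (QX r i.+1 X zh) (mscale (2 * Kp) mid)) Lam.
    rewrite lin_pen => h.
    have h1 : norm (vsub zh z0) <= rho.
      have := norm_sub_triang zh z1 z0; rewrite /de in zh1; lra.
    have h2 : symmetric (madd (QX r i.+1 X zh) (mscale (2 * Kp) mid)).
      by apply: sym_madd; [apply: Qn_sym | apply: sym_mscale; exact: sym_mid].
    have {h1 h2} h := h h1 h2.
    have h3 : Rabs (dot be (vsub zh z1)) <= norm be * de.
      apply: Rle_trans (cauchy_abs _ _) _; apply: Rmult_le_compat_l => //; exact: norm_ge0.
    have h4 : - (Kp * C3) <= Kp * (2 * dot be (vsub zh z1) - 2 * sumN (fun k => dot (S k) (S k))).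
      have -> : - (Kp * C3) = Kp * (- C3) by ring.
      by apply: Rmult_le_compat_l; [lra|rewrite /C3; move: h3; split_Rabs; lra].
    rewrite KpC in h4.
    suff : lin (QG r i.+1 G zh) (QX r i.+1 X zh) +
      Kp * (2 * dot be (vsub zh z1) - 2 * sumN (fun k => dot (S k) (S k))) <= k by lra.
    apply: h => d.
    have a1 := zhmax' (vadd zh d); rewrite /W in a1.
    have a2 := hT' zh d; rewrite -/(phi i.+1) in a2.
    have a3 : norm (vsub (vadd zh d) z1) ^ 2 - norm (vsub zh z1) ^ 2
       = 2 * dot (vsub zh z1) d + dot d d.
      have -> : vsub (vadd zh d) z1 = vadd (vsub zh z1) d by vring.
      by rewrite norm_add_sq !norm_sq; ring.
    rewrite dotDl dotZl quad_madd quad_mscale quad_mid.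
    have a4 : Kp * (norm (vsub (vadd zh d) z1) ^ 2 - norm (vsub zh z1) ^ 2)
      = Kp * (2 * dot (vsub zh z1) d + dot d d) by rewrite a3.
    move: a2; split_Rabs; lra.
  have hTi := @Qn_tay2 r i _ _ _ _ hT.
  have ex := Q_expand Lam0 B1 hTi (fun z => Qn_sym r i z hS) (Qn_bd r i hB) zh (r := r) ltac:(lra).
  (* [VP] speaks about step [i.+1] and the expansion about step [i]; one step of the walk moves the
     continuous function [lin (G z) (X z)] by little. *)
  have lQ : Rabs (lin (QG r i.+1 G zh) (QX r i.+1 X zh) - lin (QG r i G zh) (QX r i X zh)) <= e / 4.
    have := @Qn_close r 1 (e / 8) Kl _ zh r0 ltac:(lra) _ (Rlt_le _ _ Kl0) (@Qn_MQ r i _ _ _ hKl).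
    rewrite -!Qn_lin /Qn /= => h; apply: Rle_trans (h ltac:(nra)) _.
    by have := ht2 (r * (r * 1)) ltac:(nra); lra.
  have rC : r ^ 2 * (r * C4) <= r ^ 2 * (e / 4).
    by apply: Rmult_le_compat_l; [lra|have := ht1 r ltac:(lra); lra].
  have {}ex : Rabs (phi i.+1 zh - phi i zh + r ^ 2 * lin (QG r i G zh) (QX r i X zh)) <= r ^ 2 * (e / 4).
    exact: Rle_trans ex rC.
  have lle : r ^ 2 * lin (QG r i G zh) (QX r i X zh) <= r ^ 2 * (k + e * 3 / 4).
    by apply: Rmult_le_compat_l; [lra|move: lQ; split_Rabs; lra].
  have IH' := IH (ltnW hi) zh.
  apply: Rle_trans (zhmax' z) _; rewrite /W S_INR.
  by move: ex; split_Rabs; lra.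
have := claim j (leqnn j) z1; rewrite norm_subvv hj => h.
have := @Qn_diff r j f0 f z1 kk f0f; rewrite /phi in h; split_Rabs; lra.
Qed.

(** The inequality of [mv_ineq] is linear in [f] and holds at all nearby centres, so it passes to
    the average. There the walk can be expanded, since the average is smooth, and division by [tau]
    brings back the differential inequality. This is why the slack [ka] was left free: it is taken
    as [tau * e]. *)
Theorem mv_smooth l G X : rad l <= rho / 2 -> smooth2 (Avgs l f) G X -> lin (G z0) (X z0) <= k.
Proof.
move=> hl [mF [Lam [Lam0 hT]] hS [B [B1 hB]] mG mX].
apply: le_epsilon => e1 e10; pose e := e1 / 4.
have e0 : 0 < e by rewrite /e; lra.
have ml : mq (fun z => lin (G z) (X z)).
  have h1 : mq (fun z => sumN (fun i => be i * G z i)).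
    by apply: mq_sumN => i; apply: mq_scal.
  have h2 : mq (fun z => sumN (fun k => quad (X z) (S k))).
    apply: mq_sumN => q; apply: mq_sumN => i; apply: mq_sumN => q'.
    by apply: mq_ext (mq_scal (S q i * S q q') (mX i q')) => z; ring.
  by apply: mq_ext (mq_plus h1 (mq_scal (-1) h2)) => z; rewrite /lin /dot; ring.
have [Kl [Kl0 hKl]] := ml (e / 4) ltac:(lra).
have K20 := moment2_ge1.
have [t2 [t20 ht2]] := @small_prod (e / 4) (Kl * (2 * moment2)) ltac:(lra) ltac:(nra).
have [tau0 [[tau00 tau01] hmv]] := mv_ineq e0.
pose tau := Rmin tau0 t2.
have tau_gt : 0 < tau by apply: Rmin_pos.
have tau1 : tau <= tau0 by exact: Rmin_l.
have tau2 : tau <= t2 by exact: Rmin_r.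
have ka0 : 0 < tau * e by nra.
have [r0 [r00 hr0]] := hmv tau ltac:(lra) _ ka0.
pose C4 := INR n * (INR n * B) * norm be ^ 2 + Lam * reach ^ 3.
have n0 := pos_INR n.
have C40 : 0 <= C4.
  have h1 : 0 <= INR n * (INR n * B) * norm be ^ 2.
    by apply: Rmult_le_pos; [nra | have := norm_ge0 be; nra].
  have := pow_le _ 3 reach_ge0; rewrite /C4; nra.
have [t1 [t10 ht1]] := @small_prod (e / 2) C4 ltac:(lra) C40.
pose rb := Rmin (/ 2) (Rmin r0 t1).
have rb0 : 0 < rb by do 2 (apply: Rmin_pos; try lra).
(* The number of steps is chosen first and the step size second, so that [j * r ^ 2] is exactly
   [tau]. *)
have [j hj] := INR_unbounded (tau / rb ^ 2).
have jpos : 0 < INR j.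
  by apply: Rlt_trans hj; apply: Rdiv_lt_0_compat => //; nra.
pose r := sqrt (tau / INR j).
have tj : 0 < tau / INR j by apply: Rdiv_lt_0_compat.
have rr : r ^ 2 = tau / INR j by rewrite /r -Rsqr_pow2 Rsqr_sqrt //; lra.
have rpos : 0 < r by exact: sqrt_lt_R0.
have rrb : r <= rb.
  apply: Rnot_lt_le => h.
  have h1 : rb ^ 2 < tau / INR j by rewrite -rr; nra.
  have rb2 : 0 < rb ^ 2 by nra.
  have : rb ^ 2 * INR j < tau.
    have -> : tau = tau / INR j * INR j by field; lra.
    exact: Rmult_lt_compat_r.
  have : tau < rb ^ 2 * INR j.
    have -> : tau = rb ^ 2 * (tau / rb ^ 2) by field; lra.
    exact: Rmult_lt_compat_l.
  lra.
have r1 : r <= / 2 by apply: Rle_trans rrb (Rmin_l _ _).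
have r2 : r <= r0 by apply: Rle_trans rrb (Rle_trans _ _ _ (Rmin_r _ _) (Rmin_l _ _)).
have r3 : r <= t1 by apply: Rle_trans rrb (Rle_trans _ _ _ (Rmin_r _ _) (Rmin_r _ _)).
have hjt : INR j * r ^ 2 = tau by rewrite rr; field; lra.
have rsp : 0 < r ^ 2 by nra.
pose F := Avgs l f.
have h1 : F z0 <= Qn r j F z0 + tau * (k + e) + tau * e.
  have : F z0 <= Avgs l (fun z => Qn r j f z + (tau * (k + e) + tau * e)) z0.
    apply: Avgs_mono => //; first by apply: mq_plus; [exact: Qn_mq | exact: mq_cst].
    move=> z hz; have := hr0 r j ltac:(lra) hjt z ltac:(lra); lra.
  rewrite Avgs_plus; [|exact: Qn_mq|exact: mq_cst].
  by rewrite Avgs_cst Qn_Avgs // -/F; lra.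
have h2 i : (i <= j)%N -> Qn r i F z0 <= F z0 - INR i * r ^ 2 * (lin (G z0) (X z0) - e).
  elim: i => [_|i IH hi]; first by rewrite /=; lra.
  have a1 : INR i * r ^ 2 <= tau.
    by rewrite -hjt; apply: Rmult_le_compat_r; [lra|apply: le_INR; apply/leP; exact: ltnW].
  have a2 : Qn r i.+1 F z0 <= Qn r i (fun z => (F z + (- r ^ 2) * lin (G z) (X z)) + r ^ 2 * (e / 2)) z0.
    rewrite Qn_Sr; apply: Qn_mono => z.
    have ex := Q_expand Lam0 B1 hT hS hB z (r := r) ltac:(lra).
    have rC : r ^ 2 * (r * C4) <= r ^ 2 * (e / 2).
      by apply: Rmult_le_compat_l; [lra|have := ht1 r ltac:(lra); lra].
    have := Rle_trans _ _ _ ex rC; rewrite -/F; split_Rabs; lra.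
  rewrite !Qn_plus Qn_scal Qn_cst in a2.
  have a3 := @Qn_close r i (e / 4) Kl _ z0 rpos ltac:(nra) ltac:(lra) (Rlt_le _ _ Kl0) hKl.
  have a4 : Kl * (2 * moment2) * (INR i * r ^ 2) <= e / 4.
    by apply: ht2; split; [have := pos_INR i; nra|lra].
  have a5 : r ^ 2 * (lin (G z0) (X z0) - e / 2) <= r ^ 2 * Qn r i (fun z => lin (G z) (X z)) z0.
    by apply: Rmult_le_compat_l; [lra|move: a3; split_Rabs; lra].
  have := IH (ltnW hi); rewrite S_INR; lra.
have h3 := h2 j (leqnn j); rewrite hjt in h3.
have h4 : tau * lin (G z0) (X z0) <= tau * (k + 3 * e) by lra.
have : lin (G z0) (X z0) <= k + 3 * e by apply: Rmult_le_reg_l h4.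
rewrite /e; lra.
Qed.
End MV.
End Walk.

(** * Jets of sup-convolutions *)

Section Prox.
Variable n : nat.
Implicit Types (Y : mat n) (x y : vec n).

Lemma bil_suml Y m (f : 'I_m -> vec n) (c : 'I_m -> R) d :
  bil Y (fun i => sumN (fun j => c j * f j i)) d = sumN (fun j => c j * bil Y (f j) d).
Proof.
rewrite [RHS](sumN_ext (g := fun j => sumN (fun i => c j * (sumN (fun l => Y i l * f j i * d l))))); last first.
  by move=> j; rewrite sumN_scal.
rewrite sumN_exch; apply: sumN_ext => i.
transitivity (sumN (fun j => sumN (fun l => c j * (Y i l * f j i * d l)))).
  rewrite sumN_exch; apply: sumN_ext => l.
  rewrite [RHS](sumN_ext (g := fun j => (Y i l * d l) * (c j * f j i))); last by move=> j; ring.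
  by rewrite sumN_scal; ring.
by apply: sumN_ext => j; rewrite sumN_scal.
Qed.
Lemma bil_sumr Y m (f : 'I_m -> vec n) (c : 'I_m -> R) d :
  bil Y d (fun i => sumN (fun j => c j * f j i)) = sumN (fun j => c j * bil Y d (f j)).
Proof.
pose Yt : mat n := fun i j => Y j i.
have E u v : bil Y u v = bil Yt v u.
  rewrite /bil sumN_exch; apply: sumN_ext => i; apply: sumN_ext => j; rewrite /Yt; ring.
by rewrite E bil_suml; apply: sumN_ext => j; rewrite E.
Qed.
Lemma quad_lip Y x y B : norm x <= B -> norm y <= B -> symmetric Y ->
  Rabs (quad Y y - quad Y x) <= 2 * mabs Y * B * norm (vsub y x).
Proof.
move=> hx hy sY.
have -> : quad Y y - quad Y x = bil Y (vadd y x) (vsub y x).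
  have -> : vsub y x = vadd y (vscale (-1) x) by vring.
  by rewrite !quadE !(bilDl, bilDr, bilZl, bilZr) (bilC y x sY); ring.
apply: Rle_trans (bil_bound _ _ _) _.
have h := norm_triang y x; have := mabs_ge0 Y; have := norm_ge0 (vsub y x) => q1 q2.
have : norm (vadd y x) * norm (vsub y x) <= 2 * B * norm (vsub y x).
  by apply: Rmult_le_compat_r; lra.
nra.
Qed.

(** The equation [B x = y] is the Euler equation of the coercive functional [J], and the minimiser
    exists by compactness of a ball; no matrix inversion is involved. *)
Lemma sol_posdef (B : mat n) ka : 0 < ka -> symmetric B ->
  (forall x, ka * dot x x <= quad B x) -> forall y, exists x, forall d, bil B x d = dot y d.
Proof.
move=> ka0 sB hB y; pose J x := / 2 * quad B x - dot y x.
pose r := 2 * norm y / ka + 1.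
have y0 := norm_ge0 y.
have r0 : 0 < r.
  have : 0 <= 2 * norm y / ka by apply: Rmult_le_pos; [lra|apply: Rlt_le; exact: Rinv_0_lt_compat].
  rewrite /r; lra.
have [x [hx hmin]] : exists x, norm (vsub x (@vzero n)) <= r /\
    forall z, norm (vsub z (@vzero n)) <= r -> - J z <= - J x.
  apply: (@ucpt_max _ (@dV n) (fun x => norm (vsub x (@vzero n)) <= r) (fun x => - J x)).
  - exact: ucpt_ball.
  - by exists (@vzero n); rewrite norm_subvv; lra.
  - move=> x hx e e0.
    have b0 : 0 <= mabs B * r + norm y by have := mabs_ge0 B; nra.
    have [t [t0 ht]] := small_prod (a := e / 2) ltac:(lra) b0.
    exists t; split=> // z hz hzx.
    have E0 u : vsub u (@vzero n) = u by vring.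
    rewrite !E0 in hx hz.
    have h1 := quad_lip hx hz sB.
    have h2 := cauchy_abs y (vsub z x); rewrite dotBr in h2.
    have h3 := ht (norm (vsub z x)) (conj (norm_ge0 _) (Rlt_le _ _ hzx)).
    rewrite /J; move: h1 h2; split_Rabs; lra.
have E0 u : vsub u (@vzero n) = u by vring.
rewrite E0 in hx.
have gmin z : J x <= J z.
  have [hz|hz] := Rle_lt_dec (norm z) r; first by have := hmin z; rewrite E0 => /(_ hz); lra.
  have h1 := hmin (@vzero n); rewrite E0 norm_zero in h1; have {}h1 := h1 (Rlt_le _ _ r0).
  have h2 : J (@vzero n) = 0.
    rewrite /J dot0r; have -> : @vzero n = vscale 0 (@vzero n) by vring.
    by rewrite quadZ; ring.
  suff : 0 < J z by lra.
  have h3 := hB z; rewrite -norm_sq in h3; have h4 := cauchy y z.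
  have h5 : norm y < ka / 2 * norm z.
    have : ka * (2 * norm y / ka + 1) < ka * norm z by apply: Rmult_lt_compat_l.
    have -> : ka * (2 * norm y / ka + 1) = 2 * norm y + ka by field; lra.
    lra.
  rewrite /J; have : 0 < norm z by lra.
  move: h3 h4 h5; move: (norm z) (norm y) => u v *; nra.
exists x => d.
have H t : 0 <= t * (bil B x d - dot y d) + / 2 * t ^ 2 * quad B d.
  have := gmin (vadd x (vscale t d)).
  by rewrite /J quadD // quadZ bilZr dotDr dotZr; lra.
have q0 : 0 <= quad B d by have := hB d; have := dot_ge0 d; nra.
set a := bil B x d - dot y d in H.
suff : a = 0 by rewrite /a; lra.
apply: NNPP => ha.
have h1 := H (- a / (quad B d + 1)).
have : - a / (quad B d + 1) * a + / 2 * (- a / (quad B d + 1)) ^ 2 * quad B d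
  = - (a ^ 2 / (quad B d + 1)) * (1 - / 2 * (quad B d / (quad B d + 1))) by field; lra.
have h2 : 0 < a ^ 2 / (quad B d + 1).
  by apply: Rdiv_lt_0_compat; [have := pow2_gt_0 a ha|]; lra.
have h3 : quad B d / (quad B d + 1) <= 1.
  apply: (Rmult_le_reg_r (quad B d + 1)); first lra.
  have -> : quad B d / (quad B d + 1) * (quad B d + 1) = quad B d by field; lra.
  lra.
nra.
Qed.

Definition mulv (M : mat n) (y : vec n) : vec n := fun i => sumN (fun j => y j * M i j).
Lemma mulv_bound M y : norm (mulv M y) <= mabs M * norm y.
Proof.
apply: Rle_trans (norm_le_sum _) _; rewrite Rmult_comm /mabs -sumN_scal; apply: sumN_le => i.
apply: Rle_trans (sumN_abs _) _; rewrite -sumN_scal; apply: sumN_le => j.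
rewrite Rabs_mult; apply: Rmult_le_compat_r; [exact: Rabs_pos|exact: coord_le_norm].
Qed.

(* [Ys] is the matrix of the inf-convolution of the quadratic form of [Y] with [|.|^2 / eps]. *)
Lemma prox_matrix Y eps ka : 0 < eps -> 0 < ka -> symmetric Y ->
  (forall x, ka * dot x x <= dot x x + eps * quad Y x) ->
  exists M Ys, symmetric Ys /\
   (forall y, quad Ys y = quad Y (mulv M y) + norm (vsub (mulv M y) y) ^ 2 / eps) /\
   (forall x y, quad Ys y <= quad Y x + norm (vsub x y) ^ 2 / eps).
Proof.
move=> e0 ka0 sY hY.
pose B := madd (@mid n) (mscale eps Y).
have sB : symmetric B by apply: sym_madd; [exact: sym_mid | exact: sym_mscale].
have hB x : ka * dot x x <= quad B x by rewrite quad_madd quad_mid quad_mscale.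
have sol := sol_posdef ka0 sB hB.
(* The vectors [mm j] are the columns of the inverse of [B = I + eps Y]. Thus [mulv M y] minimises
   [quad Y x + |x - y|^2 / eps] over [x], and [Ys] is the matrix of the minimum value, a quadratic
   form in [y]. *)
pose mm (j : 'I_n) := proj1_sig (constructive_indefinite_description _ (sol (evec j))).
have hm j d : bil B (mm j) d = dot (evec j) d.
  exact: (proj2_sig (constructive_indefinite_description _ (sol (evec j)))).
pose M : mat n := fun i j => mm j i.
have dote j (d : vec n) : dot (evec j) d = d j.
  rewrite /dot -(@sumN_delta n d j); apply: sumN_ext => i; rewrite /evec.
  by case: (i == j); ring.
have hM y d : bil B (mulv M y) d = dot y d.
  by rewrite /mulv /M bil_suml; apply: sumN_ext => j; rewrite hm dote.
pose Ys : mat n := fun i j => bil Y (mm i) (mm j) + / eps * dot (vsub (mm i) (evec i)) (vsub (mm j) (evec j)).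
have Mid (y : vec n) : vsub (mulv M y) y = fun i => sumN (fun j => y j * vsub (mm j) (evec j) i).
  apply: functional_extensionality => i; rewrite /vsub /mulv /M.
  rewrite [RHS](sumN_ext (g := fun j => y j * mm j i - (if j == i then y j else 0))).
    by rewrite sumN_minus sumN_delta.
  by move=> j; rewrite /evec eq_sym; case: (j == i); ring.
have qYs y : quad Ys y = quad Y (mulv M y) + norm (vsub (mulv M y) y) ^ 2 / eps.
  have -> : quad Y (mulv M y) = sumN (fun i => y i * sumN (fun j => y j * bil Y (mm i) (mm j))).
    by rewrite quadE {1}/mulv bil_suml; apply: sumN_ext => i; rewrite /mulv bil_sumr.
  have -> : norm (vsub (mulv M y) y) ^ 2
     = sumN (fun i => y i * sumN (fun j => y j * dot (vsub (mm i) (evec i)) (vsub (mm j) (evec j)))).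
    rewrite norm_sq Mid -bil_mid bil_suml; apply: sumN_ext => i.
    by rewrite bil_sumr; congr Rmult; apply: sumN_ext => j; rewrite bil_mid.
  transitivity (sumN (fun i => y i * sumN (fun j => y j * bil Y (mm i) (mm j))
     + / eps * (y i * sumN (fun j => y j * dot (vsub (mm i) (evec i)) (vsub (mm j) (evec j)))))).
    apply: sumN_ext => i; rewrite -!sumN_scal -sumN_plus; apply: sumN_ext => j; rewrite /Ys; ring.
  by rewrite sumN_plus sumN_scal /Rdiv; ring.
exists M, Ys; split; [|split] => //.
- by move=> i j; rewrite /Ys (bilC (mm i) (mm j) sY) dotC.
move=> x y; rewrite qYs.
set z := mulv M y; pose d := vsub x z.
have -> : x = vadd z d by rewrite /d; vring.
have -> : vsub (vadd z d) y = vadd (vsub z y) d by vring.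
rewrite quadD // norm_add_sq.
have h1 := hM y d; rewrite -/z bil_madd bil_mid bil_mscale in h1.
have h2 := hY d; have h3 := dot_ge0 d; rewrite -norm_sq in h2 h3.
have h4 : 0 <= norm d ^ 2 + eps * quad Y d by nra.
apply: (Rmult_le_reg_l eps) => //.
have -> : eps * (quad Y z + norm (vsub z y) ^ 2 / eps) = eps * quad Y z + norm (vsub z y) ^ 2 by field; lra.
have -> : eps * (quad Y z + 2 * bil Y z d + quad Y d + (norm (vsub z y) ^ 2 + 2 * dot (vsub z y) d + norm d ^ 2) / eps)
  = eps * quad Y z + 2 * (eps * bil Y z d) + eps * quad Y d + norm (vsub z y) ^ 2 + 2 * dot (vsub z y) d + norm d ^ 2 by field; lra.
rewrite dotBl; lra.
Qed.

Lemma nonneg_cubic a b c : 0 <= c -> (forall t, 0 <= a * t + b * t ^ 2 + c * Rabs t ^ 3) -> a = 0 /\ 0 <= b.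
Proof.
move=> c0 h.
have H e : 0 < e -> exists t, 0 < t /\ t <= 1 /\ (Rabs b + c) * t <= e.
  move=> e0; have [t [t0 ht]] := small_prod e0 (b := Rabs b + c) ltac:(have := Rabs_pos b; lra).
  exists (Rmin t 1); split; first by apply: Rmin_pos; lra.
  split; first exact: Rmin_r.
  by apply: ht; split; [apply: Rlt_le; apply: Rmin_pos; lra|exact: Rmin_l].
have ha : a = 0.
  apply: NNPP => ha.
  have a0 : 0 < Rabs a by exact: Rabs_pos_lt.
  have [t [t0 [t1 ht]]] := H (Rabs a / 2) ltac:(lra).
  have key s : Rabs s = t -> b * s ^ 2 + c * Rabs s ^ 3 <= Rabs a / 2 * t.
    move=> hs; rewrite hs -(pow2_abs s) hs.
    have : b * t ^ 2 <= Rabs b * t ^ 2 by apply: Rmult_le_compat_r; [nra|exact: Rle_abs].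
    have : c * t ^ 3 <= c * t ^ 2.
      by apply: Rmult_le_compat_l => //; have -> : t ^ 3 = t * t ^ 2 by []; nra.
    nra.
  have [ap|an] := Rle_lt_dec 0 a.
    have := h (- t); have := key (- t); rewrite Rabs_Ropp (Rabs_pos_eq t); last lra.
    rewrite (Rabs_pos_eq a) // => q1 q2; have := q1 (erefl _); rewrite (Rabs_pos_eq a) in a0 => //; nra.
  have := h t; have := key t; rewrite (Rabs_pos_eq t); last lra.
  rewrite (Rabs_left a) // => q1 q2; have := q1 (erefl _); nra.
split=> //; apply: Rnot_lt_le => hb.
have [t [t0 ht]] := small_prod (a := - b / 2) ltac:(lra) c0.
have := h t; rewrite ha (Rabs_pos_eq t); last lra.
have := ht t ltac:(lra); have : 0 < t ^ 2 by nra.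
have -> : t ^ 3 = t * t ^ 2 by [].
nra.
Qed.

Lemma nonneg_jet q (Z : mat n) Lam : 0 <= Lam -> symmetric Z ->
  (forall d, 0 <= dot q d + / 2 * quad Z d + Lam * norm d ^ 3) ->
  q = @vzero n /\ forall d, 0 <= quad Z d.
Proof.
move=> L0 sZ h.
have key d : dot q d = 0 /\ 0 <= / 2 * quad Z d.
  apply: (@nonneg_cubic _ _ (Lam * norm d ^ 3)).
    by apply: Rmult_le_pos => //; apply: pow_le; exact: norm_ge0.
  move=> t; have := h (vscale t d); rewrite dotZr quadZ norm_scale Rpow_mult_distr.
  move: (Rabs t ^ 3) (norm d ^ 3) => *; lra.
split; last by move=> d; have [_] := key d; lra.
apply: norm0_eq; have [h1 _] := key q; rewrite -norm_sq in h1.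
have := norm_ge0 q; nra.
Qed.

(** The vector [b] comes from the proximal point [p1] of [p0]: the quotient of [p0 - p1] by [la] is
    an exact subgradient at [p1], and the Lipschitz bound keeps [p1] within [2 * la * CR] of [p0],
    so returning to [p0] costs at most [e]. Monotonicity, in the form [dot b (vsub p0 p1) >= 0], has
    the right sign. *)
Lemma eps_subgradient (h : vec n -> R) R0 CR p0 e : 0 < CR -> 0 < e -> norm p0 <= R0 ->
  (forall p q, norm p <= R0 + 1 -> norm q <= R0 + 1 -> Rabs (h p - h q) <= CR * norm (vsub p q)) ->
  (forall p q lam, 0 <= lam <= 1 ->
     h (vadd (vscale lam p) (vscale (1 - lam) q)) <= lam * h p + (1 - lam) * h q) ->
  exists b, forall q, h p0 - e + dot b (vsub q p0) <= h q.
Proof.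
move=> C0 e0 hp0 hL hC.
have [la [la0 hla]] : exists la, 0 < la /\ 2 * la * CR <= / 2 /\ CR * (2 * la * CR) <= e.
  have [t [t0 ht]] := small_prod (a := / 2) (b := 2 * CR) ltac:(lra) ltac:(lra).
  have [t' [t'0 ht']] := small_prod (b := 2 * CR * CR) e0 ltac:(nra).
  exists (Rmin t t'); have m0 : 0 < Rmin t t' by exact: Rmin_pos.
  split=> //; split.
    by have := ht (Rmin t t') ltac:(split; [lra|exact: Rmin_l]); lra.
  by have := ht' (Rmin t t') ltac:(split; [lra|exact: Rmin_r]); lra.
pose J p := h p + / (2 * la) * norm (vsub p p0) ^ 2.
have il : 0 < / (2 * la) by apply: Rinv_0_lt_compat; lra.
have inR p : norm (vsub p p0) <= 1 -> norm p <= R0 + 1.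
  by move=> hp; have := norm_sub_le p p0; lra.
have [p1 [hp1 hmin]] : exists p1, norm (vsub p1 p0) <= 1 /\
    forall z, norm (vsub z p0) <= 1 -> - J z <= - J p1.
  apply: (@ucpt_max _ (@dV n) (fun p => norm (vsub p p0) <= 1) (fun p => - J p)).
  - exact: ucpt_ball.
  - by exists p0; rewrite norm_subvv; lra.
  - move=> x hx e1 e10.
    have [t [t0 ht]] := small_prod (a := e1 / 2) (b := CR + / (2 * la) * 2) ltac:(lra) ltac:(lra).
    exists t; split=> // z hz hzx.
    have h1 := hL z x (inR _ hz) (inR _ hx).
    have h3 := ht (norm (vsub z x)) (conj (norm_ge0 _) (Rlt_le _ _ hzx)).
    have h4 : norm (vsub x p0) ^ 2 - norm (vsub z p0) ^ 2 <= 2 * norm (vsub z x).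
      have := norm_sub_triang x z p0; rewrite (norm_subC x z).
      have := norm_ge0 (vsub x p0); have := norm_ge0 (vsub z p0); have := norm_ge0 (vsub z x).
      move: hx hz; move: (norm _) (norm _) (norm _) => u v w *; nra.
    have : / (2 * la) * (norm (vsub x p0) ^ 2 - norm (vsub z p0) ^ 2) <= / (2 * la) * (2 * norm (vsub z x)).
      by apply: Rmult_le_compat_l; lra.
    rewrite /J; move: h1; split_Rabs; lra.
have dist1 : norm (vsub p1 p0) <= 2 * la * CR.
  have := hmin p0; rewrite norm_subvv /J norm_subvv => /(_ Rle_0_1) h1.
  have h2 := hL p1 p0 (inR _ hp1) ltac:(lra).
  have h3 : / (2 * la) * norm (vsub p1 p0) ^ 2 <= CR * norm (vsub p1 p0) by move: h2; split_Rabs; lra.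
  have h4 : norm (vsub p1 p0) ^ 2 <= 2 * la * CR * norm (vsub p1 p0).
    have -> : norm (vsub p1 p0) ^ 2 = 2 * la * (/ (2 * la) * norm (vsub p1 p0) ^ 2) by field; lra.
    by rewrite (Rmult_assoc (2 * la) CR); apply: Rmult_le_compat_l; lra.
  have := norm_ge0 (vsub p1 p0); have : 0 < 2 * la * CR by nra.
  move: h4; move: (2 * la * CR) (norm _) => u v *; nra.
pose b := vscale (/ la) (vsub p0 p1).
have sub1 q : h p1 + dot b (vsub q p1) <= h q.
  apply: le_epsilon => e1 e10.
  set v := vsub q p1.
  have [t [t0 ht]] := small_prod (a := / 2) (b := norm v) ltac:(lra) (norm_ge0 _).
  have [t' [t'0 ht']] := small_prod (b := / (2 * la) * norm v ^ 2) e10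
     ltac:(apply: Rmult_le_pos; [lra|have := norm_ge0 v; nra]).
  pose s := Rmin 1 (Rmin t t').
  have s0 : 0 < s by do 2 (apply: Rmin_pos; try lra).
  have s1 : s <= 1 by exact: Rmin_l.
  have s2 : s <= t by apply: Rle_trans (Rmin_r _ _) (Rmin_l _ _).
  have s3 : s <= t' by apply: Rle_trans (Rmin_r _ _) (Rmin_r _ _).
  have E : vsub (vadd p1 (vscale s v)) p0 = vadd (vsub p1 p0) (vscale s v) by vring.
  have hb : norm (vsub (vadd p1 (vscale s v)) p0) <= 1.
    rewrite E; apply: Rle_trans (norm_triang _ _) _.
    rewrite norm_scale (Rabs_pos_eq s); last lra.
    have := ht s ltac:(lra); lra.
  have h1 := hmin _ hb; rewrite /J E norm_add_sq norm_scale (Rabs_pos_eq s) in h1; last lra.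
  have h2 := hC q p1 s ltac:(lra).
  have E2 : vadd (vscale s q) (vscale (1 - s) p1) = vadd p1 (vscale s v) by rewrite /v; vring.
  rewrite E2 in h2.
  have h3 := ht' s ltac:(lra).
  have E3 : dot b v = - / (2 * la) * (2 * dot (vsub p1 p0) v).
    rewrite /b dotZl; have -> : vsub p0 p1 = vscale (-1) (vsub p1 p0) by vring.
    by rewrite dotZl; field; lra.
  have h3' : s * (/ (2 * la) * norm v ^ 2 * s) <= s * e1 by apply: Rmult_le_compat_l; lra.
  rewrite dotZr in h1.
  apply: (Rmult_le_reg_l s) => //; rewrite E3.
  set i := / (2 * la) in il h1 h3' E3 *; nra.
exists b => q; have h1 := sub1 q.
have E1 : vsub q p1 = vadd (vsub q p0) (vsub p0 p1) by vring.
rewrite E1 dotDr in h1.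
have h2 : 0 <= dot b (vsub p0 p1).
  rewrite /b dotZl; apply: Rmult_le_pos; last exact: dot_ge0.
  by apply: Rlt_le; apply: Rinv_0_lt_compat.
have h3 := hL p1 p0 (inR _ hp1) ltac:(lra).
have h4 : CR * norm (vsub p1 p0) <= CR * (2 * la * CR) by apply: Rmult_le_compat_l; lra.
move: h3; split_Rabs; lra.
Qed.
End Prox.

(** * Space-time as one Euclidean space, with time as coordinate [ord0] *)

Section SpaceTime.
Variable N : nat.
Definition mk (x : vec N) (t : R) : vec N.+1 :=
  fun i => if unlift ord0 i is Some j then x j else t.
Definition xp (z : vec N.+1) : vec N := fun j => z (lift ord0 j).
Definition tp (z : vec N.+1) : R := z ord0.
Definition xx (Y : mat N.+1) : mat N := fun i j => Y (lift ord0 i) (lift ord0 j).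
Lemma tp_mk x t : tp (mk x t) = t. Proof. by rewrite /tp /mk unlift_none. Qed.
Lemma xp_mk x t : xp (mk x t) = x.
Proof. by apply: functional_extensionality => j; rewrite /xp /mk liftK. Qed.
Lemma mk_eta z : mk (xp z) (tp z) = z.
Proof.
apply: functional_extensionality => i; rewrite /mk /xp /tp.
by case: unliftP => [j ->|->].
Qed.
Lemma mk_add x y s t : vadd (mk x s) (mk y t) = mk (vadd x y) (s + t).
Proof. by apply: functional_extensionality => i; rewrite /mk /vadd; case: unlift. Qed.
Lemma mk_sub x y s t : vsub (mk x s) (mk y t) = mk (vsub x y) (s - t).
Proof. by apply: functional_extensionality => i; rewrite /mk /vsub; case: unlift. Qed.
Lemma dot_mk P x t : dot P (mk x t) = tp P * t + dot (xp P) x.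
Proof.
rewrite /dot sumN_recl; congr (_ + _); first by rewrite /mk unlift_none.
by apply: sumN_ext => j; rewrite /mk liftK.
Qed.
Lemma norm_mk x t : norm (mk x t) ^ 2 = t ^ 2 + norm x ^ 2.
Proof. by rewrite !norm_sq dot_mk tp_mk xp_mk; ring. Qed.
Lemma norm_mk_le x t : norm (mk x t) <= norm x + Rabs t.
Proof.
apply: norm_le_sq; first by have := norm_ge0 x; have := Rabs_pos t; lra.
rewrite -norm_sq norm_mk -(pow2_abs t); have := norm_ge0 x; have := Rabs_pos t; nra.
Qed.
Lemma norm_xp z : norm (xp z) <= norm z.
Proof.
apply: norm_le_sq; first exact: norm_ge0.
by rewrite -norm_sq -{2}(mk_eta z) norm_mk; nra.
Qed.
Lemma abs_tp z : Rabs (tp z) <= norm z.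
Proof. exact: coord_le_norm. Qed.
Lemma quad_mk0 Y x : quad Y (mk x 0) = quad (xx Y) x.
Proof.
rewrite /quad sumN_recl (_ : sumN _ = 0) ?Rplus_0_l.
  apply: sumN_ext => i; rewrite sumN_recl /mk !liftK unlift_none.
  rewrite Rmult_0_r Rplus_0_l; apply: sumN_ext => j; by rewrite liftK.
by apply: sumN0 => j; rewrite /mk unlift_none; ring.
Qed.
Lemma quad_mk Y x t : symmetric Y ->
  Rabs (quad Y (mk x t) - quad (xx Y) x) <= mabs Y * (2 * norm x + Rabs t) * Rabs t.
Proof.
move=> sY; have -> : mk x t = vadd (mk x 0) (mk (@vzero N) t).
  by rewrite mk_add; congr mk; [vring | ring].
rewrite quadD // quad_mk0.
have n0 : norm (mk (@vzero N) t) <= Rabs t by have := norm_mk_le (@vzero N) t; rewrite norm_zero; lra.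
have n1 : norm (mk x 0) <= norm x by have := norm_mk_le x 0; rewrite Rabs_R0; lra.
have h1 := bil_bound Y (mk x 0) (mk (@vzero N) t).
have h2 := quad_bound Y (mk (@vzero N) t).
have m0 := mabs_ge0 Y; have := norm_ge0 (mk x 0); have := norm_ge0 (mk (@vzero N) t) => q1 q2.
have h3 : mabs Y * (norm (mk x 0) * norm (mk (@vzero N) t)) <= mabs Y * (norm x * Rabs t).
  by apply: Rmult_le_compat_l => //; apply: Rmult_le_compat.
have h4 : mabs Y * norm (mk (@vzero N) t) ^ 2 <= mabs Y * Rabs t ^ 2.
  by apply: Rmult_le_compat_l => //; apply: pow_incr.
move: h1 h2; split_Rabs; nra.
Qed.
Lemma sym_xx Y : symmetric Y -> symmetric (xx Y).
Proof. by move=> h i j; apply: h. Qed.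
(** Drift 1 in time and diffusion directions without time component make the constant-coefficient
    operator of the walk parabolic, so time can be averaged like the other variables. *)
Lemma trprod_lin (s : mat N) b P Y :
  lin (mk b 1) (fun k => mk (colv s k) 0) P Y = tp P + dot b (xp P) - trprod (gram s) (xx Y).
Proof.
rewrite /lin dotC dot_mk dotC trprod_gram; congr (_ - _); first ring.
by apply: sumN_ext => k; rewrite quad_mk0.
Qed.
End SpaceTime.

Definition ham N Th (sigma : Th -> vec N -> mat N) (H : Th -> vec N -> vec N -> R) th x p X :=
  - trprod (gram (sigma th x)) X + H th x p.
(** One inequality for every [th], instead of one for the supremum, so that a [th] found elsewhere
    can be inserted. In [Super] the supremum need not be attained, hence a near-optimal [th] for
    each [e]. *)
Definition Sub N Th (sigma : Th -> vec N -> mat N) H (w : vec N -> R -> R) :=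
  forall x t a p X, 0 < t -> symmetric X -> par_superjet w x t a p X ->
    forall th, a + ham sigma H th x p X <= 0.
Definition Super N Th (sigma : Th -> vec N -> mat N) H (w : vec N -> R -> R) :=
  forall x t a p X, 0 < t -> symmetric X -> par_subjet w x t a p X ->
    forall e, 0 < e -> exists th, a + ham sigma H th x p X >= - e.

Record good N L (w : vec N -> R -> R) : Prop := Good {
  g_per : forall t, periodic (fun x => w x t);
  g_lip : forall t, 0 <= t -> Lip L (fun x => w x t);
  g_cont : forall x t, 0 <= t -> forall e, 0 < e -> exists r, 0 < r /\
     forall y s, 0 <= s -> norm (vsub y x) < r -> Rabs (s - t) < r -> Rabs (w y s - w x t) < e }.

Section Good.
Variables (N : nat) (L : R) (w : vec N -> R -> R) (gw : good L w).

Lemma good_periodic : periodic w.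
Proof. by move=> x k; apply: functional_extensionality => t; apply: (g_per gw). Qed.

Let cD T : ucpt (dprod (@dV N) dR) (fun p => inbox p.1 /\ (0 <= p.2 <= T)).
Proof. exact: (ucpt_prod (@ucpt_inbox N) (@ucpt_itv 0 T)). Qed.

Lemma good_unif T e : 0 < e -> exists r, 0 < r /\ forall x s t, 0 <= s <= T -> 0 <= t <= T ->
  Rabs (s - t) < r -> Rabs (w x s - w x t) < e.
Proof.
move=> e0.
have [r [r0 hr]] : exists r, 0 < r /\ forall z, (inbox z.1 /\ 0 <= z.2 <= T) ->
    forall s, 0 <= s <= T -> Rabs (s - z.2) < r -> Rabs (w z.1 s - w z.1 z.2) < e.
  apply: (@ucpt_uniform _ _ _ (fun z r => forall s, 0 <= s <= T -> Rabs (s - z.2) < r ->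
    Rabs (w z.1 s - w z.1 z.2) < e) (@cD T)).
    by move=> z m m' h hm s hs hst; apply: h => //; lra.
  move=> [x t] [/= hx ht].
  have [r [r0 hr]] := g_cont gw x (proj1 ht) (e := e / 2) ltac:(lra).
  exists (r / 2), (r / 2); split; [lra|split; [lra|]] => -[y t'] [/= hy ht'] hd s hs hst.
  have h1 : norm (vsub y x) < r / 2 by apply: Rle_lt_trans (Rmax_l _ _) hd.
  have h2 : Rabs (t' - t) < r / 2 by apply: Rle_lt_trans (Rmax_r _ _) hd.
  have a1 := hr y s (proj1 hs) ltac:(lra) ltac:(split_Rabs; lra).
  have a2 := hr y t' (proj1 ht') ltac:(lra) ltac:(lra).
  by split_Rabs; lra.
exists r; split=> // x s t hs ht hst.
apply: (@periodic_box N _ w (fun v => Rabs (v s - v t) < e) good_periodic) => y hy.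
by apply: (hr (y, t)).
Qed.

Lemma good_bound T : exists B, 0 < B /\ forall x t, 0 <= t <= T -> Rabs (w x t) <= B.
Proof.
have [r [r0 hr]] : exists r, 0 < r /\ forall z, (inbox z.1 /\ 0 <= z.2 <= T) -> Rabs (w z.1 z.2) <= / r.
  apply: (@ucpt_uniform _ _ _ (fun z r => Rabs (w z.1 z.2) <= / r) (@cD T)).
    by move=> z m m' h [h1 h2]; apply: Rle_trans h _; apply: Rinv_le_contravar.
  move=> [x t] [/= hx ht].
  have [r [r0 hr]] := g_cont gw x (proj1 ht) Rlt_0_1.
  have q : 0 < Rabs (w x t) + 1 by have := Rabs_pos (w x t); lra.
  exists (/ (Rabs (w x t) + 1)), r; split; first exact: Rinv_0_lt_compat.
  split=> // -[y s] [/= hy hs] hd; rewrite Rinv_inv.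
  have := hr y s (proj1 hs) (Rle_lt_trans _ _ _ (Rmax_l _ _) hd) (Rle_lt_trans _ _ _ (Rmax_r _ _) hd).
  by split_Rabs; lra.
exists (/ r); split; first exact: Rinv_0_lt_compat.
move=> x t ht.
by apply: (@periodic_box N _ w (fun v => Rabs (v t) <= / r) good_periodic) => y hy; apply: (hr (y, t)).
Qed.
End Good.

Lemma supconv_attained N (v : vec N -> R) L eps x : 0 < eps -> 0 <= L -> Lip L v ->
  exists y, norm (vsub x y) <= 2 * L * eps /\
   forall y', v y' - norm (vsub x y') ^ 2 / (2 * eps) <= v y - norm (vsub x y) ^ 2 / (2 * eps).
Proof.
move=> e0 L0 hv; set r := 2 * L * eps.
have r0 : 0 <= r by rewrite /r; nra.
have ie : 0 < / (2 * eps) by apply: Rinv_0_lt_compat; lra.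
have [y [hy hmax]] : exists y, norm (vsub y x) <= r /\ forall y', norm (vsub y' x) <= r ->
   v y' - norm (vsub x y') ^ 2 / (2 * eps) <= v y - norm (vsub x y) ^ 2 / (2 * eps).
  apply: (@ucpt_max _ (@dV N) (fun y => norm (vsub y x) <= r) (fun y => v y - norm (vsub x y) ^ 2 / (2 * eps))).
  - exact: ucpt_ball.
  - by exists x; rewrite norm_subvv.
  - move=> y hy e1 e10.
    have [t [t0 ht]] := small_prod (a := e1 / 2) (b := L + / (2 * eps) * (2 * r)) ltac:(lra) ltac:(nra).
    exists t; split=> // z hz hzy.
    have h1 := hv z y.
    have h3 := ht (norm (vsub z y)) (conj (norm_ge0 _) (Rlt_le _ _ hzy)).
    have h4 : norm (vsub x y) ^ 2 - norm (vsub x z) ^ 2 <= 2 * r * norm (vsub z y).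
      have := norm_sub_triang x z y.
      rewrite (norm_subC y x) in hy; rewrite (norm_subC z x) in hz.
      have := norm_ge0 (vsub x y); have := norm_ge0 (vsub x z); have := norm_ge0 (vsub z y).
      move: hy hz; move: (norm _) (norm _) (norm _) => a b c *; nra.
    have : / (2 * eps) * (norm (vsub x y) ^ 2 - norm (vsub x z) ^ 2) <= / (2 * eps) * (2 * r * norm (vsub z y)).
      by apply: Rmult_le_compat_l; lra.
    rewrite /Rdiv; move: h1; split_Rabs; lra.
exists y; split; first by rewrite norm_subC.
move=> y'; have [h|h] := Rle_lt_dec (norm (vsub y' x)) r; first exact: hmax.
have h1 := hmax x; rewrite norm_subvv in h1; have {}h1 := h1 r0.
have h2 := hv y' x; rewrite (norm_subC y' x) in h h2.
have h3 : L * norm (vsub x y') <= norm (vsub x y') ^ 2 / (2 * eps).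
  apply: (Rmult_le_reg_l (2 * eps)); first lra.
  have -> : 2 * eps * (norm (vsub x y') ^ 2 / (2 * eps)) = norm (vsub x y') ^ 2 by field; lra.
  have := norm_ge0 (vsub x y'); rewrite /r in h; nra.
have h4 : 0 ^ 2 / (2 * eps) = 0 by field; lra.
rewrite h4 in h1; apply: Rle_trans h1; move: h2; split_Rabs; lra.
Qed.

Section Transfer.
Variables (N : nat) (Th : Type) (sigma : Th -> vec N -> mat N) (H : Th -> vec N -> vec N -> R).

Lemma Rpow3_add a b : 0 <= a -> 0 <= b -> (a + b) ^ 3 <= 4 * (a ^ 3 + b ^ 3).
Proof. move=> a0 b0; have : 0 <= (a + b) * (a - b) ^ 2 by apply: Rmult_le_pos; [lra|exact: pow2_ge_0]. nra. Qed.

(* A superjet of the sup-convolution of [w] at [(xh, th0)], attained at [ys], moves to [ys], where the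
   matrix may be replaced by the inf-convolution of its quadratic form; this turns the coefficients
   frozen at [ys] into coefficients frozen at any nearby point. *)
Lemma supconv_transfer w eps xh t0 ys P Y Lam r0 : 0 < eps -> 0 < t0 -> 0 < r0 -> 0 <= Lam -> symmetric Y ->
  Sub sigma H w ->
  (forall xi s y, Rabs s < r0 ->
    w y (t0 + s) - norm (vsub (vadd xh xi) y) ^ 2 / (2 * eps) <=
    w ys t0 - norm (vsub xh ys) ^ 2 / (2 * eps)
     + (dot P (mk xi s) + / 2 * quad Y (mk xi s) + Lam * norm (mk xi s) ^ 3)) ->
  xp P = vscale (/ eps) (vsub ys xh) /\
  forall th x0, tp P - trprod (gram (sigma th x0)) (xx Y) + H th ys (xp P)
     <= mnorm (msub (sigma th x0) (sigma th ys)) ^ 2 / eps.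
Proof.
move=> e0 t00 r00 L0 sY sub h.
set p := xp P.
have ie : 0 < / eps by apply: Rinv_0_lt_compat.
have sX := sym_xx sY.
(* With [y = ys] and the time frozen, the hypothesis compares two quadratics in [xi]: first-order
   optimality identifies [p], second-order optimality is the semiconvexity of the
   sup-convolution. *)
have [jp jq] : vadd p (vscale (/ eps) (vsub xh ys)) = @vzero N /\
   forall d, 0 <= quad (madd (xx Y) (mscale (/ eps) mid)) d.
  apply: (@nonneg_jet _ _ _ Lam L0).
    by apply: sym_madd => //; apply: sym_mscale; exact: sym_mid.
  move=> d; have := h d 0 ys; rewrite Rabs_R0 Rplus_0_r => /(_ r00).
  have -> : vsub (vadd xh d) ys = vadd (vsub xh ys) d by vring.
  rewrite norm_add_sq dot_mk quad_mk0 -/p Rmult_0_r Rplus_0_l.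
  have n1 : norm (mk d 0) <= norm d by have := norm_mk_le d 0; rewrite Rabs_R0; lra.
  have n2 : Lam * norm (mk d 0) ^ 3 <= Lam * norm d ^ 3.
    by apply: Rmult_le_compat_l => //; apply: pow_incr; split=> //; exact: norm_ge0.
  rewrite dotDl dotZl quad_madd quad_mscale quad_mid -norm_sq.
  have -> : (norm (vsub xh ys) ^ 2 + 2 * dot (vsub xh ys) d + norm d ^ 2) / (2 * eps)
    = norm (vsub xh ys) ^ 2 / (2 * eps) + / eps * dot (vsub xh ys) d + / 2 * (/ eps * norm d ^ 2) by field; lra.
  lra.
have pE : p = vscale (/ eps) (vsub ys xh).
  have -> : vscale (/ eps) (vsub ys xh) = vsub (@vzero N) (vscale (/ eps) (vsub xh ys)) by vring.
  by rewrite -jp; vring.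
split=> // th x0.
apply: le_epsilon => e1 e10.
pose A := sumN (fun k => norm (colv (sigma th x0) k) ^ 2).
have A0 : 0 <= A by apply: sumN_ge0 => k; have := norm_ge0 (colv (sigma th x0) k); nra.
(* The lower bound on [xx Y] is not strict, whereas [prox_matrix] needs a positive margin; adding
   [ka] times the identity restores it and changes the trace by at most [ka * A <= e1]. *)
have [ka [ka0 hka]] := small_prod e10 A0.
pose Yk := madd (xx Y) (mscale ka mid).
have sYk : symmetric Yk by apply: sym_madd => //; apply: sym_mscale; exact: sym_mid.
have eka : 0 < eps * ka by nra.
have posk d : (eps * ka) * dot d d <= dot d d + eps * quad Yk d.
  have := jq d; rewrite /Yk !quad_madd !quad_mscale !quad_mid => hq.
  have : 0 <= eps * (quad (xx Y) d + / eps * dot d d) by apply: Rmult_le_pos; lra.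
  have -> : eps * (quad (xx Y) d + / eps * dot d d) = eps * quad (xx Y) d + dot d d by field; lra.
  lra.
have [M [Ys [sYs [qYs oYs]]]] := prox_matrix e0 eka sYk posk.
(* To a displacement [eta] of [y] corresponds the displacement [mulv M eta] of [xh], the minimiser
   in [prox_matrix]: the second-order terms then combine into [quad Ys eta], up to [ka], and the
   linear ones into [dot p eta]. *)
have jet : par_superjet w ys t0 (tp P) p Ys.
  move=> e e_gt.
  pose mu := mabs M.
  have mu0 : 0 <= mu by exact: mabs_ge0.
  have mY := mabs_ge0 Y.
  have [r1 [r10 hr1]] := small_prod (a := e / 2) (b := mabs Y * (2 * mu + 1)) ltac:(lra) ltac:(nra).
  have [r2 [r20 hr2]] := small_prod (b := 4 * Lam * mu ^ 3) e_gt
    ltac:(by apply: Rmult_le_pos; [lra|apply: pow_le]).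
  have [r3 [r30 hr3]] := small_prod (a := e / 2) (b := 4 * Lam) ltac:(lra) ltac:(lra).
  pose de := Rmin (Rmin r0 (Rmin r1 1)) (Rmin r2 r3).
  have de0 : 0 < de by repeat (apply: Rmin_pos; try lra).
  have [d1 [d2 [d3 [d4 d5]]]] : de <= r0 /\ de <= r1 /\ de <= 1 /\ de <= r2 /\ de <= r3.
    split; first exact: Rle_trans (Rmin_l _ _) (Rmin_l _ _).
    split; first exact: Rle_trans (Rmin_l _ _) (Rle_trans _ _ _ (Rmin_r _ _) (Rmin_l _ _)).
    split; first exact: Rle_trans (Rmin_l _ _) (Rle_trans _ _ _ (Rmin_r _ _) (Rmin_r _ _)).
    split; first exact: Rle_trans (Rmin_r _ _) (Rmin_l _ _).
    exact: Rle_trans (Rmin_r _ _) (Rmin_r _ _).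
  exists de; split=> // y s s0 hy hs.
  set eta := vsub y ys in hy *.
  set sg := s - t0 in hs *.
  have := h (mulv M eta) sg y ltac:(lra).
  have -> : t0 + sg = s by rewrite /sg; ring.
  have -> : vsub (vadd xh (mulv M eta)) y = vadd (vsub xh ys) (vsub (mulv M eta) eta).
    by rewrite /eta; vring.
  rewrite norm_add_sq dot_mk -/p.
  have -> : vsub xh ys = vscale (- eps) p.
    by rewrite pE; apply: functional_extensionality => i; rewrite /vscale /vsub; field; lra.
  rewrite dotZl dotBr qYs quad_madd quad_mscale quad_mid.
  have q1 := @quad_mk _ Y (mulv M eta) sg sY.
  have n1 := mulv_bound M eta; rewrite -/mu in n1.
  have e00 := norm_ge0 eta; have s00 := Rabs_pos sg.
  have q2 : mabs Y * (2 * norm (mulv M eta) + Rabs sg) * Rabs sg <= e / 2 * Rabs sg.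
    apply: Rmult_le_compat_r => //.
    apply: Rle_trans (hr1 de ltac:(lra)).
    rewrite Rmult_assoc; apply: Rmult_le_compat_l => //.
    have : mu * norm eta <= mu * de by apply: Rmult_le_compat_l; lra.
    lra.
  have q3 : Lam * norm (mk (mulv M eta) sg) ^ 3 <= e * norm eta ^ 2 + e / 2 * Rabs sg.
    apply: (Rle_trans _ (Lam * (4 * ((mu * norm eta) ^ 3 + Rabs sg ^ 3)))).
      apply: Rmult_le_compat_l => //.
      have mn0 : 0 <= mu * norm eta by apply: Rmult_le_pos.
      apply: Rle_trans (Rpow3_add mn0 s00).
      apply: pow_incr; split; first exact: norm_ge0.
      by apply: Rle_trans (norm_mk_le _ _) _; lra.
    have a1 := hr2 (norm eta) ltac:(lra); have a2 := hr3 (Rabs sg) ltac:(lra).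
    have a3 : 4 * Lam * mu ^ 3 * norm eta * norm eta ^ 2 <= e * norm eta ^ 2.
      by apply: Rmult_le_compat_r => //; nra.
    have a4 : 4 * Lam * Rabs sg * Rabs sg <= e / 2 * Rabs sg by apply: Rmult_le_compat_r.
    have a5 : 4 * Lam * Rabs sg * Rabs sg * Rabs sg <= 4 * Lam * Rabs sg * Rabs sg * 1.
      by apply: Rmult_le_compat_l; [repeat apply: Rmult_le_pos => //; lra|lra].
    have -> : Lam * (4 * ((mu * norm eta) ^ 3 + Rabs sg ^ 3))
      = 4 * Lam * mu ^ 3 * norm eta * norm eta ^ 2 + 4 * Lam * Rabs sg * Rabs sg * Rabs sg by ring.
    lra.
  set K := norm (vscale _ _) ^ 2.
  have -> : (K + 2 * (- eps * (dot p (mulv M eta) - dot p eta)) + norm (vsub (mulv M eta) eta) ^ 2) / (2 * eps)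
    = K / (2 * eps) - dot p (mulv M eta) + dot p eta + / 2 * (norm (vsub (mulv M eta) eta) ^ 2 / eps) by field; lra.
  have k0 : 0 <= ka * dot (mulv M eta) (mulv M eta) by have := dot_ge0 (mulv M eta); nra.
  move: q1 q2 q3; split_Rabs; lra.
have := sub _ _ _ _ _ t00 sYs jet th; rewrite /ham -/p.
rewrite !trprod_gram => h1.
(* The inf-convolution inequality is applied with the column of [sigma] at [x0] against the column
   at [ys]; this is where the freezing point moves, at the price of the squared difference over
   [eps]. *)
have h2 : sumN (fun k => quad Ys (colv (sigma th ys) k)) <=
   sumN (fun k => quad (xx Y) (colv (sigma th x0) k)) + ka * A
    + mnorm (msub (sigma th x0) (sigma th ys)) ^ 2 / eps.
  apply: (Rle_trans _ (sumN (fun k => quad (xx Y) (colv (sigma th x0) k)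
    + (ka * norm (colv (sigma th x0) k) ^ 2 + / eps * norm (colv (msub (sigma th x0) (sigma th ys)) k) ^ 2)))).
    apply: sumN_le => k; have := oYs (colv (sigma th x0) k) (colv (sigma th ys) k).
    rewrite /Yk quad_madd quad_mscale quad_mid -norm_sq.
    have -> : vsub (colv (sigma th x0) k) (colv (sigma th ys) k) = colv (msub (sigma th x0) (sigma th ys)) k by [].
    rewrite /Rdiv; lra.
  rewrite !sumN_plus !sumN_scal mnorm_col /A /Rdiv; lra.
have := hka ka ltac:(lra); lra.
Qed.
End Transfer.

(** * Test functions, barriers and stationary solutions *)

Definition jet2 N (g : vec N -> R -> R) x t a p (X : mat N) :=
  forall e, 0 < e -> exists r, 0 < r /\ forall y s, norm (vsub y x) < r -> Rabs (s - t) < r ->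
    Rabs (g y s - (g x t + a * (s - t) + dot p (vsub y x) + / 2 * quad X (vsub y x)))
      <= e * (Rabs (s - t) + norm (vsub y x) ^ 2).

Lemma tay2_jet2 N (F : vec N.+1 -> R) G X Lam x t : 0 < Lam -> tay2 Lam F G X -> symmetric (X (mk x t)) ->
  jet2 (fun x t => F (mk x t)) x t (tp (G (mk x t))) (xp (G (mk x t))) (xx (X (mk x t))).
Proof.
move=> L0 hT sX e e0; set z := mk x t in sX *.
have m0 := mabs_ge0 (X z).
have [r1 [r10 hr1]] := small_prod (a := e / 2) (b := mabs (X z) * 3 + 4 * Lam) ltac:(lra) ltac:(nra).
exists (Rmin r1 1); split; first by apply: Rmin_pos; lra.
move=> y s hy hs; set d := vsub y x in hy *; set sg := s - t in hs *.
have hd : norm d < r1 by apply: Rlt_le_trans hy (Rmin_l _ _).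
have hd1 : norm d < 1 by apply: Rlt_le_trans hy (Rmin_r _ _).
have hsg : Rabs sg < r1 by apply: Rlt_le_trans hs (Rmin_l _ _).
have hsg1 : Rabs sg < 1 by apply: Rlt_le_trans hs (Rmin_r _ _).
have d0 := norm_ge0 d; have s0 := Rabs_pos sg.
have := hT z (mk d sg).
have -> : vadd z (mk d sg) = mk y s.
  by rewrite /z mk_add; congr mk; [rewrite /d; vring | rewrite /sg; ring].
rewrite dot_mk.
have h1 := @quad_mk _ (X z) d sg sX.
have h2 : mabs (X z) * (2 * norm d + Rabs sg) * Rabs sg <= mabs (X z) * 3 * (Rmax (norm d) (Rabs sg)) * Rabs sg.
  apply: Rmult_le_compat_r => //; rewrite !Rmult_assoc; apply: Rmult_le_compat_l => //.
  by have := Rmax_l (norm d) (Rabs sg); have := Rmax_r (norm d) (Rabs sg); lra.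
have h3 : Lam * norm (mk d sg) ^ 3 <= 4 * Lam * (Rmax (norm d) (Rabs sg)) * (Rabs sg + norm d ^ 2).
  apply: (Rle_trans _ (Lam * (4 * (norm d ^ 3 + Rabs sg ^ 3)))).
    apply: Rmult_le_compat_l; first lra.
    apply: Rle_trans (Rpow3_add d0 s0).
    apply: pow_incr; split; first exact: norm_ge0.
    exact: norm_mk_le.
  have q1 := Rmax_l (norm d) (Rabs sg); have q2 := Rmax_r (norm d) (Rabs sg).
  have q3 : norm d ^ 3 <= Rmax (norm d) (Rabs sg) * norm d ^ 2.
    by have -> : norm d ^ 3 = norm d * norm d ^ 2 by []; apply: Rmult_le_compat_r; nra.
  have q4 : Rabs sg ^ 3 <= Rmax (norm d) (Rabs sg) * Rabs sg.
    have -> : Rabs sg ^ 3 = (Rabs sg * Rabs sg) * Rabs sg by ring.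
    apply: Rmult_le_compat_r; nra.
  have q5 : Lam * (norm d ^ 3 + Rabs sg ^ 3) <= Lam * (Rmax (norm d) (Rabs sg) * norm d ^ 2 + Rmax (norm d) (Rabs sg) * Rabs sg).
    by apply: Rmult_le_compat_l; lra.
  lra.
have mx0 : 0 <= Rmax (norm d) (Rabs sg) by apply: Rle_trans d0 (Rmax_l _ _).
have mx1 : Rmax (norm d) (Rabs sg) <= r1 by apply: Rmax_lub; lra.
have h4 := hr1 _ (conj mx0 mx1).
have h5 : (mabs (X z) * 3 + 4 * Lam) * Rmax (norm d) (Rabs sg) * (Rabs sg + norm d ^ 2) <= e / 2 * (Rabs sg + norm d ^ 2).
  by apply: Rmult_le_compat_r => //; nra.
have h6 : 0 <= mabs (X z) * 3 * Rmax (norm d) (Rabs sg) * norm d ^ 2 by repeat (apply: Rmult_le_pos => //); lra.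
have h7 : 0 <= norm d ^ 2 by nra.
have h8 : 0 <= e * (Rabs sg + norm d ^ 2) by apply: Rmult_le_pos; lra.
move: h1 h2 h3 h5 h6; set A := F _; set B := F _; move: (quad _ _) (quad _ _) => u v.
split_Rabs; nra.
Qed.

Lemma dmin2 r1 r2 : 0 < r1 -> 0 < r2 -> exists r, 0 < r /\ r <= r1 /\ r <= r2.
Proof.
move=> h1 h2; exists (Rmin r1 r2); split; [exact: Rmin_pos|split; [exact: Rmin_l|exact: Rmin_r]].
Qed.

(** Touching from below only uses a lower expansion, so penalties such as
    [- M * Rmax 0 (s - t1) ^ 2] qualify although they are not twice differentiable. The remainder is
    negligible against [|s - t| + |y - x|^2]. *)
Definition low_test N (psi : vec N -> R -> R) x t a p (X : mat N) := exists M, 0 <= M /\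
  forall y s, norm (vsub y x) <= 1 -> Rabs (s - t) <= 1 ->
   psi y s >= psi x t + a * (s - t) + dot p (vsub y x) + / 2 * quad X (vsub y x)
     - M * ((s - t) ^ 2 + Rabs (s - t) * norm (vsub y x) + norm (vsub y x) ^ 3).

Lemma jet2_low N g x t a p (X : mat N) psi a' p' X' : jet2 g x t a p X -> low_test psi x t a' p' X' ->
  par_subjet (fun x t => g x t + psi x t) x t (a + a') (vadd p p') (madd X X').
Proof.
move=> hg [M [M0 hp]] e e0.
have [r1 [r10 hr1]] := hg (e / 2) ltac:(lra).
have [r2 [r20 hr2]] := small_prod (a := e / 4) (b := M) ltac:(lra) M0.
have [r3 [r30 [h13 h23]]] := dmin2 r10 r20.
have [r [r0 [hr3 hr4]]] := dmin2 r30 Rlt_0_1.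
exists r; split=> // y s _ hy hs.
have q1 := hr1 y s ltac:(lra) ltac:(lra).
have q2 := hp y s ltac:(lra) ltac:(lra).
rewrite dotDl quad_madd.
set d := norm (vsub y x) in hy q1 q2 *; set w := Rabs (s - t) in hs q1 q2 *.
have d0 : 0 <= d by exact: norm_ge0.
have w0 : 0 <= w by exact: Rabs_pos.
have E : (s - t) ^ 2 = w * w by rewrite -(pow2_abs (s - t)) /w; ring.
rewrite E in q2.
have q3 := hr2 w ltac:(lra); have q4 := hr2 d ltac:(lra).
have q5 : M * (w * w + w * d + d ^ 3) <= e / 2 * w + e / 4 * d ^ 2.
  have -> : M * (w * w + w * d + d ^ 3) = (M * w) * w + (M * d) * w + (M * d) * d ^ 2 by ring.
  have : (M * w) * w <= e / 4 * w by apply: Rmult_le_compat_r.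
  have : (M * d) * w <= e / 4 * w by apply: Rmult_le_compat_r.
  have : (M * d) * d ^ 2 <= e / 4 * d ^ 2 by apply: Rmult_le_compat_r => //; nra.
  lra.
have : 0 <= e * d ^ 2 by apply: Rmult_le_pos; [lra|nra].
move: q1 q2 q5; split_Rabs; lra.
Qed.

Lemma subjet_touch N (w G : vec N -> R -> R) x t a p X : 0 < t -> par_subjet G x t a p X ->
  (exists r, 0 < r /\ forall y s, norm (vsub y x) < r -> Rabs (s - t) < r -> G y s - w y s <= G x t - w x t) ->
  par_subjet w x t a p X.
Proof.
move=> t0 hG [r [r0 hr]] e e0; have [r1 [r10 hr1]] := hG e e0.
have [r2 [r20 [h1 h2]]] := dmin2 r0 r10.
exists r2; split=> // y s s0 hy hs.
have := hr1 y s s0 ltac:(lra) ltac:(lra); have := hr y s ltac:(lra) ltac:(lra); lra.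
Qed.

Section Shift.
Variables (N : nat) (L : R) (Th : Type) (sigma : Th -> vec N -> mat N) (H : Th -> vec N -> vec N -> R).
Implicit Types w : vec N -> R -> R.
Lemma good_shift w h : 0 <= h -> good L w -> good L (fun x t => w x (t + h)).
Proof.
move=> h0 gw; split.
- by move=> t; apply: (g_per gw).
- by move=> t t0; apply: (g_lip gw); lra.
- move=> x t t0 e e0; have [r [r0 hr]] := g_cont gw x (t := t + h) ltac:(lra) e0.
  exists r; split=> // y s s0 hy hs; apply: hr => //; first lra.
  by have -> : s + h - (t + h) = s - t by ring.
Qed.
Lemma Sub_shift w h : 0 <= h -> Sub sigma H w -> Sub sigma H (fun x t => w x (t + h)).
Proof.
move=> h0 sw x t a p X t0 sX hj th; apply: (sw x (t + h)) => //; first lra.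
move=> e e0; have [r [r0 hr]] := hj e e0.
have [r1 [r10 [h1 h2]]] := dmin2 r0 t0.
exists r1; split=> // y s s0 hy hs.
have := hr y (s - h); have -> : s - h - t = s - (t + h) by ring.
have -> : s - h + h = s by ring.
by apply; [split_Rabs|lra|]; lra.
Qed.
Lemma Super_shift w h : 0 <= h -> Super sigma H w -> Super sigma H (fun x t => w x (t + h)).
Proof.
move=> h0 sw x t a p X t0 sX hj; apply: (sw x (t + h)) => //; first lra.
move=> e e0; have [r [r0 hr]] := hj e e0.
have [r1 [r10 [h1 h2]]] := dmin2 r0 t0.
exists r1; split=> // y s s0 hy hs.
have := hr y (s - h); have -> : s - h - t = s - (t + h) by ring.
have -> : s - h + h = s by ring.
by apply; [split_Rabs|lra|]; lra.
Qed.
Lemma good_addc w c : good L w -> good L (fun x t => w x t + c).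
Proof.
move=> gw; split.
- by move=> t x k /=; rewrite (g_per gw t).
- by move=> t t0 x y; have -> : w x t + c - (w y t + c) = w x t - w y t by [ring]; apply: (g_lip gw).
- move=> x t t0 e e0; have [r [r0 hr]] := g_cont gw x t0 e0.
  exists r; split=> // y s s0 hy hs.
  by have -> : w y s + c - (w x t + c) = w y s - w x t by [ring]; apply: hr.
Qed.
Lemma Sub_addc w c : Sub sigma H w -> Sub sigma H (fun x t => w x t + c).
Proof.
move=> sw x t a p X t0 sX hj th; apply: (sw x t) => //.
move=> e e0; have [r [r0 hr]] := hj e e0; exists r; split=> // y s s0 hy hs.
by have := hr y s s0 hy hs; lra.
Qed.
Lemma Super_addc w c : Super sigma H w -> Super sigma H (fun x t => w x t + c).
Proof.
move=> sw x t a p X t0 sX hj; apply: (sw x t) => //.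
move=> e e0; have [r [r0 hr]] := hj e e0; exists r; split=> // y s s0 hy hs.
by have := hr y s s0 hy hs; lra.
Qed.
End Shift.

Section Touch.
Variables (N : nat) (L : R) (Th : Type) (sigma : Th -> vec N -> mat N) (H : Th -> vec N -> vec N -> R).

Lemma trprodD (s : mat N) X Y : trprod (gram s) (madd X Y) = trprod (gram s) X + trprod (gram s) Y.
Proof. by rewrite !trprod_gram -sumN_plus; apply: sumN_ext => k; rewrite quad_madd. Qed.
Lemma trprodZ (s : mat N) a X : trprod (gram s) (mscale a X) = a * trprod (gram s) X.
Proof. by rewrite !trprod_gram -sumN_scal; apply: sumN_ext => k; rewrite quad_mscale. Qed.
Lemma trprod_mid (s : mat N) : trprod (gram s) mid = mnorm s ^ 2.
Proof. by rewrite trprod_gram mnorm_col; apply: sumN_ext => k; rewrite quad_mid norm_sq. Qed.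

(** Subtracting the almost-subsolution inequality of [g], valid for the [th] selected by the
    supersolution [w], leaves an inequality on the barrier [psi] alone, in which the Hamiltonian
    costs at most [CR * norm p]. A barrier violating it for every [th] therefore forbids the
    contact. *)
Lemma touch CR w g ga gp gX psi a p X x t e0 :
  (forall th x p q, norm p <= L + 1 -> norm q <= L + 1 -> Rabs (H th x p - H th x q) <= CR * norm (vsub p q)) ->
  Super sigma H w -> 0 < t -> jet2 g x t ga gp gX -> low_test psi x t a p X -> symmetric gX -> symmetric X ->
  norm gp <= L -> norm p <= 1 -> (forall th, ga + ham sigma H th x gp gX <= e0) ->
  (exists r, 0 < r /\ forall y s, norm (vsub y x) < r -> Rabs (s - t) < r ->
     g y s + psi y s - w y s <= g x t + psi x t - w x t) ->
  forall e, 0 < e -> exists th, a - trprod (gram (sigma th x)) X + CR * norm p >= - (e + e0).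
Proof.
move=> hCR sw t0 jg lp sgX sX ngp np hg hr e e_gt.
have sj : par_subjet w x t (ga + a) (vadd gp p) (madd gX X).
  by apply: subjet_touch t0 (jet2_low jg lp) _.
have [th hth] := sw _ _ _ _ _ t0 (sym_madd sgX sX) sj e e_gt.
exists th; have := hg th; move: hth; rewrite /ham trprodD.
have n1 : norm (vadd gp p) <= L + 1 by apply: Rle_trans (norm_triang _ _) _; lra.
have := hCR th x (vadd gp p) gp n1 ltac:(lra); rewrite vsub_add; split_Rabs; lra.
Qed.

End Touch.

Lemma sq_pos_low (t1 s t : R) : Rmax 0 (s - t1) ^ 2 <= Rmax 0 (t - t1) ^ 2 + 2 * Rmax 0 (t - t1) * (s - t) + (s - t) ^ 2.
Proof.
rewrite /Rmax; case: (Rle_dec 0 (s - t1)) => h1; case: (Rle_dec 0 (t - t1)) => h2.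
- by apply: Req_le; ring.
- have : (s - t1) ^ 2 <= (s - t) ^ 2 by apply: pow_incr; lra.
  lra.
- have := pow2_ge_0 (s - t1); lra.
- have := pow2_ge_0 (s - t); lra.
Qed.

Section Ctn.
Variables (T : Type) (d : T -> T -> R) (D : T -> Prop) (x : T).
Implicit Types f g : T -> R.
Definition ctn f := forall e, 0 < e -> exists r, 0 < r /\ forall y, D y -> d y x < r -> Rabs (f y - f x) < e.
Lemma ctn_cst c : ctn (fun _ => c).
Proof. by move=> e e0; exists 1; split; [lra|move=> y _ _; rewrite Rminus_diag Rabs_R0]. Qed.
Lemma ctn_plus f g : ctn f -> ctn g -> ctn (fun y => f y + g y).
Proof.
move=> hf hg e e0; have [r1 [r10 h1]] := hf (e / 2) ltac:(lra); have [r2 [r20 h2]] := hg (e / 2) ltac:(lra).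
have [r [r0 [u1 u2]]] := dmin2 r10 r20.
exists r; split=> // y Dy hy; have := h1 y Dy ltac:(lra); have := h2 y Dy ltac:(lra); split_Rabs; lra.
Qed.
Lemma ctn_comp f (h : R -> R) : ctn f -> continuity_pt h (f x) -> ctn (fun y => h (f y)).
Proof.
move=> hf hh e e0; have [a [a0 ha]] := hh e e0.
have [r [r0 hr]] := hf a a0; exists r; split=> // y Dy hy.
have [->|ne] := Req_dec (f y) (f x); first by rewrite Rminus_diag Rabs_R0.
by apply: ha; split; [split=> //; exact: not_eq_sym|exact: hr].
Qed.
Lemma ctn_scal a f : ctn f -> ctn (fun y => a * f y).
Proof.
move=> hf; apply: (@ctn_comp f (fun t => a * t) hf).
by apply: derivable_continuous_pt; apply: derivable_pt_scal; apply: derivable_pt_id.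
Qed.
Lemma ctn_opp f : ctn f -> ctn (fun y => - f y).
Proof.
move=> hf; apply: (@ctn_comp f (fun t => - t) hf).
by apply: derivable_continuous_pt; apply: derivable_pt_opp; apply: derivable_pt_id.
Qed.
Lemma ctn_minus f g : ctn f -> ctn g -> ctn (fun y => f y - g y).
Proof. by move=> hf hg; apply: ctn_plus => //; apply: ctn_opp. Qed.
Lemma ctn_sq f : ctn f -> ctn (fun y => f y ^ 2).
Proof.
move=> hf; apply: (@ctn_comp f (fun t => t ^ 2) hf).
by apply: derivable_continuous_pt; apply: derivable_pt_pow.
Qed.
Lemma ctn_mult f g : ctn f -> ctn g -> ctn (fun y => f y * g y).
Proof.
move=> hf hg.
have h : ctn (fun y => / 4 * ((f y + g y) ^ 2 - (f y - g y) ^ 2)).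
  by apply: ctn_scal; apply: ctn_minus; apply: ctn_sq; [apply: ctn_plus|apply: ctn_minus].
have -> // : (fun y => f y * g y) = (fun y => / 4 * ((f y + g y) ^ 2 - (f y - g y) ^ 2)).
by apply: functional_extensionality => y; field.
Qed.
Lemma ctn_max0 f : ctn f -> ctn (fun y => Rmax 0 (f y)).
Proof.
move=> hf e e0; have [r [r0 hr]] := hf e e0; exists r; split=> // y Dy hy.
apply: Rle_lt_trans (hr y Dy hy); rewrite /Rmax.
by case: (Rle_dec 0 (f y)) => ?; case: (Rle_dec 0 (f x)) => ?; split_Rabs; lra.
Qed.
Lemma ctn_lip f K : 0 <= K -> (forall y, D y -> Rabs (f y - f x) <= K * d y x) -> ctn f.
Proof.
move=> K0 h e e0; exists (e / (K + 1)); split; first by apply: Rdiv_lt_0_compat; lra.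
move=> y Dy hy; apply: Rle_lt_trans (h y Dy) _.
have : (K + 1) * d y x < e.
  have -> : e = (K + 1) * (e / (K + 1)) by field; lra.
  by apply: Rmult_lt_compat_l; lra.
have [?|?] := Rle_lt_dec 0 (d y x); nra.
Qed.
End Ctn.

Lemma ctn_max T d D (f : T -> R) : ucpt d D -> (exists x, D x) -> (forall x, D x -> ctn d D x f) ->
  exists x, D x /\ forall y, D y -> f y <= f x.
Proof.
move=> cD ne hf; apply: (ucpt_max cD) => // x Dx e e0.
have [r [r0 hr]] := hf x Dx e e0; exists r; split=> // y Dy hy.
by have := hr y Dy hy; split_Rabs; lra.
Qed.
Lemma ctn_min T d D (f : T -> R) : ucpt d D -> (exists x, D x) -> (forall x, D x -> ctn d D x f) ->
  exists x, D x /\ forall y, D y -> f x <= f y.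
Proof.
move=> cD ne hf; have [x [Dx hx]] := ctn_max cD ne (fun x Dx => ctn_opp (hf x Dx)).
by exists x; split=> // y /hx; lra.
Qed.

Lemma ctn_fst S T d1 d2 (D : S * T -> Prop) (D1 : S -> Prop) (f : S -> R) x :
  (forall z, D z -> D1 z.1) -> ctn d1 D1 x.1 f -> ctn (dprod d1 d2) D x (fun z => f z.1).
Proof.
move=> hD hf e e0; have [r [r0 hr]] := hf e e0; exists r; split=> // y Dy hy.
by apply: hr; [exact: hD|apply: Rle_lt_trans (Rmax_l _ _) hy].
Qed.
Lemma ctn_snd S T d1 d2 (D : S * T -> Prop) (D2 : T -> Prop) (f : T -> R) x :
  (forall z, D z -> D2 z.2) -> ctn d2 D2 x.2 f -> ctn (dprod d1 d2) D x (fun z => f z.2).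
Proof.
move=> hD hf e e0; have [r [r0 hr]] := hf e e0; exists r; split=> // y Dy hy.
by apply: hr; [exact: hD|apply: Rle_lt_trans (Rmax_r _ _) hy].
Qed.
Lemma ctn_id D x : ctn dR D x (fun t => t).
Proof. by apply: (@ctn_lip _ _ _ _ _ 1); [lra|move=> y _; rewrite /dR; lra]. Qed.
Lemma ctn_dist n D (c : vec n) x : ctn (@dV n) D x (fun y => norm (vsub y c)).
Proof.
apply: (@ctn_lip _ _ _ _ _ 1); [lra|move=> y _; rewrite /dV Rmult_1_l].
have := norm_sub_triang y x c; have := norm_sub_triang x y c; rewrite (norm_subC x y); split_Rabs; lra.
Qed.

Lemma low_test_add N psi1 psi2 x t a1 a2 p1 p2 (X1 X2 : mat N) :
  low_test psi1 x t a1 p1 X1 -> low_test psi2 x t a2 p2 X2 ->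
  low_test (fun y s => psi1 y s + psi2 y s) x t (a1 + a2) (vadd p1 p2) (madd X1 X2).
Proof.
move=> [K1 [K10 h1]] [K2 [K20 h2]]; exists (K1 + K2); split; first lra.
move=> y s hy hs; rewrite dotDl quad_madd.
by have := h1 y s hy hs; have := h2 y s hy hs; lra.
Qed.
Lemma low_rem_ge0 N (x y : vec N) s t : 0 <= Rabs (s - t) * norm (vsub y x) + norm (vsub y x) ^ 3.
Proof.
have := Rabs_pos (s - t); have := norm_ge0 (vsub y x) => u v.
have : 0 <= norm (vsub y x) ^ 3 by apply: pow_le.
nra.
Qed.
Lemma low_test_time N (x : vec N) t t1 M : 0 <= M ->
  low_test (fun (y : vec N) s => - M * Rmax 0 (s - t1) ^ 2) x t (- M * (2 * Rmax 0 (t - t1))) (@vzero N) (mscale 0 mid).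
Proof.
move=> M0; exists M; split=> // y s _ _; rewrite dot0l quad_mscale.
have q1 := sq_pos_low t1 s t.
have q2 : M * Rmax 0 (s - t1) ^ 2 <= M * (Rmax 0 (t - t1) ^ 2 + 2 * Rmax 0 (t - t1) * (s - t) + (s - t) ^ 2).
  by apply: Rmult_le_compat_l; lra.
have q3 : 0 <= M * (Rabs (s - t) * norm (vsub y x) + norm (vsub y x) ^ 3).
  by apply: Rmult_le_pos => //; exact: low_rem_ge0.
lra.
Qed.
Lemma low_test_scal N psi x t a p (X : mat N) k : 0 <= k -> low_test psi x t a p X ->
  low_test (fun y s => k * psi y s) x t (k * a) (vscale k p) (mscale k X).
Proof.
move=> k0 [M [M0 h]]; exists (k * M); split; first nra.
move=> y s hy hs; rewrite dotZl quad_mscale.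
have := h y s hy hs; move: (psi y s) (psi x t) => A B h1.
have : k * (A - B - a * (s - t) - dot p (vsub y x) - / 2 * quad X (vsub y x)
  + M * ((s - t) ^ 2 + Rabs (s - t) * norm (vsub y x) + norm (vsub y x) ^ 3)) >= 0 by apply: Rle_ge; apply: Rmult_le_pos; lra.
lra.
Qed.

Definition outer n (z : vec n) : mat n := fun i j => z i * z j.
Lemma quad_outer n (z d : vec n) : quad (outer z) d = dot z d ^ 2.
Proof.
have -> : quad (outer z) d = sumN (fun i => (z i * d i) * dot z d).
  apply: sumN_ext => i; rewrite /dot -sumN_scal; apply: sumN_ext => j; rewrite /outer; ring.
have -> : sumN (fun i => z i * d i * dot z d) = sumN (fun i => dot z d * (z i * d i)).
  by apply: sumN_ext => i; ring.
by rewrite sumN_scal -/(dot z d); ring.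
Qed.
Lemma sym_outer n (z : vec n) : symmetric (outer z).
Proof. by move=> i j; rewrite /outer; ring. Qed.
Lemma trprod_outer n (s : mat n) z : trprod (gram s) (outer z) = quad (gram s) z.
Proof.
apply: sumN_ext => i; apply: sumN_ext => j; rewrite /outer; ring.
Qed.

Record sol N Th (sigma : Th -> vec N -> mat N) H L (w : vec N -> R -> R) : Prop :=
  Sol { s_good : good L w; s_sub : Sub sigma H w; s_sup : Super sigma H w }.

Lemma jet2_shift N g x t h a p (X : mat N) : jet2 g x (t - h) a p X -> jet2 (fun x t => g x (t - h)) x t a p X.
Proof.
move=> j e e0; have [r [r0 hr]] := j e e0; exists r; split=> // y s hy hs.
have := hr y (s - h) hy; have -> : s - h - (t - h) = s - t by ring.
by apply.
Qed.
Lemma jet2_comb N g1 g2 x t a1 a2 p1 p2 (X1 X2 : mat N) mu : 0 <= mu <= 1 ->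
  jet2 g1 x t a1 p1 X1 -> jet2 g2 x t a2 p2 X2 ->
  jet2 (fun x t => mu * g1 x t + (1 - mu) * g2 x t) x t (mu * a1 + (1 - mu) * a2)
    (vadd (vscale mu p1) (vscale (1 - mu) p2)) (madd (mscale mu X1) (mscale (1 - mu) X2)).
Proof.
move=> hm j1 j2 e e0; have [r1 [r10 h1]] := j1 e e0; have [r2 [r20 h2]] := j2 e e0.
have [r [r0 [u1 u2]]] := dmin2 r10 r20; exists r; split=> // y s hy hs.
have {h1} := h1 y s ltac:(lra) ltac:(lra); have {h2} := h2 y s ltac:(lra) ltac:(lra).
rewrite dotDl !dotZl quad_madd !quad_mscale.
set E := e * _; set A1 := g1 y s - _; set A2 := g2 y s - _ => q2 q1.
set goalx := (X in Rabs X <= _).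
have -> : goalx = mu * A1 + (1 - mu) * A2 by rewrite /goalx /A1 /A2; ring.
apply: Rle_trans (Rabs_triang _ _) _.
rewrite !Rabs_mult (Rabs_pos_eq mu) ?(Rabs_pos_eq (1 - mu)); try lra.
have : mu * Rabs A1 <= mu * E by apply: Rmult_le_compat_l; lra.
have : (1 - mu) * Rabs A2 <= (1 - mu) * E by apply: Rmult_le_compat_l; lra.
lra.
Qed.

(** A polynomial substitute for the exponential Hopf barrier: [w] vanishes on the sphere of radius
    [R0] about [y], and near it a large [K] makes the positive second derivative [8 K z z^T] in the
    normal direction dominate. *)
Lemma hopf_low N (x y z : vec N) t K R0 : 0 <= K -> z = vsub x y ->
  let w (y' : vec N) := R0 ^ 2 - norm (vsub y' y) ^ 2 in
  low_test (fun y' (_ : R) => w y' + K * w y' ^ 2) x t 0 (vscale (- 2 * (1 + 2 * K * w x)) z)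
    (madd (mscale (- 2 * (1 + 2 * K * w x)) mid) (mscale (8 * K) (outer z))).
Proof.
move=> K0 zE w; set w0 := w x.
have n0 := norm_ge0 z.
exists (4 * K * norm z); split; first by apply: Rmult_le_pos; lra.
move=> y' s hy _; set eta := vsub y' x in hy *.
have e0 := norm_ge0 eta.
have E : w y' = w0 - (2 * dot z eta + norm eta ^ 2).
  rewrite /w0 /w; have -> : vsub y' y = vadd z eta by rewrite zE /eta; vring.
  by rewrite norm_add_sq -zE; ring.
rewrite -/w0 E dotZl quad_madd !quad_mscale quad_mid quad_outer -norm_sq.
have zeta : Rabs (dot z eta) <= norm z * norm eta by exact: cauchy_abs.
have b : 4 * K * dot z eta * norm eta ^ 2 >= - (4 * K * norm z) * norm eta ^ 3.
  have : - (norm z * norm eta) * norm eta ^ 2 <= dot z eta * norm eta ^ 2.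
    by apply: Rmult_le_compat_r; [nra|split_Rabs; lra].
  move=> b1; have : 4 * K * (- (norm z * norm eta) * norm eta ^ 2) <= 4 * K * (dot z eta * norm eta ^ 2).
    by apply: Rmult_le_compat_l; lra.
  lra.
have b2 : 0 <= K * (norm eta ^ 2) ^ 2 by apply: Rmult_le_pos => //; exact: pow2_ge_0.
have b3 : 0 <= 4 * K * norm z * ((s - t) ^ 2 + Rabs (s - t) * norm eta).
  apply: Rmult_le_pos; first by apply: Rmult_le_pos; lra.
  by have := pow2_ge_0 (s - t); have := Rabs_pos (s - t); nra.
lra.
Qed.
Lemma low_test_sqtime N (x : vec N) t s0 M : 0 <= M ->
  low_test (fun (y : vec N) s => - M * (s - s0) ^ 2) x t (- M * (2 * (t - s0))) (@vzero N) (mscale 0 mid).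
Proof.
move=> M0; exists M; split=> // y s _ _; rewrite dot0l quad_mscale.
have q3 : 0 <= M * (Rabs (s - t) * norm (vsub y x) + norm (vsub y x) ^ 3).
  by apply: Rmult_le_pos => //; exact: low_rem_ge0.
nra.
Qed.

Section SigmaSet.
Variables (N : nat) (Th : Type) (sigma : Th -> vec N -> mat N) (C : R).
Hypotheses (C0 : 0 < C) (Hsig_per : forall th, periodic (sigma th))
  (Hsig_lip : forall th x y, mnorm (msub (sigma th x) (sigma th y)) <= C * norm (vsub x y)).

Lemma inSigma_zero y : inSigma sigma y -> forall th i j, sigma th y i j = 0.
Proof.
move=> h th i j; have := h th i i; rewrite /gram => h0.
have := @sumN_ge1 _ (fun k => sigma th y i k * sigma th y i k) j (fun k => ltac:(nra)); rewrite h0; nra.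
Qed.
Lemma inSigma_mnorm y x th : inSigma sigma y -> mnorm (sigma th x) <= C * norm (vsub x y).
Proof.
move=> /inSigma_zero h; have := Hsig_lip th x y.
have -> // : msub (sigma th x) (sigma th y) = sigma th x.
by apply: functional_extensionality => i; apply: functional_extensionality => j; rewrite /msub h; ring.
Qed.
Lemma inSigma_vint y k : inSigma sigma y -> inSigma sigma (vadd y (vint k)).
Proof. by move=> h th i j; rewrite /gram (Hsig_per th); apply: h. Qed.

Lemma ell_near z : (forall delta, 0 < delta -> exists nu, 0 < nu /\
      forall th x, dist_Sigma_gt sigma x delta ->
        forall xi, quad (gram (sigma th x)) xi >= nu * dot xi xi) ->
  ~ inSigma sigma z -> exists nu d, 0 < nu /\ 0 < d /\ forall x, norm (vsub x z) <= d ->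
    forall th xi, quad (gram (sigma th x)) xi >= nu * dot xi xi.
Proof.
move=> Hi nz.
have [th hth] : exists th, 0 < mnorm (sigma th z).
  apply: NNPP => hn; apply: nz => th i j.
  have m0 : mnorm (sigma th z) = 0.
    by have [h|h] := Rle_lt_or_eq_dec _ _ (mnorm_ge0 (sigma th z)); [case: hn; exists th|].
  have s0 i' k : sigma th z i' k = 0.
    have h1 := mnorm_col (sigma th z); rewrite m0 in h1.
    have h2 := @sumN_ge1 _ (fun k => norm (colv (sigma th z) k) ^ 2) k (fun k => pow2_ge_0 _).
    have h3 := coord_le_norm (colv (sigma th z) k) i'; rewrite /colv in h3.
    have h4 := norm_ge0 (colv (sigma th z) k).
    have h5 : norm (colv (sigma th z) k) = 0 by nra.
    by rewrite /colv in h5; rewrite h5 in h3; split_Rabs; lra.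
  by apply: sumN0 => k; rewrite !s0; ring.
set c := mnorm (sigma th z) in hth.
(* Since [sigma] is [C]-Lipschitz and vanishes on [Sigma], the value [c] at [z] forces distance at
   least [4 * d] from [Sigma]; the ball of radius [d] about [z] then stays at distance at least
   [3 * d]. *)
pose d := c / (4 * C).
have d0 : 0 < d by apply: Rdiv_lt_0_compat; lra.
have dC : 4 * C * d = c by rewrite /d; field; lra.
have [nu [nu0 hnu]] := Hi d d0.
exists nu, d; split=> //; split=> // x hx th' xi; apply: hnu.
exists (2 * d); split; first lra.
move=> y hy k.
have h1 := inSigma_mnorm z th (inSigma_vint k hy); rewrite -/c in h1.
have h2 : 4 * d <= norm (vsub z (vadd y (vint k))) by apply: (Rmult_le_reg_l C) => //; lra.
have := norm_sub_triang z x (vadd y (vint k)); rewrite (norm_subC z x); lra.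
Qed.
End SigmaSet.

Lemma sq_le_le a b : 0 <= b -> a ^ 2 <= b ^ 2 -> a <= b.
Proof. move=> b0 h; apply: Rnot_lt_le => hlt; nra. Qed.

Lemma sq_le_add2 a b c : a <= b + c -> 0 <= a -> 0 <= b -> 0 <= c -> a ^ 2 <= 2 * (b ^ 2 + c ^ 2).
Proof. by move=> *; have := pow2_ge_0 (b - c); nra. Qed.
Lemma sq_mono a b : 0 <= a -> a <= b -> a ^ 2 <= b * b.
Proof. by move=> *; nra. Qed.

Lemma crude_subjet N (w : vec N -> R -> R) x t a p X M : 0 <= M ->
  (exists r, 0 < r /\ forall y s, norm (vsub y x) < r -> Rabs (s - t) < r ->
     w y s >= w x t + a * (s - t) + dot p (vsub y x) + / 2 * quad X (vsub y x) - M * (s - t) ^ 2) ->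
  par_subjet w x t a p X.
Proof.
move=> M0 [r [r0 hr]] e e0; have [r1 [r10 hr1]] := small_prod e0 M0.
have [r2 [r20 [u1 u2]]] := dmin2 r0 r10.
exists r2; split=> // y s _ hy hs; have := hr y s ltac:(lra) ltac:(lra).
have hs1 : Rabs (s - t) <= r1 by lra.
have q1 := hr1 _ (conj (Rabs_pos _) hs1).
have q2 : M * (s - t) ^ 2 <= e * Rabs (s - t).
  rewrite -(pow2_abs (s - t)); have := Rabs_pos (s - t); nra.
have : 0 <= e * norm (vsub y x) ^ 2 by apply: Rmult_le_pos; [lra|exact: pow2_ge_0].
lra.
Qed.
Lemma crude_superjet N (w : vec N -> R -> R) x t a p X M : 0 <= M ->
  (exists r, 0 < r /\ forall y s, norm (vsub y x) < r -> Rabs (s - t) < r ->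
     w y s <= w x t + a * (s - t) + dot p (vsub y x) + / 2 * quad X (vsub y x) + M * (s - t) ^ 2) ->
  par_superjet w x t a p X.
Proof.
move=> M0 [r [r0 hr]] e e0; have [r1 [r10 hr1]] := small_prod e0 M0.
have [r2 [r20 [u1 u2]]] := dmin2 r0 r10.
exists r2; split=> // y s _ hy hs; have := hr y s ltac:(lra) ltac:(lra).
have hs1 : Rabs (s - t) <= r1 by lra.
have q1 := hr1 _ (conj (Rabs_pos _) hs1).
have q2 : M * (s - t) ^ 2 <= e * Rabs (s - t).
  rewrite -(pow2_abs (s - t)); have := Rabs_pos (s - t); nra.
have : 0 <= e * norm (vsub y x) ^ 2 by apply: Rmult_le_pos; [lra|exact: pow2_ge_0].
lra.
Qed.

(** * Strict convexity, uniformly over separated gradients *)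

Section Gap.
Variables (N : nat) (Th : Type) (h : Th -> vec N -> R) (mu Rr r CR : R).
Hypotheses (mu01 : 0 < mu < 1) (r0 : 0 < r) (CR0 : 0 < CR)
  (hL : forall th p q, norm p <= Rr -> norm q <= Rr -> Rabs (h th p - h th q) <= CR * norm (vsub p q))
  (hS : forall p q : vec N, (exists i, p i <> q i) -> exists m, 0 < m /\ forall th,
     mu * h th p + (1 - mu) * h th q - h th (vadd (vscale mu p) (vscale (1 - mu) q)) >= m).

(** The gap depends on the pair of gradients, but Lipschitz continuity uniform in [th] preserves
    half of it nearby, and bounded pairs at distance at least [r] form a compact set. *)
Lemma uniform_gap : exists m, 0 < m /\ forall p q, norm p <= Rr -> norm q <= Rr -> r <= norm (vsub p q) ->
  forall th, mu * h th p + (1 - mu) * h th q - h th (vadd (vscale mu p) (vscale (1 - mu) q)) >= m.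
Proof.
have E0 (u : vec N) : vsub u (@vzero N) = u by vring.
pose S (z : vec N * vec N) := (norm (vsub z.1 (@vzero N)) <= Rr /\ norm (vsub z.2 (@vzero N)) <= Rr) /\ r <= norm (vsub z.1 z.2).
have cS : ucpt (dprod (@dV N) (@dV N)) S.
  apply: (ucpt_sub (ucpt_prod (@ucpt_ball N (@vzero N) Rr) (@ucpt_ball N (@vzero N) Rr))); first by move=> z [].
  move=> [p q] hpq hcl; split=> //=; apply: Rnot_lt_le => hlt.
  have [[p' q'] [[_ /= h1] h2]] := hcl ((r - norm (vsub p q)) / 2) ltac:(lra).
  have a1 : norm (vsub p' p) < (r - norm (vsub p q)) / 2 by apply: Rle_lt_trans (Rmax_l _ _) h2.
  have a2 : norm (vsub q' q) < (r - norm (vsub p q)) / 2 by apply: Rle_lt_trans (Rmax_r _ _) h2.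
  have := norm_sub_triang p' p q'; have := norm_sub_triang p q q'; rewrite (norm_subC q q'); lra.
have conv (p q : vec N) : norm p <= Rr -> norm q <= Rr -> norm (vadd (vscale mu p) (vscale (1 - mu) q)) <= Rr.
  move=> hp hq; apply: Rle_trans (norm_triang _ _) _.
  rewrite !norm_scale (Rabs_pos_eq mu) ?(Rabs_pos_eq (1 - mu)); try lra.
  have : mu * norm p <= mu * Rr by apply: Rmult_le_compat_l; lra.
  have : (1 - mu) * norm q <= (1 - mu) * Rr by apply: Rmult_le_compat_l; lra.
  lra.
have [m [m0 hm]] : exists m, 0 < m /\ forall z, S z -> forall th, mu * h th z.1 + (1 - mu) * h th z.2
    - h th (vadd (vscale mu z.1) (vscale (1 - mu) z.2)) >= m.
  apply: (ucpt_uniform (P := fun z m => forall th, mu * h th z.1 + (1 - mu) * h th z.2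
    - h th (vadd (vscale mu z.1) (vscale (1 - mu) z.2)) >= m) cS).
    by move=> z m m' hz hm th; have := hz th; lra.
  move=> [p q] [[/= hp hq] hpq]; rewrite !E0 in hp hq.
  have [m [m0 hm]] : exists m, 0 < m /\ forall th,
     mu * h th p + (1 - mu) * h th q - h th (vadd (vscale mu p) (vscale (1 - mu) q)) >= m.
    apply: hS; apply: NNPP => hn.
    have E : p = q by apply: functional_extensionality => i; apply: NNPP => hi; apply: hn; exists i.
    by rewrite E norm_subvv in hpq; lra.
  (* Within this radius each of the three Hamiltonian values moves by at most [m / 4]; with weights
     [mu], [1 - mu] and 1 the total loss is [m / 2]. *)
  exists (m / 2), (m / (4 * CR)); split; first lra.
  have d0 : 0 < m / (4 * CR) by apply: Rdiv_lt_0_compat; lra.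
  split=> // -[p' q'] [[/= hp' hq'] _] hd th; rewrite !E0 in hp' hq'.
  have a1 : norm (vsub p' p) < m / (4 * CR) by apply: Rle_lt_trans (Rmax_l _ _) hd.
  have a2 : norm (vsub q' q) < m / (4 * CR) by apply: Rle_lt_trans (Rmax_r _ _) hd.
  have dE : CR * (m / (4 * CR)) = m / 4 by field; lra.
  have b1 : CR * norm (vsub p' p) <= m / 4 by rewrite -dE; apply: Rmult_le_compat_l; lra.
  have b2 : CR * norm (vsub q' q) <= m / 4 by rewrite -dE; apply: Rmult_le_compat_l; lra.
  have c1 := hL th hp' hp; have c2 := hL th hq' hq; have c3 := hL th (conv _ _ hp' hq') (conv _ _ hp hq).
  have b3 : CR * norm (vsub (vadd (vscale mu p') (vscale (1 - mu) q')) (vadd (vscale mu p) (vscale (1 - mu) q))) <= m / 4.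
    have -> : vsub (vadd (vscale mu p') (vscale (1 - mu) q')) (vadd (vscale mu p) (vscale (1 - mu) q))
      = vadd (vscale mu (vsub p' p)) (vscale (1 - mu) (vsub q' q)) by vring.
    rewrite -dE; apply: Rmult_le_compat_l; first lra.
    apply: Rle_trans (norm_triang _ _) _.
    rewrite !norm_scale (Rabs_pos_eq mu) ?(Rabs_pos_eq (1 - mu)); try lra.
    have : mu * norm (vsub p' p) <= mu * (m / (4 * CR)) by apply: Rmult_le_compat_l; lra.
    have : (1 - mu) * norm (vsub q' q) <= (1 - mu) * (m / (4 * CR)) by apply: Rmult_le_compat_l; lra.
    lra.
  have := hm th.
  have e1 : mu * (h th p' - h th p) >= mu * (- (m / 4)).
    by apply: Rle_ge; apply: Rmult_le_compat_l; [lra|move: c1; split_Rabs; lra].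
  have e2 : (1 - mu) * (h th q' - h th q) >= (1 - mu) * (- (m / 4)).
    by apply: Rle_ge; apply: Rmult_le_compat_l; [lra|move: c2; split_Rabs; lra].
  by move: c3; split_Rabs; lra.
exists m; split=> // p q hp hq hpq th; apply: (hm (p, q)).
by split=> //=; rewrite !E0.
Qed.
End Gap.

Lemma bilNl N (X : mat N) y z : bil X (vscale (-1) y) z = - bil X y z.
Proof. by rewrite bilZl; ring. Qed.

Lemma quad_diff N (X : mat N) a b : symmetric X ->
  Rabs (quad X a - quad X b) <= mabs X * (norm (vsub a b) * (norm a + norm b)).
Proof.
move=> sX.
have -> : quad X a - quad X b = bil X (vsub a b) (vadd a b).
  have -> : vsub a b = vadd a (vscale (-1) b) by vring.
  by rewrite bilDl bilNl !bilDr !quadE (bilC b a sX); ring.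
apply: Rle_trans (bil_bound _ _ _) _; apply: Rmult_le_compat_l; first exact: mabs_ge0.
by apply: Rmult_le_compat_l; [exact: norm_ge0|exact: norm_triang].
Qed.

(** * Stationary functions as solutions of the evolution equation *)

Section Stationary.
Variables (N : nat) (Th : Type) (sigma : Th -> vec N -> mat N) (H : Th -> vec N -> vec N -> R).
Definition SubS (v : vec N -> R) := forall x p X, symmetric X -> superjet v x p X ->
  forall th, ham sigma H th x p X <= 0.
Definition SuperS (v : vec N -> R) := forall x p X, symmetric X -> subjet v x p X ->
  forall e, 0 < e -> exists th, ham sigma H th x p X >= - e.

Lemma time_slope b a t : 0 < t -> (forall e, 0 < e -> exists r, 0 < r /\
  forall s, 0 < s -> Rabs (s - t) < r -> 0 <= b * (a * (s - t)) + e * Rabs (s - t)) -> b * a = 0.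
Proof.
move=> t0 h; apply: NNPP => hn.
have [r [r0 hr]] := h (Rabs (b * a) / 2) ltac:(have := Rabs_pos_lt _ hn; lra).
have [r1 [r10 [u1 u2]]] := dmin2 r0 t0.
have a1 := hr (t + r1 / 2) ltac:(lra) ltac:(have -> : t + r1 / 2 - t = r1 / 2 by [ring]; rewrite Rabs_pos_eq; lra).
have a2 := hr (t - r1 / 2) ltac:(lra) ltac:(have -> : t - r1 / 2 - t = - (r1 / 2) by [ring]; rewrite Rabs_Ropp Rabs_pos_eq; lra).
move: a1 a2.
have -> : t + r1 / 2 - t = r1 / 2 by ring.
have -> : t - r1 / 2 - t = - (r1 / 2) by ring.
rewrite Rabs_Ropp (Rabs_pos_eq (r1 / 2)); last lra.
have q : 0 < r1 * Rabs (b * a) by apply: Rmult_lt_0_compat => //; exact: Rabs_pos_lt.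
have E : r1 * Rabs (b * a) = Rabs (r1 * (b * a)) by rewrite (Rabs_mult r1) (Rabs_pos_eq r1) //; lra.
rewrite -> E in q.
have -> : Rabs (b * a) / 2 * (r1 / 2) = Rabs (r1 * (b * a)) / 4 by rewrite -E; field.
by split_Rabs; lra.
Qed.

Lemma stat_superjet v x t a p (X : mat N) : 0 < t -> par_superjet (fun x _ => v x) x t a p X -> a = 0 /\ superjet v x p X.
Proof.
move=> t0 hj; split.
  have := @time_slope 1 a t t0 _; rewrite Rmult_1_l; apply=> e e0.
  have [r [r0 hr]] := hj e e0; exists r; split=> // s s0 hs.
  have := hr x s s0 ltac:(by rewrite norm_subvv) hs; rewrite norm_subvv.
  have -> : vsub x x = @vzero N by vring.
  by rewrite dot0r quadE -[@vzero N](_ : vscale 0 (@vzero N) = _) ?bilZl ?bilZr; [lra|vring].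
move=> e e0; have [r [r0 hr]] := hj e e0; exists r; split=> // y hy.
have := hr y t t0 hy ltac:(by rewrite Rminus_diag Rabs_R0); rewrite Rminus_diag Rabs_R0; lra.
Qed.

Lemma stat_subjet v x t a p (X : mat N) : 0 < t -> par_subjet (fun x _ => v x) x t a p X -> a = 0 /\ subjet v x p X.
Proof.
move=> t0 hj; split.
  have : -1 * a = 0; last lra.
  apply: (@time_slope (-1) a t t0) => e e0.
  have [r [r0 hr]] := hj e e0; exists r; split=> // s s0 hs.
  have := hr x s s0 ltac:(by rewrite norm_subvv) hs; rewrite norm_subvv.
  have -> : vsub x x = @vzero N by vring.
  by rewrite dot0r quadE -[@vzero N](_ : vscale 0 (@vzero N) = _) ?bilZl ?bilZr; [lra|vring].
move=> e e0; have [r [r0 hr]] := hj e e0; exists r; split=> // y hy.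
have := hr y t t0 hy ltac:(by rewrite Rminus_diag Rabs_R0); rewrite Rminus_diag Rabs_R0; lra.
Qed.

Lemma stat_good L v : periodic v -> 0 <= L -> Lip L v -> good L (fun (x : vec N) _ => v x).
Proof.
move=> pv L0 hv; split=> // x t _ e e0.
exists (e / (L + 1)); split; first by apply: Rdiv_lt_0_compat; lra.
move=> y s _ hy _; apply: Rle_lt_trans (hv _ _) _.
have := norm_ge0 (vsub y x) => n0.
have : (L + 1) * norm (vsub y x) < (L + 1) * (e / (L + 1)) by apply: Rmult_lt_compat_l; lra.
have -> : (L + 1) * (e / (L + 1)) = e by field; lra.
lra.
Qed.

Lemma stat_sol L v : periodic v -> 0 <= L -> Lip L v -> SubS v -> SuperS v -> sol sigma H L (fun x _ => v x).
Proof.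
move=> pv L0 hv sv Sv; split; first exact: stat_good.
  move=> x t a p X t0 sX /(stat_superjet t0) [-> hj] th; rewrite Rplus_0_l; exact: sv.
move=> x t a p X t0 sX /(stat_subjet t0) [-> hj] e e0.
by have [th h] := Sv x p X sX hj e e0; exists th; rewrite Rplus_0_l.
Qed.
End Stationary.

Lemma norm_mulv N (X : mat N) d : norm (fun i => sumN (fun j => X i j * d j)) <= mabs X * norm d.
Proof.
set z : vec N := fun i => _.
have [z0|z0] := Rle_lt_dec (norm z) 0.
  by apply: Rle_trans z0 _; apply: Rmult_le_pos; [exact: mabs_ge0|exact: norm_ge0].
have h := bil_bound X z d; rewrite bil_dot -/z -norm_sq in h.
apply: (Rmult_le_reg_l (norm z)) => //; move: h; split_Rabs; nra.
Qed.

(** The stability mechanism: a strictly penalised test function for [phi] still has an interior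
    contact with any [w] uniformly close to it, at a nearby point with nearby derivatives. The bound
    [e] is uniform over all [w]. *)
Lemma perturbed_superjet N (phi : vec N -> R) x0 p X : symmetric X -> superjet phi x0 p X ->
  forall rho, 0 < rho -> exists e, 0 < e /\ forall L w, good L w ->
    (forall x t, 0 <= t <= 2 -> Rabs (w x t - phi x) <= e) ->
    exists y s a P k, 0 < s /\ norm (vsub y x0) <= rho /\ Rabs a <= rho /\ norm (vsub P p) <= rho /\ Rabs k <= rho /\
      par_superjet w y s a P (madd X (mscale k mid)).
Proof.
move=> sX hj rho rho0.
pose k := rho / 4.
have k0 : 0 < k by rewrite /k; lra.
have [dl [dl0 hdl]] := hj k k0.
have m0 := mabs_ge0 X.
have [r1 [r10 hr1]] := small_prod (b := mabs X + 4 * k + 2) rho0 ltac:(lra).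
have [r2 [r20 [u1 u2]]] := dmin2 r10 (r2 := / 2) ltac:(lra).
have [r3 [r30 [u3 u4]]] := dmin2 r20 rho0.
have [r [r0 [u5 u6]]] := dmin2 r30 (r2 := dl / 2) ltac:(lra).
have hr : (mabs X + 4 * k + 2) * r <= rho by apply: hr1; lra.
have rr : 0 < r ^ 2 by exact: pow_lt.
have krr : 0 < k * r ^ 2 by exact: Rmult_lt_0_compat.
have [e [e0 [u7 u8]]] := dmin2 (r1 := k * r ^ 2 / 4) (r2 := r ^ 2 / 4) ltac:(lra) ltac:(lra).
exists e; split=> // L w gw hw.
(* Of the [2 * k] added here, [k] absorbs the error of the superjet and [k] makes the maximum
   strict. The time penalty around 1, the middle of [[0, 2]], does the same in time. The Hessian
   shift [4 * k] equals [rho]. *)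
pose Q y := dot p (vsub y x0) + / 2 * quad X (vsub y x0) + 2 * k * norm (vsub y x0) ^ 2.
pose G (z : vec N * R) := w z.1 z.2 - Q z.1 - (z.2 - 1) ^ 2.
pose D (z : vec N * R) := norm (vsub z.1 x0) <= r /\ 1 - r <= z.2 <= 1 + r.
have [[y s] [[/= hy hs] hmax]] : exists z, D z /\ forall z', D z' -> G z' <= G z.
  apply: (ctn_max (d := dprod (@dV N) dR)).
  - exact: (ucpt_prod (@ucpt_ball N x0 r) (@ucpt_itv (1 - r) (1 + r))).
  - by exists (x0, 1); split=> /=; [rewrite norm_subvv|]; lra.
  move=> [y s] [/= hy hs]; apply: ctn_minus; first apply: ctn_minus.
  - move=> e' e'0; have [r' [r'0 hr']] := g_cont gw y (t := s) ltac:(lra) e'0.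
    exists r'; split=> // -[y' s'] [/= _ hs'] hd; apply: hr'; first lra.
      by apply: Rle_lt_trans hd; exact: Rmax_l.
    by apply: Rle_lt_trans hd; exact: Rmax_r.
  - apply: (@ctn_fst _ _ _ _ _ (fun y => norm (vsub y x0) <= r) Q); first by move=> z [].
    apply: ctn_plus; first apply: ctn_plus.
    + apply: (@ctn_lip _ _ _ _ _ (norm p)); first exact: norm_ge0.
      move=> y' _; rewrite /dV -dotBr.
      have -> : vsub (vsub y' x0) (vsub y x0) = vsub y' y by vring.
      exact: cauchy_abs.
    + apply: ctn_scal; apply: (@ctn_lip _ _ _ _ _ (mabs X * (2 * r))); first by apply: Rmult_le_pos; lra.
      move=> y' hy'; apply: Rle_trans (quad_diff _ _ sX) _.
      have -> : vsub (vsub y' x0) (vsub y x0) = vsub y' y by vring.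
      rewrite Rmult_assoc; apply: Rmult_le_compat_l => //; rewrite Rmult_comm /dV.
      by apply: Rmult_le_compat_r; [exact: norm_ge0|rewrite /=; lra].
    + apply: ctn_scal; apply: ctn_sq; exact: ctn_dist.
  - apply: (@ctn_snd _ _ _ _ _ (fun s => 1 - r <= s <= 1 + r) (fun s => (s - 1) ^ 2)); first by move=> z [].
    apply: ctn_sq; apply: ctn_minus; [exact: ctn_id|exact: ctn_cst].
set d := vsub y x0 in hy.
have n0 := norm_ge0 d.
have key : k * norm d ^ 2 + (s - 1) ^ 2 <= 2 * e.
  have := hmax (x0, 1) ltac:(by split=> /=; [rewrite norm_subvv|]; lra).
  rewrite /G /Q /= -/d.
  have -> : vsub x0 x0 = vscale 0 x0 by vring.
  rewrite quadZ dotZr norm_scale Rabs_R0 => h1.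
  have h2 := hdl y ltac:(rewrite -/d; lra); rewrite -/d in h2.
  have h3 := hw y s ltac:(lra); have h4 := hw x0 1 ltac:(lra).
  by move: h1 h3 h4; split_Rabs; lra.
have ks := pow2_ge_0 (s - 1).
have kn : 0 <= k * norm d ^ 2 by apply: Rmult_le_pos; [lra|exact: pow2_ge_0].
have hd : norm d < r.
  apply: Rnot_le_lt => hle.
  have : k * r ^ 2 <= k * norm d ^ 2 by apply: Rmult_le_compat_l; [lra|apply: pow_incr; lra].
  lra.
have hs1 : Rabs (s - 1) < r.
  apply: Rnot_le_lt => hle.
  have : r ^ 2 <= Rabs (s - 1) ^ 2 by apply: pow_incr; lra.
  rewrite pow2_abs; lra.
pose z : vec N := fun i => sumN (fun j => X i j * d j).
exists y, s, (2 * (s - 1)), (vadd p (vadd z (vscale (4 * k) d))), (4 * k).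
have mr : 0 <= mabs X * r by apply: Rmult_le_pos; lra.
have kr : 0 <= 4 * k * r by apply: Rmult_le_pos; lra.
split; first by move: hs1; split_Rabs; lra.
split; first by rewrite -/d; lra.
split; first by rewrite Rabs_mult (Rabs_pos_eq 2); lra.
split.
  have -> : vsub (vadd p (vadd z (vscale (4 * k) d))) p = vadd z (vscale (4 * k) d) by vring.
  apply: Rle_trans (norm_triang _ _) _; rewrite norm_scale Rabs_pos_eq; last lra.
  have : norm z <= mabs X * r by apply: Rle_trans (norm_mulv X d) _; apply: Rmult_le_compat_l; lra.
  have : 4 * k * norm d <= 4 * k * r by apply: Rmult_le_compat_l; lra.
  lra.
split; first by rewrite Rabs_pos_eq /k; lra.
apply: (@crude_superjet _ _ _ _ _ _ _ 1); first lra.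
have [r' [r'0 [v1 v2]]] := dmin2 (r1 := r - norm d) (r2 := r - Rabs (s - 1)) ltac:(lra) ltac:(lra).
exists r'; split=> // y' s' hy' hs'.
have : w y' s' - Q y' - (s' - 1) ^ 2 <= w y s - Q y - (s - 1) ^ 2.
  apply: (hmax (y', s')); split=> /=; last by move: hs' v2; split_Rabs; lra.
  by have := norm_sub_triang y' y x0; rewrite -/d; lra.
rewrite /Q -/d; set f := vsub y' y.
have -> : vsub y' x0 = vadd d f by rewrite /d /f; vring.
rewrite quadD // (bilC d f sX) bil_dot -/z quad_madd quad_mscale quad_mid -norm_sq.
move: (z) (d) (f) => z' d' f'.
rewrite norm_add_sq !dotDl !dotDr dotZl (dotC f' z') => hm; clear -hm; lra.
Qed.

(** * Smooth approximation, comparison and large-time behaviour *)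

Section LongTime.
Variables (N : nat) (Th : Type) (sigma : Th -> vec N -> mat N) (H : Th -> vec N -> vec N -> R) (C L : R).
Hypotheses (C0 : 0 < C) (L0 : 0 < L)
  (Hsig_bd : forall th x, mnorm (sigma th x) <= C)
  (Hsig_lip : forall th x y, mnorm (msub (sigma th x) (sigma th y)) <= C * norm (vsub x y))
  (HH_lip : forall Rr, 0 < Rr -> exists CR, 0 < CR /\
      forall th x y p q, norm p <= Rr -> norm q <= Rr ->
        Rabs (H th x p - H th y q) <= CR * (norm (vsub x y) + norm (vsub p q)))
  (Hconv : forall th x p q lam, 0 <= lam <= 1 ->
      H th x (vadd (vscale lam p) (vscale (1 - lam) q)) <= lam * H th x p + (1 - lam) * H th x q)
  (Hsig_per : forall th, periodic (sigma th))
  (Hi : forall delta, 0 < delta -> exists nu, 0 < nu /\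
      forall th x, dist_Sigma_gt sigma x delta ->
        forall xi, quad (gram (sigma th x)) xi >= nu * dot xi xi)
  (Hiii : forall x, inSigma sigma x -> forall lam, 0 < lam < 1 ->
      forall p q : vec N, (exists i, p i <> q i) ->
        exists m, 0 < m /\ forall th,
          lam * H th x p + (1 - lam) * H th x q
            - H th x (vadd (vscale lam p) (vscale (1 - lam) q)) >= m).
Notation sol := (sol sigma H L).

(** Extends functions of time constantly outside [[0, T]], so that they can be averaged over all of
    space-time; the equation is only invoked where [clip] is the identity. *)
Definition clip T t := Rmax 0 (Rmin t T).
Lemma clip_itv T t : 0 <= T -> 0 <= clip T t <= T.
Proof.
move=> T0; split; first exact: Rmax_l.
by apply: Rmax_lub => //; exact: Rmin_r.
Qed.
Lemma clip_id T t : 0 <= t <= T -> clip T t = t.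
Proof. by move=> [h1 h2]; rewrite /clip Rmin_left // Rmax_right. Qed.
Lemma clip_lip T s t : Rabs (clip T s - clip T t) <= Rabs (s - t).
Proof.
have h : Rabs (Rmin s T - Rmin t T) <= Rabs (s - t).
  by rewrite /Rmin; case: Rle_dec => ?; case: Rle_dec => ?; split_Rabs; lra.
move: h; rewrite /clip; move: (Rmin s T) (Rmin t T) => u v h.
by rewrite /Rmax; case: Rle_dec => ?; case: Rle_dec => ?; move: h; split_Rabs; lra.
Qed.

Lemma unif_mq n (f : vec n -> R) B : (forall z, Rabs (f z) <= B) ->
  (forall e, 0 < e -> exists r, 0 < r /\ forall z z', norm (vsub z z') < r -> Rabs (f z - f z') <= e) -> mq f.
Proof.
move=> hB hU e /hU [r [r0 hr]].
have B0 : 0 <= B by apply: Rle_trans (Rabs_pos _) (hB (@vzero n)).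
have r2 : 0 < r ^ 2 by nra.
exists (2 * B / r ^ 2 + 1); split.
  have : 0 <= 2 * B / r ^ 2 by apply: Rmult_le_pos; [lra|apply: Rlt_le; exact: Rinv_0_lt_compat].
  lra.
move=> z z'; have n0 := norm_ge0 (vsub z z').
have q : 0 <= 2 * B / r ^ 2 by apply: Rmult_le_pos; [lra|apply: Rlt_le; exact: Rinv_0_lt_compat].
have [h|h] := Rlt_le_dec (norm (vsub z z')) r.
  have := hr z z' h; nra.
have e0 : 0 <= e by apply: Rle_trans (hr z z ltac:(rewrite norm_subvv; lra)); exact: Rabs_pos.
have : 2 * B / r ^ 2 * r ^ 2 <= 2 * B / r ^ 2 * norm (vsub z z') ^ 2.
  by apply: Rmult_le_compat_l => //; apply: pow_incr; lra.
have -> : 2 * B / r ^ 2 * r ^ 2 = 2 * B by field; lra.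
have := hB z; have := hB z'; have : 0 <= norm (vsub z z') ^ 2 by nra.
split_Rabs; lra.
Qed.

(* Sup-convolution in space, then averaging in space-time; the convexity of [H] in [p] enters through
   a subgradient, which reduces the inequality at each point to one with constant coefficients. *)
Theorem smooth_sub w a b e : good L w -> Sub sigma H w -> 0 < a <= b -> 0 < e ->
  exists g ga gp gX,
  (forall t, periodic (fun x => g x t)) /\
  (forall e, 0 < e -> exists r, 0 < r /\ forall x y s t,
     norm (vsub x y) < r -> Rabs (s - t) < r -> Rabs (g x s - g y t) < e) /\
  (forall x t, a <= t <= b -> Rabs (g x t - w x t) <= e /\ norm (gp x t) <= L /\
     symmetric (gX x t) /\ forall th, ga x t + ham sigma H th x (gp x t) (gX x t) <= e) /\
  (forall x t, jet2 g x t (ga x t) (gp x t) (gX x t)).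
Proof.
move=> gw sw [a0 ab] e0.
have [CR [CR0 hCR]] := HH_lip (Rr := 2 * L + 2) ltac:(lra).
(* Three errors of size [eps]: moving the matrices and moving the Hamiltonian over a distance
   [(1 + 2 * L) * eps], and the gap [2 * L ^ 2 * eps] between a Lipschitz function and its
   sup-convolution. *)
pose K0 := (C * (1 + 2 * L)) ^ 2 + CR * (1 + 2 * L) + 2 * L ^ 2.
have K00 : 0 <= K0 by rewrite /K0; nra.
have [t1 [t10 ht1]] := small_prod (a := e / 2) (b := K0) ltac:(lra) K00.
pose eps := Rmin t1 1.
have eps0 : 0 < eps by apply: Rmin_pos; lra.
have Keps : K0 * eps <= e / 2 by apply: ht1; split; [lra|exact: Rmin_l].
have ieps : 0 < / (2 * eps) by apply: Rinv_0_lt_compat; lra.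
pose T := b + 1.
have T0 : 0 <= T by rewrite /T; lra.
pose wc x t := w x (clip T t).
have [B [B0 hB]] := good_bound gw T.
have wB x t : Rabs (wc x t) <= B by apply: hB; exact: clip_itv.
have wL t : Lip L (fun x => wc x t) by apply: (g_lip gw); case: (clip_itv t T0).
have hys x t := supconv_attained x eps0 (Rlt_le _ _ L0) (wL t).
pose ys x t := proj1_sig (constructive_indefinite_description _ (hys x t)).
have ysP x t : norm (vsub x (ys x t)) <= 2 * L * eps /\
   forall y', wc y' t - norm (vsub x y') ^ 2 / (2 * eps) <= wc (ys x t) t - norm (vsub x (ys x t)) ^ 2 / (2 * eps).
  exact: (proj2_sig (constructive_indefinite_description _ (hys x t))).
pose fx x t := wc (ys x t) t - norm (vsub x (ys x t)) ^ 2 / (2 * eps).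
pose f z := fx (xp z) (tp z).
have fge x t y : wc y t - norm (vsub x y) ^ 2 / (2 * eps) <= fx x t by case: (ysP x t).
have f_ge x t : wc x t <= fx x t.
  have := fge x t x; rewrite norm_subvv.
  have -> : 0 ^ 2 / (2 * eps) = 0 by field; lra.
  lra.
have f_le x t : fx x t <= wc x t + 2 * L ^ 2 * eps.
  have [h1 _] := ysP x t; have h2 := wL t (ys x t) x; rewrite (norm_subC (ys x t) x) in h2.
  have : 0 <= norm (vsub x (ys x t)) ^ 2 / (2 * eps) by apply: Rmult_le_pos; [have := norm_ge0 (vsub x (ys x t)); nra|lra].
  have : L * norm (vsub x (ys x t)) <= L * (2 * L * eps) by apply: Rmult_le_compat_l; lra.
  rewrite /fx; move: h2; split_Rabs; lra.
have fB z : Rabs (f z) <= B + 2 * L ^ 2 * eps.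
  have := f_ge (xp z) (tp z); have := f_le (xp z) (tp z); have := wB (xp z) (tp z).
  have : 0 <= 2 * L ^ 2 * eps by apply: Rmult_le_pos; nra.
  by rewrite /f; split_Rabs; lra.
have fxx x y t : fx x t - fx y t <= L * norm (vsub x y).
  have h1 := fge y t (vadd (ys x t) (vsub y x)).
  have E : vsub y (vadd (ys x t) (vsub y x)) = vsub x (ys x t) by vring.
  rewrite E in h1.
  have h2 := wL t (vadd (ys x t) (vsub y x)) (ys x t).
  rewrite vsub_add (norm_subC y x) in h2.
  by rewrite {1}/fx; move: h2; split_Rabs; lra.
have ft e1 : 0 < e1 -> exists r, 0 < r /\ forall x s t, Rabs (s - t) < r -> fx x s - fx x t < e1.
  move=> e10; have [r [r0 hr]] := good_unif gw T e10.
  exists r; split=> // x s t hst.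
  have h1 := fge x t (ys x s); rewrite {1}/fx.
  have := hr (ys x s) (clip T s) (clip T t) (clip_itv s T0) (clip_itv t T0) (Rle_lt_trans _ _ _ (clip_lip T s t) hst).
  by rewrite /wc in h1 *; split_Rabs; lra.
have mf : mq f.
  apply: (unif_mq fB) => e1 e10.
  have [r [r0 hr]] := ft (e1 / 2) ltac:(lra).
  have [r1 [r10 hr1]] := small_prod (a := e1 / 2) (b := L) ltac:(lra) ltac:(lra).
  exists (Rmin r r1); split; first exact: Rmin_pos.
  have H1 z z' : norm (vsub z z') < Rmin r r1 -> f z - f z' <= e1.
    move=> hz.
    have hz1 : norm (vsub z z') < r by apply: Rlt_le_trans hz (Rmin_l _ _).
    have hz2 : norm (vsub z z') <= r1 by apply: Rlt_le; apply: Rlt_le_trans hz (Rmin_r _ _).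
    have a1 := fxx (xp z) (xp z') (tp z).
    have a2 := hr (xp z') (tp z) (tp z') (Rle_lt_trans _ _ _ (abs_tp (vsub z z')) hz1).
    have a3 : norm (vsub (xp z) (xp z')) <= norm (vsub z z') by exact: norm_xp (vsub z z').
    have a4 : L * norm (vsub (xp z) (xp z')) <= L * norm (vsub z z') by apply: Rmult_le_compat_l; lra.
    have := hr1 (norm (vsub z z')) (conj (norm_ge0 _) hz2).
    by rewrite /f; lra.
  move=> z z' hz; have := H1 _ _ hz; rewrite norm_subC in hz; have := H1 _ _ hz.
  by split_Rabs; lra.
have [w1 [w10 hw1]] := mq_sub (e := e / 2) ltac:(lra) mf.
(* The averaging radius stays below [eps], so that the total displacement remains of order [eps],
   below the continuity radius [w1], and small enough for the times involved to remain positive and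
   below [T]. *)
pose rho := Rmin (Rmin eps w1) (Rmin (a / 2) (/ 2)).
have rho0 : 0 < rho by repeat (apply: Rmin_pos; try lra).
have [rh1 [rh2 [rh3 rh4]]] : rho <= eps /\ rho <= w1 /\ rho <= a / 2 /\ rho <= / 2.
  split; first exact: Rle_trans (Rmin_l _ _) (Rmin_l _ _).
  split; first exact: Rle_trans (Rmin_l _ _) (Rmin_r _ _).
  split; first exact: Rle_trans (Rmin_r _ _) (Rmin_l _ _).
  exact: Rle_trans (Rmin_r _ _) (Rmin_r _ _).
have n0 := pos_INR N.+1.
pose rr := rho / 2 / (3 * INR N.+1 + 1).
have rr0 : 0 < rr by apply: Rdiv_lt_0_compat; lra.
have hrad : rad (dirs3 N.+1 rr) <= rho / 2.
  rewrite rad_dirs3 //.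
  have -> : 3 * INR N.+1 * rr = rho / 2 - rr by rewrite /rr; field; lra.
  lra.
set l := dirs3 N.+1 rr in hrad *.
have [G [X sm]] := mollify_smooth rr0 mf fB; rewrite -/l in sm.
have [m0 [Lam [Lam0 hT]] hS _ _ _] := sm.
pose F := Avgs l f.
exists (fun x t => F (mk x t)), (fun x t => tp (G (mk x t))), (fun x t => xp (G (mk x t))), (fun x t => xx (X (mk x t))).
split; [|split; [|split]].
- move=> t x k.
  have fper : (fun z => f (vadd z (mk (vint k) 0))) = f.
    apply: functional_extensionality => z; rewrite /f.
    have -> : xp (vadd z (mk (vint k) 0)) = vadd (xp z) (vint k).
      by rewrite -{1}(mk_eta z) mk_add xp_mk.
    have -> : tp (vadd z (mk (vint k) 0)) = tp z.
      by rewrite -{1}(mk_eta z) mk_add tp_mk; ring.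
    have le x' k' t' : fx (vadd x' (vint k')) t' <= fx x' t'.
      have := fge x' t' (vadd (ys (vadd x' (vint k')) t') (vint (fun i => - k' i)%Z)).
      have -> : wc (vadd (ys (vadd x' (vint k')) t') (vint (fun i => - k' i)%Z)) t'
         = wc (ys (vadd x' (vint k')) t') t' by exact: (g_per gw).
      have -> : vsub x' (vadd (ys (vadd x' (vint k')) t') (vint (fun i => - k' i)%Z))
         = vsub (vadd x' (vint k')) (ys (vadd x' (vint k')) t').
        by apply: functional_extensionality => i; rewrite /vsub /vadd /vint opp_IZR; ring.
      by [].
    apply: Rle_antisym; first exact: le.
    have := le (vadd (xp z) (vint k)) (fun i => - k i)%Z (tp z).
    have -> // : vadd (vadd (xp z) (vint k)) (vint (fun i => - k i)%Z) = xp z.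
    by apply: functional_extensionality => i; rewrite /vadd /vint opp_IZR; ring.
  by rewrite /F -{2}fper Avgs_trans mk_add Rplus_0_r.
- move=> e1 e10; have [r [r0 hr]] := mq_sub e10 m0.
  exists (r / 2); split; first lra.
  move=> x y s t h1 h2; apply: hr; rewrite mk_sub.
  by apply: Rle_lt_trans (norm_mk_le _ _) _; lra.
- move=> x t [ta tb]; set z0 := mk x t.
  have tz : tp z0 = t by exact: tp_mk.
  have xz : xp z0 = x by exact: xp_mk.
  have wct : wc x t = w x t by rewrite /wc clip_id // /T; lra.
  (* The average inherits the spatial Lipschitz constant [L]; a longer gradient [p] would contradict
     it along a small multiple of [p] itself. *)
  have gnorm : norm (xp (G z0)) <= L.
    have FL d : F (vadd z0 (mk d 0)) - F z0 <= L * norm d.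
      have : Rabs (F (vadd z0 (mk d 0)) - F z0) <= L * norm d.
        rewrite /F -Avgs_trans; apply: Avgs_diff => //; first exact: mq_trans.
        move=> z' _; rewrite /f -{1 2 3 4}(mk_eta z') mk_add !xp_mk !tp_mk Rplus_0_r.
        have h1 := fxx (vadd (xp z') d) (xp z') (tp z').
        have h2 := fxx (xp z') (vadd (xp z') d) (tp z').
        rewrite (norm_subC (xp z')) in h2; rewrite vsub_add in h1 h2.
        by split_Rabs; lra.
      by split_Rabs; lra.
    apply: Rnot_lt_le => hp; set p := xp (G z0) in hp.
    pose q := norm p * (norm p - L).
    have q0 : 0 < q by rewrite /q; apply: Rmult_lt_0_compat; lra.
    pose KK := mabs (X z0) * norm p ^ 2 + Lam * norm p ^ 3.
    have KK0 : 0 <= KK.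
      have := mabs_ge0 (X z0); have := norm_ge0 p => u v.
      have : 0 <= norm p ^ 3 by apply: pow_le.
      by rewrite /KK; nra.
    have [ta' [ta0 hta]] := small_prod (a := q / 2) ltac:(lra) KK0.
    pose s := Rmin ta' 1.
    have s0 : 0 < s by apply: Rmin_pos; lra.
    have s1 : s <= 1 by exact: Rmin_r.
    have h1 := FL (vscale s p); have h2 := hT z0 (mk (vscale s p) 0).
    rewrite dot_mk -/p dotZr -norm_sq Rmult_0_r Rplus_0_l quad_mk0 quadZ -/F in h2.
    have h3 := hta s ltac:(split; [lra|exact: Rmin_l]).
    rewrite norm_scale (Rabs_pos_eq s) in h1; last lra.
    have nm : norm (mk (vscale s p) 0) <= s * norm p.
      by apply: Rle_trans (norm_mk_le _ _) _; rewrite norm_scale Rabs_R0 (Rabs_pos_eq s); lra.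
    have h4 : Lam * norm (mk (vscale s p) 0) ^ 3 <= Lam * (s * norm p) ^ 3.
      by apply: Rmult_le_compat_l; [lra|apply: pow_incr; split => //; exact: norm_ge0].
    have h5 : Rabs (quad (xx (X z0)) p) <= mabs (X z0) * norm p ^ 2.
      rewrite -quad_mk0; apply: Rle_trans (quad_bound _ _) _.
      apply: Rmult_le_compat_l; first exact: mabs_ge0.
      apply: pow_incr; split; first exact: norm_ge0.
      by have := norm_mk_le p 0; rewrite Rabs_R0; lra.
    have h6 : Lam * (s * norm p) ^ 3 <= s ^ 2 * (Lam * norm p ^ 3).
      have -> : Lam * (s * norm p) ^ 3 = s * (s ^ 2 * (Lam * norm p ^ 3)) by ring.
      have : 0 <= s ^ 2 * (Lam * norm p ^ 3).
        by apply: Rmult_le_pos; [nra|apply: Rmult_le_pos; [lra|apply: pow_le; exact: norm_ge0]].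
      nra.
    have h7 : s ^ 2 * Rabs (quad (xx (X z0)) p) <= s ^ 2 * (mabs (X z0) * norm p ^ 2).
      by apply: Rmult_le_compat_l => //; nra.
    have h8 : s * norm p ^ 2 - L * (s * norm p) = s * q by rewrite /q; ring.
    have h9 : s * (KK * s) <= s * (q / 2) by apply: Rmult_le_compat_l; lra.
    have h10 : s * (KK * s) = s ^ 2 * (mabs (X z0) * norm p ^ 2) + s ^ 2 * (Lam * norm p ^ 3) by rewrite /KK; ring.
    have h11 : Rabs (/ 2 * (s ^ 2 * quad (xx (X z0)) p)) <= s ^ 2 * Rabs (quad (xx (X z0)) p).
      rewrite Rabs_mult Rabs_mult (Rabs_pos_eq (s ^ 2)); last nra.
      rewrite (Rabs_pos_eq (/ 2)); last lra.
      have := Rabs_pos (quad (xx (X z0)) p); have : 0 <= s ^ 2 by nra.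
      nra.
    have h12 : 0 < s * q by apply: Rmult_lt_0_compat.
    move: h2 h11; set u := / 2 * _; set v := F (vadd _ _) in h1 *.
    by split_Rabs; lra.
  split; [|split; [|split]] => //.
  + have h1 : Rabs (F z0 - f z0) <= e / 2.
      apply: Avgs_close => // z' hz; apply: Rlt_le; apply: hw1; lra.
    have h2 := f_ge x t; have h3 := f_le x t.
    have h4 : 2 * L ^ 2 * eps <= K0 * eps.
      by apply: Rmult_le_compat_r; [lra|rewrite /K0; nra].
    have h5 : f z0 = fx x t by rewrite /f tz xz.
    by rewrite wct in h2 h3; rewrite h5 in h1; split_Rabs; lra.
  + exact: sym_xx.
  + move=> th.
    set p0 := xp (G z0) in gnorm *.
    (* The affine minorant of [H th x] touches, up to [e / 2], at the gradient [p0] of the average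
       itself. Replacing [H] by it leaves an inequality linear in the derivatives, which averages
       preserve, and almost nothing is lost at [p0]. *)
    have [bb hbb] : exists bb, forall q, H th x p0 - e / 2 + dot bb (vsub q p0) <= H th x q.
      apply: (@eps_subgradient _ (H th x) L CR p0 (e / 2)) => //; [lra| |exact: Hconv].
      move=> p q hp hq; have := hCR th x x p q ltac:(lra) ltac:(lra).
      by rewrite norm_subvv Rplus_0_l.
    pose k := K0 * eps - H th x p0 + e / 2 + dot bb p0.
    have := @mv_smooth N.+1 N (mk bb 1) (fun j => mk (colv (sigma th x) j) 0) f mf _ fB z0 rho k rho0 _ l G X hrad sm.
    rewrite trprod_lin -/p0 /ham => hh.
    suff : tp (G z0) + dot bb p0 - trprod (gram (sigma th x)) (xx (X z0)) <= k by rewrite /k; lra.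
    apply: hh => zh P Y La hz sY htouch.
    rewrite trprod_lin.
    set xh := xp zh; set th' := tp zh.
    have thd : Rabs (th' - t) <= rho.
      by apply: Rle_trans hz; rewrite -tz; exact: abs_tp (vsub zh z0).
    have xhd : norm (vsub x xh) <= rho.
      by rewrite norm_subC; apply: Rle_trans hz; rewrite -xz; exact: norm_xp (vsub zh z0).
    have hc s : Rabs s < a / 4 -> Rabs s < / 4 -> 0 <= th' + s <= T.
      by rewrite /T => *; split_Rabs; lra.
    have c1 : clip T th' = th' by apply: clip_id; have := hc 0; rewrite Rabs_R0 Rplus_0_r; apply; lra.
    have thp : 0 < th' by split_Rabs; lra.
    have rp : 0 < Rmin (a / 4) (/ 4) by apply: Rmin_pos; lra.
    have [|pE tr] := @supconv_transfer N Th sigma H w eps xh th' (ys xh th') P Y (Rmax La 0) (Rmin (a / 4) (/ 4))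
      eps0 thp rp (Rmax_r _ _) sY sw.
      move=> xi s y hs.
      have hs1 : Rabs s < a / 4 by apply: Rlt_le_trans hs (Rmin_l _ _).
      have hs2 : Rabs s < / 4 by apply: Rlt_le_trans hs (Rmin_r _ _).
      have h1 := fge (vadd xh xi) (th' + s) y.
      rewrite {1}/wc clip_id in h1; last exact: hc.
      have h2 := htouch (mk xi s).
      have -> : w (ys xh th') th' = wc (ys xh th') th' by rewrite /wc c1.
      have h3 : f (vadd zh (mk xi s)) = fx (vadd xh xi) (th' + s).
        by rewrite /f -{1 2}(mk_eta zh) mk_add xp_mk tp_mk.
      rewrite h3 in h2.
      have h4 : La * norm (mk xi s) ^ 3 <= Rmax La 0 * norm (mk xi s) ^ 3.
        by apply: Rmult_le_compat_r; [apply: pow_le; exact: norm_ge0|exact: Rmax_l].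
      have h5 : f zh = wc (ys xh th') th' - norm (vsub xh (ys xh th')) ^ 2 / (2 * eps) by [].
      lra.
    have [yd _] := ysP xh th'.
    have xyd : norm (vsub x (ys xh th')) <= (1 + 2 * L) * eps.
      by have := norm_sub_triang x xh (ys xh th'); lra.
    have pn : norm (xp P) <= 2 * L.
      rewrite pE norm_scale Rabs_pos_eq; last by apply: Rlt_le; apply: Rinv_0_lt_compat.
      rewrite norm_subC; apply: (Rmult_le_reg_l eps) => //.
      rewrite -Rmult_assoc Rinv_r ?Rmult_1_l; lra.
    have h1 := tr th x.
    have h2 := Hsig_lip th x (ys xh th').
    have h3 : mnorm (msub (sigma th x) (sigma th (ys xh th'))) ^ 2 / eps <= (C * (1 + 2 * L)) ^ 2 * eps.
      apply: (Rmult_le_reg_l eps) => //.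
      have -> : eps * (mnorm (msub (sigma th x) (sigma th (ys xh th'))) ^ 2 / eps)
        = mnorm (msub (sigma th x) (sigma th (ys xh th'))) ^ 2 by field; lra.
      have -> : eps * ((C * (1 + 2 * L)) ^ 2 * eps) = (C * ((1 + 2 * L) * eps)) ^ 2 by ring.
      apply: pow_incr; split; first exact: mnorm_ge0.
      by apply: Rle_trans h2 _; apply: Rmult_le_compat_l; lra.
    have h4 := hCR th x (ys xh th') (xp P) (xp P) ltac:(lra) ltac:(lra).
    rewrite norm_subvv Rplus_0_r in h4.
    have h5 : CR * norm (vsub x (ys xh th')) <= CR * ((1 + 2 * L) * eps) by apply: Rmult_le_compat_l; lra.
    have h6 := hbb (xp P); rewrite dotBr in h6.
    have h7 : (C * (1 + 2 * L)) ^ 2 * eps + CR * ((1 + 2 * L) * eps) <= K0 * eps.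
      have : 0 <= 2 * L ^ 2 * eps by apply: Rmult_le_pos; nra.
      rewrite /K0; lra.
    by rewrite /k; move: h4; split_Rabs; lra.
- move=> x t; apply: (tay2_jet2 Lam0 hT); exact: hS.
Qed.
Theorem comparison w1 w2 m : good L w1 -> Sub sigma H w1 -> good L w2 -> Super sigma H w2 ->
  (forall x, w1 x 0 <= w2 x 0 + m) -> forall x t, 0 <= t -> w1 x t <= w2 x t + m.
Proof.
move=> g1 s1 g2 s2 h0 x1 t1 t10.
have [t1p|t1z] := Rle_lt_or_eq_dec _ _ t10; last by rewrite -t1z.
apply: Rnot_lt_le => hlt.
pose d := w1 x1 t1 - w2 x1 t1 - m.
have d0 : 0 < d by rewrite /d; lra.
have [r1 [r10 hr1]] := good_unif g1 t1 (e := d / 8) ltac:(lra).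
have [r2 [r20 hr2]] := good_unif g2 t1 (e := d / 8) ltac:(lra).
have [r [r0 [hra hrb]]] := dmin2 r10 r20.
have [a' [a'0 [ha1 ha2]]] := dmin2 r0 t1p.
pose a := a' / 2.
have a0 : 0 < a by rewrite /a; lra.
have hstart x : w1 x a - w2 x a <= m + d / 4.
  have q1 := hr1 x a 0 ltac:(rewrite /a; lra) ltac:(lra) ltac:(rewrite Rminus_0_r /a; split_Rabs; lra).
  have q2 := hr2 x a 0 ltac:(rewrite /a; lra) ltac:(lra) ltac:(rewrite Rminus_0_r /a; split_Rabs; lra).
  by have := h0 x; move: q1 q2; split_Rabs; lra.
pose k := d / (8 * t1).
have k0 : 0 < k by apply: Rdiv_lt_0_compat; lra.
have kt : k * t1 = d / 8 by rewrite /k; field; lra.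
have [e [e0 [he1 he2]]] := dmin2 (r1 := d / 8) (r2 := k / 4) ltac:(lra) ltac:(lra).
pose b := t1 + 1.
have ab : 0 < a <= b by rewrite /b; split=> //; rewrite /a; lra.
have [g [ga [gp [gX [gper [gcont [gprop gjet]]]]]]] := smooth_sub g1 s1 ab e0.
have [B1 [B10 hB1]] := good_bound g1 b; have [B2 [B20 hB2]] := good_bound g2 b.
pose M := B1 + B2 + e + Rabs m + d.
have M0 : 0 < M by rewrite /M; have := Rabs_pos m; lra.
(* The slope [- k] makes the test function strictly subsolution; [k * t1 = d / 8] is too small to
   destroy the excess [d] at [t1]. The quadratic term starts at [t1], and [M] exceeds all values
   involved, so that the maximum cannot sit at the final time [b]. *)
pose psi (y : vec N) s := - k * (s - a) - M * Rmax 0 (s - t1) ^ 2.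
pose Phi (z : vec N * R) := g z.1 z.2 + psi z.1 z.2 - w2 z.1 z.2.
have psic t : forall e1, 0 < e1 -> exists r, 0 < r /\ forall (y y' : vec N) s, Rabs (s - t) < r -> psi y s < psi y' t + e1.
  move=> e1 e10.
  have [r3 [r30 hr3]] := small_prod (a := e1 / 2) (b := k + 2 * M * Rmax 0 (t - t1)) ltac:(lra)
    ltac:(have := Rmax_l 0 (t - t1); nra).
  exists r3; split=> // y y' s hs.
  have q1 := hr3 (Rabs (s - t)) (conj (Rabs_pos _) (Rlt_le _ _ hs)).
  have q2 := Rmax_l 0 (t - t1).
  have q3 : - Rmax 0 (s - t1) ^ 2 <= - Rmax 0 (t - t1) ^ 2 + 2 * Rmax 0 (t - t1) * Rabs (s - t).
    have q4 := sq_pos_low t1 t s.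
    have q5 : Rmax 0 (t - t1) <= Rmax 0 (s - t1) + Rabs (t - s).
      rewrite /Rmax; case: (Rle_dec 0 (t - t1)) => ?; case: (Rle_dec 0 (s - t1)) => ?; split_Rabs; lra.
    rewrite (Rabs_minus_sym t s) in q5.
    have := Rmax_l 0 (s - t1); have := Rabs_pos (s - t).
    move: q5; move: (Rmax 0 (t - t1)) (Rmax 0 (s - t1)) (Rabs (s - t)) q2 => u v w' u0 uvw w0 v0; have [?|?] := Rle_lt_dec u v; nra.
  have q6 : M * - Rmax 0 (s - t1) ^ 2 <= M * (- Rmax 0 (t - t1) ^ 2 + 2 * Rmax 0 (t - t1) * Rabs (s - t)).
    by apply: Rmult_le_compat_l; lra.
  have q7 : - k * (s - t) <= k * Rabs (s - t) by split_Rabs; nra.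
  rewrite /psi; lra.
have cD : ucpt (dprod (@dV N) dR) (fun p => inbox p.1 /\ (a <= p.2 <= b)).
  exact: (ucpt_prod (@ucpt_inbox N) (@ucpt_itv a b)).
have [[xh th] [[/= hxh hth] hmax]] : exists z : vec N * R, (inbox z.1 /\ a <= z.2 <= b) /\
    forall z', (inbox z'.1 /\ a <= z'.2 <= b) -> Phi z' <= Phi z.
  apply: (ucpt_max cD).
    by exists (@vzero N, a); split; [exact: inbox_zero|rewrite /b /a /=; lra].
  move=> [x t] [/= hx ht] e1 e10.
  have [q1 [q10 hq1]] := gcont (e1 / 3) ltac:(lra).
  have [q2 [q20 hq2]] := psic t (e1 / 3) ltac:(lra).
  have [q3 [q30 hq3]] := g_cont g2 x (t := t) ltac:(lra) (e := e1 / 3) ltac:(lra).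
  have [q4 [q40 [u1 u2]]] := dmin2 q10 q20; have [q5 [q50 [u3 u4]]] := dmin2 q40 q30.
  exists q5; split=> // -[y s] [/= hy hs] hd.
  have l1 : norm (vsub y x) < q5 by apply: Rle_lt_trans (Rmax_l _ _) hd.
  have l2 : Rabs (s - t) < q5 by apply: Rle_lt_trans (Rmax_r _ _) hd.
  have v1 := hq1 y x s t ltac:(lra) ltac:(lra).
  have v2 := hq2 y x s ltac:(lra).
  have v3 := hq3 y s ltac:(lra) ltac:(lra) ltac:(lra).
  by rewrite /Phi /=; move: v1 v3; split_Rabs; lra.
have hmax' y s : a <= s <= b -> Phi (y, s) <= Phi (xh, th).
  move=> hs; rewrite {1}/Phi /=.
  have pper : periodic (fun x => (g x s, w2 x s)).
    by move=> x kk; congr pair; [apply: gper|apply: (g_per g2)].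
  have -> : psi y s = psi xh s by [].
  apply: (@periodic_box N _ _ (fun v => v.1 + psi xh s - v.2 <= Phi (xh, th)) pper) => x hx.
  exact: (hmax (x, s)).
have val1 : m + d * 5 / 8 <= Phi (xh, th).
  apply: Rle_trans (hmax' x1 t1 ltac:(rewrite /a /b; lra)).
  have [q1 _] := gprop x1 t1 ltac:(rewrite /a /b; lra).
  have q2 : Rmax 0 (t1 - t1) = 0 by rewrite Rminus_diag Rmax_left //; lra.
  have q3 : k * (t1 - a) <= k * t1 by apply: Rmult_le_compat_l; lra.
  rewrite /Phi /psi /= q2; rewrite /d in d0 he1 kt *; move: q1; split_Rabs; lra.
have tha : a < th.
  have [//|heq] : a < th \/ a = th by lra.
  have [q1 _] := gprop xh a ltac:(rewrite /b /a; lra).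
  have q2 := hstart xh.
  have q3 : Rmax 0 (a - t1) = 0 by rewrite Rmax_left // /a; lra.
  rewrite -heq /Phi /psi /= q3 in val1; move: q1; split_Rabs; lra.
have thb : th < b.
  have [//|heq] : th < b \/ th = b by lra.
  have [q1 _] := gprop xh b ltac:(rewrite /b /a; lra).
  have q2 := hB1 xh b ltac:(rewrite /b /a; lra); have q3 := hB2 xh b ltac:(rewrite /b /a; lra).
  have q4 : Rmax 0 (b - t1) = 1 by rewrite Rmax_right /b; lra.
  have q5 : 0 <= k * (b - a) by apply: Rmult_le_pos; rewrite /b /a; lra.
  rewrite heq /Phi /psi /= q4 /M in val1.
  by move: q1 q2 q3; split_Rabs; lra.
have [CR [CR0 hCR]] := HH_lip (Rr := L + 1) ltac:(lra).
have hCR' t x p q : norm p <= L + 1 -> norm q <= L + 1 -> Rabs (H t x p - H t x q) <= CR * norm (vsub p q).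
  by move=> hp hq; have := hCR t x x p q hp hq; rewrite norm_subvv Rplus_0_l.
have [_ [gn [gs ge]]] := gprop xh th ltac:(lra).
pose al := - k - 2 * M * Rmax 0 (th - t1).
have ltest : low_test psi xh th al (@vzero N) (mscale 0 mid).
  exists M; split; first lra.
  move=> y s _ _; rewrite dot0l quad_mscale /psi /al.
  have q1 := sq_pos_low t1 s th.
  have q2 : M * Rmax 0 (s - t1) ^ 2 <= M * (Rmax 0 (th - t1) ^ 2 + 2 * Rmax 0 (th - t1) * (s - th) + (s - th) ^ 2).
    by apply: Rmult_le_compat_l; lra.
  have q3 : 0 <= M * (Rabs (s - th) * norm (vsub y xh) + norm (vsub y xh) ^ 3).
    apply: Rmult_le_pos; first lra.
    have := Rabs_pos (s - th); have := norm_ge0 (vsub y xh) => u v.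
    have : 0 <= norm (vsub y xh) ^ 3 by apply: pow_le.
    nra.
  nra.
have [r5 [r50 [hr5 hr6]]] := dmin2 (r1 := th - a) (r2 := b - th) ltac:(lra) ltac:(lra).
have [|th0] := touch hCR' s2 (w := w2) (x := xh) (t := th) (e := k / 4) ltac:(lra) (gjet xh th) ltest gs
  (sym_mscale 0 (@sym_mid N)) gn ltac:(rewrite norm_zero; lra) ge _ ltac:(lra).
  exists r5; split=> // y s _ hs.
  apply: (hmax' y s); split_Rabs; lra.
rewrite trprodZ norm_zero /al.
have : 0 <= M * Rmax 0 (th - t1) by apply: Rmult_le_pos; [lra|exact: Rmax_l].
lra.
Qed.

Lemma sol_shift w h : 0 <= h -> sol w -> sol (fun x t => w x (t + h)).
Proof. by move=> h0 [g s S]; split; [exact: good_shift|exact: Sub_shift|exact: Super_shift]. Qed.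
Lemma sol_addc w c : sol w -> sol (fun x t => w x t + c).
Proof. by move=> [g s S]; split; [exact: good_addc|exact: Sub_addc|exact: Super_addc]. Qed.

Lemma cmp_from w1 w2 m s : sol w1 -> sol w2 -> 0 <= s -> (forall x, w1 x s <= w2 x s + m) ->
  forall x t, s <= t -> w1 x t <= w2 x t + m.
Proof.
move=> h1 h2 s0 h x t st.
have [g1 sb1 _] := sol_shift s0 h1; have [g2 _ sp2] := sol_shift s0 h2.
have := comparison (m := m) g1 sb1 g2 sp2 _ x (t := t - s).
have -> : t - s + s = t by ring.
by apply; [move=> y; rewrite Rplus_0_l|lra].
Qed.
Lemma cmp_abs w1 w2 m s : sol w1 -> sol w2 -> 0 <= s -> (forall x, Rabs (w1 x s - w2 x s) <= m) ->
  forall x t, s <= t -> Rabs (w1 x t - w2 x t) <= m.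
Proof.
move=> h1 h2 s0 h x t st.
have q1 := @cmp_from w1 w2 m s h1 h2 s0 (fun y => ltac:(have := h y; split_Rabs; lra)) x t st.
have q2 := @cmp_from w2 w1 m s h2 h1 s0 (fun y => ltac:(have := h y; split_Rabs; lra)) x t st.
by split_Rabs; lra.
Qed.

(** Uniform continuity at time 0 is propagated to all times: [u] and its translate in time are both
    solutions, and comparison never increases their distance. *)
Lemma sol_umod u : sol u -> forall e, 0 < e -> exists r, 0 < r /\
  forall x s t, 0 <= s -> 0 <= t -> Rabs (s - t) < r -> Rabs (u x s - u x t) <= e.
Proof.
move=> su e e0; have [r1 [r10 hr1]] := good_unif (s_good su) 1 e0.
have [r [r0 [u1 u2]]] := dmin2 r10 Rlt_0_1.
exists r; split=> //.
have key x t h : 0 <= t -> 0 <= h < r -> Rabs (u x (t + h) - u x t) <= e.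
  move=> t0 [h0 hr].
  apply: (@cmp_abs (fun x t => u x (t + h)) u e 0) => //; [exact: sol_shift|lra|].
  move=> y; apply: Rlt_le; rewrite Rplus_0_l; apply: hr1; try lra.
  by rewrite Rminus_0_r Rabs_pos_eq; lra.
move=> x s t s0 t0 hst; have [h|h] := Rle_lt_dec t s.
  by have := key x t (s - t) t0; have -> : t + (s - t) = s by [ring]; apply; split_Rabs; lra.
rewrite Rabs_minus_sym; have := key x s (t - s) s0; have -> : s + (t - s) = t by ring.
by apply; split_Rabs; lra.
Qed.
Lemma sol_nonexp u s h m : sol u -> 0 <= s -> 0 <= h -> (forall x, Rabs (u x (s + h) - u x s) <= m) ->
  forall x t, s <= t -> Rabs (u x (t + h) - u x t) <= m.
Proof.
move=> su s0 h0 hm; apply: (@cmp_abs (fun x t => u x (t + h)) u m s) => //; exact: sol_shift.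
Qed.

(** * Empty [Sigma]: spreading of positivity *)

Section Harnack.
Variables (nu : R) (nu0 : 0 < nu) (Hell : forall th x z, quad (gram (sigma th x)) z >= nu * dot z z).
Variables (u : vec N -> R -> R) (v : vec N -> R) (su : sol u) (sv : sol (fun x _ => v x)).

(** Squaring [W] lets the barrier reach zero with zero slope, so it can be cut off where [W] becomes
    negative. Where [W] is small, the positive term [8 z z^T] of its Hessian dominates, and
    elsewhere the exponential decay [- be * W ^ 2] does. *)
Lemma harnack_low y be tau0 G0 kap t x z : 0 <= be ->
  let th s := exp (- be * (s - tau0)) in
  let W (y' : vec N) s := G0 + kap * (s - tau0) - norm (vsub y' y) ^ 2 in
  z = vsub x y ->
  low_test (fun y' s => th s * W y' s ^ 2) x t
    (th t * (2 * W x t * kap - be * W x t ^ 2)) (vscale (th t * (- 4 * W x t)) z)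
    (madd (mscale (8 * th t) (outer z)) (mscale (- 4 * th t * W x t) mid)).
Proof.
move=> be0 th W zE.
have th0 : 0 < th t by exact: exp_pos.
set w := W x t; set n := norm z.
have n0 : 0 <= n by exact: norm_ge0.
pose q1 := 2 * n + 1.
pose dd := Rabs kap + q1.
exists (th t * (2 * Rabs kap * q1 + 4 * n + be * (2 * Rabs w * dd + 2 * (dd * dd)))).
have k0 := Rabs_pos kap; have w0 := Rabs_pos w.
have dd0 : 0 <= dd by rewrite /dd /q1; lra.
have P0 : 0 <= 2 * Rabs w * dd + 2 * (dd * dd) by nra.
split.
  apply: Rmult_le_pos; first lra.
  have : 0 <= Rabs kap * q1 by apply: Rmult_le_pos; rewrite /q1; lra.
  have : 0 <= be * (2 * Rabs w * dd + 2 * (dd * dd)) by apply: Rmult_le_pos.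
  lra.
move=> y' s hy hs.
set eta := vsub y' x in hy *; set sg := s - t in hs *.
have e0 := norm_ge0 eta; have s0 := Rabs_pos sg.
pose q := 2 * dot z eta + norm eta ^ 2.
pose de := kap * sg - q.
have EW : W y' s = w + de.
  rewrite /w /W /de /q /sg.
  have -> : vsub y' y = vadd z eta by rewrite zE /eta; vring.
  by rewrite norm_add_sq -zE; ring.
have eth : th s >= th t * (1 - be * sg).
  have -> : th s = th t * exp (- be * sg) by rewrite /th -exp_plus; congr exp; rewrite /sg; ring.
  apply: Rle_ge; apply: Rmult_le_compat_l; first lra.
  have := exp_ineq1_le (- be * sg); lra.
have h1 : th s * W y' s ^ 2 >= th t * (1 - be * sg) * (w + de) ^ 2.
  rewrite EW; apply: Rle_ge; apply: Rmult_le_compat_r; [exact: pow2_ge_0|lra].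
rewrite dotZl quad_madd !quad_mscale quad_outer quad_mid -norm_sq -/w.
have zeta : Rabs (dot z eta) <= n * norm eta by exact: cauchy_abs.
have qb : Rabs q <= q1 * norm eta.
  rewrite /q /q1; have : norm eta ^ 2 <= norm eta by nra.
  have : 0 <= norm eta ^ 2 by nra.
  by move: zeta; split_Rabs; lra.
have deb : Rabs de <= dd * (Rabs sg + norm eta).
  have : Rabs (kap * sg) = Rabs kap * Rabs sg by rewrite Rabs_mult.
  have : 0 <= Rabs kap * norm eta by nra.
  have : 0 <= q1 * Rabs sg by rewrite /q1; nra.
  rewrite /de /dd => a1 a2 a3; have := Rabs_triang (kap * sg) (- q); rewrite Rabs_Ropp.
  have -> : kap * sg + - q = kap * sg - q by ring.
  lra.
pose S := sg ^ 2 + Rabs sg * norm eta + norm eta ^ 3.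
have Esg : sg ^ 2 = Rabs sg * Rabs sg by rewrite -(pow2_abs sg); ring.
have e3 : 0 <= norm eta ^ 3 by apply: pow_le.
have r1 : - (2 * kap * sg * q) >= - (2 * Rabs kap * q1) * S.
  have : Rabs (kap * sg * q) <= Rabs kap * q1 * (Rabs sg * norm eta).
    rewrite !Rabs_mult.
    have : Rabs kap * Rabs sg * Rabs q <= Rabs kap * Rabs sg * (q1 * norm eta).
      by apply: Rmult_le_compat_l => //; nra.
    lra.
  have : Rabs kap * q1 * (Rabs sg * norm eta) <= Rabs kap * q1 * S.
    apply: Rmult_le_compat_l; first by rewrite /q1; nra.
    by rewrite /S Esg; nra.
  split_Rabs; lra.
have r2 : 4 * dot z eta * norm eta ^ 2 >= - (4 * n) * S.
  have : Rabs (dot z eta * norm eta ^ 2) <= n * norm eta ^ 3.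
    rewrite Rabs_mult (Rabs_pos_eq (norm eta ^ 2)); last nra.
    have -> : n * norm eta ^ 3 = n * norm eta * norm eta ^ 2 by ring.
    by apply: Rmult_le_compat_r; nra.
  have : n * norm eta ^ 3 <= n * S.
    by apply: Rmult_le_compat_l => //; rewrite /S Esg; nra.
  split_Rabs; lra.
have r3 : - (be * sg * (2 * w * de + de ^ 2)) >= - (be * (2 * Rabs w * dd + 2 * (dd * dd))) * S.
  have s01 : Rabs sg * (Rabs sg + norm eta) <= S by rewrite /S Esg; nra.
  have b1 : Rabs (sg * (2 * w * de)) <= 2 * Rabs w * dd * S.
    rewrite !Rabs_mult (Rabs_pos_eq 2); last lra.
    have : Rabs sg * (2 * Rabs w * Rabs de) <= Rabs sg * (2 * Rabs w * (dd * (Rabs sg + norm eta))).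
      by apply: Rmult_le_compat_l => //; apply: Rmult_le_compat_l => //; lra.
    have : 2 * Rabs w * dd * (Rabs sg * (Rabs sg + norm eta)) <= 2 * Rabs w * dd * S.
      by apply: Rmult_le_compat_l => //; nra.
    lra.
  have b2 : Rabs (sg * de ^ 2) <= 2 * (dd * dd) * S.
    rewrite Rabs_mult (Rabs_pos_eq (de ^ 2)); last exact: pow2_ge_0.
    have : de ^ 2 <= (dd * (Rabs sg + norm eta)) ^ 2.
      by rewrite -(pow2_abs de); apply: pow_incr; split=> //; exact: Rabs_pos.
    move=> b3.
    have b4 : (Rabs sg + norm eta) ^ 2 <= 2 * (Rabs sg + norm eta) by nra.
    have b5 : Rabs sg * de ^ 2 <= Rabs sg * (dd * (Rabs sg + norm eta)) ^ 2 by apply: Rmult_le_compat_l.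
    have b6 : (dd * dd * Rabs sg) * (Rabs sg + norm eta) ^ 2 <= (dd * dd * Rabs sg) * (2 * (Rabs sg + norm eta)).
      by apply: Rmult_le_compat_l => //; nra.
    have b7 : dd * dd * (Rabs sg * (Rabs sg + norm eta)) <= dd * dd * S by apply: Rmult_le_compat_l => //; nra.
    have E5 : Rabs sg * (dd * (Rabs sg + norm eta)) ^ 2 = (dd * dd * Rabs sg) * (Rabs sg + norm eta) ^ 2 by ring.
    lra.
  have b8 : Rabs (sg * (2 * w * de + de ^ 2)) <= (2 * Rabs w * dd + 2 * (dd * dd)) * S.
    have -> : sg * (2 * w * de + de ^ 2) = sg * (2 * w * de) + sg * de ^ 2 by ring.
    by apply: Rle_trans (Rabs_triang _ _) _; lra.
  have b9 : be * Rabs (sg * (2 * w * de + de ^ 2)) <= be * ((2 * Rabs w * dd + 2 * (dd * dd)) * S).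
    exact: Rmult_le_compat_l.
  have b10 : be * (sg * (2 * w * de + de ^ 2)) <= be * Rabs (sg * (2 * w * de + de ^ 2)).
    by apply: Rmult_le_compat_l => //; exact: Rle_abs.
  lra.
pose M := 2 * Rabs kap * q1 + 4 * n + be * (2 * Rabs w * dd + 2 * (dd * dd)).
have main : (1 - be * sg) * (w + de) ^ 2 - (w ^ 2 + (2 * w * kap - be * w ^ 2) * sg
    + (- 4 * w) * dot z eta + / 2 * (8 * dot z eta ^ 2 + - 4 * w * norm eta ^ 2)) >= - M * S.
  have -> : (1 - be * sg) * (w + de) ^ 2 - (w ^ 2 + (2 * w * kap - be * w ^ 2) * sg
    + (- 4 * w) * dot z eta + / 2 * (8 * dot z eta ^ 2 + - 4 * w * norm eta ^ 2))
    = - (2 * kap * sg * q) + 4 * dot z eta * norm eta ^ 2 - (be * sg * (2 * w * de + de ^ 2))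
      + ((kap * sg) ^ 2 + (norm eta ^ 2) ^ 2) by rewrite /de /q; field.
  have := pow2_ge_0 (kap * sg); have := pow2_ge_0 (norm eta ^ 2).
  rewrite /M; lra.
have mt : th t * ((1 - be * sg) * (w + de) ^ 2 - (w ^ 2 + (2 * w * kap - be * w ^ 2) * sg
    + (- 4 * w) * dot z eta + / 2 * (8 * dot z eta ^ 2 + - 4 * w * norm eta ^ 2))) >= th t * (- M * S).
  by apply: Rle_ge; apply: Rmult_le_compat_l; [lra|exact: Rge_le].
rewrite -/S -/M; lra.
Qed.
End Harnack.

Lemma mnorm_sq_bd th x : mnorm (sigma th x) ^ 2 <= C ^ 2.
Proof. by apply: pow_incr; split; [exact: mnorm_ge0|exact: Hsig_bd]. Qed.

Section Harnack.
Variables (nu : R) (nu0 : 0 < nu) (Hell : forall th x z, quad (gram (sigma th x)) z >= nu * dot z z).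
Variables (u : vec N -> R -> R) (v : vec N -> R) (su : sol u) (sv : sol (fun x _ => v x)).

(* The lower barrier [exp (- be s) (G s - |x - y|^2)^2] spreads positivity of [u - v] from a small ball
   to a full period in unit time. *)
Lemma harnack_step a : 0 < a -> exists m, 0 < m /\ forall t l0, 0 <= t ->
  (forall x, u x t - v x >= l0) -> (exists y, u y t - v y >= l0 + 2 * a) ->
  forall x, u x (t + 1) - v x >= l0 + m.
Proof.
move=> a0.
have [CR [CR0 hCR]] := HH_lip (Rr := L + 1) ltac:(lra).
have hCR' th x p q : norm p <= L + 1 -> norm q <= L + 1 -> Rabs (H th x p - H th x q) <= CR * norm (vsub p q).
  by move=> hp hq; have := hCR th x x p q hp hq; rewrite norm_subvv Rplus_0_l.
(* From the excess [2 * a] at [y], moving [u] and [v] over a distance [rho] costs [a / 2], and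
   waiting for the time [tau0] costs another [a / 2]; the excess [a] remains on the whole ball. *)
pose rho := a / (4 * L).
have rho0 : 0 < rho by apply: Rdiv_lt_0_compat; lra.
have Lrho : 2 * L * rho = a / 2 by rewrite /rho; field; lra.
have [rt [rt0 hrt]] := sol_umod su (e := a / 2) ltac:(lra).
have [tau' [tau'0 [ht1 ht2]]] := dmin2 rt0 Rlt_0_1.
pose tau0 := tau' / 2.
have tau00 : 0 < tau0 by rewrite /tau0; lra.
have tau0h : tau0 <= / 2 by rewrite /tau0; lra.
have tau0r : tau0 < rt by rewrite /tau0; lra.
pose nN := INR N.
have nN0 : 0 <= nN by exact: pos_INR.
(* The speed at which the support of the barrier grows: since [tau0 <= / 2], at time 1 one has
   [W >= 1] within distance [N] of [y], which reaches a periodic copy of every point. *)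
pose kap := 2 * (nN ^ 2 + 1).
have kap0 : 2 <= kap by rewrite /kap; nra.
pose Gm := rho ^ 2 + 2 * kap.
have rho2 : 0 < rho ^ 2 by nra.
have Gm0 : 4 < Gm by rewrite /Gm; lra.
pose K := 2 * kap + 4 * C ^ 2 + 4 * CR * (1 + Gm).
have K0 : 0 < K.
  have : 0 < CR * (1 + Gm) by apply: Rmult_lt_0_compat; lra.
  by have := pow2_ge_0 C; rewrite /K; lra.
(* [K] collects the terms linear in [W], and [8 * nu] comes from replacing [|z|^2] by [rho ^ 2 - W]
   in the elliptic gain. Completing the square, their maximum against [be * W ^ 2] is
   [4 * nu * rho ^ 2], half of the gain. *)
pose be := (K + 8 * nu) ^ 2 / (16 * nu * rho ^ 2).
have nr : 0 < nu * rho ^ 2 by apply: Rmult_lt_0_compat.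
have be0 : 0 < be by apply: Rdiv_lt_0_compat; [apply: pow_lt|]; lra.
(* The amplitude is limited twice: the barrier must stay below [a] when it starts on the ball, and
   its gradient must have length at most 1 for [touch]. *)
pose k0 := Rmin (a / Gm ^ 2) (/ (4 * (Gm * (1 + Gm)))).
have GG : 0 < Gm * (1 + Gm) by nra.
have k00 : 0 < k0.
  by apply: Rmin_pos; [apply: Rdiv_lt_0_compat; nra|apply: Rinv_0_lt_compat; lra].
have k0a : k0 * Gm ^ 2 <= a.
  have : k0 * Gm ^ 2 <= a / Gm ^ 2 * Gm ^ 2 by apply: Rmult_le_compat_r; [nra|exact: Rmin_l].
  have -> : a / Gm ^ 2 * Gm ^ 2 = a by field; lra.
  by [].
have k0p : k0 * (4 * (Gm * (1 + Gm))) <= 1.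
  have : k0 * (4 * (Gm * (1 + Gm))) <= / (4 * (Gm * (1 + Gm))) * (4 * (Gm * (1 + Gm))).
    by apply: Rmult_le_compat_r; [lra|exact: Rmin_r].
  rewrite Rinv_l; lra.
pose m := k0 * exp (- be * 2).
have m0 : 0 < m by apply: Rmult_lt_0_compat => //; exact: exp_pos.
exists (m / 2); split; first lra.
move=> t l0 t0 hl [y hy] x.
pose w x s := u x (s + t).
have sw : sol w by exact: sol_shift.
have wl x' s : 0 <= s -> w x' s >= v x' + l0.
  move=> s0; have := @cmp_from (fun x _ => v x) u (- l0) t sv su t0
     (fun z => ltac:(have := hl z; lra)) x' (s + t) ltac:(lra).
  by rewrite /w; lra.
have wball x' : norm (vsub x' y) <= rho -> w x' tau0 >= v x' + l0 + a.
  move=> hx'.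
  have q1 := hrt x' (tau0 + t) t ltac:(lra) t0 ltac:(rewrite Rplus_minus_r Rabs_pos_eq; lra).
  have q2 := g_lip (s_good su) t0 x' y; have q3 := g_lip (s_good sv) t0 x' y.
  have q4 : L * norm (vsub x' y) <= L * rho by apply: Rmult_le_compat_l; lra.
  by rewrite /w; move: q1 q2 q3; split_Rabs; lra.
pose th s := exp (- be * (s - tau0)).
pose G s := rho ^ 2 + kap * (s - tau0).
pose W (y' : vec N) s := rho ^ 2 + kap * (s - tau0) - norm (vsub y' y) ^ 2.
have th0 s : 0 < th s by exact: exp_pos.
have th1 s : tau0 <= s -> th s <= 1.
  move=> hs; rewrite /th -exp_0; have [h|->] : - be * (s - tau0) < 0 \/ - be * (s - tau0) = 0 by nra.
    by apply: Rlt_le; apply: exp_increasing.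
  lra.
have th2 s : s <= 2 -> exp (- be * 2) <= th s.
  move=> hs; have h : - be * 2 < - be * (s - tau0) by nra.
  by rewrite /th; apply: Rlt_le; apply: exp_increasing.
have WG y' s : tau0 <= s <= 2 -> W y' s <= Gm.
  by move=> hs; have := pow2_ge_0 (norm (vsub y' y)); rewrite /W /Gm; nra.
pose m1 := k0 * exp (- be * 2) * (4 * (nu * rho ^ 2)).
have m10 : 0 < m1 by repeat (apply: Rmult_lt_0_compat => //; try lra); exact: exp_pos.
have [e [e0 [he1 he2]]] := dmin2 (r1 := m1 / 4) (r2 := m / 4) ltac:(lra) ltac:(lra).
have ab : 0 < tau0 <= 2 by lra.
have [g [ga [gp [gX [gper [gcont [gprop gjet]]]]]]] := smooth_sub (s_good sv) (s_sub sv) ab e0.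
(* The largest value of the barrier: the time penalty, absent until time 1, has cancelled it at time
   2, which excludes a positive maximum there. *)
pose M := k0 * Gm ^ 2.
have M0 : 0 < M by apply: Rmult_lt_0_compat => //; nra.
pose R2 := 1 + Gm.
pose Phi (z : vec N * R) := g z.1 z.2 + (l0 - e) + k0 * (th z.2 * Rmax 0 (W z.1 z.2) ^ 2)
   + (- M) * Rmax 0 (z.2 - 1) ^ 2 - w z.1 z.2.
pose D (z : vec N * R) := norm (vsub z.1 y) <= R2 /\ tau0 <= z.2 <= 2.
have Wc z : ctn (dprod (@dV N) dR) D z (fun z => W z.1 z.2).
  apply: ctn_minus; last first.
    apply: ctn_sq; apply: (@ctn_fst _ _ _ _ D (fun _ => True) (fun x => norm (vsub x y)) z) => //; exact: ctn_dist.
  apply: ctn_plus; first exact: ctn_cst.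
  apply: ctn_scal; apply: ctn_minus; last exact: ctn_cst.
  by apply: (@ctn_snd _ _ _ _ D (fun _ => True) (fun t => t) z) => //; exact: ctn_id.
have [[xh sh] [[/= hxh hsh] hmax]] : exists z, D z /\ forall z', D z' -> Phi z' <= Phi z.
  apply: (ctn_max (d := dprod (@dV N) dR)).
  - exact: (ucpt_prod (@ucpt_ball N y R2) (@ucpt_itv tau0 2)).
  - by exists (y, tau0); split; rewrite /= ?norm_subvv /R2; lra.
  - move=> z Dz.
    have cs : ctn (dprod (@dV N) dR) D z (fun z => z.2).
      by apply: (@ctn_snd _ _ _ _ D (fun _ => True) (fun t => t) z) => //; exact: ctn_id.
    apply: ctn_minus; last first.
      move=> e1 e10; have [r [r0 hr]] := g_cont (s_good sw) z.1 (t := z.2) ltac:(case: Dz => _ [?]; lra) e10.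
      exists r; split=> // z' [_ Dz'] hd; apply: hr; first by lra.
        exact: Rle_lt_trans (Rmax_l _ _) hd.
      exact: Rle_lt_trans (Rmax_r _ _) hd.
    apply: ctn_plus; last first.
      apply: ctn_scal; apply: ctn_sq; apply: ctn_max0; apply: ctn_minus => //; exact: ctn_cst.
    apply: ctn_plus; last first.
      apply: ctn_scal; apply: ctn_mult; last by apply: ctn_sq; apply: ctn_max0.
      apply: (@ctn_comp _ _ _ _ (fun z => - be * (z.2 - tau0)) exp).
        by apply: ctn_scal; apply: ctn_minus => //; exact: ctn_cst.
      by apply: derivable_continuous_pt; apply: derivable_pt_exp.
    apply: ctn_plus; last exact: ctn_cst.
    move=> e1 e10; have [r [r0 hr]] := gcont e1 e10.
    exists r; split=> // z' _ hd; apply: hr.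
      exact: Rle_lt_trans (Rmax_l _ _) hd.
    exact: Rle_lt_trans (Rmax_r _ _) hd.
have Phi0 : Phi (xh, sh) <= 0.
  apply: Rnot_lt_le => hpos.
  have [gc [gn [gs ge]]] := gprop xh sh hsh.
  have wlx := wl xh sh ltac:(lra).
  have pen0 : 0 <= M * Rmax 0 (sh - 1) ^ 2 by apply: Rmult_le_pos; [lra|exact: pow2_ge_0].
  have Wpos : 0 < W xh sh.
    apply: Rnot_le_lt => hW; move: hpos; rewrite /Phi /= Rmax_left // => hpos.
    by move: gc; split_Rabs; lra.
  have RW : Rmax 0 (W xh sh) = W xh sh by rewrite Rmax_right; lra.
  have Wsq : th sh * W xh sh ^ 2 <= Gm ^ 2.
    have : W xh sh ^ 2 <= Gm ^ 2 by apply: pow_incr; have := WG xh sh hsh; lra.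
    by have := Rmult_le_compat_r _ _ _ (pow2_ge_0 (W xh sh)) (th1 sh ltac:(lra)); lra.
  have kW : k0 * (th sh * W xh sh ^ 2) <= k0 * Gm ^ 2 by apply: Rmult_le_compat_l; lra.
  have sh1 : tau0 < sh.
    have [//|heq] : tau0 < sh \/ tau0 = sh by lra.
    have : norm (vsub xh y) <= rho.
      apply: norm_le_sq; first lra.
      by rewrite -norm_sq; move: Wpos; rewrite /W -heq; lra.
    move=> /wball; rewrite heq => hb.
    move: hpos; rewrite /Phi /= RW; move: gc; split_Rabs; lra.
  have sh2 : sh < 2.
    have [//|heq] : sh < 2 \/ sh = 2 by lra.
    move: hpos; rewrite /Phi /= RW.
    have -> : Rmax 0 (sh - 1) = 1 by rewrite Rmax_right heq; lra.
    move: gc; rewrite /M; split_Rabs; lra.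
  have xin : norm (vsub xh y) < R2.
    apply: Rnot_le_lt => h.
    have : R2 ^ 2 <= norm (vsub xh y) ^ 2 by apply: pow_incr; rewrite /R2 in h *; lra.
    have : norm (vsub xh y) ^ 2 < Gm.
      have := Rmult_le_compat_l kap _ _ ltac:(lra) (Rlt_le _ _ sh2); have : 0 <= kap * tau0 by apply: Rmult_le_pos; lra.
      by move: Wpos; rewrite /W /Gm; lra.
    have : 0 <= Gm ^ 2 by exact: pow2_ge_0.
    by rewrite /R2; lra.
  pose z := vsub xh y.
  have lt1 := low_test_scal (Rlt_le _ _ k00) (@harnack_low y be tau0 (rho ^ 2) kap sh xh z (Rlt_le _ _ be0) (erefl _)).
  have lt2 := @low_test_time N xh sh 1 M (Rlt_le _ _ M0).
  have lt := low_test_add lt1 lt2.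
  rewrite -/(W xh sh) -/(th sh) in lt.
  set W0 := W xh sh in Wpos RW Wsq kW lt *; set th' := th sh in Wsq kW lt *.
  have th'0 : 0 < th' by exact: th0.
  have zn0 : 0 <= norm z by exact: norm_ge0.
  have zsq : norm z ^ 2 + W0 <= Gm /\ rho ^ 2 <= norm z ^ 2 + W0.
    have := Rmult_le_compat_l kap _ _ ltac:(lra) (Rlt_le _ _ sh2); have : 0 <= kap * (sh - tau0) by apply: Rmult_le_pos; lra.
    have : 0 <= kap * tau0 by apply: Rmult_le_pos; lra.
    by rewrite /W0 /W /Gm -/z; lra.
  have zn : norm z <= 1 + Gm by move: xin; rewrite -/z /R2; lra.
  have pn : norm (vadd (vscale k0 (vscale (th' * (-4 * W0)) z)) (@vzero N)) <= k0 * th' * (4 * W0) * norm z.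
    apply: Rle_trans (norm_triang _ _) _; rewrite norm_zero !norm_scale.
    rewrite (Rabs_pos_eq k0); last lra.
    rewrite Rabs_left; last by have := Rmult_lt_0_compat _ _ th'0 Wpos; lra.
    by apply: Req_le; ring.
  have pn1 : k0 * th' * (4 * W0) * norm z <= 1.
    apply: Rle_trans k0p.
    have W0le : W0 <= Gm by apply: WG.
    have a1 : W0 * norm z <= Gm * (1 + Gm) by apply: Rmult_le_compat; lra.
    have a0' : 0 <= W0 * norm z by apply: Rmult_le_pos; lra.
    have a2 : th' <= 1 by apply: th1; lra.
    have a3 : th' * (W0 * norm z) <= 1 * (Gm * (1 + Gm)) by apply: Rmult_le_compat; lra.
    have : k0 * (4 * (th' * (W0 * norm z))) <= k0 * (4 * (1 * (Gm * (1 + Gm)))) by apply: Rmult_le_compat_l; lra.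
    lra.
  have shp : 0 < sh by lra.
  have sX : symmetric (madd (mscale k0 (madd (mscale (8 * th') (outer z)) (mscale (-4 * th' * W0) mid))) (mscale 0 mid)).
    apply: sym_madd; last by apply: sym_mscale; exact: sym_mid.
    by apply: sym_mscale; apply: sym_madd; apply: sym_mscale; [exact: sym_outer|exact: sym_mid].
  have [|thh] := touch hCR' (s_sup sw) shp (gjet xh sh) lt gs sX gn (Rle_trans _ _ _ pn pn1) ge _ e0.
  - have [r1 [r10 hr1]] := Wc (xh, sh) W0 Wpos.
    have [r2 [r20 [u1 u2]]] := dmin2 r10 (r2 := R2 - norm (vsub xh y)) ltac:(lra).
    have [r3 [r30 [u3 u4]]] := dmin2 (r1 := sh - tau0) (r2 := 2 - sh) ltac:(lra) ltac:(lra).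
    have [r [r0 [u5 u6]]] := dmin2 r20 r30.
    exists r; split=> // y' s hy' hs'.
    have Dy : D (y', s).
      split=> /=; last by split_Rabs; lra.
      have := norm_sub_triang y' xh y; lra.
    have := hmax (y', s) Dy.
    have Wy : 0 < W y' s.
      have := hr1 (y', s) Dy; rewrite /= -/W0 => h.
      have : Rabs (W y' s - W0) < W0 by apply: h; apply: Rmax_lub_lt; rewrite /= /dV /dR; lra.
      by split_Rabs; lra.
    rewrite /Phi /= RW (Rmax_right 0 (W y' s)); last lra.
    rewrite /W0 /th' /W /th; lra.
  rewrite trprodD !trprodZ trprodD !trprodZ trprod_outer trprod_mid.
  have el := Hell thh xh z; rewrite -norm_sq in el.
  have sb := mnorm_sq_bd thh xh.
  have pnC := Rmult_le_compat_l CR _ _ (Rlt_le _ _ CR0) pn.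
  have Rp : 0 <= M * (2 * Rmax 0 (sh - 1)) by apply: Rmult_le_pos; [lra|have := Rmax_l 0 (sh - 1); lra].
  have kt0 : 0 < k0 * th' by apply: Rmult_lt_0_compat.
  pose br := 2 * W0 * kap - be * W0 ^ 2 - 8 * nu * norm z ^ 2 + 4 * W0 * C ^ 2 + 4 * CR * W0 * (1 + Gm).
  have brle : br <= - (4 * (nu * rho ^ 2)).
    have b1 : br <= (K + 8 * nu) * W0 - be * W0 ^ 2 - 8 * (nu * rho ^ 2).
      have : nu * rho ^ 2 <= nu * (norm z ^ 2 + W0) by apply: Rmult_le_compat_l; lra.
      by rewrite /br /K; lra.
    have b2 : 0 <= be * (W0 - (K + 8 * nu) / (2 * be)) ^ 2.
      by apply: Rmult_le_pos; [lra|exact: pow2_ge_0].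
    have b3 : be * (W0 - (K + 8 * nu) / (2 * be)) ^ 2 = be * W0 ^ 2 - (K + 8 * nu) * W0 + (K + 8 * nu) ^ 2 / (4 * be).
      by field; lra.
    have b4 : (K + 8 * nu) ^ 2 / (4 * be) = 4 * (nu * rho ^ 2).
      rewrite /be; field; repeat split; try lra; nra.
    lra.
  have c1 : k0 * th' * br <= k0 * th' * - (4 * (nu * rho ^ 2)) by apply: Rmult_le_compat_l; lra.
  have c2 : m1 <= k0 * th' * (4 * (nu * rho ^ 2)).
    apply: Rmult_le_compat_r; first lra.
    by apply: Rmult_le_compat_l; [lra|apply: th2; lra].
  have c3 : k0 * th' * (8 * quad (gram (sigma thh xh)) z) >= k0 * th' * (8 * (nu * norm z ^ 2)).
    by apply: Rle_ge; apply: Rmult_le_compat_l; lra.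
  have kt : 0 <= k0 * th' * (4 * W0) by repeat apply: Rmult_le_pos; lra.
  have c4 : k0 * th' * (4 * W0) * mnorm (sigma thh xh) ^ 2 <= k0 * th' * (4 * W0) * C ^ 2.
    by apply: Rmult_le_compat_l => //; exact: mnorm_sq_bd.
  have c5 : CR * (k0 * th' * (4 * W0) * norm z) <= CR * (k0 * th' * (4 * W0) * (1 + Gm)).
    by apply: Rmult_le_compat_l; [lra|apply: Rmult_le_compat_l; lra].
  by rewrite /br in c1; lra.
have [kk hkk] := box_repr (vsub x y).
pose x1 := vadd x (vint kk).
have hx1 : norm (vsub x1 y) <= nN.
  have -> : vsub x1 y = vadd (vsub x y) (vint kk) by rewrite /x1; vring.
  exact: inbox_norm.
have D1 : D (x1, 1).
  split=> /=; last lra.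
  have : nN <= kap by rewrite /kap; have := pow2_ge_0 (nN - 1); lra.
  by rewrite /R2 /Gm; lra.
have := Rle_trans _ _ _ (hmax _ D1) Phi0; rewrite /Phi /=.
have -> : Rmax 0 (1 - 1) = 0 by rewrite Rmax_left; lra.
have W1 : 1 <= W x1 1.
  have : norm (vsub x1 y) ^ 2 <= nN ^ 2 by apply: pow_incr; split=> //; exact: norm_ge0.
  have q := Rmult_le_compat_l kap tau0 (/ 2) ltac:(lra) tau0h.
  by have := pow2_ge_0 rho; rewrite /W; rewrite /kap in q *; lra.
have RW : Rmax 0 (W x1 1) = W x1 1 by rewrite Rmax_right; lra.
rewrite RW.
have [gc _] := gprop x1 1 ltac:(lra).
have W2 : exp (- be * 2) <= th 1 * W x1 1 ^ 2.
  have h1 := th2 1 ltac:(lra); have h2 := th0 1.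
  have h3 : 1 ^ 2 <= W x1 1 ^ 2 by apply: pow_incr; lra.
  have := Rmult_le_compat_l (th 1) _ _ (Rlt_le _ _ h2) h3; lra.
have W3 : m <= k0 * (th 1 * W x1 1 ^ 2) by apply: Rmult_le_compat_l; lra.
have -> : w x1 1 = u x (t + 1) by rewrite /w Rplus_comm /x1; exact: (g_per (s_good su)).
have -> : v x = v x1 by rewrite /x1; symmetry; exact: (g_per (s_good sv) 0).
by move: gc; split_Rabs; lra.
Qed.

(** By comparison lower bounds of [u - v] persist, and [l] is their supremum over all times. Once
    the lower bound is within [m] of [l], an excess at any point would let [harnack_step] raise it
    beyond [l]. *)
Lemma harnack_conv : exists l, forall e, 0 < e -> exists T, 0 <= T /\ forall t, T <= t ->
  forall x, Rabs (u x t - v x - l) <= e.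
Proof.
have [B1 [B10 hB1]] := good_bound (s_good su) 0; have [B2 [B20 hB2]] := good_bound (s_good sv) 0.
have bd x t : 0 <= t -> Rabs (u x t - v x) <= B1 + B2.
  move=> t0; apply: (@cmp_abs u (fun x _ => v x) (B1 + B2) 0 su sv) => //; first lra.
  move=> z; have := hB1 z 0 ltac:(lra); have := hB2 z 0 ltac:(lra); split_Rabs; lra.
have [l [l1 l2]] : {l | is_lub (fun r => exists t, 0 <= t /\ forall x, u x t - v x >= r) l}.
  apply: completeness.
    exists (B1 + B2) => r [t [t0 hr]]; have := hr (@vzero N); have := bd (@vzero N) t t0; split_Rabs; lra.
  exists (- (B1 + B2)), 0; split; first lra.
  by move=> x; have := bd x 0 ltac:(lra); split_Rabs; lra.
exists l => e e0.
have [m [m0 hm]] := harnack_step (a := e / 4) ltac:(lra).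
have [k [k0 [k1 k2]]] := dmin2 m0 (r2 := e / 2) ltac:(lra).
have [r [[T [T0 hT]] hr]] : exists r, (exists t, 0 <= t /\ forall x, u x t - v x >= r) /\ l - k < r.
  apply: NNPP => hn; have : l <= l - k; last lra.
  apply: l2 => r hr; apply: Rnot_lt_le => h; apply: hn; by exists r.
exists T; split=> // t hTt x.
have low z s : T <= s -> u z s - v z >= r.
  move=> hs; have := @cmp_from (fun x _ => v x) u (- r) T sv su T0
     (fun z => ltac:(have := hT z; lra)) z s hs; lra.
have hr' : r <= l by apply: l1; exists T.
have lo := low x t hTt.
have up : u x t - v x < r + 2 * (e / 4).
  apply: Rnot_le_lt => hx.
  have := hm t r ltac:(lra) (fun z => low z t hTt) ltac:(exists x; lra) => h.
  have : r + m <= l by apply: l1; exists (t + 1); split; [lra|].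
  lra.
by split_Rabs; lra.
Qed.
End Harnack.

(** * The contact function and the Hopf principle *)

Section Contact.
Variables (u : vec N -> R -> R) (v : vec N -> R) (su : sol u) (sv : sol (fun x _ => v x)).
Variables (B2 eta mu : R) (eta0 : 0 < eta) (mu01 : 0 <= mu < 1).
Hypothesis ubd : forall x t, 0 <= t -> 1 <= u x t - v x <= B2.
Definition Psi x t h := u x (t + h) - v x + eta * h - mu * (u x t - v x).
Hypothesis Hlow : forall ka, 0 < ka -> exists T, 0 <= T /\ forall x t h, T <= t -> 0 <= h -> - ka <= Psi x t h.
Hypothesis Hnot : forall ka, 0 < ka -> ~ exists T, 0 <= T /\ forall x t h, T <= t -> 0 <= h -> ka <= Psi x t h.

Lemma mu_gt0 : 0 < mu.
Proof.
apply: Rnot_le_lt => hm; have m0 : mu = 0 by lra.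
apply: (Hnot Rlt_0_1); exists 0; split; first lra.
move=> x t h t0 h0; have := ubd x (t := t + h) ltac:(lra).
have : 0 <= eta * h by apply: Rmult_le_pos; lra.
by rewrite /Psi m0; lra.
Qed.

(** The levels whose supremum [D x] is the lower limit, as [t] tends to infinity, of the infimum of
    [Psi x t h] over [h >= 0]. Working with it directly avoids extracting limits of time translates
    of [u]. *)
Definition eventually_ge x r := exists T, 0 <= T /\ forall t h, T <= t -> 0 <= h -> r <= Psi x t h.
Lemma D_ex x : {l | is_lub (eventually_ge x) l}.
Proof.
apply: completeness.
  exists B2 => r [T [T0 h]]; have := h T 0 ltac:(lra) ltac:(lra).
  have := ubd x T0; rewrite /Psi Rplus_0_r; have := mu01; nra.
have [T [T0 h]] := Hlow Rlt_0_1; exists (- (1)), T; split=> //.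
by move=> t k ht hk; apply: h.
Qed.
Definition D x := proj1_sig (D_ex x).
Lemma D_lub x : is_lub (eventually_ge x) (D x).
Proof. exact: (proj2_sig (D_ex x)). Qed.
Lemma D_lt x r : r < D x -> eventually_ge x r.
Proof.
move=> h; apply: NNPP => hn; have : D x <= r; last lra.
apply: (proj2 (D_lub x)) => r' [T [T0 hT]]; apply: Rnot_lt_le => hr; apply: hn.
by exists T; split=> // t k ht hk; have := hT t k ht hk; lra.
Qed.
Lemma D_gt x r T : D x < r -> 0 <= T -> exists t h, T <= t /\ 0 <= h /\ Psi x t h < r.
Proof.
move=> h T0; apply: NNPP => hn; have : r <= D x; last lra.
apply: (proj1 (D_lub x)); exists T; split=> // t k ht hk.
by apply: Rnot_lt_le => hr; apply: hn; exists t, k.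
Qed.
Lemma Psi_lip x y t h : 0 <= t -> 0 <= h -> Psi x t h <= Psi y t h + 4 * L * norm (vsub x y).
Proof.
move=> t0 h0.
have q1 := g_lip (s_good su) (t := t + h) ltac:(lra) x y; have q2 := g_lip (s_good su) t0 x y.
have q3 := g_lip (s_good sv) t0 x y.
have n0 := norm_ge0 (vsub x y); have n1 : 0 <= L * norm (vsub x y) by nra.
have q4 : mu * ((u y t - v y) - (u x t - v x)) <= 2 * (L * norm (vsub x y)).
  have : (u y t - v y) - (u x t - v x) <= 2 * (L * norm (vsub x y)) by move: q2 q3; split_Rabs; lra.
  have := mu01; nra.
by rewrite /Psi; move: q1 q3; split_Rabs; lra.
Qed.
Lemma D_lip x y : D x - D y <= 4 * L * norm (vsub x y).
Proof.
have : D x <= D y + 4 * L * norm (vsub x y); last lra.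
apply: (proj2 (D_lub x)) => r [T [T0 hT]].
have : r - 4 * L * norm (vsub x y) <= D y; last lra.
apply: (proj1 (D_lub y)); exists T; split=> // t h ht hh.
have := hT t h ht hh; have := @Psi_lip x y t h ltac:(lra) hh; lra.
Qed.
Lemma D_Lip : Lip (4 * L) D.
Proof.
move=> x y; have := D_lip x y; have := D_lip y x; rewrite (norm_subC y x); split_Rabs; lra.
Qed.
Lemma Psi_per x k t h : Psi (vadd x (vint k)) t h = Psi x t h.
Proof.
rewrite /Psi; have -> := g_per (s_good su) (t + h) x k; have -> := g_per (s_good su) t x k.
by have -> := g_per (s_good sv) 0 x k.
Qed.
Lemma D_per : periodic D.
Proof.
move=> x k; apply: Rle_antisym.
  by apply: (proj2 (D_lub _)) => r [T [T0 h]]; apply: (proj1 (D_lub x)); exists T; split=> // t q ht hq;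
    rewrite -(Psi_per x k); apply: h.
by apply: (proj2 (D_lub _)) => r [T [T0 h]]; apply: (proj1 (D_lub _)); exists T; split=> // t q ht hq;
  rewrite Psi_per; apply: h.
Qed.
(** Both [D] and [Psi] are Lipschitz in [x] with constant [4 * L], whatever the times, so the
    waiting time found at one point serves its neighbours; compactness of a period does the rest. *)
Lemma D_unif ka : 0 < ka -> exists T, 0 <= T /\ forall x t h, T <= t -> 0 <= h -> D x - ka <= Psi x t h.
Proof.
move=> k0.
have [m [m0 hm]] : exists m, 0 < m /\ forall x, inbox x -> forall t h, / m <= t -> 0 <= h -> D x - ka <= Psi x t h.
  apply: (ucpt_uniform (P := fun x m => forall t h, / m <= t -> 0 <= h -> D x - ka <= Psi x t h) (@ucpt_inbox N)).
    move=> x m m' hx [h1 h2] t h ht hh; apply: hx => //.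
    by apply: Rle_trans ht; apply: Rinv_le_contravar.
  move=> x _; have [T [T0 hT]] := @D_lt x (D x - ka / 2) ltac:(lra).
  have T1 : 0 < T + 1 by lra.
  exists (/ (T + 1)), (ka / (16 * L)); split; first exact: Rinv_0_lt_compat.
  have d0 : 0 < ka / (16 * L) by apply: Rdiv_lt_0_compat; lra.
  split=> // y _ hy t h; rewrite Rinv_inv => ht hh.
  have h1 := hT t h ltac:(lra) hh.
  have h2 := @Psi_lip x y t h ltac:(lra) hh; have h3 := D_lip y x.
  rewrite (norm_subC x y) in h2; rewrite /dV in hy.
  have : 8 * L * norm (vsub y x) <= 8 * L * (ka / (16 * L)) by apply: Rmult_le_compat_l; lra.
  have -> : 8 * L * (ka / (16 * L)) = ka / 2 by field; lra.
  lra.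
exists (/ m); split; first by apply: Rlt_le; apply: Rinv_0_lt_compat.
move=> x t h ht hh; have [k hk] := box_repr x.
by rewrite -(D_per x k) -(Psi_per x k); apply: hm.
Qed.
Lemma D_ge0 x : 0 <= D x.
Proof.
apply: le_epsilon => ka k0; have [T [T0 h]] := Hlow k0.
suff : - ka <= D x by lra.
by apply: (proj1 (D_lub x)); exists T; split=> // t q ht hq; apply: h.
Qed.
Lemma D_ctn dom x : ctn (@dV N) dom x D.
Proof. by apply: (@ctn_lip _ _ _ _ _ (4 * L)); [lra|move=> y _; exact: D_Lip]. Qed.
(** A positive minimum of [D] would, after a uniform waiting time, be a positive lower bound for
    [Psi] everywhere, which [Hnot] excludes. *)
Lemma D_zero : exists x, D x = 0.
Proof.
have [x [hx hmin]] := ctn_min (@ucpt_inbox N) (ex_intro _ _ (@inbox_zero N)) (fun x _ => @D_ctn _ x).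
exists x; apply: Rle_antisym; last exact: D_ge0.
apply: Rnot_lt_le => hpos.
have [T [T0 hT]] := @D_unif (D x / 2) ltac:(lra).
apply: (@Hnot (D x / 2)); first lra.
exists T; split=> // y t h ht hh; apply: Rle_trans (hT y t h ht hh).
have [k hk] := box_repr y; have := hmin _ hk; rewrite (D_per y k); lra.
Qed.

(** Hopf's argument, transferred from the contact function to the solutions: at late times [D] is
    nearly realised by the supersolution [u] minus a smooth approximation of the subsolution
    [mu u + (1 - mu) v], and a small multiple of the barrier is added to the latter. *)
Lemma no_interior_touch z y R0 nu dd : 0 < R0 -> 0 < nu -> 0 < dd -> D z = 0 -> norm (vsub z y) = R0 ->
  (forall x, norm (vsub x y) <= R0 -> D x = 0 -> x = z) ->
  (forall x, norm (vsub x z) <= dd -> forall th xi, quad (gram (sigma th x)) xi >= nu * dot xi xi) -> False.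
Proof.
move=> R00 nu0 dd0 Dz zy hZ ell.
have [CR [CR0 hCR]] := HH_lip (Rr := L + 1) ltac:(lra).
have hCR' th x p q : norm p <= L + 1 -> norm q <= L + 1 -> Rabs (H th x p - H th x q) <= CR * norm (vsub p q).
  by move=> hp hq; have := hCR th x x p q hp hq; rewrite norm_subvv Rplus_0_l.
have nR : 0 < 2 * nu * R0 ^ 2 by have : 0 < nu * R0 ^ 2 by [apply: Rmult_lt_0_compat => //; apply: pow_lt]; lra.
(* On the small ball [norm zz >= R0 / 2], so the normal second derivative contributes at least
   [2 * nu * R0 ^ 2 * K]; it must beat the tangential trace, at most [3 * C ^ 2], and the
   Hamiltonian, at most [5 * CR * R0], by the margin 1. *)
pose K := (3 * C ^ 2 + 5 * CR * R0 + 1) / (2 * nu * R0 ^ 2).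
have KE : 2 * nu * R0 ^ 2 * K = 3 * C ^ 2 + 5 * CR * R0 + 1 by rewrite /K; field; lra.
have K0 : 0 < K.
  apply: Rdiv_lt_0_compat => //; have := pow2_ge_0 C; have : 0 < CR * R0 by apply: Rmult_lt_0_compat.
  lra.
clearbody K.
have [d1 [d10 [u1 u2]]] := dmin2 dd0 (r2 := R0 / 2) ltac:(lra).
have [d2 hd2] := small_prod (a := / 4) (b := K * (3 * R0)) ltac:(lra) ltac:(nra).
case: hd2 => d20 hd2.
have [d [d0 [u3 u4]]] := dmin2 d10 d20.
pose w x := R0 ^ 2 - norm (vsub x y) ^ 2.
have ball x : norm (vsub x z) <= d -> R0 / 2 <= norm (vsub x y) <= 3 / 2 * R0 /\ Rabs (2 * K * w x) <= / 2.
  move=> hx.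
  have a1 := norm_sub_triang x z y; have a2 := norm_sub_triang z x y; rewrite (norm_subC z x) in a2.
  have n0 := norm_ge0 (vsub x y).
  split; first by lra.
  have a3 : Rabs (w x) <= 3 * R0 * d.
    have -> : w x = (R0 - norm (vsub x y)) * (R0 + norm (vsub x y)) by rewrite /w; ring.
    rewrite Rabs_mult (Rabs_pos_eq (R0 + _)); last lra.
    have b1 : Rabs (R0 - norm (vsub x y)) <= d by split_Rabs; lra.
    have := Rabs_pos (R0 - norm (vsub x y)); nra.
  have a4 := hd2 d ltac:(lra).
  rewrite !Rabs_mult (Rabs_pos_eq 2) ?(Rabs_pos_eq K); try lra.
  have : K * Rabs (w x) <= K * (3 * R0 * d) by apply: Rmult_le_compat_l; lra.
  lra.
pose psi x := w x + K * w x ^ 2.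
have psiE x : psi x = w x * (1 + K * w x) by rewrite /psi; ring.
have psib x : norm (vsub x z) <= d -> psi x <= 2 * R0 ^ 2.
  move=> /ball [hb hw]; rewrite psiE.
  have wle : w x <= R0 ^ 2 by rewrite /w; have := pow2_ge_0 (norm (vsub x y)); lra.
  have f1 : 0 < 1 + K * w x <= 2 by move: hw; split_Rabs; lra.
  have [h|h] := Rle_lt_dec 0 (w x); first by nra.
  have := pow2_ge_0 R0; nra.
have psin x : norm (vsub x z) <= d -> w x < 0 -> psi x < 0.
  move=> /ball [hb hw] hn; rewrite psiE.
  have f1 : 0 < 1 + K * w x by move: hw; split_Rabs; lra.
  nra.
have psiz : psi z = 0 by rewrite /psi /w zy; ring.
have wc dom x : ctn (@dV N) dom x w.
  by apply: ctn_minus; [exact: ctn_cst|apply: ctn_sq; exact: ctn_dist].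
have psic dom x : ctn (@dV N) dom x psi.
  by apply: ctn_plus => //; apply: ctn_scal; apply: ctn_sq.
(* On the sphere about [z] the barrier is harmless: where [w < 0] it is negative, and where [w >= 0]
   the function [D] is bounded below, [z] being its only zero in the large ball. The bound on
   [k * (9 * R0)] keeps the gradient admissible for [touch]. *)
have [k [k0 [kR kS]]] : exists k, 0 < k /\ k * (9 * R0) <= 1 /\
   forall x, norm (vsub x z) = d -> 0 < D x - k * psi x.
  pose S x := norm (vsub x z) = d /\ 0 <= w x.
  have cS : ucpt (@dV N) S.
    apply: (ucpt_sub (@ucpt_ball N z d)); first by move=> x [h _]; lra.
    move=> x _ hx; split.
      apply: cond_eq => e e0; have [y' [[h1 h2] h3]] := hx e e0.
      have := norm_sub_triang x y' z; have := norm_sub_triang y' x z; rewrite (norm_subC x y').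
      by rewrite /dV in h3; rewrite h1; split_Rabs; lra.
    apply: Rnot_lt_le => hw.
    have [r [r0 hr]] := wc (fun _ => True) x (- w x) ltac:(lra).
    have [y' [[h1 h2] h3]] := hx r r0; have := hr y' I h3; split_Rabs; lra.
  have [m1 [m10 hm1]] : exists m, 0 < m /\ forall x, S x -> m <= D x.
    have [hne|hne] := classic (exists x, S x); last first.
      by exists 1; split; [lra|move=> x Sx; case: hne; exists x].
    have [x [Sx hx]] := ctn_min cS hne (fun x _ => @D_ctn _ x).
    exists (D x); split=> //.
    have [//|h] := Rle_lt_or_eq_dec _ _ (D_ge0 x).
    have : x = z.
      apply: hZ => //; case: Sx => _; rewrite /w => h1; have := norm_ge0 (vsub x y); nra.
    by move=> E; move: (proj1 Sx); rewrite E norm_subvv; lra.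
  have p1 : 0 < / (9 * R0) by apply: Rinv_0_lt_compat; lra.
  have p2 : 0 < m1 / (4 * R0 ^ 2) by apply: Rdiv_lt_0_compat => //; have := pow_lt R0 2 R00; lra.
  have [k [k0 [h1 h2]]] := dmin2 p1 p2.
  exists k; split=> //; split.
    have : k * (9 * R0) <= / (9 * R0) * (9 * R0) by apply: Rmult_le_compat_r; lra.
    rewrite Rinv_l; lra.
  move=> x hx; have [hw|hw] := Rle_lt_dec 0 (w x).
    have q1 := hm1 x (conj hx hw); have q2 := psib x ltac:(lra).
    have R2 := pow_lt R0 2 R00.
    have : k * psi x <= k * (2 * R0 ^ 2) by apply: Rmult_le_compat_l; lra.
    have : k * (2 * R0 ^ 2) <= m1 / (4 * R0 ^ 2) * (2 * R0 ^ 2) by apply: Rmult_le_compat_r; lra.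
    have -> : m1 / (4 * R0 ^ 2) * (2 * R0 ^ 2) = m1 / 2 by field; lra.
    lra.
  have := psin x ltac:(lra) hw; have := D_ge0 x; nra.
have cB := @ucpt_ball N z d.
have Dk dom x : ctn (@dV N) dom x (fun x => D x - k * psi x).
  by apply: ctn_minus; [exact: D_ctn|apply: ctn_scal].
have [m [m0 hm]] : exists m, 0 < m /\ forall x, norm (vsub x z) = d -> m <= D x - k * psi x.
  have cS : ucpt (@dV N) (fun x => norm (vsub x z) = d).
    apply: (ucpt_sub cB); first by move=> x h; lra.
    move=> x _ hx; apply: cond_eq => e e0; have [y' [h1 h3]] := hx e e0.
    have := norm_sub_triang x y' z; have := norm_sub_triang y' x z; rewrite (norm_subC x y').
    by rewrite /dV in h3; rewrite h1; split_Rabs; lra.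
  have [hne|hne] := classic (exists x, norm (vsub x z) = d); last first.
    by exists 1; split; [lra|move=> x Sx; case: hne; exists x].
  have [x [Sx hx]] := ctn_min cS hne (fun x _ => @Dk _ x).
  by exists (D x - k * psi x); split=> //; apply: kS.
have zz0 : norm (vsub z z) <= d by rewrite norm_subvv; lra.
have [x1 [hx1 hmin]] := ctn_min cB (ex_intro (fun x => norm (vsub x z) <= d) z zz0) (fun x _ => @Dk _ x).
have q0 : D x1 - k * psi x1 <= 0 by have := hmin z zz0; rewrite Dz psiz; lra.
have [e [e0 [em ek]]] := dmin2 (r1 := m / 8) (r2 := k / 32) ltac:(lra) ltac:(lra).
have [T [T0 hT]] := D_unif e0.
(* Times at which [Psi] almost attains its lower limit at [x1]. From here on [h1] is fixed, so
   [eta * h1] is a mere constant; the margin 2 keeps the time window of radius 1 beyond [T]. *)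
have [t1 [h1 [ht1 [hh1 hP]]]] := @D_gt x1 (D x1 + e) (T + 2) ltac:(lra) ltac:(lra).
have ab : 0 < t1 - 1 <= t1 + 1 by lra.
have [g [ga [gp [gX [gper [gcont [gprop gjet]]]]]]] := smooth_sub (s_good su) (s_sub su) ab e0.
have [f [fa [fp [fX [fper [fcont [fprop fjet]]]]]]] := smooth_sub (s_good sv) (s_sub sv) ab e0.
(* Large enough for values of order [e <= k / 32] to confine the contact to [|s - s1| < 1], small
   enough for the resulting slope, at most [k / 2], to stay below the strict margin [k] of the
   barrier. *)
pose k2 := k / 4.
pose gg x s := mu * g x (s - h1) + (1 - mu) * f x (s - h1).
pose s1 := t1 + h1.
pose G (p : vec N * R) := gg p.1 p.2 + (k * psi p.1 + (- k2) * (p.2 - s1) ^ 2) - u p.1 p.2.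
pose dom (p : vec N * R) := norm (vsub p.1 z) <= d /\ s1 - 1 <= p.2 <= s1 + 1.
have mu1 : 0 <= mu <= 1 by lra.
have [[xh sh] [[/= hxh hsh] hmax]] : exists p, dom p /\ forall p', dom p' -> G p' <= G p.
  apply: (ctn_max (d := dprod (@dV N) dR)).
  - exact: (ucpt_prod cB (@ucpt_itv (s1 - 1) (s1 + 1))).
  - by exists (z, s1); split; rewrite /= ?norm_subvv; lra.
  - move=> p Dp.
    have gc (q : vec N -> R -> R) : (forall e, 0 < e -> exists r, 0 < r /\ forall x y s t,
       norm (vsub x y) < r -> Rabs (s - t) < r -> Rabs (q x s - q y t) < e) ->
       ctn (dprod (@dV N) dR) dom p (fun p => q p.1 (p.2 - h1)).
      move=> hq e1 e10; have [r [r0 hr]] := hq e1 e10; exists r; split=> // p' _ hd; apply: hr.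
        exact: Rle_lt_trans (Rmax_l _ _) hd.
      have -> : p'.2 - h1 - (p.2 - h1) = p'.2 - p.2 by ring.
      exact: Rle_lt_trans (Rmax_r _ _) hd.
    apply: ctn_minus.
      apply: ctn_plus; first by apply: ctn_plus; apply: ctn_scal; apply: gc.
      apply: ctn_plus.
        by apply: ctn_scal; apply: (@ctn_fst _ _ _ _ dom (fun _ => True) psi p).
      apply: ctn_scal; apply: ctn_sq; apply: ctn_minus; last exact: ctn_cst.
      by apply: (@ctn_snd _ _ _ _ dom (fun _ => True) (fun t => t) p) => //; exact: ctn_id.
    move=> e1 e10; have [r [r0 hr]] := g_cont (s_good su) p.1 (t := p.2) ltac:(case: Dp => _; rewrite /s1; lra) e10.
    exists r; split=> // p' [_ Dp'] hd; apply: hr; first by rewrite /s1 in Dp'; lra.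
      exact: Rle_lt_trans (Rmax_l _ _) hd.
    exact: Rle_lt_trans (Rmax_r _ _) hd.
have ggPsi x s : s1 - 1 <= s <= s1 + 1 ->
   Rabs (gg x s - u x s + Psi x (s - h1) h1 - eta * h1) <= e.
  move=> hs.
  have [a1 _] := gprop x (s - h1) ltac:(rewrite /s1 in hs; lra).
  have [a2 _] := fprop x (s - h1) ltac:(rewrite /s1 in hs; lra).
  have -> : gg x s - u x s + Psi x (s - h1) h1 - eta * h1
    = mu * (g x (s - h1) - u x (s - h1)) + (1 - mu) * (f x (s - h1) - v x).
    rewrite /gg /Psi; have -> : s - h1 + h1 = s by ring.
    ring.
  apply: Rle_trans (Rabs_triang _ _) _; rewrite !Rabs_mult (Rabs_pos_eq mu) ?(Rabs_pos_eq (1 - mu)); try lra.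
  have : mu * Rabs (g x (s - h1) - u x (s - h1)) <= mu * e by apply: Rmult_le_compat_l; lra.
  have : (1 - mu) * Rabs (f x (s - h1) - v x) <= (1 - mu) * e by apply: Rmult_le_compat_l; lra.
  lra.
have val1 : eta * h1 - (D x1 - k * psi x1) - 2 * e <= G (xh, sh).
  apply: Rle_trans (hmax (x1, s1) _); last by split=> /=; lra.
  have := ggPsi x1 s1 ltac:(lra); rewrite /G /= Rminus_diag.
  have -> : s1 - h1 = t1 by rewrite /s1; ring.
  by split_Rabs; lra.
have hPh : D xh - e <= Psi xh (sh - h1) h1 by apply: hT; rewrite /s1 in hsh; lra.
have ggh := ggPsi xh sh hsh.
have minh := hmin xh hxh.
have xin : norm (vsub xh z) < d.
  have [//|heq] := Rle_lt_or_eq_dec _ _ hxh.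
  have := hm xh heq; move: val1; rewrite /G /= => val1 hmm.
  have p0 : 0 <= k2 * (sh - s1) ^ 2 by apply: Rmult_le_pos; [rewrite /k2; lra|exact: pow2_ge_0].
  by move: ggh; split_Rabs; lra.
have tin : Rabs (sh - s1) < 1.
  have : k2 * (sh - s1) ^ 2 <= 4 * e.
    by move: val1; rewrite /G /= => val1; move: ggh; split_Rabs; lra.
  move=> h; have : (sh - s1) ^ 2 < 1.
    apply: (Rmult_lt_reg_l k2); rewrite /k2 in h *; lra.
  by move=> h3; rewrite -[X in _ < X]Rabs_R1; apply: Rsqr_lt_abs_0; rewrite !Rsqr_pow2; lra.
have [_ [gn [gs ge]]] := gprop xh (sh - h1) ltac:(rewrite /s1 in hsh; lra).
have [_ [fn [fs fe]]] := fprop xh (sh - h1) ltac:(rewrite /s1 in hsh; lra).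
have jg := jet2_comb mu1 (jet2_shift (gjet xh (sh - h1))) (jet2_shift (fjet xh (sh - h1))).
rewrite -/gg in jg.
pose zz := vsub xh y.
have lt := low_test_add (low_test_scal (Rlt_le _ _ k0) (@hopf_low N xh y zz sh K R0 (Rlt_le _ _ K0) (erefl _)))
  (@low_test_sqtime N xh sh s1 k2 ltac:(rewrite /k2; lra)).
rewrite -/(w xh) in lt.
set w0 := w xh in lt.
have [zb wb] := ball xh hxh; rewrite -/w0 -/zz in zb wb.
have w1 : / 2 <= 1 + 2 * K * w0 <= 3 / 2 by move: wb; split_Rabs; lra.
set al := 1 + 2 * K * w0 in lt w1.
have pn : norm (vadd (vscale k (vscale (-2 * al) zz)) (@vzero N)) <= k * (2 * al * norm zz).
  apply: Rle_trans (norm_triang _ _) _; rewrite norm_zero !norm_scale (Rabs_pos_eq k); last lra.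
  by rewrite (Rabs_left (-2 * al)); [apply: Req_le; ring|lra].
have alz : 2 * al * norm zz <= 9 / 2 * R0.
  have : al * norm zz <= 3 / 2 * (3 / 2 * R0) by apply: Rmult_le_compat; lra.
  lra.
have pn1 : k * (2 * al * norm zz) <= 1.
  have : k * (2 * al * norm zz) <= k * (9 / 2 * R0) by apply: Rmult_le_compat_l; lra.
  lra.
have sX : symmetric (madd (mscale k (madd (mscale (-2 * al) mid) (mscale (8 * K) (outer zz)))) (mscale 0 mid)).
  apply: sym_madd; last by apply: sym_mscale; exact: sym_mid.
  by apply: sym_mscale; apply: sym_madd; apply: sym_mscale; [exact: sym_mid|exact: sym_outer].
have sG : symmetric (madd (mscale mu (gX xh (sh - h1))) (mscale (1 - mu) (fX xh (sh - h1)))).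
  by apply: sym_madd; apply: sym_mscale.
have nG : norm (vadd (vscale mu (gp xh (sh - h1))) (vscale (1 - mu) (fp xh (sh - h1)))) <= L.
  apply: Rle_trans (norm_triang _ _) _; rewrite !norm_scale (Rabs_pos_eq mu) ?(Rabs_pos_eq (1 - mu)); try lra.
  have : mu * norm (gp xh (sh - h1)) <= mu * L by apply: Rmult_le_compat_l; lra.
  have : (1 - mu) * norm (fp xh (sh - h1)) <= (1 - mu) * L by apply: Rmult_le_compat_l; lra.
  lra.
have hG th : mu * ga xh (sh - h1) + (1 - mu) * fa xh (sh - h1) + ham sigma H th xh
    (vadd (vscale mu (gp xh (sh - h1))) (vscale (1 - mu) (fp xh (sh - h1))))
    (madd (mscale mu (gX xh (sh - h1))) (mscale (1 - mu) (fX xh (sh - h1)))) <= e.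
  have a1 := ge th; have a2 := fe th; rewrite /ham in a1 a2 *.
  rewrite trprodD !trprodZ.
  have a3 := Hconv th xh (gp xh (sh - h1)) (fp xh (sh - h1)) mu1.
  have b1 := Rmult_le_compat_l mu _ _ (proj1 mu1) a1.
  have b2 := Rmult_le_compat_l (1 - mu) _ _ ltac:(lra) a2.
  lra.
have shp : 0 < sh by rewrite /s1 in hsh; lra.
have [|th] := touch hCR' (s_sup su) shp jg lt sG sX nG (Rle_trans _ _ _ pn pn1) hG _ e0.
  have [r1 [r10 [v1 v2]]] := dmin2 (r1 := d - norm (vsub xh z)) (r2 := 1 - Rabs (sh - s1)) ltac:(lra) ltac:(lra).
  exists r1; split=> // y' s hy hs.
  apply: (hmax (y', s)); split=> /=.
    by have := norm_sub_triang y' xh z; lra.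
  by move: tin v2 hs; split_Rabs; lra.
rewrite trprodD !trprodZ trprodD !trprodZ trprod_outer trprod_mid.
have el := ell xh ltac:(lra) th zz; rewrite -norm_sq in el.
have sb := mnorm_sq_bd th xh.
have pnC := Rmult_le_compat_l CR _ _ (Rlt_le _ _ CR0) (Rle_trans _ _ _ pn (Rmult_le_compat_l k _ _ (Rlt_le _ _ k0) alz)).
have c1 : 8 * K * quad (gram (sigma th xh)) zz >= 3 * C ^ 2 + 5 * CR * R0 + 1.
  have z2 : (R0 / 2) ^ 2 <= norm zz ^ 2 by apply: pow_incr; lra.
  have : nu * (R0 / 2) ^ 2 <= nu * norm zz ^ 2 by apply: Rmult_le_compat_l; lra.
  move=> c2; have : 8 * K * (nu * (R0 / 2) ^ 2) <= 8 * K * quad (gram (sigma th xh)) zz.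
    by apply: Rmult_le_compat_l; lra.
  lra.
have c2 : 2 * al * mnorm (sigma th xh) ^ 2 <= 3 * C ^ 2.
  have : 2 * al * mnorm (sigma th xh) ^ 2 <= 3 * mnorm (sigma th xh) ^ 2.
    by apply: Rmult_le_compat_r; [exact: pow2_ge_0|lra].
  lra.
have c3 : k * (- (2 * al) * mnorm (sigma th xh) ^ 2 + 8 * K * quad (gram (sigma th xh)) zz) >= k * (5 * CR * R0 + 1).
  by apply: Rle_ge; apply: Rmult_le_compat_l; lra.
have c4 : - k2 * (2 * (sh - s1)) <= 2 * k2.
  have : - (sh - s1) <= 1 by move: tin; split_Rabs; lra.
  move=> h; have : k2 * - (sh - s1) <= k2 * 1 by apply: Rmult_le_compat_l; rewrite /k2; lra.
  lra.
have c5 : 0 < k * (CR * R0) by repeat apply: Rmult_lt_0_compat.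
rewrite /k2 in c4 *; lra.
Qed.

(** Take a zero [z] of [D] nearest to a point of [Sigma]. If [z] were outside [Sigma], the operator
    would be elliptic near it and a ball free of other zeros would touch it, which Hopf's argument
    forbids. *)
Lemma D_zero_Sigma : (exists x, inSigma sigma x) -> exists x, inSigma sigma x /\ D x = 0.
Proof.
move=> [s0 hs0]; apply: NNPP => hn.
have [z0 hz0] := D_zero.
pose S x := norm (vsub x s0) <= norm (vsub z0 s0) /\ D x = 0.
have cS : ucpt (@dV N) S.
  apply: (ucpt_sub (@ucpt_ball N s0 (norm (vsub z0 s0)))); first by move=> x [].
  move=> x hx1 hx; split=> //; apply: cond_eq => e e0.
  have [r [r0 hr]] := D_ctn (fun _ => True) x e0.
  have [y [[h1 h2] h3]] := hx r r0; have := hr y I h3; rewrite h2; split_Rabs; lra.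
have [z [[hz1 Dz] hz]] := ctn_min cS (ex_intro S z0 (conj (Rle_refl _) hz0)) (fun x _ => @ctn_dist N S s0 x).
have zn0 : 0 < norm (vsub z s0).
  have [//|/esym h] := Rle_lt_or_eq_dec _ _ (norm_ge0 (vsub z s0)).
  case: hn; exists s0; split=> //.
  have -> // : s0 = z.
  have h1 := norm0_eq h.
  by have -> : z = vadd s0 (vsub z s0) by [vring]; rewrite h1; vring.
have nz : ~ inSigma sigma z by move=> h; apply: hn; exists z.
have [nu [d [nu0 [d0 hell]]]] := ell_near C0 Hsig_per Hsig_lip Hi nz.
(* The ball having the segment from [s0] to [z] as diameter is internally tangent at [z] to the ball
   about [s0], whose interior contains no zero. The parallelogram identity [par] turns this into
   uniqueness of the zero [z]. *)
pose R0 := norm (vsub z s0) / 2.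
pose y := vscale (/ 2) (vadd s0 z).
have E1 : vsub z y = vscale (/ 2) (vsub z s0).
  by apply: functional_extensionality => i; rewrite /y /vsub /vscale /vadd; field.
apply: (@no_interior_touch z y R0 nu d) => //; first by rewrite /R0; lra.
  by rewrite E1 norm_scale Rabs_pos_eq /R0; lra.
move=> x hx Dx.
have xs : norm (vsub z s0) <= norm (vsub x s0).
  have [h|h] := Rle_lt_dec (norm (vsub x s0)) (norm (vsub z0 s0)); first by apply: hz.
  lra.
have par : norm (vsub x s0) ^ 2 + norm (vsub x z) ^ 2 = 2 * norm (vsub x y) ^ 2 + 2 * R0 ^ 2.
  have -> : vsub x s0 = vadd (vsub x y) (vscale (/ 2) (vsub z s0)).
    by apply: functional_extensionality => i; rewrite /y /vsub /vscale /vadd; field.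
  have -> : vsub x z = vadd (vsub x y) (vscale (- / 2) (vsub z s0)).
    by apply: functional_extensionality => i; rewrite /y /vsub /vscale /vadd; field.
  rewrite !norm_add_sq !norm_scale !dotZr Rabs_Ropp (Rabs_pos_eq (/ 2)); last lra.
  rewrite /R0; field.
have h1 : (2 * R0) ^ 2 <= norm (vsub x s0) ^ 2 by apply: pow_incr; rewrite /R0; lra.
have h2 : norm (vsub x y) ^ 2 <= R0 ^ 2 by apply: pow_incr; split=> //; exact: norm_ge0.
have h3 : norm (vsub x z) = 0 by have := norm_ge0 (vsub x z); nra.
have h4 := norm0_eq h3.
by have -> : x = vadd z (vsub x z) by [vring]; rewrite h4; vring.
Qed.
End Contact.

(** * Contact at a point of [Sigma] *)

Section ContactOnSigma.
Variables (u : vec N -> R -> R) (v : vec N -> R) (su : sol u) (sv : sol (fun x _ => v x)).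
Variables (B2 eta mu : R) (eta0 : 0 < eta) (mu01 : 0 < mu < 1).
Hypothesis ubd : forall x t, 0 <= t -> 1 <= u x t - v x <= B2.
Hypothesis Hlow : forall ka, 0 < ka -> exists T, 0 <= T /\ forall x t h, T <= t -> 0 <= h -> - ka <= Psi u v eta mu x t h.

(* On [Sigma] the diffusion is quadratically small, so that doubling the variables only requires the
   first-order part of the equations: [u] at time [s], [u] at time [t] and [v] are tested at nearby points. *)
Lemma no_touch_Sigma x0 : inSigma sigma x0 ->
  (forall ka T, 0 < ka -> 0 <= T -> exists t h, T <= t /\ 0 <= h /\ Psi u v eta mu x0 t h < ka) -> False.
Proof.
move=> hx0 hPsi.
(* [K1 * ep] will bound the whole penalty: [2 * ep] from the near-minimality of [Psi], and
   [L ^ 2 * ep] for each of the two Lipschitz differences absorbed by the quadratic terms. Then [Rr]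
   contains the three resulting gradients. *)
pose K1 := 2 + 2 * L ^ 2.
have K1g : 2 <= K1 by rewrite /K1; have := pow2_ge_0 L; lra.
have imu : 0 < / mu by apply: Rinv_0_lt_compat; lra.
have imu' : 0 < / (1 - mu) by apply: Rinv_0_lt_compat; lra.
pose Rr := 4 * K1 + 1 + 2 * K1 * / mu + 2 * K1 * / (1 - mu).
have q1 : 0 < 2 * K1 * / mu by apply: Rmult_lt_0_compat; lra.
have q2 : 0 < 2 * K1 * / (1 - mu) by apply: Rmult_lt_0_compat; lra.
have Rr0 : 0 < Rr by rewrite /Rr; lra.
have [CR [CR0 hCR]] := HH_lip Rr0.
(* The threshold between the two cases: gradients closer than [r] change the Hamiltonian by at most
   [eta / 8], while at distance at least [r] the uniform gap [m] is available. *)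
pose r := eta / (8 * CR).
have r0 : 0 < r by apply: Rdiv_lt_0_compat; lra.
have CRr : CR * r = eta / 8 by rewrite /r; field; lra.
have hCR0 th p q : norm p <= Rr -> norm q <= Rr -> Rabs (H th x0 p - H th x0 q) <= CR * norm (vsub p q).
  by move=> hp hq; have := hCR th x0 x0 p q hp hq; rewrite norm_subvv Rplus_0_l.
have [m [m0 hm]] := uniform_gap mu01 r0 CR0 hCR0 (Hiii hx0 mu01).
have [sg [sg0 [sg1 sg2]]] := dmin2 (r1 := m / 4) (r2 := eta / 8) ltac:(lra) ltac:(lra).
pose C2 := 2 * C ^ 2 * (/ mu + / (1 - mu) + 1).
have CC : 0 < C ^ 2 by apply: pow_lt.
have C20 : 0 < C2 by apply: Rmult_lt_0_compat; lra.
have C2a : 2 * C ^ 2 * / mu <= C2 by apply: Rmult_le_compat_l; lra.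
have C2b : 2 * C ^ 2 * / (1 - mu) <= C2 by apply: Rmult_le_compat_l; lra.
have C2c : 2 * C ^ 2 <= C2 by rewrite -{1}(Rmult_1_r (2 * C ^ 2)); apply: Rmult_le_compat_l; lra.
(* The test matrices have size [/ ep], and [y] is only known to satisfy
   [|y - x0|^2 <= K1 * ep / kp], so the traces are of order [C2 * K1 / kp], which does not vanish
   with [ep]. The weight at [x0] must be fixed large beforehand; [d] and [ep] are chosen after
   it. *)
pose kp := 1 + 8 * C2 * K1 / sg.
have kpos : 0 < 8 * C2 * K1 / sg by apply: Rdiv_lt_0_compat => //; apply: Rmult_lt_0_compat; lra.
have kp1 : 1 < kp by rewrite /kp; lra.
have kpS : C2 * K1 / kp <= sg / 8.
  apply: (Rmult_le_reg_l kp); first lra.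
  have -> : kp * (C2 * K1 / kp) = C2 * K1 by field; lra.
  have -> : kp * (sg / 8) = sg / 8 + C2 * K1 by rewrite /kp; field; lra.
  lra.
have [rt [rt0 hrt]] := sol_umod su (e := (1 - mu) / 2) ltac:(lra).
have [r1' [r1'0 [w1 w2]]] := dmin2 (r1 := rt / 2) (r2 := 1) ltac:(lra) ltac:(lra).
pose A := CR * (3 + 2 * kp) + 2 * kp + 2 * / mu + 2 + C ^ 2 + 1.
have A0 : 0 < A by rewrite /A; have : 0 < CR * (3 + 2 * kp) by [apply: Rmult_lt_0_compat; lra]; lra.
have [d1 [d10 hd1]] := small_prod (a := Rmin (sg / 8) 1) ltac:(by apply: Rmin_pos; lra) (Rlt_le _ _ A0).
have [d2 [d20 [w3 w4]]] := dmin2 d10 (r2 := r1' / 2) ltac:(lra).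
have [d [d0 [w5 w6]]] := dmin2 d20 (r2 := / 4) ltac:(lra).
have Ad : A * d <= sg / 8 by apply: Rle_trans (Rmin_l _ _); apply: hd1; lra.
have Ad1 : A * d <= 1 by apply: Rle_trans (Rmin_r _ _); apply: hd1; lra.
have kpd : 0 < kp * d by apply: Rmult_lt_0_compat; lra.
have CRd : 0 < CR * d by apply: Rmult_lt_0_compat.
have CRkd : 0 < CR * (kp * d) by apply: Rmult_lt_0_compat.
have imud : 0 < / mu * d by apply: Rmult_lt_0_compat.
have CCd : 0 < C ^ 2 * d by apply: Rmult_lt_0_compat.
have AdE : A * d = 3 * (CR * d) + 2 * (CR * (kp * d)) + 2 * (kp * d) + 2 * (/ mu * d) + 2 * d + C ^ 2 * d + d.
  by rewrite /A; ring.
have d2pos : 0 < d ^ 2 by exact: pow_lt.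
have [e1 [e10 he1]] := small_prod (a := Rmin (d ^ 2) (Rmin d (sg / 8))) (b := K1 + 2 * K1 + C2 * (4 * K1 ^ 2))
  ltac:(by apply: Rmin_pos => //; apply: Rmin_pos; lra)
  ltac:(have := Rmult_le_pos _ _ (Rlt_le _ _ C20) (Rmult_le_pos 4 _ ltac:(lra) (pow2_ge_0 K1)); lra).
have [e2 [e20 [w7 w8]]] := dmin2 e10 Rlt_0_1.
have [ep [ep0 [w9 w10]]] := dmin2 e20 (r2 := (1 - mu) / 4) ltac:(lra).
have K1e : 0 < K1 * ep by apply: Rmult_lt_0_compat; lra.
have C2e : 0 <= C2 * (4 * K1 ^ 2) * ep.
  by apply: Rmult_le_pos; [apply: Rmult_le_pos; [lra|have := pow2_ge_0 K1; lra]|lra].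
have heps := he1 ep ltac:(lra).
have E1 : K1 * ep <= d ^ 2 by have := Rmin_l (d ^ 2) (Rmin d (sg / 8)); lra.
have E2 : 2 * K1 * ep <= d.
  by have := Rle_trans _ _ _ (Rmin_r (d ^ 2) (Rmin d (sg / 8))) (Rmin_l d (sg / 8)); lra.
have E3 : C2 * (4 * K1 ^ 2) * ep <= sg / 8.
  by have := Rle_trans _ _ _ (Rmin_r (d ^ 2) (Rmin d (sg / 8))) (Rmin_r d (sg / 8)); lra.
have iep : 0 < / ep by apply: Rinv_0_lt_compat.
have [T [T0 hT]] := Hlow ep0.
have [t1 [h1 [ht1 [hh1 hP]]]] := hPsi ep (T + 2) ep0 ltac:(lra).
(* For [h] below [rt], the bound [u - v >= 1] and continuity give [Psi >= (1 - mu) / 2], which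
   exceeds [ep]. Hence the windows for [t] and [s], of radius at most [rt / 2], stay ordered and
   [Hlow] applies to the pair. *)
have h1low : rt <= h1.
  apply: Rnot_lt_le => hlt.
  have a1 := hrt x0 (t1 + h1) t1 ltac:(lra) ltac:(lra) ltac:(by have -> : t1 + h1 - t1 = h1 by [ring]; rewrite Rabs_pos_eq; lra).
  have a2 := ubd x0 (t := t1) ltac:(lra).
  have a3 : (1 - mu) * 1 <= (1 - mu) * (u x0 t1 - v x0) by apply: Rmult_le_compat_l; lra.
  have a4 : 0 <= eta * h1 by apply: Rmult_le_pos; lra.
  by move: hP a1; rewrite /Psi; split_Rabs; lra.
pose s1 := t1 + h1.
pose P5 := (((vec N * vec N) * vec N) * (R * R))%type.
pose dd := dprod (dprod (dprod (@dV N) (@dV N)) (@dV N)) (dprod dR dR).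
pose pen (p : P5) := / (2 * ep) * (norm (vsub p.1.1.1 p.1.1.2) ^ 2 + norm (vsub p.1.2 p.1.1.2) ^ 2)
  + kp * norm (vsub p.1.1.2 x0) ^ 2 + ((p.2.1 - t1) ^ 2 + (p.2.2 - s1) ^ 2).
pose G (p : P5) := u p.1.1.2 p.2.2 + eta * (p.2.2 - p.2.1) - mu * u p.1.1.1 p.2.1 - (1 - mu) * v p.1.2 + pen p.
have GE a b c q r' : G (((a, b), c), (q, r')) = u b r' + eta * (r' - q) - mu * u a q - (1 - mu) * v c
  + (/ (2 * ep) * (norm (vsub a b) ^ 2 + norm (vsub c b) ^ 2) + kp * norm (vsub b x0) ^ 2
     + ((q - t1) ^ 2 + (r' - s1) ^ 2)) by [].
pose dom (p : P5) := ((norm (vsub p.1.1.1 x0) <= 2 /\ norm (vsub p.1.1.2 x0) <= 1) /\ norm (vsub p.1.2 x0) <= 2) /\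
   (t1 - r1' <= p.2.1 <= t1 + r1' /\ s1 - r1' <= p.2.2 <= s1 + r1').
have domP p : dom p -> T <= p.2.1 /\ 0 <= p.2.2 - p.2.1 by move=> [_ [h2 h3]]; rewrite /s1 in h3; lra.
have p0dom : dom (((x0, x0), x0), (t1, s1)) by split=> /=; [rewrite norm_subvv|]; lra.
have [ph [hph hmin]] : exists p, dom p /\ forall p', dom p' -> G p <= G p'.
  apply: (ctn_min (d := dd)).
  - exact: (ucpt_prod (ucpt_prod (ucpt_prod (@ucpt_ball N x0 2) (@ucpt_ball N x0 1)) (@ucpt_ball N x0 2))
      (ucpt_prod (@ucpt_itv (t1 - r1') (t1 + r1')) (@ucpt_itv (s1 - r1') (s1 + r1')))).
  - by exists (((x0, x0), x0), (t1, s1)).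
  - move=> p Dp.
    have cx p' : norm (vsub p'.1.1.1 p.1.1.1) <= dd p' p.
      exact: Rle_trans (Rmax_l _ _) (Rle_trans _ _ _ (Rmax_l _ _) (Rmax_l _ _)).
    have cy p' : norm (vsub p'.1.1.2 p.1.1.2) <= dd p' p.
      exact: Rle_trans (Rmax_r _ _) (Rle_trans _ _ _ (Rmax_l _ _) (Rmax_l _ _)).
    have cz p' : norm (vsub p'.1.2 p.1.2) <= dd p' p by exact: Rle_trans (Rmax_r _ _) (Rmax_l _ _).
    have ct p' : Rabs (p'.2.1 - p.2.1) <= dd p' p by exact: Rle_trans (Rmax_l _ _) (Rmax_r _ _).
    have cs p' : Rabs (p'.2.2 - p.2.2) <= dd p' p by exact: Rle_trans (Rmax_r _ _) (Rmax_r _ _).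
    have cu (Y : P5 -> vec N) (S : P5 -> R) : (forall p', dom p' -> 0 <= S p') ->
       (forall p', norm (vsub (Y p') (Y p)) <= dd p' p) -> (forall p', Rabs (S p' - S p) <= dd p' p) ->
       ctn dd dom p (fun p => u (Y p) (S p)).
      move=> S0 hY hS e e0; have [ra [ra0 hra]] := g_cont (s_good su) (Y p) (S0 p Dp) e0.
      exists ra; split=> // p' Dp' hd; apply: hra; first exact: S0.
        exact: Rle_lt_trans (hY _) hd.
      exact: Rle_lt_trans (hS _) hd.
    have cd (Y Z : P5 -> vec N) : (forall p', norm (vsub (Y p') (Y p)) <= dd p' p) ->
       (forall p', norm (vsub (Z p') (Z p)) <= dd p' p) -> ctn dd dom p (fun p => norm (vsub (Y p) (Z p))).
      move=> hY hZ; apply: (@ctn_lip _ _ _ _ _ 2); first lra.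
      move=> p' _; have := hY p'; have := hZ p'.
      have -> : vsub (Y p') (Z p') = vadd (vsub (Y p) (Z p)) (vsub (vsub (Y p') (Y p)) (vsub (Z p') (Z p))) by vring.
      have a1 := norm_triang (vsub (Y p) (Z p)) (vsub (vsub (Y p') (Y p)) (vsub (Z p') (Z p))).
      have a2 := norm_subl (vsub (Y p') (Y p)) (vsub (Z p') (Z p)).
      have a3 := norm_subl (vadd (vsub (Y p) (Z p)) (vsub (vsub (Y p') (Y p)) (vsub (Z p') (Z p)))) (vsub (vsub (Y p') (Y p)) (vsub (Z p') (Z p))).
      have E : vsub (vadd (vsub (Y p) (Z p)) (vsub (vsub (Y p') (Y p)) (vsub (Z p') (Z p)))) (vsub (vsub (Y p') (Y p)) (vsub (Z p') (Z p))) = vsub (Y p) (Z p) by vring.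
      rewrite E in a3; split_Rabs; lra.
    have cR (S : P5 -> R) : (forall p', Rabs (S p' - S p) <= dd p' p) -> ctn dd dom p S.
      by move=> hS; apply: (@ctn_lip _ _ _ _ _ 1); [lra|move=> p' _; rewrite Rmult_1_l].
    have cst0 p' : norm (vsub x0 x0) <= dd p' p by rewrite norm_subvv; apply: Rle_trans (cx p'); exact: norm_ge0.
    have ctt : ctn dd dom p (fun p => p.2.1) by exact: cR.
    have css : ctn dd dom p (fun p => p.2.2) by exact: cR.
    have cv : ctn dd dom p (fun p => v p.1.2).
      apply: (@ctn_lip _ _ _ _ _ L); first lra.
      move=> p' _; apply: Rle_trans (g_lip (s_good sv) (Rle_refl 0) _ _) _; apply: Rmult_le_compat_l; [lra|exact: cz].
    apply: ctn_plus.
      apply: ctn_minus; last by apply: ctn_scal.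
      apply: ctn_minus; last first.
        by apply: ctn_scal; apply: (cu (fun p => p.1.1.1) (fun p => p.2.1)) => // p' /domP [h2 _]; lra.
      apply: ctn_plus; last by apply: ctn_scal; apply: ctn_minus.
      by apply: (cu (fun p => p.1.1.2) (fun p => p.2.2)) => // p' /domP [h2 h3]; lra.
    apply: ctn_plus; last first.
      by apply: ctn_plus; apply: ctn_sq; apply: ctn_minus => //; exact: ctn_cst.
    apply: ctn_plus.
      apply: ctn_scal; apply: ctn_plus; apply: ctn_sq.
        exact: (cd (fun p => p.1.1.1) (fun p => p.1.1.2)).
      exact: (cd (fun p => p.1.2) (fun p => p.1.1.2)).
    by apply: ctn_scal; apply: ctn_sq; exact: (cd (fun p => p.1.1.2) (fun _ => x0)).
case: ph hph hmin => [[[x y] z] [t s]] hph hmin.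
have [/= tT st] := domP _ hph.
case: (hph) => [[[/= bx by0] bz] [bt bs]].
have hG0 : G (((x, y), z), (t, s)) <= ep.
  apply: Rle_trans (hmin _ p0dom) _; rewrite !GE !norm_subvv !Rminus_diag.
  have : eta * (s1 - t1) = eta * h1 by rewrite /s1; ring.
  have : u x0 s1 = u x0 (t1 + h1) by [].
  by move: hP; rewrite /Psi; lra.
have lxy : u y t - u x t >= - L * norm (vsub x y).
  by have := g_lip (s_good su) (t := t) ltac:(lra) y x; rewrite (norm_subC y x); split_Rabs; lra.
have lzy : v y - v z >= - L * norm (vsub z y).
  by have := g_lip (s_good sv) (Rle_refl 0) y z; rewrite (norm_subC y z); split_Rabs; lra.
set nx := norm (vsub x y) in lxy; set nz := norm (vsub z y) in lzy; set ny := norm (vsub y x0) in by0.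
have nx0 : 0 <= nx by exact: norm_ge0.
have nz0 : 0 <= nz by exact: norm_ge0.
have ny0 : 0 <= ny by exact: norm_ge0.
have pq a : / (2 * ep) * a ^ 2 - L * a >= / (4 * ep) * a ^ 2 - L ^ 2 * ep.
  have -> : / (2 * ep) * a ^ 2 = / (4 * ep) * a ^ 2 + / (4 * ep) * a ^ 2 by field; lra.
  have : 0 <= / (4 * ep) * (a - 2 * L * ep) ^ 2.
    by apply: Rmult_le_pos; [apply: Rlt_le; apply: Rinv_0_lt_compat; lra|exact: pow2_ge_0].
  have -> : / (4 * ep) * (a - 2 * L * ep) ^ 2 = / (4 * ep) * a ^ 2 - L * a + L ^ 2 * ep by field; lra.
  lra.
have Q : / (4 * ep) * nx ^ 2 + / (4 * ep) * nz ^ 2 + kp * ny ^ 2 + ((t - t1) ^ 2 + (s - s1) ^ 2) <= K1 * ep.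
  have a1 := hT y t (s - t) tT st.
  have E : t + (s - t) = s by ring.
  move: a1 hG0; rewrite /Psi E !GE -/nx -/nz -/ny => a1 a2.
  have a3 := pq nx; have a4 := pq nz.
  have a5 : mu * (u y t - u x t) >= - L * nx.
    have : 0 <= L * nx by apply: Rmult_le_pos; lra.
    move=> a6; have : mu * (L * nx) <= 1 * (L * nx) by apply: Rmult_le_compat_r; lra.
    have : mu * (- L * nx) <= mu * (u y t - u x t) by apply: Rmult_le_compat_l; lra.
    lra.
  have a6 : (1 - mu) * (v y - v z) >= - L * nz.
    have : 0 <= L * nz by apply: Rmult_le_pos; lra.
    move=> a7; have : (1 - mu) * (L * nz) <= 1 * (L * nz) by apply: Rmult_le_compat_r; lra.
    have : (1 - mu) * (- L * nz) <= (1 - mu) * (v y - v z) by apply: Rmult_le_compat_l; lra.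
    lra.
  by rewrite /K1; lra.
have i4 : 0 < / (4 * ep) by apply: Rinv_0_lt_compat; lra.
have p1 : 0 <= / (4 * ep) * nx ^ 2 by apply: Rmult_le_pos; [lra|exact: pow2_ge_0].
have p2 : 0 <= / (4 * ep) * nz ^ 2 by apply: Rmult_le_pos; [lra|exact: pow2_ge_0].
have p3 : 0 <= kp * ny ^ 2 by apply: Rmult_le_pos; [lra|exact: pow2_ge_0].
have p4 := pow2_ge_0 (t - t1); have p5 := pow2_ge_0 (s - s1).
have nsq a : 0 <= a -> / (4 * ep) * a ^ 2 <= K1 * ep -> a ^ 2 <= 4 * K1 ^ 2 * ep ^ 2 /\ a <= 2 * K1 * ep.
  move=> a0 ha.
  have b1 : a ^ 2 <= 4 * K1 * ep ^ 2.
    have -> : a ^ 2 = 4 * ep * (/ (4 * ep) * a ^ 2) by field; lra.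
    have -> : 4 * K1 * ep ^ 2 = 4 * ep * (K1 * ep) by ring.
    by apply: Rmult_le_compat_l; lra.
  have b2 : 4 * K1 * ep ^ 2 <= 4 * K1 ^ 2 * ep ^ 2.
    by apply: Rmult_le_compat_r; [exact: pow2_ge_0|have : K1 * 1 <= K1 * K1 by [apply: Rmult_le_compat_l; lra]; lra].
  split; first lra.
  have : a ^ 2 <= (2 * K1 * ep) ^ 2 by have -> : (2 * K1 * ep) ^ 2 = 4 * K1 ^ 2 * ep ^ 2 by [ring]; lra.
  by apply: sq_le_le; lra.
have [nx2 nx1] := nsq nx nx0 ltac:(lra).
have [nz2 nz1] := nsq nz nz0 ltac:(lra).
have ny2 : ny ^ 2 <= K1 * ep / kp.
  apply: (Rmult_le_reg_l kp); first lra.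
  have -> : kp * (K1 * ep / kp) = K1 * ep by field; lra.
  lra.
have ny1 : ny <= d.
  have : 1 * ny ^ 2 <= kp * ny ^ 2 by apply: Rmult_le_compat_r; [exact: pow2_ge_0|lra].
  by move=> ?; apply: sq_le_le; lra.
have absd a : a ^ 2 <= d ^ 2 -> Rabs a <= d by rewrite -(pow2_abs a) => ?; apply: sq_le_le; lra.
have td := absd (t - t1) ltac:(lra).
have sd := absd (s - s1) ltac:(lra).
have nxd : nx <= d by lra.
have nzd : nz <= d by lra.
have xx0 : norm (vsub x x0) <= 2 * d by have := norm_sub_triang x y x0; rewrite -/nx -/ny; lra.
have zx0 : norm (vsub z x0) <= 2 * d by have := norm_sub_triang z y x0; rewrite -/nz -/ny; lra.
(* The weights [mu] and [1 - mu] in [G] rescale the gradients at [x] and [z], so the gradient [py]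
   at the middle point is the convex combination of [px] and [pz], apart from the term in [kp]. *)
pose px := vscale (/ (ep * mu)) (vsub x y).
pose pz := vscale (/ (ep * (1 - mu))) (vsub z y).
pose py := vadd (vadd (vscale (/ ep) (vsub x y)) (vscale (/ ep) (vsub z y))) (vscale (- 2 * kp) (vsub y x0)).
have iem : 0 < / (ep * mu) by apply: Rinv_0_lt_compat; apply: Rmult_lt_0_compat; lra.
have iem' : 0 < / (ep * (1 - mu)) by apply: Rinv_0_lt_compat; apply: Rmult_lt_0_compat; lra.
have npx : norm px <= 2 * K1 * / mu.
  rewrite norm_scale Rabs_pos_eq -/nx; last lra.
  have -> : 2 * K1 * / mu = / (ep * mu) * (2 * K1 * ep) by field; lra.
  by apply: Rmult_le_compat_l; lra.
have npz : norm pz <= 2 * K1 * / (1 - mu).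
  rewrite norm_scale Rabs_pos_eq -/nz; last lra.
  have -> : 2 * K1 * / (1 - mu) = / (ep * (1 - mu)) * (2 * K1 * ep) by field; lra.
  by apply: Rmult_le_compat_l; lra.
have nen a : a <= 2 * K1 * ep -> / ep * a <= 2 * K1.
  move=> ha; have -> : 2 * K1 = / ep * (2 * K1 * ep) by field; lra.
  by apply: Rmult_le_compat_l; lra.
have npy : norm py <= 4 * K1 + 1.
  apply: Rle_trans (norm_triang _ _) _.
  have := norm_triang (vscale (/ ep) (vsub x y)) (vscale (/ ep) (vsub z y)).
  rewrite !norm_scale -/nx -/nz -/ny (Rabs_pos_eq (/ ep)) ?(Rabs_left (-2 * kp)); try lra.
  have := nen nx nx1; have := nen nz nz1.
  have : kp * ny <= kp * d by apply: Rmult_le_compat_l; lra.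
  lra.
pose PP := vadd (vscale mu px) (vscale (1 - mu) pz).
have PPE : PP = vadd (vscale (/ ep) (vsub x y)) (vscale (/ ep) (vsub z y)).
  by apply: functional_extensionality => i; rewrite /PP /px /pz /vadd /vscale; field; lra.
have nPP : norm PP <= 4 * K1.
  rewrite PPE; apply: Rle_trans (norm_triang _ _) _; rewrite !norm_scale -/nx -/nz Rabs_pos_eq; last lra.
  by have := nen nx nx1; have := nen nz nz1; lra.
have rl : 0 < r1' - d by lra.
have jy : par_subjet u y s (- eta - 2 * (s - s1)) py (mscale (- (2 * / ep + 2 * kp)) mid).
  apply: (@crude_subjet _ _ _ _ _ _ _ 1); first lra.
  exists (Rmin (r1' - d) (/ 2)); split; first by apply: Rmin_pos; lra.
  move=> y' s' hy' hs'.
  have hs1 : Rabs (s' - s) < r1' - d by apply: Rlt_le_trans hs' (Rmin_l _ _).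
  have hy1 : norm (vsub y' y) < / 2 by apply: Rlt_le_trans hy' (Rmin_r _ _).
  have := hmin (((x, y'), z), (t, s')); rewrite !GE => hm'.
  have {hm'} := hm' ltac:(split=> /=; [split=> //; split=> //; have := norm_sub_triang y' y x0; rewrite -/ny; lra
    |split=> //; move: sd hs1; split_Rabs; lra]).
  set e := vsub y' y.
  have -> : vsub x y' = vadd (vsub x y) (vscale (-1) e) by rewrite /e; vring.
  have -> : vsub z y' = vadd (vsub z y) (vscale (-1) e) by rewrite /e; vring.
  have -> : vsub y' x0 = vadd (vsub y x0) e by rewrite /e; vring.
  have -> : dot py e = / ep * dot (vsub x y) e + / ep * dot (vsub z y) e - 2 * kp * dot (vsub y x0) e.
    by rewrite /py; move: (vsub x y) (vsub z y) (vsub y x0) e => *; rewrite !dotDl !dotZl; ring.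
  rewrite quad_mscale quad_mid -norm_sq; move: (vsub x y) (vsub z y) (vsub y x0) e => f1 f2 f3 e.
  rewrite !norm_add_sq !norm_scale !dotZr Rabs_Ropp Rabs_R1 Rmult_1_l.
  have -> : / (2 * ep) = / 2 * / ep by field; lra.
  move=> hm'; clear -hm'; lra.
have jx : par_superjet u x t (/ mu * (- eta + 2 * (t - t1))) px (mscale (/ (ep * mu)) mid).
  apply: (@crude_superjet _ _ _ _ _ _ _ (/ mu)); first lra.
  exists (Rmin (r1' - d) (/ 2)); split; first by apply: Rmin_pos; lra.
  move=> x' t' hx' ht'.
  have hs1 : Rabs (t' - t) < r1' - d by apply: Rlt_le_trans ht' (Rmin_l _ _).
  have hy1 : norm (vsub x' x) < / 2 by apply: Rlt_le_trans hx' (Rmin_r _ _).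
  have := hmin (((x', y), z), (t', s)); rewrite !GE => hm'.
  have {hm'} := hm' ltac:(split=> /=; [split=> //; split=> //; have := norm_sub_triang x' x x0; lra
    |split=> //; move: td hs1; split_Rabs; lra]).
  set e := vsub x' x.
  have -> : vsub x' y = vadd (vsub x y) e by rewrite /e; vring.
  rewrite /px !dotZl quad_mscale quad_mid -norm_sq; move: (vsub x y) (vsub z y) e => f1 f2 e.
  rewrite norm_add_sq => hm'.
  apply: (Rmult_le_reg_l mu); first lra.
  have -> : mu * (u x t + / mu * (- eta + 2 * (t - t1)) * (t' - t) + / (ep * mu) * dot f1 e
    + / 2 * (/ (ep * mu) * norm e ^ 2) + / mu * (t' - t) ^ 2)
    = mu * u x t + (- eta + 2 * (t - t1)) * (t' - t) + / ep * dot f1 e + / (2 * ep) * norm e ^ 2 + (t' - t) ^ 2.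
    by field; lra.
  have EE : / (2 * ep) * (2 * dot f1 e) = / ep * dot f1 e by field; lra.
  clear -hm' EE; lra.
have jz : par_superjet (fun x _ => v x) z 1 0 pz (mscale (/ (ep * (1 - mu))) mid).
  apply: (@crude_superjet _ _ _ _ _ _ _ 0); first lra.
  exists (/ 2); split; first lra.
  move=> z' t' hz' _.
  have := hmin (((x, y), z'), (t, s)); rewrite !GE => hm'.
  have {hm'} := hm' ltac:(split=> /=; [split=> //; have := norm_sub_triang z' z x0; lra|split=> //]).
  set e := vsub z' z.
  have -> : vsub z' y = vadd (vsub z y) e by rewrite /e; vring.
  rewrite /pz !dotZl quad_mscale quad_mid -norm_sq; move: (vsub z y) (vsub x y) e => f1 f2 e.
  rewrite norm_add_sq => hm'.
  apply: (Rmult_le_reg_l (1 - mu)); first lra.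
  have -> : (1 - mu) * (v z + 0 * (t' - 1) + / (ep * (1 - mu)) * dot f1 e
    + / 2 * (/ (ep * (1 - mu)) * norm e ^ 2) + 0 * (t' - 1) ^ 2)
    = (1 - mu) * v z + / ep * dot f1 e + / (2 * ep) * norm e ^ 2.
    by field; lra.
  have EE : / (2 * ep) * (2 * dot f1 e) = / ep * dot f1 e by field; lra.
  clear -hm' EE; lra.
have sp : 0 < s by lra.
have tpos : 0 < t by lra.
(* The supersolution selects [th]; the two subsolution inequalities hold for every [th] and are then
   taken at this one. *)
have [th hy] := s_sup su sp (sym_mscale _ (@sym_mid N)) jy (e := sg / 8) ltac:(lra).
have hx := s_sub su tpos (sym_mscale _ (@sym_mid N)) jx th.
have hz := s_sub sv Rlt_0_1 (sym_mscale _ (@sym_mid N)) jz th.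
rewrite /ham trprodZ trprod_mid in hx; rewrite /ham trprodZ trprod_mid in hy; rewrite /ham trprodZ trprod_mid in hz.
have mb (x' : vec N) : mnorm (sigma th x') ^ 2 <= C ^ 2 * norm (vsub x' x0) ^ 2.
  rewrite -Rpow_mult_distr; apply: pow_incr; split; first exact: mnorm_ge0.
  exact (inSigma_mnorm Hsig_lip x' th hx0).
have K1kp : 0 <= K1 * ep / kp by apply: Rle_trans ny2; exact: pow2_ge_0.
have trx : / (ep * mu) * mnorm (sigma th x) ^ 2 <= sg / 4.
  have a1 := mb x.
  have a2 := sq_le_add2 (norm_sub_triang x y x0) (norm_ge0 _) nx0 ny0; rewrite -/nx -/ny in a2.
  have a3 : / (ep * mu) * mnorm (sigma th x) ^ 2 <= / (ep * mu) * (C ^ 2 * (2 * (4 * K1 ^ 2 * ep ^ 2 + K1 * ep / kp))).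
    apply: Rmult_le_compat_l; first lra.
    by apply: Rle_trans a1 _; apply: Rmult_le_compat_l; lra.
  have a4 : / (ep * mu) * (C ^ 2 * (2 * (4 * K1 ^ 2 * ep ^ 2 + K1 * ep / kp)))
    = 2 * C ^ 2 * / mu * (4 * K1 ^ 2 * ep + K1 / kp) by field; lra.
  have a5 : 2 * C ^ 2 * / mu * (4 * K1 ^ 2 * ep + K1 / kp) <= C2 * (4 * K1 ^ 2 * ep + K1 / kp).
    apply: Rmult_le_compat_r => //.
    have : 0 <= 4 * K1 ^ 2 * ep by apply: Rmult_le_pos; [have := pow2_ge_0 K1|]; lra.
    have : 0 < K1 / kp by apply: Rdiv_lt_0_compat; lra.
    lra.
  by rewrite /Rdiv in kpS a5 *; lra.
have trz : / (ep * (1 - mu)) * mnorm (sigma th z) ^ 2 <= sg / 4.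
  have a1 := mb z.
  have a2 := sq_le_add2 (norm_sub_triang z y x0) (norm_ge0 _) nz0 ny0; rewrite -/nz -/ny in a2.
  have a3 : / (ep * (1 - mu)) * mnorm (sigma th z) ^ 2 <= / (ep * (1 - mu)) * (C ^ 2 * (2 * (4 * K1 ^ 2 * ep ^ 2 + K1 * ep / kp))).
    apply: Rmult_le_compat_l; first lra.
    by apply: Rle_trans a1 _; apply: Rmult_le_compat_l; lra.
  have a4 : / (ep * (1 - mu)) * (C ^ 2 * (2 * (4 * K1 ^ 2 * ep ^ 2 + K1 * ep / kp)))
    = 2 * C ^ 2 * / (1 - mu) * (4 * K1 ^ 2 * ep + K1 / kp) by field; lra.
  have a5 : 2 * C ^ 2 * / (1 - mu) * (4 * K1 ^ 2 * ep + K1 / kp) <= C2 * (4 * K1 ^ 2 * ep + K1 / kp).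
    apply: Rmult_le_compat_r => //.
    have : 0 <= 4 * K1 ^ 2 * ep by apply: Rmult_le_pos; [have := pow2_ge_0 K1|]; lra.
    have : 0 < K1 / kp by apply: Rdiv_lt_0_compat; lra.
    lra.
  by rewrite /Rdiv in kpS a5 *; lra.
have trY : (2 * / ep + 2 * kp) * mnorm (sigma th y) ^ 2 <= sg / 4.
  have a1 := mb y; rewrite -/ny in a1.
  have a2 : 2 * / ep * mnorm (sigma th y) ^ 2 <= 2 * / ep * (C ^ 2 * (K1 * ep / kp)).
    apply: Rmult_le_compat_l; first lra.
    by apply: Rle_trans a1 _; apply: Rmult_le_compat_l; lra.
  have a3 : 2 * / ep * (C ^ 2 * (K1 * ep / kp)) = 2 * C ^ 2 * (K1 / kp) by field; lra.
  have a4 : 2 * C ^ 2 * (K1 / kp) <= C2 * (K1 / kp).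
    by apply: Rmult_le_compat_r => //; apply: Rlt_le; apply: Rdiv_lt_0_compat; lra.
  have a5 : 2 * kp * mnorm (sigma th y) ^ 2 <= 2 * kp * (C ^ 2 * (d * d)).
    apply: Rmult_le_compat_l; first lra.
    by apply: Rle_trans a1 _; apply: Rmult_le_compat_l; [lra|exact: sq_mono].
  have a6 : 2 * (kp * d) <= 1 by lra.
  have a7 : 2 * (kp * d) * (C ^ 2 * d) <= 1 * (C ^ 2 * d) by apply: Rmult_le_compat_r; lra.
  by rewrite /Rdiv in kpS a4 *; lra.
have Ly := hCR th y x0 py PP ltac:(rewrite /Rr; lra) ltac:(rewrite /Rr; lra).
have Lx := hCR th x x0 px px ltac:(rewrite /Rr; lra) ltac:(rewrite /Rr; lra).
have Lz := hCR th z x0 pz pz ltac:(rewrite /Rr; lra) ltac:(rewrite /Rr; lra).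
rewrite !norm_subvv !Rplus_0_r in Lx Lz.
have pyPP : norm (vsub py PP) <= 2 * (kp * d).
  have -> : vsub py PP = vscale (- 2 * kp) (vsub y x0) by rewrite PPE /py; vring.
  rewrite norm_scale -/ny Rabs_left; last lra.
  have : kp * ny <= kp * d by apply: Rmult_le_compat_l; lra.
  lra.
have Ly1 : CR * (norm (vsub y x0) + norm (vsub py PP)) <= CR * d + 2 * (CR * (kp * d)).
  have : CR * (norm (vsub y x0) + norm (vsub py PP)) <= CR * (d + 2 * (kp * d)) by apply: Rmult_le_compat_l; rewrite -/ny; lra.
  lra.
have Lx1 : CR * norm (vsub x x0) <= CR * (2 * d) by apply: Rmult_le_compat_l; lra.
have Lz1 : CR * norm (vsub z x0) <= CR * (2 * d) by apply: Rmult_le_compat_l; lra.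
(* The slope in the later time gives [eta] at the mixed gradient; the slope in the earlier time,
   divided by [mu], gives back at most [eta] after multiplication by [mu]. Convexity thus compares
   two quantities that agree up to multiples of [sg]. *)
have Hy : H th x0 PP >= eta - sg.
  by move: Ly sd; split_Rabs; lra.
have Hx : mu * H th x0 px <= eta + mu * sg.
  have b1 : H th x0 px <= / mu * eta + 2 * (/ mu * d) + sg / 4 + CR * (2 * d).
    have b2 : / mu * (- eta + 2 * (t - t1)) >= / mu * (- eta - 2 * d).
      by apply: Rle_ge; apply: Rmult_le_compat_l; [lra|move: td; split_Rabs; lra].
    by move: Lx; split_Rabs; lra.
  have b3 : H th x0 px <= / mu * eta + sg by lra.
  have b4 : mu * H th x0 px <= mu * (/ mu * eta + sg) by apply: Rmult_le_compat_l; lra.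
  have b5 : mu * (/ mu * eta + sg) = eta + mu * sg by field; lra.
  lra.
have Hz : H th x0 pz <= sg by move: Lz; split_Rabs; lra.
have Hz' : (1 - mu) * H th x0 pz <= (1 - mu) * sg by apply: Rmult_le_compat_l; lra.
(* Far gradients: the gap [m] exceeds the total error [2 * sg <= m / 2]. Close gradients: [H] at
   [PP] is at least [eta - sg], yet within [eta / 8] of its value at [pz], which is at most
   [sg <= eta / 8]. *)
have [hr|hr] := Rle_lt_dec r (norm (vsub px pz)).
  have := hm px pz ltac:(rewrite /Rr; lra) ltac:(rewrite /Rr; lra) hr th; rewrite -/PP; lra.
have := hCR0 th PP pz ltac:(rewrite /Rr; lra) ltac:(rewrite /Rr; lra).
have -> : vsub PP pz = vscale mu (vsub px pz) by rewrite /PP; vring.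
rewrite norm_scale (Rabs_pos_eq mu); last lra.
have : CR * (mu * norm (vsub px pz)) <= CR * r.
  apply: Rmult_le_compat_l; first lra.
  have nn := norm_ge0 (vsub px pz).
  have : mu * norm (vsub px pz) <= 1 * norm (vsub px pz) by apply: Rmult_le_compat_r; lra.
  lra.
by split_Rabs; lra.
Qed.
End ContactOnSigma.

(** * Almost monotonicity in time *)

Section Monotone.
Variables (u : vec N -> R -> R) (v : vec N -> R) (su : sol u) (sv : sol (fun x _ => v x)).
Variables (B2 : R) (ubd : forall x t, 0 <= t -> 1 <= u x t - v x <= B2).
Hypothesis Hne : exists x, inSigma sigma x.

Lemma almost_monotone eta eps : 0 < eta -> 0 < eps -> exists T, 0 <= T /\ forall x t h, T <= t -> 0 <= h ->
  u x t - eps <= u x (t + h) + eta * h.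
Proof.
move=> eta0 eps0.
have B20 : 1 <= B2 by have := ubd (@vzero N) (Rle_refl 0); lra.
pose valid mu := exists T, 0 <= T /\ forall x t h, T <= t -> 0 <= h -> 0 <= Psi u v eta mu x t h.
pose E mu := 0 <= mu <= 1 /\ valid mu.
have E0 : E 0.
  split; first lra.
  exists 0; split; first lra.
  move=> x t h t0 h0; have := ubd x (t := t + h) ltac:(lra).
  by have : 0 <= eta * h by [apply: Rmult_le_pos; lra]; rewrite /Psi; lra.
have [m [m1 m2]] : {m | is_lub E m}.
  apply: completeness; first by exists 1 => r [? _]; lra.
  by exists 0.
have near d : 0 < d -> exists mu, E mu /\ m - d < mu.
  move=> d0; apply: NNPP => hn; have : m <= m - d; last lra.
  by apply: m2 => r hr; apply: Rnot_lt_le => hlt; apply: hn; exists r.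
have m01 : 0 <= m <= 1 by split; [exact: m1|apply: m2 => r [? _]; lra].
have B2u x t d : 0 <= t -> 0 <= d -> 0 <= d * (u x t - v x) <= d * B2.
  move=> t0 d0; have := ubd x t0 => hu.
  by split; [apply: Rmult_le_pos; lra|apply: Rmult_le_compat_l; lra].
have m_1 : m = 1.
  apply: NNPP => mn.
  have mu01 : 0 <= m < 1 by lra.
  (* Numbers slightly below the supremum [m] are admissible, and replacing one by [m] lowers [Psi]
     by at most their difference times [B2]. *)
  have Hlow ka : 0 < ka -> exists T, 0 <= T /\ forall x t h, T <= t -> 0 <= h -> - ka <= Psi u v eta m x t h.
    move=> ka0; have [mu [[mu0 [T [T0 hT]]] hmu]] := near (ka / B2) ltac:(apply: Rdiv_lt_0_compat; lra).
    exists T; split=> // x t h ht h0; have := hT x t h ht h0; rewrite /Psi.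
    have mum : mu <= m by apply: m1; split=> //; exists T.
    have := B2u x t (m - mu) ltac:(lra) ltac:(lra) => q1.
    have : (m - mu) * B2 <= ka / B2 * B2 by apply: Rmult_le_compat_r; lra.
    have -> : ka / B2 * B2 = ka by field; lra.
    lra.
  (* Conversely, a positive lower bound for [Psi] would leave room to enlarge [m] by [ka / B2], here
     kept below [1 - m]. *)
  have Hnot ka : 0 < ka -> ~ exists T, 0 <= T /\ forall x t h, T <= t -> 0 <= h -> ka <= Psi u v eta m x t h.
    move=> ka0 [T [T0 hT]].
    have [d [d0 [d1 d2]]] := dmin2 (r1 := ka / B2) (r2 := 1 - m) ltac:(apply: Rdiv_lt_0_compat; lra) ltac:(lra).
    have : m + d <= m; last lra.
    apply: m1; split; first lra.
    exists T; split=> // x t h ht h0; have := hT x t h ht h0; rewrite /Psi.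
    have := B2u x t d ltac:(lra) ltac:(lra) => q1.
    have : d * B2 <= ka / B2 * B2 by apply: Rmult_le_compat_r; lra.
    have -> : ka / B2 * B2 = ka by field; lra.
    lra.
  have mp := mu_gt0 eta0 mu01 ubd Hnot.
  have [x0 [hx0 D0]] := D_zero_Sigma su sv mu01 ubd Hlow Hnot Hne.
  refine (no_touch_Sigma su sv eta0 (conj mp (proj2 mu01)) ubd Hlow hx0 _).
  move=> ka T ka0 T0; apply: (D_gt (mu01 := mu01) (ubd := ubd) (Hlow := Hlow)) => //; lra.
have [mu [[mu0 [T [T0 hT]]] hmu]] := near (eps / B2) ltac:(apply: Rdiv_lt_0_compat; lra).
exists T; split=> // x t h ht h0; have := hT x t h ht h0; rewrite /Psi.
have := B2u x t (1 - mu) ltac:(lra) ltac:(lra) => q1.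
have : (1 - mu) * B2 <= eps / B2 * B2 by apply: Rmult_le_compat_r; lra.
have -> : eps / B2 * B2 = eps by field; lra.
lra.
Qed.
End Monotone.

(** * Stability under uniform limits *)

Lemma colv_le (s : mat N) k : norm (colv s k) <= mnorm s.
Proof.
apply: sq_le_le; first exact: mnorm_ge0.
by rewrite mnorm_col; apply: (@sumN_ge1 _ (fun k => norm (colv s k) ^ 2)) => i; exact: pow2_ge_0.
Qed.

Lemma ham_continuous x p X : symmetric X -> forall e, 0 < e -> exists r, 0 < r /\ forall th y q k,
  norm (vsub y x) <= r -> norm (vsub q p) <= r -> Rabs k <= r ->
  Rabs (ham sigma H th y q (madd X (mscale k mid)) - ham sigma H th x p X) <= e.
Proof.
move=> sX e e0.
have p0 := norm_ge0 p; have m0 := mabs_ge0 X; have n0 := pos_INR N.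
have [CR [CR0 hCR]] := HH_lip (Rr := norm p + 1) ltac:(lra).
have B0 : 0 <= INR N * (mabs X * (2 * C ^ 2)).
  by apply: Rmult_le_pos => //; apply: Rmult_le_pos => //; have := pow2_ge_0 C; lra.
pose K := INR N * (mabs X * (2 * C ^ 2)) + C ^ 2 + 2 * CR.
have K0 : 0 <= K by have := pow2_ge_0 C; rewrite /K; lra.
have [r1 [r10 hr1]] := small_prod e0 K0.
have [r [r0 [u1 u2]]] := dmin2 r10 Rlt_0_1.
exists r; split=> // th y q k hy hq hk.
have hKr : K * r <= e by apply: hr1; lra.
rewrite /ham trprodD trprodZ trprod_mid.
have h1 : Rabs (H th y q - H th x p) <= CR * (2 * r).
  apply: Rle_trans (hCR th y x q p _ _) _; [have := norm_sub_le q p; lra|lra|].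
  by apply: Rmult_le_compat_l; lra.
have h2 : Rabs (k * mnorm (sigma th y) ^ 2) <= r * C ^ 2.
  rewrite Rabs_mult (Rabs_pos_eq (_ ^ 2)); last exact: pow2_ge_0.
  by apply: Rmult_le_compat => //; [exact: Rabs_pos|exact: pow2_ge_0|exact: mnorm_sq_bd].
have h3 : Rabs (trprod (gram (sigma th y)) X - trprod (gram (sigma th x)) X) <= INR N * (mabs X * (C * r * (2 * C))).
  rewrite !trprod_gram -sumN_minus; apply: Rle_trans (sumN_abs _) _.
  rewrite -sumN_cst; apply: sumN_le => j; apply: Rle_trans (quad_diff _ _ sX) _.
  apply: Rmult_le_compat_l => //; apply: Rmult_le_compat.
  - exact: norm_ge0.
  - by have := norm_ge0 (colv (sigma th y) j); have := norm_ge0 (colv (sigma th x) j); lra.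
  - apply: Rle_trans (_ : C * norm (vsub y x) <= _); last by apply: Rmult_le_compat_l; lra.
    by apply: Rle_trans (Hsig_lip th y x); exact: (colv_le (msub (sigma th y) (sigma th x)) j).
  - have := colv_le (sigma th y) j; have := colv_le (sigma th x) j.
    by have := Hsig_bd th x; have := Hsig_bd th y; lra.
have E : K * r = INR N * (mabs X * (C * r * (2 * C))) + r * C ^ 2 + CR * (2 * r) by rewrite /K; ring.
by move: h1 h2 h3; split_Rabs; lra.
Qed.

Lemma trprod_bound (s : mat N) X : Rabs (trprod (gram s) X) <= mabs X * mnorm s ^ 2.
Proof.
rewrite trprod_gram mnorm_col -sumN_scal; apply: Rle_trans (sumN_abs _) _.
by apply: sumN_le => k; exact: quad_bound.
Qed.

Lemma Fsup_exists C1 x p X (th0 : Th) : (forall th, Rabs (H th x (@vzero N)) <= C1) -> exists s, Fsup sigma H x p X s.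
Proof.
move=> h0; have p0 := norm_ge0 p.
have [CR [CR0 hCR]] := HH_lip (Rr := norm p + 1) ltac:(lra).
have [s hs] : {s | is_lub (fun r => exists th, r = - trprod (gram (sigma th x)) X + H th x p) s}.
  apply: completeness; last by exists (- trprod (gram (sigma th0 x)) X + H th0 x p), th0.
  exists (mabs X * C ^ 2 + C1 + CR * norm p) => r [th ->].
  have q1 := trprod_bound (sigma th x) X.
  have q2 : mabs X * mnorm (sigma th x) ^ 2 <= mabs X * C ^ 2.
    by apply: Rmult_le_compat_l; [exact: mabs_ge0|exact: mnorm_sq_bd].
  have := hCR th x x p (@vzero N) ltac:(lra) ltac:(rewrite norm_zero; lra).
  rewrite norm_subvv Rplus_0_l.
  have -> : vsub p (@vzero N) = p by vring.
  by move: q1 (h0 th); split_Rabs; lra.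
by exists s.
Qed.

Section Stability.
Variables (phi : vec N -> R)
  (approx : forall e, 0 < e -> exists w, sol w /\ forall x t, 0 <= t <= 2 -> Rabs (w x t - phi x) <= e).

Lemma stability_sub : SubS sigma H phi.
Proof.
move=> x p X sX hj th; apply: Rnot_lt_le => hlt.
set h := ham _ _ _ _ _ _ in hlt.
have [r [r0 hr]] := ham_continuous x p sX (e := h / 4) ltac:(lra).
have [rho [rho0 [u1 u2]]] := dmin2 r0 (r2 := h / 4) ltac:(lra).
have [e [e0 he]] := perturbed_superjet sX hj rho0.
have [w [sw hw]] := approx e0.
have [y [s [a [P [k [s0 [h1 [h2 [h3 [h4 hjet]]]]]]]]]] := he L w (s_good sw) hw.
have q1 := s_sub sw s0 (sym_madd sX (sym_mscale k (@sym_mid N))) hjet th.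
have q2 := hr th y P k ltac:(lra) ltac:(lra) ltac:(lra).
by move: h2 q2; rewrite -/h; split_Rabs; lra.
Qed.

Lemma good_opp w : good L w -> good L (fun (x : vec N) t => - w x t).
Proof.
move=> gw; split.
- by move=> t x k /=; rewrite (g_per gw t).
- move=> t t0 x y; have -> : - w x t - - w y t = - (w x t - w y t) by ring.
  by rewrite Rabs_Ropp; apply: (g_lip gw).
move=> x t t0 e e0; have [r [r0 hr]] := g_cont gw x t0 e0; exists r; split=> // y s s0 hy hs.
have -> : - w y s - - w x t = - (w y s - w x t) by ring.
by rewrite Rabs_Ropp; apply: hr.
Qed.

Lemma quad_opp (X : mat N) z : quad (mscale (-1) X) z = - quad X z.
Proof. by rewrite quad_mscale; ring. Qed.

(** The perturbation lemma is applied to the negatives: it concerns only touching and [good], not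
    the equation, so a subjet of [phi] can be handled as a superjet of its opposite. *)
Lemma stability_sup : SuperS sigma H phi.
Proof.
move=> x p X sX hj e e0.
have [r [r0 hr]] := ham_continuous x p sX (e := e / 4) ltac:(lra).
have [rho [rho0 [u1 u2]]] := dmin2 r0 (r2 := e / 4) ltac:(lra).
have hj' : superjet (fun x => - phi x) x (vscale (-1) p) (mscale (-1) X).
  move=> e' e'0; have [d [d0 hd]] := hj e' e'0; exists d; split=> // y hy.
  by have := hd y hy; rewrite dotZl quad_opp; lra.
have [e' [e'0 he]] := perturbed_superjet (sym_mscale (-1) sX) hj' rho0.
have [w [sw hw]] := approx e'0.
have [|y [s [a [P [k [s0 [h1 [h2 [h3 [h4 hjet]]]]]]]]]] := he L _ (good_opp (s_good sw)).
  by move=> z t ht; have := hw z t ht; split_Rabs; lra.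
have hjet' : par_subjet w y s (- a) (vscale (-1) P) (madd X (mscale (- k) mid)).
  move=> e2 e20; have [d [d0 hd]] := hjet e2 e20; exists d; split=> // y' s' s'0 hy' hs'.
  by have := hd y' s' s'0 hy' hs'; rewrite dotZl !quad_madd !quad_mscale; lra.
have [th q1] := s_sup sw s0 (sym_madd sX (sym_mscale (- k) (@sym_mid N))) hjet' (e := e / 4) ltac:(lra).
exists th.
have h5 : norm (vsub (vscale (-1) P) p) <= r.
  have -> : vsub (vscale (-1) P) p = vscale (-1) (vsub P (vscale (-1) p)) by vring.
  by rewrite norm_scale Rabs_Ropp Rabs_R1; lra.
have q2 := hr th y (vscale (-1) P) (- k) ltac:(lra) h5 ltac:(rewrite Rabs_Ropp; lra).
by move: h2 q2; split_Rabs; lra.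
Qed.
End Stability.

(** * The limit function and convergence to it *)

Definition ulim (f : nat -> R) : R :=
  epsilon (inhabits 0) (fun l => forall e, 0 < e -> UF (fun n => Rabs (f n - l) < e)).
Lemma ulimP f B : (forall n, Rabs (f n) <= B) -> forall e, 0 < e -> UF (fun n => Rabs (f n - ulim f) < e).
Proof.
move=> hB; apply: (epsilon_spec (inhabits 0) (fun l => forall e, 0 < e -> UF (fun n => Rabs (f n - l) < e))).
have [l [_ hl]] := @ulim_ex f (- B) B (fun n => ltac:(have := hB n; split_Rabs; lra)).
by exists l.
Qed.

Section Limit.
Variables (u : vec N -> R -> R) (B : R) (su : sol u) (ubd : forall x t, 0 <= t -> Rabs (u x t) <= B).
Hypothesis mono : forall eta eps, 0 < eta -> 0 < eps -> exists T, 0 <= T /\ forall x t h, T <= t -> 0 <= h ->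
  u x t - eps <= u x (t + h) + eta * h.
Let phi x := ulim (fun n => u x (INR n)).

Let phiP x e : 0 < e -> UF (fun n => Rabs (u x (INR n) - phi x) < e).
Proof. by move=> e0; apply: (@ulimP _ B) => // n; apply: ubd; exact: pos_INR. Qed.

Lemma phi_periodic : periodic phi.
Proof.
move=> x k; rewrite /phi; congr ulim; apply: functional_extensionality => n.
exact: (g_per (s_good su) (INR n)).
Qed.

Lemma phi_Lip : Lip L phi.
Proof.
move=> x y; apply: Rnot_lt_le => hlt.
set e := Rabs (phi x - phi y) - L * norm (vsub x y) in hlt.
have e0 : 0 < e by rewrite /e; lra.
have [n [h1 h2]] := UF_ex (UF_and (phiP x (e := e / 2) ltac:(lra)) (phiP y (e := e / 2) ltac:(lra))).
have := g_lip (s_good su) (pos_INR n) x y.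
by move: h1 h2; rewrite /e; split_Rabs; lra.
Qed.

(** The functions share the Lipschitz constant [L]: points where closeness fails converge along the
    ultrafilter, and at their limit pointwise convergence contradicts the failure. *)
Lemma phi_uniform e : 0 < e -> UF (fun n => forall x, Rabs (u x (INR n) - phi x) <= e).
Proof.
move=> e0.
have [//|hn] := UF_em (fun n => forall x, Rabs (u x (INR n) - phi x) <= e).
have hz n : exists x, inbox x /\ (~ (forall x, Rabs (u x (INR n) - phi x) <= e) -> e < Rabs (u x (INR n) - phi x)).
  have [h|h] := classic (forall x, Rabs (u x (INR n) - phi x) <= e).
    by exists (@vzero N); split=> //; exact: inbox_zero.
  apply: NNPP => h'; apply: h.
  apply: (@periodic_box N R (fun x => u x (INR n) - phi x) (fun r => Rabs r <= e)).
    by move=> x k; rewrite phi_periodic (g_per (s_good su) (INR n)).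
  move=> x hx; apply: Rnot_lt_le => hlt; apply: h'; by exists x.
pose z n := proj1_sig (constructive_indefinite_description _ (hz n)).
have zP n : inbox (z n) /\ (~ (forall x, Rabs (u x (INR n) - phi x) <= e) -> e < Rabs (u (z n) (INR n) - phi (z n))).
  exact: (proj2_sig (constructive_indefinite_description _ (hz n))).
have [x [_ hx]] := @ucpt_inbox N z (fun n => proj1 (zP n)).
have d0 : 0 < e / (4 * L) by apply: Rdiv_lt_0_compat; lra.
have [n [[h1 h2] h3]] := UF_ex (UF_and (UF_and (hx _ d0) (phiP x (e := e / 4) ltac:(lra))) hn).
have h4 := proj2 (zP n) h3.
have h5 : L * norm (vsub (z n) x) <= e / 4.
  have -> : e / 4 = L * (e / (4 * L)) by field; lra.
  by apply: Rmult_le_compat_l; [lra|exact: Rlt_le].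
have h6 := g_lip (s_good su) (pos_INR n) (z n) x; have h7 := phi_Lip (z n) x.
by exfalso; move: h2 h4 h6 h7; split_Rabs; lra.
Qed.

(* A long almost-period [P] combined with almost monotonicity freezes [u] on the whole window [[t0, t0 + P]]. *)
Lemma frozen_window e : 0 < e -> exists t0, 0 <= t0 /\
  forall x t, 0 <= t <= 2 -> Rabs (u x (t0 + t) - phi x) <= e.
Proof.
move=> e0.
have hA := phi_uniform (e := e / 8) ltac:(lra).
have [n hn] := UF_ex hA.
have [m [hm nm]] := UF_ex (UF_and hA (UF_tail (n + 2))).
have P2 : 2 <= INR m - INR n.
  by have := le_INR _ _ nm; rewrite plus_INR /=; lra.
set P := INR m - INR n in P2.
(* Two instants at which [u] is close to [phi] make [P] an almost-period at time [INR n]; the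
   comparison of [u] with its translate preserves it at all later times. *)
have per x t : INR n <= t -> Rabs (u x (t + P) - u x t) <= e / 4.
  apply: sol_nonexp => //; [exact: pos_INR|lra|move=> y].
  have -> : INR n + P = INR m by rewrite /P; ring.
  by have := hn y; have := hm y; split_Rabs; lra.
(* The almost-period is known before the speed is chosen, so the drift allowed by [eta] over a full
   window of length [P] is at most [e / 4]. *)
have [T [T0 hT]] := mono (eta := e / (4 * P)) (eps := e / 8) ltac:(apply: Rdiv_lt_0_compat; lra) ltac:(lra).
have [k hk] := INR_unbounded T.
have [n1 [hn1 hn1t]] := UF_ex (UF_and hA (UF_tail (n + k))).
have nn1 : INR n + INR k <= INR n1 by rewrite -plus_INR; exact: le_INR.
have := pos_INR n; have := pos_INR k => p1 p2.
exists (INR n1); split; first lra.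
move=> x t ht.
have eP s : 0 <= s <= P -> e / (4 * P) * s <= e / 4.
  move=> hs; have -> : e / 4 = e / (4 * P) * P by field; lra.
  by apply: Rmult_le_compat_l; [apply: Rlt_le; apply: Rdiv_lt_0_compat; lra|lra].
(* [b1] bounds [u] from below by its value at the start of the window, [b2] from above by its value
   at the end; the almost-period says that these two values nearly agree. *)
have b1 := hT x (INR n1) t ltac:(lra) ltac:(lra).
have b2 := hT x (INR n1 + t) (P - t) ltac:(lra) ltac:(lra).
have E : INR n1 + t + (P - t) = INR n1 + P by ring.
rewrite E in b2.
have b3 := per x (INR n1) ltac:(lra); have b4 := hn1 x.
have b5 := eP t ltac:(lra); have b6 := eP (P - t) ltac:(lra).
by move: b3 b4; split_Rabs; lra.
Qed.

Lemma limit_exists : exists phi, periodic phi /\ Lip L phi /\ SubS sigma H phi /\ SuperS sigma H phi /\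
  forall e, 0 < e -> exists T, 0 <= T /\ forall t, T <= t -> forall x, Rabs (u x t - phi x) <= e.
Proof.
have approx e : 0 < e -> exists w, sol w /\ forall x t, 0 <= t <= 2 -> Rabs (w x t - phi x) <= e.
  move=> e0; have [t0 [t00 h]] := frozen_window e0.
  exists (fun x t => u x (t + t0)); split; first exact: sol_shift.
  by move=> x t ht; rewrite Rplus_comm; exact: h.
have sb := stability_sub approx; have sp := stability_sup approx.
have sphi := stat_sol phi_periodic (Rlt_le _ _ L0) phi_Lip sb sp.
exists phi; split; first exact: phi_periodic.
split; first exact: phi_Lip.
split=> //; split=> // e e0; have [t0 [t00 h]] := frozen_window e0.
exists t0; split=> // t ht x; apply: (@cmp_abs u (fun x _ => phi x) e t0) => // y.
by have := h y 0 ltac:(lra); rewrite Rplus_0_r.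
Qed.
End Limit.

Lemma large_time u v : sol u -> sol (fun x _ => v x) ->
  exists phi, periodic phi /\ Lip L phi /\ SubS sigma H phi /\ SuperS sigma H phi /\
  forall e, 0 < e -> exists T, 0 <= T /\ forall t, T <= t -> forall x, Rabs (u x t - phi x) <= e.
Proof.
move=> su sv.
have [Hne|Hem] := classic (exists x, inSigma sigma x); last first.
  (* With [Sigma] empty, the distance condition holds vacuously at every point, so nondegeneracy at
     one scale is ellipticity on the whole torus. *)
  have [nu [nu0 hnu]] := Hi Rlt_0_1.
  have Hell th x z : quad (gram (sigma th x)) z >= nu * dot z z.
    by apply: hnu; exists 2; split; [lra|move=> y hy; case: Hem; exists y].
  have [l hl] := harnack_conv nu0 Hell su sv.
  pose phi x := v x + l.
  have hphi e : 0 < e -> exists T, 0 <= T /\ forall t, T <= t -> forall x, Rabs (u x t - phi x) <= e.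
    move=> /hl [T [T0 hT]]; exists T; split=> // t ht x.
    have -> : u x t - phi x = u x t - v x - l by rewrite /phi; ring.
    exact: hT.
  have approx e : 0 < e -> exists w, sol w /\ forall x t, 0 <= t <= 2 -> Rabs (w x t - phi x) <= e.
    move=> /hphi [T [T0 hT]]; exists (fun x t => u x (t + T)); split; first exact: sol_shift.
    by move=> x t ht; apply: hT; lra.
  have sphi := sol_addc l sv.
  exists phi; split; first by move=> x k; exact: (g_per (s_good sphi) 0).
  split; first exact: (g_lip (s_good sphi) (Rle_refl 0)).
  split; first exact (stability_sub  approx).
  by split; first exact (stability_sup  approx).
have [B1 [B10 hB1]] := good_bound (s_good su) 0; have [B2 [B20 hB2]] := good_bound (s_good sv) 0.
have bd x t : 0 <= t -> Rabs (u x t - v x) <= B1 + B2.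
  move=> t0; apply: (@cmp_abs u (fun x _ => v x) (B1 + B2) 0 su sv) => //; first lra.
  move=> z; have := hB1 z 0 ltac:(lra); have := hB2 z 0 ltac:(lra); split_Rabs; lra.
have ubd x t : 0 <= t -> Rabs (u x t) <= B1 + 2 * B2.
  by move=> t0; have := bd x t t0; have := hB2 x 0 ltac:(lra); split_Rabs; lra.
pose v1 x := v x + - (B1 + B2 + 1).
have sv1 : sol (fun x _ => v1 x) := sol_addc _ sv.
have bd1 x t : 0 <= t -> 1 <= u x t - v1 x <= 2 * (B1 + B2) + 1.
  by move=> t0; have := bd x t t0; rewrite /v1; split_Rabs; lra.
apply: (limit_exists  su ubd).
exact: (almost_monotone  su sv1 bd1 Hne).
Qed.
End LongTime.

Theorem theorem2p1
  (N : nat) (Th : Type) (dTh : Th -> Th -> R) (HdTh : is_metric dTh)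
  (HTh : inhabited Th) (C : R) (HC : 0 < C)
  (sigma : Th -> vec N -> mat N) (H : Th -> vec N -> vec N -> R)
  (* standing assumptions on sigma_theta : W^{1,oo}, |sigma|, |D sigma| <= C *)
  (Hsig_per : forall th, periodic (sigma th))
  (Hsig_bd : forall th x, mnorm (sigma th x) <= C)
  (Hsig_lip : forall th x y, mnorm (msub (sigma th x) (sigma th y)) <= C * norm (vsub x y))
  (* standing assumptions on H_theta *)
  (HH_per : forall th p, periodic (fun x => H th x p))
  (HH_0 : forall th x, Rabs (H th x (@vzero N)) <= C)
  (HH_lip : forall Rr, 0 < Rr -> exists CR, 0 < CR /\
      forall th x y p q, norm p <= Rr -> norm q <= Rr ->
        Rabs (H th x p - H th y q) <= CR * (norm (vsub x y) + norm (vsub p q)))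
  (* the Lipschitz viscosity solution u of (E) *)
  (u0 : vec N -> R) (u : vec N -> R -> R)
  (Hu : visc_sol_E sigma H u0 u)
  (Hu_lip : forall t, 0 <= t -> lipschitz C (fun x => u x t))
  (* existence of Lipschitz solutions of (E_lambda) *)
  (Hvlam : forall lam, 0 < lam -> exists v, visc_sol_Elam sigma H lam v /\ lipschitz C v)
  (* c is the ergodic constant: (S) has a W^{1,oo}(T^N) solution *)
  (c : R)
  (Hc : exists v L, lipschitz L v /\ visc_sol_S sigma H c v)
  (* (i) nondegeneracy outside Sigma *)
  (Hi : forall delta, 0 < delta -> exists nu, 0 < nu /\
      forall th x, dist_Sigma_gt sigma x delta ->
        forall xi, quad (gram (sigma th x)) xi >= nu * dot xi xi)
  (* (ii) convexity in p *)
  (Hii : forall th x p q lam, 0 <= lam <= 1 ->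
      H th x (vadd (vscale lam p) (vscale (1 - lam) q))
        <= lam * H th x p + (1 - lam) * H th x q)
  (* (iii) uniform strict convexity on Sigma *)
  (Hiii : forall x, inSigma sigma x -> forall lam, 0 < lam < 1 ->
      forall p q : vec N, (exists i, p i <> q i) ->
        exists m, 0 < m /\ forall th,
          lam * H th x p + (1 - lam) * H th x q
            - H th x (vadd (vscale lam p) (vscale (1 - lam) q)) >= m) :
  exists uinf : vec N -> R,
    visc_sol_S sigma H c uinf /\
    (forall eps, 0 < eps -> exists T, forall t, T <= t -> forall x,
       Rabs (u x t + c * t - uinf x) <= eps).
Proof.
have [v [Lv [hLv [v_cont [v_per [v_sub v_sup]]]]]] := Hc.
have [u_cont [u_per [_ [u_sub u_sup]]]] := Hu.
have [th0] := HTh.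
pose L := Rmax C Lv.
have LC : C <= L := Rmax_l _ _.
have LLv : Lv <= L := Rmax_r _ _.
have L0 : 0 < L by lra.
have lipL K (f : vec N -> R) : K <= L -> lipschitz K f -> Lip L f.
  move=> hK hf x y; apply: Rle_trans (hf x y) _.
  by apply: Rmult_le_compat_r => //; exact: norm_ge0.
(* Moves the ergodic constant into the Hamiltonian: [v] becomes a stationary solution and [u + c t]
   a solution of the same equation, while every structural hypothesis is insensitive to an additive
   constant. *)
pose H' th x p := H th x p - c.
have hamE th x p X : ham sigma H' th x p X = - trprod (gram (sigma th x)) X + H th x p - c by rewrite /ham /H'; ring.
have sup_near x p X s : Fsup sigma H x p X s -> forall e, 0 < e ->
    exists th, - trprod (gram (sigma th x)) X + H th x p > s - e.
  move=> [h1 h2] e e0; apply: NNPP => hn; have : s <= s - e; last lra.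
  by apply: h2 => r [th ->]; apply: Rnot_lt_le => hlt; apply: hn; exists th.
have HH_lip' Rr : 0 < Rr -> exists CR, 0 < CR /\
    forall th x y p q, norm p <= Rr -> norm q <= Rr ->
      Rabs (H' th x p - H' th y q) <= CR * (norm (vsub x y) + norm (vsub p q)).
  move=> /HH_lip [CR [CR0 hCR]]; exists CR; split=> // th x y p q hp hq.
  have -> : H' th x p - H' th y q = H th x p - H th y q by rewrite /H'; ring.
  exact: hCR.
have Hii' th x p q lam : 0 <= lam <= 1 ->
    H' th x (vadd (vscale lam p) (vscale (1 - lam) q)) <= lam * H' th x p + (1 - lam) * H' th x q.
  by move=> hl; have := Hii th x p q lam hl; rewrite /H'; lra.
have Hiii' x : inSigma sigma x -> forall lam, 0 < lam < 1 -> forall p q : vec N, (exists i, p i <> q i) ->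
    exists m, 0 < m /\ forall th, lam * H' th x p + (1 - lam) * H' th x q
      - H' th x (vadd (vscale lam p) (vscale (1 - lam) q)) >= m.
  move=> hx lam hl p q /(Hiii x hx lam hl) [m [m0 hm]]; exists m; split=> // th.
  by have := hm th; rewrite /H'; lra.
have sv : sol sigma H' L (fun x _ => v x).
  apply: stat_sol => //; [lra|exact: lipL hLv| |].
    move=> x p X sX /(v_sub x p X sX) [s [[hs _] hsc]] th; rewrite hamE.
    by have := hs _ (ex_intro _ th erefl); lra.
  move=> x p X sX /(v_sup x p X sX) [s [hs hsc]] e e0.
  by have [th hth] := sup_near _ _ _ _ hs e e0; exists th; rewrite hamE; lra.
have su : sol sigma H' L (fun x t => u x t + c * t).
  split.
  - split.
    + by move=> t x k /=; rewrite (u_per t x k).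
    + move=> t t0 x y; have -> : u x t + c * t - (u y t + c * t) = u x t - u y t by ring.
      exact: (lipL _ _ LC (Hu_lip t t0)).
    + move=> x t t0 e e0; have [r1 [r10 hr1]] := u_cont x t t0 (e / 2) ltac:(lra).
      have [r2 [r20 hr2]] := small_prod (a := e / 4) (b := Rabs c) ltac:(lra) (Rabs_pos c).
      have [r [r0 [h1 h2]]] := dmin2 r10 r20.
      exists r; split=> // y s s0 hy hs.
      have q1 := hr1 y s s0 ltac:(lra) ltac:(lra).
      have hs2 : Rabs (s - t) <= r2 by lra.
      have q2 := hr2 _ (conj (Rabs_pos _) hs2).
      rewrite -Rabs_mult in q2.
      have E : c * (s - t) = c * s - c * t by ring.
      by rewrite E in q2; move: q1 q2; split_Rabs; lra.
  - move=> x t a p X t0 sX hj th; rewrite hamE.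
    have [|s [[hs _] hsc]] := u_sub x t (a - c) p X t0 sX.
      move=> e e0; have [r [r0 hr]] := hj e e0; exists r; split=> // y s s0 hy hs.
      by have := hr y s s0 hy hs; lra.
    by have := hs _ (ex_intro _ th erefl); lra.
  - move=> x t a p X t0 sX hj e e0.
    have [|s [hs hsc]] := u_sup x t (a - c) p X t0 sX.
      move=> e' e'0; have [r [r0 hr]] := hj e' e'0; exists r; split=> // y s s0 hy hs.
      by have := hr y s s0 hy hs; lra.
    by have [th hth] := sup_near _ _ _ _ hs e e0; exists th; rewrite hamE; lra.
have [phi [ph_per [ph_lip [ph_sub [ph_sup ph_lim]]]]] :=
  large_time HC L0 Hsig_bd Hsig_lip HH_lip' Hii' Hsig_per Hi Hiii' su sv.
exists phi; split; last first.
  by move=> e e0; have [T [_ hT]] := ph_lim e e0; exists T.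
split.
  move=> x e e0; have [r [r0 hr]] := g_cont (stat_good ph_per (Rlt_le _ _ L0) ph_lip) x (Rle_refl 0) e0.
  by exists r; split=> // y hy; apply: (hr y 0 (Rle_refl 0) hy); rewrite Rminus_diag Rabs_R0.
split=> //; split=> x p X sX hj; have [s hs] := Fsup_exists Hsig_bd HH_lip p X th0 (fun th => HH_0 th x);
  exists s; split=> //.
  by apply: (proj2 hs) => r [th ->]; have := ph_sub x p X sX hj th; rewrite hamE; lra.
apply: Rnot_lt_ge => hlt.
have [th hth] := ph_sup x p X sX hj ((c - s) / 2) ltac:(lra).
have := proj1 hs _ (ex_intro _ th erefl); rewrite hamE in hth; lra.
Qed.
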